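(* For each value of $\gamma\in(-1,1)$, the discrete bead model with parameters $\gamma,t$ (with its vertical coordinate rescaled so that a bead at the site $(x,ty)$ is placed at $(x,\,t y\sqrt{1-\gamma^2})\in\mathbb{Z}\times\mathbb{R}$) converges weakly, as $t\to0^+$, to a determinantal random point field on $\mathbb{Z}\times\mathbb{R}$. The kernel of this limiting determinantal random point field is $\big((x,\xi),(x',\xi')\big)\mapsto J_\gamma(x-x',\xi-\xi')$, where $$J_\gamma(x,\xi)=\begin{cases}\displaystyle\int_{[-1,1]}e^{-i\xi\phi}\big(\gamma+i\phi\sqrt{1-\gamma^2}\big)^{x}\frac{d\phi}{2\pi}, & x\ge 0,\\[2mm] \displaystyle-\int_{\mathbb{R}\setminus[-1,1]}e^{-i\xi\phi}\big(\gamma+i\phi\sqrt{1-\gamma^2}\big)^{x}\frac{d\phi}{2\pi}, & x<0.\end{cases}$$ The marginal of the limiting process on a given line $\{x\}\times\mathbb{R}$ is a determinantal random point field on $\mathbb{R}$ with kernel $$J_\gamma(0,\xi-\xi')=\frac{\sin(\xi-\xi')}{\pi(\xi-\xi')},$$ i.e. the sine random point field of the eigenvalues of large random Hermitian matrices.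
   Context: Discrete bead model: let $\gamma\in(-1,1)$ and let $t>0$ be small enough that $t,1,e^{\gamma t}$ satisfy the strict triangle inequalities. Under the probability $\mathbb{P}_{\gamma,t}$, the random configuration $\omega$ is a random subset of $\mathbb{Z}\times t\mathbb{Z}$ whose law is characterized by: for distinct sites $(x_1,ty_1),\dots,(x_k,ty_k)$, $$\mathbb{P}_{\gamma,t}\big[(x_1,ty_1),\dots,(x_k,ty_k)\in\omega\big]=t^k\det_{1\le i,j\le k}\Big[\mathsf{K}^{-1}_{\gamma,t}(x_i-x_j,\,y_i-y_j)\Big],$$ $$\mathsf{K}^{-1}_{\gamma,t}(x,y)=\iint_{|z|=|w|=1}\frac{z^{-y}w^{x}}{t+\frac1w(1+ze^{\gamma t})}\,\frac{dz}{2i\pi z}\,\frac{dw}{2i\pi w}.$$ (This is the law of the edges of weight $a=t$ in the Gibbs measure of the dimer model on the honeycomb lattice with edge weights $a=t$, $b=1$, $c=e^{\gamma t}$ according to orientation; a bead is present at $(x,ty)$ iff the $a$-edge in the fundamental domain $(x,y)$ is in the dimer configuration.) A random point field on $\mathbb{Z}\times\mathbb{R}$ is determinantal with kernel $k$ if its $n$-point correlation function with respect to (counting measure)$\times$(Lebesgue measure) is $\det[k(p_i,p_j)]_{1\le i,j\le n}$ for all $n$; similarly on $\mathbb{R}$ with Lebesgue measure. Weak convergence is convergence in distribution of point processes (equivalently, convergence of the joint laws of the numbers of points in finitely many bounded intervals of threads). For $x=-1$ the integral defining $J_\gamma(-1,\xi)$ is a convergent improper integral for $\xi\ne0$; its value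 at $\xi=0$ is irrelevant. *)

(* Defs.v *)
From HB Require Import structures.
From mathcomp Require Import all_boot all_order all_algebra finmap.
From mathcomp Require Import all_classical all_reals all_analysis measurable_realfun.
From mathcomp Require Import complex.

Set Implicit Arguments.
Unset Strict Implicit.
Unset Printing Implicit Defensive.
Import Order.TTheory GRing.Theory Num.Theory.
Import numFieldNormedType.Exports.

Local Open Scope classical_set_scope.
Local Open Scope complex_scope.
Local Open Scope ring_scope.

(* [int] carries the discrete topology and the discrete sigma-algebra, so that
   [int * R] is the space Z x R with its product topology and its Borel sets. *)
HB.instance Definition _ := isPointed.Build int 0.
HB.instance Definition _ := hasNbhs.Build int principal_filter.
HB.instance Definition _ := Discrete_ofNbhs.Build int erefl.
HB.instance Definition _ := @isMeasurable.Build default_measure_display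
  int discrete_measurable discrete_measurable0
  discrete_measurableC discrete_measurableU.

Section complex_integrals.
Context {R : realType}.

Definition expi (theta : R) : R[i] := cos theta +i* sin theta.

Definition cintegral d (T : measurableType d) (mu : {measure set T -> \bar R})
    (D : set T) (f : T -> R[i]) : R[i] :=
  (\int[mu]_(x in D) complex.Re (f x)) +i* (\int[mu]_(x in D) complex.Im (f x)).

(* The double contour integral over |z| = |w| = 1 of
   f z w dz/(2 i pi z) dw/(2 i pi w), with z = e^(i theta_1) and
   w = e^(i theta_2), for which dz/(2 i pi z) = dtheta_1/(2 pi). *)
Definition torus_integral (f : R[i] -> R[i] -> R[i]) : R[i] :=
  cintegral (lebesgue_measure \x lebesgue_measure)%E
    (`[0, 2 * pi] `*` `[0, 2 * pi])
    (fun theta : R * R => f (expi theta.1) (expi theta.2))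
  / ((2 * pi) ^+ 2)%:C.

(* The improper integral over the complement of [-1, 1]: each half-line is
   treated separately. *)
Definition outer_integral (g : R -> R) : R :=
  lim ((\int[lebesgue_measure]_(x in `]1, A]) g x) @[A --> +oo])
  + lim ((\int[lebesgue_measure]_(x in `[- A, (-1)[) g x) @[A --> +oo]).

Definition couter_integral (f : R -> R[i]) : R[i] :=
  outer_integral (fun x => complex.Re (f x))
  +i* outer_integral (fun x => complex.Im (f x)).

End complex_integrals.

Section point_fields.
Context {R : realType}.

(* Integral of f over B 0 x ... x B (n-1) with respect to the n-th power of
   mu, as an iterated integral. *)
Fixpoint box_integral d (E : measurableType d) (mu : {measure set E -> \bar R})
    (n : nat) : ('I_n -> set E) -> (n.-tuple E -> \bar R) -> \bar R :=
  match n with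
  | 0 => fun _ f => f [tuple]
  | n'.+1 => fun B f =>
      (\int[mu]_(x in B ord0)
        box_integral mu (fun i => B (lift ord0 i))
          (fun s : n'.-tuple E => f [tuple of x :: s]))%E
  end.

(* A simple random point field on E, with configurations as subsets of E.
   The sigma-algebra of E is its Borel one; cpt stands for the compact sets of
   E, in which a configuration has finitely many points. *)
Definition point_field d (Omega : measurableType d) dE (E : measurableType dE)
    (cpt : set (set E)) (X : Omega -> set E) : Prop :=
  (forall o (K : set E), cpt K -> finite_set (X o `&` K)) /\
  (forall B : set E, measurable B ->
     measurable_fun [set: Omega] (fun o => @counting E R (X o `&` B) : \bar R)).

(* rho is the n-point correlation function with respect to mu: its integral
   over B 0 x ... x B (n-1) is the mean number of n-tuples of distinct points
   of X with i-th entry in B i. It is given as a complex-valued function. *)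
Definition correlation_function d (Omega : measurableType d)
    (P : probability Omega R) dE (E : measurableType dE)
    (mu : {measure set E -> \bar R}) (X : Omega -> set E)
    (n : nat) (rho : n.-tuple E -> R[i]) : Prop :=
  forall B : 'I_n -> set E, (forall i, measurable (B i)) ->
    (\int[P]_o @counting (n.-tuple E) R
        [set s : n.-tuple E | uniq s /\ forall i, (X o `&` B i) (tnth s i)]
      = box_integral mu B (fun s => (complex.Re (rho s))%:E))%E /\
    (box_integral mu B (fun s => (complex.Im (rho s))%:E) = 0)%E.

Definition determinantal_field d (Omega : measurableType d)
    (P : probability Omega R) dE (E : measurableType dE)
    (mu : {measure set E -> \bar R}) (cpt : set (set E))
    (k : E -> E -> R[i]) (X : Omega -> set E) : Prop :=
  point_field cpt X /\
  forall n, correlation_function P mu X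
    (fun s : n.-tuple E => \det (\matrix_(i, j) k (tnth s i) (tnth s j))).

(* The numbers of points of a configuration of Z x R in the intervals
   {x i} x I i. *)
Definition interval_counts (m : nat) (x : 'I_m -> int) (I : 'I_m -> interval R)
    (A : set (int * R)) (i : 'I_m) : nat :=
  #|` fset_set [set xi : R | xi \in I i /\ A (x i, xi)] |.

(* The laws of the vectors of counts live on the discrete space of functions
   'I_m -> nat, all of whose subsets are continuity sets. *)
Definition cvg_weakly (F : set_system R)
    (d : R -> measure_display) (Omega : forall t, measurableType (d t))
    (P : forall t, probability (Omega t) R)
    (X : forall t, Omega t -> set (int * R))
    d' (Omega' : measurableType d') (P' : probability Omega' R)
    (X' : Omega' -> set (int * R)) : Prop :=
  forall (m : nat) (x : 'I_m -> int) (I : 'I_m -> interval R),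
    (forall i, bounded_set [set` I i]) ->
    forall S : set ('I_m -> nat),
      P t [set o | S (interval_counts x I (X t o))] @[t --> F]
        --> P' [set o | S (interval_counts x I (X' o))].

Definition counting_lebesgue :
    {measure set (int * measurableTypeR R) -> \bar R} :=
  ((@counting int R) \x (@lebesgue_measure R))%E.

End point_fields.

Section beads.
Context {R : realType}.

Definition strict_triangle (a b c : R) : Prop :=
  [/\ a < b + c, b < a + c & c < a + b].

Definition K_inv (gamma t : R) (x y : int) : R[i] :=
  torus_integral (fun z w =>
    z ^ (- y) * w ^ x / (t%:C + w^-1 * (1 + z * (expR (gamma * t))%:C))).

(* The site (x, t y) of Z x tZ is encoded by the pair (x, y). *)
Definition discrete_bead_model (gamma t : R) d (Omega : measurableType d)
    (P : probability Omega R) (omega : Omega -> set (int * int)) : Prop :=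
  (forall p, measurable [set o | omega o p]) /\
  forall (k : nat) (p : 'I_k -> int * int), injective p ->
    (fine (P [set o | forall i, omega o (p i)]))%:C =
    t%:C ^+ k *
    \det (\matrix_(i, j) K_inv gamma t ((p i).1 - (p j).1) ((p i).2 - (p j).2)).

Definition rescaled_beads (gamma t : R) (A : set (int * int)) : set (int * R) :=
  [set (p.1, t * p.2%:~R * Num.sqrt (1 - gamma ^+ 2)) | p in A].

(* For x = -1 and xi = 0 the improper integral diverges and the value is
   arbitrary. *)
Definition J (gamma : R) (x : int) (xi : R) : R[i] :=
  let f (phi : R) : R[i] :=
    expi (- (xi * phi)) * (gamma +i* (phi * Num.sqrt (1 - gamma ^+ 2))) ^ x
    / (2 * pi)%:C in
  if 0 <= x then cintegral lebesgue_measure `[-1, 1] f else - couter_integral f.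

Definition sine_kernel (xi : R) : R :=
  if xi == 0 then pi^-1 else sin xi / (pi * xi).

End beads.

(* Main.v *)
Require Import Defs.
From HB Require Import structures.
From mathcomp Require Import all_boot all_order all_algebra.
From mathcomp Require Import all_classical all_reals all_analysis measurable_realfun.
From mathcomp Require Import complex.
From mathcomp Require Import sesquilinear spectral ring lra zify.
From mathcomp Require Import finmap.

Set Implicit Arguments.
Unset Strict Implicit.
Unset Printing Implicit Defensive.
Import Order.TTheory GRing.Theory Num.Theory.
Import numFieldNormedType.Exports.

Local Open Scope classical_set_scope.
Local Open Scope complex_scope.
Local Open Scope ring_scope.

(** Why the theorem holds.

    The kernel. Integrated in w, the double integral is a residue: the pole lies
    inside the unit circle or not according to whether |1 + z e^(gamma t)| < t
    [torus_integralE]. With sg = sqrt (1 - gamma^2) and z = - e^(i t sg phi), the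
    quotient q = - (1 + z e^(gamma t)) / t tends to gamma + i sg phi, which has
    modulus less than 1 exactly for |phi| < 1. So t K_inv (x, y), up to the gauge
    factor (-1)^y, is the mesh h = t sg times an integral of e^(- i h y phi) q^x
    [K_invE] that tends to J gamma x xi when h y tends to xi [kscal_cvg]. For
    x <> -1 this is dominated convergence; for x = -1 the integrals converge only
    conditionally, and an integration by parts on each half-line is needed. Local
    bounds hold as well [kscal_locally_bounded]; at x = -1 they come from a
    recurrence in y.

    The factorial moments. The mean number of k-tuples of distinct beads in a box
    is a Riemann sum for the integral of det [J gamma] over this box [bead_moment];
    Hadamard's inequality makes it converge for boxes with regular sides
    [bead_moment_cvg] and shows that the k-th moments are negligible with respect to
    k!.

    The limit field. Bonferroni's inequalities then give the convergence of the
    probabilities that a bounded set contains no bead [void_limit], and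
    inclusion-exclusion that of the laws of the hits of finitely many sets. A space
    for the limit is the unit interval with Lebesgue measure: it carries a random
    bit for each dyadic cell of Z x R, with the limits of the laws of the hits
    [limit_bit_expectation]. Almost surely these bits are the trace of a locally
    finite configuration [sure_trace]. Its mean numbers of k-tuples are the limits
    of those of the beads, first for unions of dyadic cells [saturated_counts], then
    for all boxes by Dynkin's theorem [campbell_box]: the field is determinantal with
    kernel J. A thread is the case of boxes with sides in {x} x R, where J gamma 0 is
    the sine kernel [J_sine].

    Weak convergence. At a fine dyadic level the numbers of points in intervals are
    the numbers of cells that are hit, unless two points share a cell, which has a
    small probability along the whole sequence [counts_cvg]. The factorial moments
    determine the void probabilities [alternating_unique], so that every sequence
    t_n -> 0+ leads to the same limit. *)

(** * Complex numbers by coordinates *)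

Definition cabs {R : rcfType} (z : R[i]) : R := ComplexField.Normc.normc z.

Section complex_moduli.
Context {R : realType}.
Implicit Types z w : R[i].

Lemma cabsE z : cabs z = Num.sqrt (complex.Re z ^+ 2 + complex.Im z ^+ 2).
Proof. by case: z. Qed.

Lemma cabs_ge0 z : 0 <= cabs z.
Proof. by rewrite cabsE sqrtr_ge0. Qed.

Lemma cabs2E z : cabs z ^+ 2 = complex.Re z ^+ 2 + complex.Im z ^+ 2.
Proof. by rewrite cabsE sqr_sqrtr// addr_ge0// sqr_ge0. Qed.

Lemma Re_le_cabs z : `|complex.Re z| <= cabs z.
Proof. by rewrite cabsE -sqrtr_sqr ler_sqrt ?addr_ge0 ?sqr_ge0// lerDl sqr_ge0. Qed.

Lemma Im_le_cabs z : `|complex.Im z| <= cabs z.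
Proof. by rewrite cabsE -sqrtr_sqr ler_sqrt ?addr_ge0 ?sqr_ge0// lerDr sqr_ge0. Qed.

Lemma cabs_le_ReIm z : cabs z <= `|complex.Re z| + `|complex.Im z|.
Proof.
rewrite -(@ler_pXn2r _ 2)// ?nnegrE ?cabs_ge0 ?addr_ge0//.
rewrite cabs2E sqrrD !real_normK ?num_real//.
have := normr_ge0 (complex.Re z); have := normr_ge0 (complex.Im z); nra.
Qed.

Lemma cabsM z w : cabs (z * w) = cabs z * cabs w.
Proof. exact: ComplexField.Normc.normcM. Qed.

Lemma cabsV z : cabs z^-1 = (cabs z)^-1.
Proof. exact: ComplexField.Normc.normcV. Qed.

Lemma cabsN z : cabs (- z) = cabs z.
Proof. by rewrite !cabsE !raddfN !sqrrN. Qed.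

Lemma cabs0 : cabs (0 : R[i]) = 0.
Proof. exact: ComplexField.Normc.normc0. Qed.

Lemma cabs1 : cabs (1 : R[i]) = 1.
Proof. exact: ComplexField.Normc.normc1. Qed.

Lemma cabsR (x : R) : cabs x%:C = `|x|.
Proof. by rewrite cabsE /= expr0n addr0 sqrtr_sqr. Qed.

Lemma cabs_eq0 z : (cabs z == 0) = (z == 0).
Proof.
apply/eqP/eqP => [|->]; last exact: cabs0.
exact: ComplexField.Normc.eq0_normc.
Qed.

Lemma cabsD z w : cabs (z + w) <= cabs z + cabs w.
Proof. exact: le_normcD. Qed.

Lemma cabsX z n : cabs (z ^+ n) = cabs z ^+ n.
Proof. by elim: n => [|n IH]; rewrite ?expr0 ?cabs1// !exprS cabsM IH. Qed.

Lemma cabsXz z (n : int) : cabs (z ^ n) = cabs z ^ n.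
Proof. by case: n => n; rewrite ?NegzE -?exprnP -?exprnN ?cabsV cabsX. Qed.

Lemma ReD z w : complex.Re (z + w) = complex.Re z + complex.Re w.
Proof. by case: z; case: w. Qed.
Lemma ImD z w : complex.Im (z + w) = complex.Im z + complex.Im w.
Proof. by case: z; case: w. Qed.
Lemma ReN z : complex.Re (- z) = - complex.Re z.
Proof. by case: z. Qed.
Lemma ImN z : complex.Im (- z) = - complex.Im z.
Proof. by case: z. Qed.
Lemma ReM z w : complex.Re (z * w) =
  complex.Re z * complex.Re w - complex.Im z * complex.Im w.
Proof. by case: z; case: w. Qed.
Lemma ImM z w : complex.Im (z * w) =
  complex.Re z * complex.Im w + complex.Im z * complex.Re w.
Proof. by case: z; case: w => a b c d /=. Qed.
Lemma ReV z : complex.Re z^-1 = complex.Re z / (cabs z ^+ 2).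
Proof. by rewrite cabs2E; case: z. Qed.
Lemma ImV z : complex.Im z^-1 = - complex.Im z / (cabs z ^+ 2).
Proof. by rewrite cabs2E mulNr; case: z. Qed.

Lemma cabs_expi (x : R) : cabs (expi x) = 1.
Proof. by rewrite cabsE /= cos2Dsin2 sqrtr1. Qed.

Lemma expiD (x y : R) : expi (x + y) = expi x * expi y.
Proof.
apply/eqP; rewrite eq_complex /= cosD sinD; apply/andP; split; apply/eqP => //.
by rewrite addrC mulrC.
Qed.

Lemma expi0 : expi (0 : R) = 1.
Proof. by rewrite /expi cos0 sin0. Qed.

Lemma expi_neq0 (x : R) : expi x != 0.
Proof. by rewrite -cabs_eq0 cabs_expi oner_eq0. Qed.

Lemma expiN (x : R) : expi (- x) = (expi x)^-1.
Proof.
apply: (mulfI (expi_neq0 x)); rewrite divff ?expi_neq0//.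
by rewrite -expiD subrr expi0.
Qed.

Lemma expiXz (x : R) (n : int) : expi x ^ n = expi (x * n%:~R).
Proof.
have h m : expi x ^+ m = expi (x * m%:R).
  elim: m => [|m IH]; first by rewrite mulr0 expi0.
  by rewrite exprS IH -expiD -natr1 mulrDr mulr1 addrC.
case: n => n; first by rewrite -exprnP h.
by rewrite NegzE -exprnN h -expiN mulrNz mulrN.
Qed.

Lemma expi_pi : expi (pi : R) = -1.
Proof. by rewrite /expi cospi sinpi; apply/eqP; rewrite eq_complex /= oppr0 !eqxx. Qed.

End complex_moduli.

Section complex_limits.
Context {R : realType}.
Implicit Types (u v : nat -> R[i]) (l m : R[i]).

(** Taken on the two coordinates, where limits and integrals are those of real
    functions. *)
Definition ccvg u l :=
  complex.Re (u n) @[n --> \oo] --> complex.Re l /\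
  complex.Im (u n) @[n --> \oo] --> complex.Im l.

Lemma ccvg_cst l : ccvg (fun=> l) l.
Proof. by split; exact: cvg_cst. Qed.

Lemma ccvgD u v l m : ccvg u l -> ccvg v m -> ccvg (fun n => u n + v n) (l + m).
Proof.
move=> [u1 u2] [v1 v2]; split.
  by under eq_fun do rewrite ReD; rewrite ReD; exact: cvgD.
by under eq_fun do rewrite ImD; rewrite ImD; exact: cvgD.
Qed.

Lemma ccvgN u l : ccvg u l -> ccvg (fun n => - u n) (- l).
Proof.
move=> [u1 u2]; split.
  by under eq_fun do rewrite ReN; rewrite ReN; exact: cvgN.
by under eq_fun do rewrite ImN; rewrite ImN; exact: cvgN.
Qed.

Lemma ccvgM u v l m : ccvg u l -> ccvg v m -> ccvg (fun n => u n * v n) (l * m).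
Proof.
move=> [u1 u2] [v1 v2]; split.
  under eq_fun do rewrite ReM; rewrite ReM; apply: cvgB; exact: cvgM.
under eq_fun do rewrite ImM; rewrite ImM; apply: cvgD; exact: cvgM.
Qed.

Lemma ccvg_cabs u l : ccvg u l -> cabs (u n) @[n --> \oo] --> cabs l.
Proof.
move=> [u1 u2]; under eq_fun do rewrite cabsE; rewrite cabsE.
apply: continuous_cvg; first exact: sqrt_continuous.
apply: cvgD; rewrite expr2; under eq_fun do rewrite expr2; exact: cvgM.
Qed.

Lemma ccvgV u l : l != 0 -> ccvg u l -> ccvg (fun n => (u n)^-1) l^-1.
Proof.
move=> l0 ul; have [u1 u2] := ul.
have c2 : (cabs (u n) ^+ 2) @[n --> \oo] --> cabs l ^+ 2.
  under eq_fun do rewrite expr2; rewrite expr2.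
  by apply: cvgM; exact: ccvg_cabs.
have l2 : cabs l ^+ 2 != 0 by rewrite expf_eq0 /= cabs_eq0.
split.
  under eq_fun do rewrite ReV; rewrite ReV; apply: cvgM => //; exact: cvgV.
under eq_fun do rewrite ImV; rewrite ImV; apply: cvgM; last exact: cvgV.
exact: cvgN.
Qed.

Lemma ccvgX u l k : ccvg u l -> ccvg (fun n => u n ^+ k) (l ^+ k).
Proof.
move=> ul; elim: k => [|k IH]; first exact: ccvg_cst.
by under eq_fun do rewrite exprS; rewrite exprS; exact: ccvgM.
Qed.

Lemma ccvgXz u l (k : int) : l != 0 -> ccvg u l ->
  ccvg (fun n => u n ^ k) (l ^ k).
Proof.
move=> l0 ul; case: k => k.
  by under eq_fun do rewrite -exprnP; rewrite -exprnP; exact: ccvgX.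
under eq_fun do rewrite NegzE -exprnN; rewrite NegzE -exprnN.
by apply: ccvgV; [rewrite expf_neq0|exact: ccvgX].
Qed.

Lemma ccvg_real (u : nat -> R) (l : R) : u n @[n --> \oo] --> l ->
  ccvg (fun n => (u n)%:C) l%:C.
Proof. by move=> ul; split => //=; exact: cvg_cst. Qed.

Lemma ccvg_expi (u : nat -> R) (l : R) : u n @[n --> \oo] --> l ->
  ccvg (fun n => expi (u n)) (expi l).
Proof.
move=> ul; split => /=; apply: continuous_cvg => //.
  exact: continuous_cos.
exact: continuous_sin.
Qed.

Lemma ccvg_sum I (r : seq I) (P : pred I) (F : nat -> I -> R[i]) (G : I -> R[i]) :
  (forall i, P i -> ccvg (F ^~ i) (G i)) ->
  ccvg (fun n => \sum_(i <- r | P i) F n i) (\sum_(i <- r | P i) G i).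
Proof.
move=> FG; elim: r => [|i r IH].
  by under eq_fun do rewrite big_nil; rewrite big_nil; exact: ccvg_cst.
under eq_fun do rewrite big_cons; rewrite big_cons.
by case: ifPn => // Pi; apply: ccvgD => //; exact: FG.
Qed.

Lemma ccvg_prod I (r : seq I) (P : pred I) (F : nat -> I -> R[i]) (G : I -> R[i]) :
  (forall i, P i -> ccvg (F ^~ i) (G i)) ->
  ccvg (fun n => \prod_(i <- r | P i) F n i) (\prod_(i <- r | P i) G i).
Proof.
move=> FG; elim: r => [|i r IH].
  by under eq_fun do rewrite big_nil; rewrite big_nil; exact: ccvg_cst.
under eq_fun do rewrite big_cons; rewrite big_cons.
by case: ifPn => // Pi; apply: ccvgM => //; exact: FG.
Qed.

Lemma ccvg_det k (A : nat -> 'M[R[i]]_k) (B : 'M[R[i]]_k) :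
  (forall i j, ccvg (fun n => A n i j) (B i j)) ->
  ccvg (fun n => \det (A n)) (\det B).
Proof.
move=> AB; apply: ccvg_sum => s _; apply: ccvgM; first exact: ccvg_cst.
by apply: ccvg_prod => i _; exact: AB.
Qed.

End complex_limits.

(** * Measurable and integrable complex functions *)

Section complex_measurability.
Context {R : realType} d (T : measurableType d).
Implicit Types f g : T -> R[i].

Lemma measurable_inv : measurable_fun [set: R] (fun x : R => x^-1).
Proof.
rewrite -(setUv [set 0 : R]); apply/measurable_funU => //.
- exact: measurableC.
- split; first exact: measurable_fun_set1.
apply: open_continuous_measurable_fun.
  by rewrite openC; apply: accessible_closed_set1; exact: hausdorff_accessible (@Rhausdorff R).
move=> x /set_mem /eqP x0; exact: inv_continuous.
Qed.

Definition cmeasurable (D : set T) f :=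
  measurable_fun D (fun x => complex.Re (f x)) /\
  measurable_fun D (fun x => complex.Im (f x)).

Lemma cmeas_cst D z : cmeasurable D (fun=> z).
Proof. by split; exact: measurable_cst. Qed.

Lemma cmeasS D E f : measurable E -> D `<=` E ->
  cmeasurable E f -> cmeasurable D f.
Proof. by move=> mE DE [f1 f2]; split; apply: measurable_funS DE _. Qed.

Lemma cmeasD D f g : cmeasurable D f -> cmeasurable D g ->
  cmeasurable D (fun x => f x + g x).
Proof.
move=> [f1 f2] [g1 g2]; split.
  by under eq_fun do rewrite ReD; exact: measurable_funD.
by under eq_fun do rewrite ImD; exact: measurable_funD.
Qed.

Lemma cmeasN D f : cmeasurable D f -> cmeasurable D (fun x => - f x).
Proof.
move=> [f1 f2]; split.
  by under eq_fun do rewrite ReN; exact: measurableT_comp.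
by under eq_fun do rewrite ImN; exact: measurableT_comp.
Qed.

Lemma cmeasM D f g : cmeasurable D f -> cmeasurable D g ->
  cmeasurable D (fun x => f x * g x).
Proof.
move=> [f1 f2] [g1 g2]; split.
  under eq_fun do rewrite ReM.
  by apply: measurable_funB; exact: measurable_funM.
under eq_fun do rewrite ImM.
by apply: measurable_funD; exact: measurable_funM.
Qed.

Lemma measurable_cabs D f : cmeasurable D f ->
  measurable_fun D (fun x => cabs (f x)).
Proof.
move=> [f1 f2]; under eq_fun do rewrite cabsE.
apply: (@measurableT_comp _ _ _ _ _ _ (@Num.sqrt R)).
  apply: continuous_measurable_fun; exact: sqrt_continuous.
by apply: measurable_funD; exact: measurable_funX.
Qed.

Lemma cmeasV D f : cmeasurable D f -> cmeasurable D (fun x => (f x)^-1).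
Proof.
move=> mf; have [f1 f2] := mf.
have m2 : measurable_fun D (fun x => (cabs (f x) ^+ 2)^-1).
  apply: (measurableT_comp measurable_inv).
  by apply: measurable_funX; exact: measurable_cabs.
split.
  by under eq_fun do rewrite ReV; exact: measurable_funM.
under eq_fun do rewrite ImV.
by apply: measurable_funM => //; exact: measurableT_comp.
Qed.

Lemma cmeasX D f k : cmeasurable D f -> cmeasurable D (fun x => f x ^+ k).
Proof.
move=> mf; elim: k => [|k IH]; first exact: cmeas_cst.
by under eq_fun do rewrite exprS; exact: cmeasM.
Qed.

Lemma cmeasXz D f (k : int) : cmeasurable D f ->
  cmeasurable D (fun x => f x ^ k).
Proof.
move=> mf; case: k => k.
  by under eq_fun do rewrite -exprnP; exact: cmeasX.
by under eq_fun do rewrite NegzE -exprnN; apply: cmeasV; exact: cmeasX.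
Qed.

Lemma cmeas_expi D (u : T -> R) : measurable_fun D u ->
  cmeasurable D (fun x => expi (u x)).
Proof.
move=> mu; split => /=; apply: measurableT_comp => //;
  apply: continuous_measurable_fun; [exact: continuous_cos|exact: continuous_sin].
Qed.

Lemma cmeas_if D (b : T -> bool) f g : measurable D ->
  measurable_fun D b -> cmeasurable D f -> cmeasurable D g ->
  cmeasurable D (fun x => if b x then f x else g x).
Proof.
move=> mD mb [f1 f2] [g1 g2]; split.
  under eq_fun do rewrite (fun_if (@complex.Re R)).
  apply: measurable_fun_if => //; apply: measurable_funS.
  - exact: mD.
  - by apply: subIsetl.
  - by [].
  - exact: mD.
  - by apply: subIsetl.
  - by [].
under eq_fun do rewrite (fun_if (@complex.Im R)).
apply: measurable_fun_if => //; apply: measurable_funS.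
- exact: mD.
- by apply: subIsetl.
- by [].
- exact: mD.
- by apply: subIsetl.
- by [].
Qed.

End complex_measurability.

Section complex_integration.
Context {R : realType} d (T : measurableType d).
Variables (mu : {measure set T -> \bar R}) (D : set T) (mD : measurable D).
Implicit Types f g : T -> R[i].

Definition cintegrable f :=
  mu.-integrable D (fun x => (complex.Re (f x))%:E) /\
  mu.-integrable D (fun x => (complex.Im (f x))%:E).

Lemma cintegrable_le f (b : T -> R) : cmeasurable D f ->
  mu.-integrable D (EFin \o b) -> (forall x, D x -> cabs (f x) <= b x) ->
  cintegrable f.
Proof.
move=> [f1 f2] ib fb; split.
  apply: (le_integrable mD _ _ ib); first exact/measurable_EFinP.
  move=> x Dx; rewrite !abse_EFin lee_fin.
  by apply: (le_trans (Re_le_cabs _)); apply: (le_trans (fb x Dx)); exact: ler_norm.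
apply: (le_integrable mD _ _ ib); first exact/measurable_EFinP.
move=> x Dx; rewrite !abse_EFin lee_fin.
by apply: (le_trans (Im_le_cabs _)); apply: (le_trans (fb x Dx)); exact: ler_norm.
Qed.

Lemma integrable_cabs f : cintegrable f ->
  mu.-integrable D (fun x => (cabs (f x))%:E).
Proof.
move=> [f1 f2].
have mf : cmeasurable D f.
  by split; apply/measurable_EFinP; [have := measurable_int _ f1|
    have := measurable_int _ f2].
apply: (@le_integrable _ _ _ mu D mD _
  (fun x => `|(complex.Re (f x))%:E| + `|(complex.Im (f x))%:E|)%E).
- by apply/measurable_EFinP; exact: measurable_cabs.
- move=> x Dx; rewrite /= lee_fin.
  rewrite (ger0_norm (cabs_ge0 _)) ger0_norm ?addr_ge0//; exact: cabs_le_ReIm.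
- by apply: integrableD => //; exact: integrable_abse.
Qed.

Lemma cintegrableD f g : cintegrable f -> cintegrable g ->
  cintegrable (fun x => f x + g x).
Proof.
move=> [f1 f2] [g1 g2]; split.
  by under eq_fun do rewrite ReD EFinD; exact: integrableD.
by under eq_fun do rewrite ImD EFinD; exact: integrableD.
Qed.

Lemma cintegrableZ f z : cintegrable f -> cintegrable (fun x => z * f x).
Proof.
move=> [f1 f2]; split.
  under eq_fun do rewrite ReM EFinB !EFinM.
  by apply: integrableB => //; exact: integrableZl.
under eq_fun do rewrite ImM EFinD !EFinM.
by apply: integrableD => //; exact: integrableZl.
Qed.

Lemma cintegralD f g : cintegrable f -> cintegrable g ->
  cintegral mu D (fun x => f x + g x) = cintegral mu D f + cintegral mu D g.
Proof.
move=> [f1 f2] [g1 g2]; apply/eqP; rewrite eq_complex /=.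
under eq_Rintegral do rewrite ReD.
rewrite RintegralD// eqxx /=.
by under eq_Rintegral do rewrite ImD; rewrite RintegralD.
Qed.

Lemma cintegralZ f z : cintegrable f ->
  cintegral mu D (fun x => z * f x) = z * cintegral mu D f.
Proof.
move=> [f1 f2]; apply/eqP; rewrite eq_complex /=.
under eq_Rintegral do rewrite ReM.
have iZ (r : R) (h : T -> R) : mu.-integrable D (EFin \o h) ->
    mu.-integrable D (EFin \o (fun x => r * h x)).
  by move=> ih; rewrite (_ : _ \o _ = (fun x => r%:E * (h x)%:E)%E)//; exact: integrableZl.
rewrite RintegralB ?RintegralZl//; [|exact: iZ|exact: iZ].
under [X in _ && (X == _)]eq_Rintegral do rewrite ImM.
rewrite RintegralD ?RintegralZl//; [|exact: iZ|exact: iZ].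
by case: z => a b /=; rewrite !eqxx.
Qed.

Lemma cintegrable_sum N (F : nat -> T -> R[i]) :
  (forall k, cintegrable (F k)) -> cintegrable (fun x => \sum_(k < N) F k x).
Proof.
move=> iF; elim: N => [|N IH].
  rewrite (_ : (fun x => _) = (fun=> 0)); first by split; exact: integrable0.
  by apply/funext => x; rewrite big_ord0.
rewrite (_ : (fun x => _) = (fun x => \sum_(k < N) F k x + F N x)).
  exact: cintegrableD.
by apply/funext => x; rewrite big_ord_recr.
Qed.

Lemma cintegral_sum N (F : nat -> T -> R[i]) : (forall k, cintegrable (F k)) ->
  cintegral mu D (fun x => \sum_(k < N) F k x) = \sum_(k < N) cintegral mu D (F k).
Proof.
move=> iF; elim: N => [|N IH].
  rewrite (_ : (fun x => _) = (fun=> 0)); last by apply/funext => x; rewrite big_ord0.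
  by rewrite big_ord0 /cintegral /Rintegral !integral0.
rewrite (_ : (fun x => _) = (fun x => \sum_(k < N) F k x + F N x)).
  by rewrite cintegralD ?IH ?big_ord_recr//; exact: cintegrable_sum.
by apply/funext => x; rewrite big_ord_recr.
Qed.

Lemma cintegralN f : cintegrable f ->
  cintegral mu D (fun x => - f x) = - cintegral mu D f.
Proof.
move=> f1; rewrite -mulN1r -cintegralZ//; congr cintegral.
by apply/funext => x; rewrite mulN1r.
Qed.

Lemma eq_cintegral f g : (forall x, D x -> f x = g x) ->
  cintegral mu D f = cintegral mu D g.
Proof.
move=> fg; congr (_ +i* _); apply: eq_Rintegral => x /set_mem Dx; by rewrite fg.
Qed.

Lemma cabs_cintegral_le f (b : T -> R) : cintegrable f ->
  mu.-integrable D (EFin \o b) -> (forall x, D x -> cabs (f x) <= b x) ->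
  cabs (cintegral mu D f) <= 2 * \int[mu]_(x in D) b x.
Proof.
move=> [f1 f2] ib fb; apply: (le_trans (cabs_le_ReIm _)).
rewrite mulr_natl mulr2n; apply: lerD.
  apply: (le_trans (le_normr_Rintegral _ _)) => //.
  apply: le_Rintegral => //; first exact: integrable_abse f1.
  by move=> x Dx; apply: (le_trans (Re_le_cabs _)); exact: fb.
apply: (le_trans (le_normr_Rintegral _ _)) => //.
apply: le_Rintegral => //; first exact: integrable_abse f2.
by move=> x Dx; apply: (le_trans (Im_le_cabs _)); exact: fb.
Qed.

Lemma Rdominated_convergence (f_ : nat -> T -> R) (f b : T -> R) :
  (forall n, measurable_fun D (f_ n)) -> measurable_fun D f ->
  {ae mu, forall x, D x -> f_ n x @[n --> \oo] --> f x} ->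
  mu.-integrable D (EFin \o b) ->
  (forall n x, D x -> `|f_ n x| <= b x) ->
  \int[mu]_(x in D) f_ n x @[n --> \oo] --> \int[mu]_(x in D) f x.
Proof.
move=> mf_ mf cf ib fb.
have [h1 _ h2] : [/\ mu.-integrable D (EFin \o f),
  (\int[mu]_(x in D) (`|(f_ n x)%:E - (f x)%:E|))%E @[n --> \oo] --> 0%E &
  (\int[mu]_(x in D) (f_ n x)%:E)%E @[n --> \oo] -->
  (\int[mu]_(x in D) (f x)%:E)%E].
  apply: (@dominated_convergence _ _ _ mu D mD (fun n => EFin \o f_ n)
    (EFin \o f) (EFin \o b)) => //.
  - by move=> n; exact/measurable_EFinP.
  - exact/measurable_EFinP.
  - by apply: filterS cf => x h Dx; apply: cvg_EFin; [exact: nearW|exact: h].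
  - by apply: aeW => x n Dx; rewrite /= lee_fin; exact: fb.
apply: fine_cvg; rewrite /Rintegral fineK //; exact: integrable_fin_num.
Qed.

Lemma cdominated_convergence (f_ : nat -> T -> R[i]) f (b : T -> R) :
  (forall n, cmeasurable D (f_ n)) -> cmeasurable D f ->
  {ae mu, forall x, D x -> ccvg (f_ ^~ x) (f x)} ->
  mu.-integrable D (EFin \o b) ->
  (forall n x, D x -> cabs (f_ n x) <= b x) ->
  ccvg (fun n => cintegral mu D (f_ n)) (cintegral mu D f).
Proof.
move=> mf_ mf cf ib fb; split => /=.
  apply: (@Rdominated_convergence _ _ b) => //.
  - by move=> n; case: (mf_ n).
  - by case: mf.
  - by apply: filterS cf => x h /h [].
  - by move=> n x Dx; apply: (le_trans (Re_le_cabs _)); exact: fb.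
apply: (@Rdominated_convergence _ _ b) => //.
- by move=> n; case: (mf_ n).
- by case: mf.
- by apply: filterS cf => x h /h [].
- by move=> n x Dx; apply: (le_trans (Im_le_cabs _)); exact: fb.
Qed.

End complex_integration.

(** * Affine substitution and the fundamental theorem of calculus *)

Section affine_substitution.
Context {R : realType}.
Notation leb := (@lebesgue_measure R).

Lemma measurable_affine (a b : R) :
  measurable_fun [set: measurableTypeR R] (fun x : measurableTypeR R => a * x + b : measurableTypeR R).
Proof. by apply: measurable_funD => //; apply: measurable_funM. Qed.

Definition affine_image_measure (a : R) (a0 : 0 < a) (b : R) :
    {measure set (measurableTypeR R) -> \bar R} :=
  mscale (NngNum (ltW a0))
    (measure_function_pushforward__canonical__measure_function_Measure leb
      (measurable_affine a b)).

Lemma lebesgue_measure_affine (a b : R) (A : set (measurableTypeR R)) : 0 < a ->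
  measurable A ->
  (leb A = a%:E * leb ((fun x : R => (a * x + b)%R) @^-1` A))%E.
Proof.
move=> a0 mA.
pose phi : measurableTypeR R -> measurableTypeR R := fun x => a * x + b.
have mphi : measurable_fun [set: measurableTypeR R] phi by exact: measurable_affine.
pose m := affine_image_measure a0 b.
rewrite (lebesgue_measure_unique (mu := m)) //.
move=> X [[u v] _ <-]; rewrite /m /affine_image_measure /= /mscale /= /pushforward /=.
have -> : phi @^-1` `]u, v] = `](u - b) / a, (v - b) / a]%classic.
  apply/seteqP; split => x; rewrite /phi /= !in_itv /= ltr_pdivrMr// ler_pdivlMr//;
    by rewrite ltrBlDr lerBrDr mulrC.
rewrite !lebesgue_measure_itv /= !lte_fin ltr_pM2r ?invr_gt0// ltrD2r.
case: ifPn => _; last by rewrite mule0.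
rewrite -EFinD -EFinM; congr EFin; field; exact: lt0r_neq0.
Qed.

Lemma ge0_integral_affine (a b : R) (f : R -> \bar R) : 0 < a ->
  measurable_fun [set: measurableTypeR R] f -> (forall x, 0 <= f x)%E ->
  (\int[leb]_x f x = a%:E * \int[leb]_x f (a * x + b)%R)%E.
Proof.
move=> a0 mf f0.
transitivity (\int[affine_image_measure a0 b]_x f x)%E.
  apply: eq_measure_integral => A mA _.
  exact: lebesgue_measure_affine.
rewrite ge0_integral_mscale //=; congr (_ * _)%E.
by rewrite ge0_integral_pushforward//; exact: measurable_affine.
Qed.

Lemma integrable_affine (a b : R) (f : R -> R) : 0 < a ->
  leb.-integrable setT (EFin \o f) ->
  leb.-integrable setT (EFin \o (fun x => f (a * x + b))).
Proof.
move=> a0 /integrableP[mf lf].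
apply/integrableP; split.
  apply: (measurableT_comp mf (measurable_affine a b)).
move: lf; rewrite (ge0_integral_affine b a0) //=; last first.
  apply/measurable_EFinP; apply: measurableT_comp => //; exact/measurable_EFinP.
set I := (\int[_]_x _)%E => h.
have I0 : (0 <= I)%E by exact: integral_ge0.
move: h; case: I I0 => [r||] //=; rewrite ?ltry//.
by rewrite gt0_muley ?lte_fin.
Qed.

Lemma Rintegral_affine (a b : R) (f : R -> R) : 0 < a ->
  leb.-integrable setT (EFin \o f) ->
  \int[leb]_x f x = a * \int[leb]_x f (a * x + b).
Proof.
move=> a0 fi.
have fi' := integrable_affine b a0 fi.
have mf : measurable_fun [set: measurableTypeR R] (EFin \o f) := measurable_int _ fi.
rewrite /Rintegral.
have -> : (\int[leb]_x (f x)%:E = a%:E * \int[leb]_x (f (a * x + b)%R)%:E)%E.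
  have hp := @ge0_integral_affine a b (fun x => (EFin \o f)^\+ x)%E a0
    (measurable_funepos mf) (fun=> funepos_ge0 _ _).
  have hn := @ge0_integral_affine a b (fun x => (EFin \o f)^\- x)%E a0
    (measurable_funeneg mf) (fun=> funeneg_ge0 _ _).
  rewrite integralE hp hn.
  rewrite [X in _ = (_ * X)%E]integralE.
  rewrite -(@muleBr _ a%:E) //.
    congr (_ * (_ - _))%E; apply: eq_integral => x _.
      by rewrite !funeposE.
    by rewrite !funenegE.
  apply: fin_num_adde_defl.
  rewrite fin_numN; have := integrable_neg_fin_num measurableT fi'.
  by congr (_ \is a fin_num); apply: eq_integral => x _; rewrite !funenegE.
by rewrite fineM //; exact: integrable_fin_num.
Qed.

Lemma cintegral_affine (a b : R) (f : R -> R[i]) : 0 < a ->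
  cintegrable leb setT f ->
  cintegral leb setT f = a%:C * cintegral leb setT (fun x => f (a * x + b)).
Proof.
move=> a0 [f1 f2]; apply/eqP; rewrite eq_complex /=.
rewrite (Rintegral_affine b a0 f1) (Rintegral_affine b a0 f2).
by rewrite !mul0r addr0 subr0 !eqxx.
Qed.

Definition cpatch (D : set R) (f : R -> R[i]) x := if x \in D then f x else 0.

Lemma cintegral_mkcond (D : set R) (f : R -> R[i]) :
  cintegral leb D f = cintegral leb setT (cpatch D f).
Proof.
congr (_ +i* _); rewrite Rintegral_mkcond; apply: eq_Rintegral => x _;
  by rewrite /cpatch patchE; case: ifP.
Qed.

Lemma cintegrable_mkcond (D : set (measurableTypeR R)) (f : R -> R[i]) : measurable D ->
  cintegrable leb D f <-> cintegrable leb setT (cpatch D f).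
Proof.
move=> mD; split => [[f1 f2]|[f1 f2]]; split.
- move/integrable_mkcond : f1 => /(_ mD); congr integrable; apply/funext => x.
  by rewrite patchE /cpatch; case: ifP.
- move/integrable_mkcond : f2 => /(_ mD); congr integrable; apply/funext => x.
  by rewrite patchE /cpatch; case: ifP.
- apply/integrable_mkcond => //; move: f1; congr integrable; apply/funext => x.
  by rewrite patchE /cpatch; case: ifP.
- apply/integrable_mkcond => //; move: f2; congr integrable; apply/funext => x.
  by rewrite patchE /cpatch; case: ifP.
Qed.

End affine_substitution.

Section complex_ftc.
Context {R : realType}.
Notation leb := (@lebesgue_measure R).
Implicit Types (f F G : R -> R[i]).

Definition cderive F (z : R[i]) (x : R) :=
  is_derive x 1 (fun y => complex.Re (F y)) (complex.Re z) /\
  is_derive x 1 (fun y => complex.Im (F y)) (complex.Im z).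

Lemma cderive_cst z x : cderive (fun=> z) 0 x.
Proof. by split; exact: is_derive_cst. Qed.

Lemma cderiveM F G z w x : cderive F z x -> cderive G w x ->
  cderive (fun y => F y * G y) (z * G x + F x * w) x.
Proof.
move=> [F1 F2] [G1 G2]; split.
  under eq_fun do rewrite ReM.
  apply: is_derive_eq; rewrite ReD !ReM /GRing.scale /=; ring.
under eq_fun do rewrite ImM.
apply: is_derive_eq; rewrite ImD !ImM /GRing.scale /=; ring.
Qed.

Lemma cderiveD F G z w x : cderive F z x -> cderive G w x ->
  cderive (fun y => F y + G y) (z + w) x.
Proof.
move=> [F1 F2] [G1 G2]; split.
  by under eq_fun do rewrite ReD; apply: is_derive_eq; rewrite ReD.
by under eq_fun do rewrite ImD; apply: is_derive_eq; rewrite ImD.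
Qed.

Lemma cderive_expi (a b : R) x :
  cderive (fun y => expi (a * y + b)) ('i * a%:C * expi (a * x + b)) x.
Proof.
split => /=; apply: is_derive_eq; rewrite /GRing.scale /=; ring.
Qed.

Lemma cderiveV F z x : F x != 0 -> cderive F z x ->
  cderive (fun y => (F y)^-1) (- (z / F x ^+ 2)) x.
Proof.
move=> Fx0 [F1 F2].
have n0 : complex.Re (F x) ^+ 2 + complex.Im (F x) ^+ 2 != 0.
  by rewrite -cabs2E expf_eq0 /= cabs_eq0.
have n1 (p q : R) : p ^+ 2 + q ^+ 2 != 0 ->
    (p * p - q * q) ^+ 2 + (p * q + q * p) ^+ 2 != 0.
  by move=> h; rewrite (_ : _ + _ = (p ^+ 2 + q ^+ 2) ^+ 2) ?expf_neq0//; ring.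
split.
  under eq_fun do rewrite ReV cabs2E.
  apply: is_derive_eq; rewrite /GRing.scale /=.
  rewrite ReN ReM ReV ImV cabs2E expr2 ReM ImM.
  by field; rewrite n1 ?n0.
under eq_fun do rewrite ImV cabs2E.
apply: is_derive_eq; rewrite /GRing.scale /=.
rewrite ImN ImM ReV ImV cabs2E expr2 ReM ImM.
by field; rewrite n1 ?n0.
Qed.

Lemma seq_continuous (g : R -> R) (x : R) :
  (forall u : nat -> R, u n @[n --> \oo] --> x -> g (u n) @[n --> \oo] --> g x) ->
  {for x, continuous g}.
Proof. by move=> h; apply/(@cvg_nbhsP _ R^o). Qed.

Lemma cintegral_FTC F f (a b : R) : a < b ->
  (forall x, a <= x <= b -> cderive F (f x) x) ->
  (forall x, a <= x <= b -> forall u : nat -> R, u n @[n --> \oo] --> x ->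
     ccvg (fun n => f (u n)) (f x)) ->
  cintegral leb `[a, b] f = F b - F a.
Proof.
move=> ab dF cf.
have aux (g G : R -> R) : (forall x, a <= x <= b -> is_derive x 1 G (g x)) ->
    (forall x, a <= x <= b -> {for x, continuous g}) ->
    \int[leb]_(x in `[a, b]) g x = G b - G a.
  move=> dG cg; rewrite /Rintegral (@continuous_FTC2 _ g G) //.
  - apply: continuous_in_subspaceT => x /set_mem; rewrite /= in_itv /=; exact: cg.
  - have cG x : a <= x <= b -> {for x, continuous G}.
      move=> xab; apply: differentiable_continuous; apply/derivable1_diffP.
      by have [] := dG x xab.
    split.
    + move=> x; rewrite in_itv /= => /andP[h1 h2].
      by have [] := dG x; rewrite ?(ltW h1) ?(ltW h2).
    + by apply: cvg_at_right_filter; apply: cG; rewrite lexx ltW.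
    + by apply: cvg_at_left_filter; apply: cG; rewrite lexx ltW.
  - move=> x; rewrite in_itv /= => /andP[h1 h2].
    rewrite derive1E; have [] // := dG x; by rewrite ?(ltW h1) ?(ltW h2).
apply/eqP; rewrite eq_complex /=; apply/andP; split; apply/eqP.
  rewrite ReD ReN; apply: (aux _ (fun x => complex.Re (F x))).
    by move=> x /dF [].
  by move=> x xab; apply: seq_continuous => u ux; case: (cf x xab u ux).
rewrite ImD ImN; apply: (aux _ (fun x => complex.Im (F x))).
  by move=> x /dF [].
by move=> x xab; apply: seq_continuous => u ux; case: (cf x xab u ux).
Qed.

End complex_ftc.

(** * The contour integral in w *)

Section fourier_integrals.
Context {R : realType}.
Notation leb := (@lebesgue_measure R).
Notation circle := ([set` `[0, 2 * pi]] : set (measurableTypeR R)).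

Lemma leb_itv_lty (a b : R) : (leb `[a, b]%classic < +oo)%E.
Proof. by rewrite /= lebesgue_measure_itv /=; case: ifP => _; rewrite ltry. Qed.

Lemma integrable_cst_itv (a b c : R) : leb.-integrable `[a, b] (EFin \o cst c).
Proof.
apply: measurable_bounded_integrable => //; first exact: leb_itv_lty.
exists `|c|; split; first exact: num_real.
by move=> y cy x _; exact: ltW.
Qed.

Lemma cintegrable_bounded (a b c : R) (f : R -> R[i]) :
  cmeasurable `[a, b]%classic f -> (forall x, a <= x <= b -> cabs (f x) <= c) ->
  cintegrable leb `[a, b] f.
Proof.
move=> mf fc; apply: (@cintegrable_le _ _ _ _ _ _ _ (cst c)) => //.
exact: integrable_cst_itv.
Qed.

Lemma Rintegral_cst_itv (a b c : R) : a <= b ->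
  \int[leb]_(x in `[a, b]) c = c * (b - a).
Proof.
move=> ab; rewrite Rintegral_cst//= lebesgue_measure_itv /= lte_fin.
case: ltP => //= h; have -> : a = b by apply/eqP; rewrite eq_le ab.
by rewrite subrr.
Qed.

Lemma cintegral_bound (a b c : R) (f : R -> R[i]) : a <= b ->
  cmeasurable `[a, b]%classic f -> (forall x, a <= x <= b -> cabs (f x) <= c) ->
  cabs (cintegral leb `[a, b] f) <= 2 * (c * (b - a)).
Proof.
move=> ab mf fc; rewrite -Rintegral_cst_itv//.
apply: cabs_cintegral_le => //.
  exact: cintegrable_bounded fc.
exact: integrable_cst_itv.
Qed.

Lemma cintegral_cst_itv (a b : R) (z : R[i]) : a <= b ->
  cintegral leb `[a, b] (fun=> z) = (b - a)%:C * z.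
Proof.
move=> ab; apply/eqP; rewrite eq_complex /= !Rintegral_cst_itv//.
by case: z => u v /=; rewrite !mul0r subr0 addr0 !(mulrC (b - a)) !eqxx.
Qed.

Lemma cmeas_expi_lin (D : set (measurableTypeR R)) (a b : R) :
  cmeasurable D (fun x : measurableTypeR R => expi (a * x + b)).
Proof.
apply: cmeas_expi; apply: (measurable_funS measurableT) => //.
exact: measurable_affine.
Qed.

Lemma cmeas_expi_lin0 (D : set (measurableTypeR R)) (a : R) :
  cmeasurable D (fun x : measurableTypeR R => expi (a * x)).
Proof.
rewrite (_ : (fun x => _) = (fun x : measurableTypeR R => expi (a * x + 0))).
  exact: cmeas_expi_lin.
by apply/funext => x; rewrite addr0.
Qed.

Lemma expi_per (n : int) : expi (2 * pi * n%:~R) = 1 :> R[i].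
Proof.
rewrite -expiXz mulr_natl mulr2n expiD expi_pi mulrNN mulr1.
by rewrite exp1rz.
Qed.

Lemma cintegral_expi (n : int) :
  cintegral leb circle (fun x => expi (n%:~R * x)) =
  if n == 0 then (2 * pi)%:C else 0.
Proof.
have p0 : 0 < 2 * pi :> R by rewrite mulr_gt0// pi_gt0.
have [->|n0] := eqVneq n 0.
  under eq_cintegral do rewrite mul0r expi0.
  by rewrite cintegral_cst_itv ?ltW// mulr1 subr0.
have c0 : 'i * (n%:~R : R)%:C != 0 :> R[i].
  by rewrite eq_complex /= !mul0r !mul1r subr0 add0r eqxx /= intr_eq0.
rewrite (@cintegral_FTC _ (fun x => ('i * (n%:~R : R)%:C)^-1 * expi (n%:~R * x + 0))) //.
- by rewrite mulr0 !addr0 (mulrC n%:~R) expi_per expi0 subrr.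
- move=> x _.
  rewrite (_ : expi (n%:~R * x) = 0 * expi (n%:~R * x + 0) +
      ('i * (n%:~R : R)%:C)^-1 * ('i * (n%:~R)%:C * expi (n%:~R * x + 0))).
    by apply: cderiveM; [exact: cderive_cst|exact: cderive_expi].
  by rewrite mul0r add0r mulrA mulVf// mul1r addr0.
- by move=> x _ u ux; apply: ccvg_expi; apply: cvgMr.
Qed.

Lemma cgeo_sum (q : R[i]) N : q != 1 ->
  (1 - q)^-1 = \sum_(k < N) q ^+ k + q ^+ N * (1 - q)^-1.
Proof.
move=> q1; have q0 : 1 - q != 0 by rewrite subr_eq0 eq_sym.
apply: (mulIf q0); rewrite mulVf// mulrDl -mulrA mulVf// mulr1 mulrC.
by apply/eqP; rewrite -subr_eq -[1 - _]opprB subrX1 -mulNr opprB.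
Qed.

Lemma cabs_1B (z : R[i]) : 1 - cabs z <= cabs (1 - z).
Proof. by rewrite lerBlDr -(@cabs1 R) -{1}(subrK z 1); exact: cabsD. Qed.

Lemma eq0_geo_bound (x c r : R) N0 : 0 <= x -> 0 <= r < 1 ->
  (forall N, (N0 <= N)%N -> x <= c * r ^+ N) -> x = 0.
Proof.
move=> x0 /andP[r0 r1] h; apply/eqP; rewrite eq_le x0 andbT.
have cr : c * r ^+ N @[N --> \oo] --> 0.
  rewrite -[X in _ --> X](mulr0 c); apply: cvgMr; apply: cvg_expr.
  by rewrite ger0_norm.
rewrite -(cvg_lim (@Rhausdorff R) cr); apply: limr_ge; first by apply/cvg_ex; exists 0.
by exists N0 => // N /= N0N; exact: h.
Qed.

(** Expanding the geometric series up to order N leaves an error of order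
    |q| ^ N, so that only the resonant term contributes. *)
Lemma cintegral_geo (q : R[i]) (m e : int) : cabs q < 1 -> e * e = 1 ->
  cintegral leb circle
    (fun x => expi (m%:~R * x) * (1 - q * expi (- e%:~R * x))^-1) =
  if 0 <= e * m then (2 * pi)%:C * q ^ (e * m) else 0.
Proof.
move=> q1 ee.
have p0 : 0 <= 2 * pi :> R by rewrite mulr_ge0// pi_ge0.
have mlin (a : R) : cmeasurable circle (fun x : measurableTypeR R => expi (a * x)).
  exact: cmeas_expi_lin0.
have mg : cmeasurable circle
    (fun x : measurableTypeR R => (1 - q * expi (- e%:~R * x))^-1).
  apply: cmeasV; apply: cmeasD; first exact: cmeas_cst.
  apply: cmeasN; apply: cmeasM; first exact: cmeas_cst.
  exact: mlin.
have q1' : 0 < 1 - cabs q by rewrite subr_gt0.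
have gb x : cabs (1 - q * expi (- e%:~R * x))^-1 <= (1 - cabs q)^-1.
  rewrite cabsV lef_pV2 ?posrE//.
    by apply: le_trans (cabs_1B _); rewrite cabsM cabs_expi mulr1.
  apply: (lt_le_trans q1').
  by apply: le_trans (cabs_1B _); rewrite cabsM cabs_expi mulr1.
set I := cintegral _ _ _; set L := (if _ then _ else _).
suff : cabs (I - L) = 0 by move/eqP; rewrite cabs_eq0 subr_eq0 => /eqP.
apply: (@eq0_geo_bound _ (2 * ((1 - cabs q)^-1 * (2 * pi))) (cabs q)
  (`|m|%N.+1)) => [||N mN]; first exact: cabs_ge0.
  by rewrite cabs_ge0.
pose rest x := q ^+ N * (expi ((m - e * N%:Z)%:~R * x) * (1 - q * expi (- e%:~R * x))^-1).
have mrest : cmeasurable circle rest.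
  apply: cmeasM; first exact: cmeas_cst.
  by apply: cmeasM => //; exact: mlin.
have brest x : 0 <= x <= 2 * pi -> cabs (rest x) <= cabs q ^+ N * (1 - cabs q)^-1.
  move=> _; rewrite /rest !cabsM cabs_expi mul1r cabsX ler_wpM2l//.
  by rewrite exprn_ge0// cabs_ge0.
have irest := cintegrable_bounded mrest brest.
pose main x := \sum_(k < N) q ^+ k * expi ((m - e * k%:Z)%:~R * x).
have iterm k : cintegrable leb circle
    (fun x => q ^+ k * expi ((m - e * k%:Z)%:~R * x)).
  apply: cintegrableZ => //; apply: (@cintegrable_bounded _ _ 1); first exact: mlin.
  by move=> x _; rewrite cabs_expi.
have imain : cintegrable leb circle main.
  by refine (@cintegrable_sum R _ _ leb circle _ N (fun k x => q ^+ k * expi ((m - e * k%:Z)%:~R * x)) _).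
have Imain : cintegral leb circle main =
    \sum_(k < N) q ^+ k * (if m - e * k%:Z == 0 then (2 * pi)%:C else 0).
  rewrite (@cintegral_sum R _ _ leb circle _ N (fun k x => q ^+ k * expi ((m - e * k%:Z)%:~R * x)))//; apply: eq_bigr => k _.
  rewrite cintegralZ// ?cintegral_expi//.
  apply: (@cintegrable_bounded _ _ 1); first exact: cmeas_expi_lin0.
  by move=> x _; rewrite cabs_expi.
have IE : I = cintegral leb circle main + cintegral leb circle rest.
  rewrite -cintegralD//.
  apply: eq_cintegral => x _; rewrite (@cgeo_sum _ N); last first.
    apply/eqP => h; have := congr1 cabs h.
    by rewrite cabsM cabs_expi mulr1 cabs1 => h1; move: q1; rewrite h1 ltxx.
  have ek k : expi (m%:~R * x) * (q * expi (- e%:~R * x)) ^+ k =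
      q ^+ k * expi ((m - e * k%:Z)%:~R * x).
    rewrite exprMn mulrCA; congr (_ * _).
    rewrite [_ ^+ k]exprnP expiXz -expiD; congr expi.
    by rewrite intrB intrM; ring.
  rewrite mulrDr mulr_sumr; congr (_ + _); first by apply: eq_bigr => k _; exact: ek.
  by rewrite mulrA ek -mulrA.
have mainL : cintegral leb circle main = L.
  rewrite Imain /L; case: ifPn => em.
    have hk : (absz (e * m)%R < N)%N.
      by rewrite abszM; move: ee mN; rewrite -!expr2 => /eqP; rewrite sqrf_eq1 => /orP[]/eqP->; rewrite ?abszN mul1n.
    rewrite (bigD1 (Ordinal hk)) //= gez0_abs// mulrA ee mul1r subrr eqxx.
    rewrite big1 ?addr0 => [|k /eqP kk]; first by rewrite mulrC exprnP gez0_abs.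
    case: eqP => [h|]; last by rewrite mulr0.
    case: kk; apply: val_inj => /=.
    have -> : m = e * k%:Z by apply/eqP; rewrite -subr_eq0 h.
    by rewrite mulrA ee mul1r absz_nat.
  rewrite big1 // => k _; case: eqP => [h|]; last by rewrite mulr0.
  case/negP: em; have -> : m = e * k%:Z by apply/eqP; rewrite -subr_eq0 h.
  by rewrite mulrA ee mul1r.
rewrite IE mainL addrAC subrr add0r.
apply: (le_trans (cintegral_bound p0 mrest brest)); rewrite subr0 le_eqVlt; apply/orP; left; apply/eqP; ring.
Qed.

(** The contour integral in w: the pole of the integrand lies inside the unit
    circle exactly when |a| < t. *)
Lemma cintegral_pole (t : R) (a : R[i]) (x : int) : 0 < t -> cabs a != t ->
  cintegral leb circle
    (fun th => expi th ^ x / (t%:C + (expi th)^-1 * a)) =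
  (2 * pi)%:C * (t%:C^-1 * (- a / t%:C) ^ x *
    (if 0 <= x then if cabs a < t then 1 else 0
     else if t < cabs a then -1 else 0)).
Proof.
move=> t0 at_.
have tC0 : t%:C != 0 :> R[i] by rewrite eq_complex /= negb_and lt0r_neq0.
have e0 th : expi th != 0 :> R[i] by exact: expi_neq0.
have aux (m e : int) (q : R[i]) : cabs q < 1 -> cintegrable leb circle
    (fun th => expi (m%:~R * th) * (1 - q * expi (- e%:~R * th))^-1).
  move=> q1; have q1' : 0 < 1 - cabs q by rewrite subr_gt0.
  apply: (@cintegrable_bounded _ _ (1 - cabs q)^-1).
    apply: cmeasM; first exact: cmeas_expi_lin0.
    apply: cmeasV; apply: cmeasD; first exact: cmeas_cst.
    apply: cmeasN; apply: cmeasM; first exact: cmeas_cst.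
    exact: cmeas_expi_lin0.
  move=> th _; rewrite cabsM cabs_expi mul1r cabsV.
  have h : 1 - cabs q <= cabs (1 - q * expi (- e%:~R * th)).
    by apply: le_trans (cabs_1B _); rewrite cabsM cabs_expi mulr1.
  by rewrite lef_pV2 ?posrE// (lt_le_trans q1').
have [alt|agt] := ltP (cabs a) t.
  rewrite ltNge (ltW alt) /=.
  have q1 : cabs (- a / t%:C) < 1.
    by rewrite cabsM cabsN cabsV cabsR gtr0_norm// ltr_pdivrMr ?mul1r.
  transitivity (t%:C^-1 * cintegral leb circle
    (fun th => expi (x%:~R * th) * (1 - (- a / t%:C) * expi (- (1 : int)%:~R * th))^-1)).
    rewrite -cintegralZ //; last exact: aux.
    apply: eq_cintegral => th _; rewrite expiXz (mulrC th) mulrCA; congr (_ * _).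
    rewrite -invfM; congr (_^-1); rewrite mulN1r expiN; field.
    by rewrite tC0 e0.
  rewrite (cintegral_geo x q1 (mulr1 1)) !mul1r; case: ifP => _; last by rewrite !mulr0.
  by rewrite mulr1; ring.
have {}agt : t < cabs a by rewrite lt_neqAle eq_sym at_.
rewrite agt /=.
have a0 : a != 0 by rewrite -cabs_eq0 gt_eqF// (lt_trans t0).
have q1 : cabs (- t%:C / a) < 1.
  by rewrite cabsM cabsN cabsV cabsR gtr0_norm// ltr_pdivrMr ?mul1r// (lt_trans t0).
transitivity (a^-1 * cintegral leb circle
  (fun th => expi ((x + 1)%:~R * th) * (1 - (- t%:C / a) * expi (- (-1 : int)%:~R * th))^-1)).
  rewrite -cintegralZ //; last exact: aux.
  apply: eq_cintegral => th _; rewrite intrD mulrDl expiD -mulrA expiXz (mulrC th) mulrCA.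
  congr (_ * _); rewrite mul1r (_ : - (-1)%:~R * th = th); last by rewrite rmorphN1 opprK mul1r.
  have [/eqP h|h] := eqVneq (a + t%:C * expi th) 0.
    rewrite addrC addr_eq0 in h; have h' := eqP h.
    have := congr1 cabs h'; rewrite cabsM cabs_expi cabsN cabsR gtr0_norm// mulr1 => ta.
    by move: agt; rewrite ta ltxx.
  field; rewrite e0 a0 /=.
  by rewrite mulNr opprK h.
rewrite (cintegral_geo (x + 1) q1 (mulrNN 1 1)) mulN1r.
have [x0|x0] := leP 0 x.
  by rewrite ifF ?mulr0//; apply/negbTE; rewrite -ltNge; lia.
rewrite ifT; last by lia.
rewrite mulrCA; congr (_ * _).
have -> : - t%:C / a = (- a / t%:C)^-1 by field; rewrite tC0 a0.
rewrite exprz_inv opprK expfzDr ?expr1z; last by rewrite mulf_neq0 ?oppr_eq0 ?invr_eq0.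
by field; rewrite tC0 a0.
Qed.

End fourier_integrals.

(** * Elementary bounds *)

Section elementary_bounds.
Context {R : realType}.
Notation leb := (@lebesgue_measure R).

Lemma sin_ge_half (u : R) : 0 <= u <= pi / 2 -> u / 2 <= sin u.
Proof.
move=> /andP[u0 up]; set v := u / 2.
have pi0 := @pi_gt0 R.
have [e0|u_neq0] := eqVneq u 0; first by rewrite /v e0 sin0 mul0r.
have v0 : 0 < v by rewrite divr_gt0// lt_neqAle eq_sym u_neq0.
have vp : v <= pi / 4 by rewrite /v; lra.
set k := cos (pi / 4 : R).
have k2 : k * k = 1 / 2.
  have : cos (pi / 2 : R) = 0 by exact: cos_pihalf.
  have -> : pi / 2 = (pi / 4) *+ 2 :> R by rewrite mulr2n; field.
  rewrite cos_mulr2n expr2 -/k mulr2n => h; lra.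
have k0 : 0 <= k by apply: cos_ge0_pihalf; apply/andP; split; lra.
have ck x : 0 <= x <= pi / 4 -> k <= cos x.
  move=> /andP[x0 xp]; rewrite /k; have [->//|xn] := eqVneq x (pi / 4).
  apply: ltW; rewrite ltr_cos ?in_itv /=; first by rewrite lt_neqAle xn.
    by apply/andP; split; lra.
  by apply/andP; split; lra.
have [c /itvP cv sv] : exists2 c, c \in `]0, v[%R & sin v - sin 0 = cos c * (v - 0).
  apply: (@MVT _ sin cos) => //.
  by apply: continuous_subspaceT; exact: continuous_sin.
rewrite sin0 !subr0 in sv.
have -> : u = v *+ 2 by rewrite /v mulr2n; field.
rewrite sin_mulr2n mulr2n sv.
have h1 : k <= cos c by apply: ck; rewrite !cv /= (le_trans _ vp) ?cv.
have h2 : k <= cos v by apply: ck; rewrite vp ltW.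
have h3 : k * k <= cos c * cos v by apply: ler_pM.
have h4 : v * (k * k) <= v * (cos c * cos v) by rewrite ler_pM2l.
rewrite k2 in h4.
by rewrite [leRHS](_ : _ = v * (cos c * cos v) + v * (cos c * cos v)); [lra|ring].
Qed.

Lemma normr_sin_ge_half (u : R) : `|u| <= pi / 2 -> `|u| / 2 <= `|sin u|.
Proof.
move=> hu; have [u0|u0] := leP 0 u.
  rewrite ger0_norm// in hu *; apply: le_trans (ler_norm _).
  by apply: sin_ge_half; rewrite u0.
rewrite ltr0_norm// in hu *.
rewrite -normrN -sinN; apply: le_trans (ler_norm _).
by apply: sin_ge_half; rewrite hu oppr_ge0 ltW.
Qed.

Lemma sin_ge_ends (v : R) : 0 <= v <= pi -> Num.min v (pi - v) / 2 <= sin v.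
Proof.
move=> /andP[v0 vp]; have [h|h] := leP v (pi / 2).
  rewrite min_l; last by lra.
  by apply: sin_ge_half; rewrite v0.
rewrite min_r; last by lra.
have -> : sin v = sin (pi - v) by rewrite sinB sinpi cospi; ring.
by apply: sin_ge_half; apply/andP; split; lra.
Qed.

Lemma cosB_prod (x y : R) : cos x - cos y = - 2 * sin ((x + y) / 2) * sin ((x - y) / 2).
Proof.
have -> : cos x = cos ((x + y) / 2 + (x - y) / 2) by congr cos; field.
have -> : cos y = cos ((x + y) / 2 - (x - y) / 2) by congr cos; field.
rewrite cosD cosB; ring.
Qed.

(** cos x - cos y vanishes only to first order at x = y, uniformly in x. *)
Lemma cosB_lower (x y : R) : 0 <= x <= pi -> 0 < y < pi ->
  Num.min y (pi - y) / 4 * (`|x - y| / 4) * 2 <= `|cos x - cos y|.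
Proof.
move=> /andP[x0 xp] /andP[y0 yp].
have h1 : Num.min y (pi - y) / 4 <= `|sin ((x + y) / 2)|.
  apply: le_trans (ler_norm _); apply: le_trans (sin_ge_ends _); last first.
    by apply/andP; split; lra.
  have m1 : Num.min y (pi - y) <= y by rewrite ge_min lexx.
  have m2 : Num.min y (pi - y) <= pi - y by rewrite ge_min lexx orbT.
  have : Num.min y (pi - y) / 2 <= Num.min ((x + y) / 2) (pi - (x + y) / 2).
    by rewrite le_min; apply/andP; split; lra.
  by lra.
have h2 : `|x - y| / 4 <= `|sin ((x - y) / 2)|.
  have hp : `|x - y| <= pi by rewrite ler_norml; apply/andP; split; lra.
  apply: le_trans (normr_sin_ge_half _); rewrite normrM (@ger0_norm _ 2^-1)//; lra.
have m0 : 0 <= Num.min y (pi - y) / 4.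
  by rewrite divr_ge0// le_min; apply/andP; split; lra.
have h3 := ler_pM m0 (divr_ge0 (normr_ge0 (x - y)) (ler0n R 4)) h1 h2.
rewrite cosB_prod !normrM normrN (@ger0_norm _ 2)//.
by lra.
Qed.

(** A nonnegative derivative is integrable on an open interval as soon as its
    primitive is bounded there. *)
Lemma ge0_integral_primitive (f G : R -> R) (a b M : R) : a < b ->
  (forall x, a < x < b -> 0 <= f x) ->
  (forall x, a < x < b -> is_derive x 1 G (f x)) ->
  (forall x, a < x < b -> {for x, continuous f}) ->
  (forall x, a < x < b -> `|G x| <= M) ->
  (\int[leb]_(x in `]a, b[) (f x)%:E <= (2 * M)%:E)%E.
Proof.
move=> ab f0 dG cf GM.
pose e n := (b - a) / n.+3%:R.
pose F n : set (measurableTypeR R) := `[a + e n, b - e n]%classic.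
have eps n : 0 < e n by rewrite divr_gt0// subr_gt0.
have epsm m n : (m <= n)%N -> e n <= e m.
  by move=> mn; rewrite ler_pM2l ?subr_gt0// lef_pV2 ?posrE// ler_nat.
have eps3 n : e n <= (b - a) / 3 by apply: (epsm 0%N).
have UF : \bigcup_n F n = `]a, b[%classic.
  apply/seteqP; split => x.
    move=> [n _]; rewrite /F /= !in_itv /= => /andP[h1 h2].
    by have := eps n => h; apply/andP; split; lra.
  rewrite /= in_itv /= => /andP[h1 h2].
  pose m := Num.min (x - a) (b - x).
  have m0 : 0 < m by rewrite lt_min !subr_gt0 h1.
  have [n _ hn] : \forall n \near \oo, (b - a) / n.+1%:R < m.
    have : (b - a) / n.+1%:R @[n --> \oo] --> 0.
      rewrite -[X in _ --> X](mulr0 (b - a)); apply: cvgMr; exact: cvg_harmonic.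
    by move/cvgr_lt; apply.
  exists n => //; rewrite /F /= in_itv /=.
  have := hn n.+2 (leq_trans (leqnSn _) (leqnSn _)).
  rewrite -/(e n) /m lt_min => /andP[k1 k2].
  by apply/andP; split; lra.
have mf : measurable_fun `]a, b[%classic (EFin \o f).
  apply/measurable_EFinP; apply: open_continuous_measurable_fun.
    exact: interval_open.
  by move=> x /set_mem; rewrite /= in_itv; exact: cf.
rewrite -UF.
have := @ge0_nondecreasing_set_cvg_integral _ _ R F (EFin \o f) leb.
move=> H.
have cvgF : (\int[leb]_(x in F n) (f x)%:E)%E @[n --> \oo] --> (\int[leb]_(x in \bigcup_n F n) (f x)%:E)%E.
  apply: H.
  - move=> m n mn; apply/subsetPset => x; rewrite /F /= !in_itv /= => /andP[h1 h2].
    by have h := epsm _ _ mn; apply/andP; split; lra.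
  - by move=> n; exact: measurable_itv.
  - by move=> n; apply: measurable_funS mf => //; rewrite -UF; exact: bigcup_sup.
  - move=> n x; rewrite /F /= in_itv /= => /andP[h1 h2]; rewrite lee_fin; apply: f0.
    by have := eps n => h; apply/andP; split; lra.
apply: (cvge_le _ cvgF); apply: nearW => n.
have Fab x : a + e n <= x <= b - e n -> a < x < b.
  by move=> /andP[h1 h2]; have := eps n => h; apply/andP; split; lra.
have ee : a + e n < b - e n.
  have := eps3 n => h; have : 0 < b - a by rewrite subr_gt0.
  by move=> h'; lra.
have cG x : a < x < b -> {for x, continuous G}.
  move=> xab; apply: differentiable_continuous; apply/derivable1_diffP.
  by have [] := dG x xab.
rewrite (@continuous_FTC2 _ f G) //.
- rewrite -EFinB lee_fin; apply: le_trans (ler_norm _) _.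
  apply: le_trans (ler_normB _ _) _; rewrite mulr_natl mulr2n.
  by apply: lerD; apply: GM; apply: Fab; rewrite lexx ltW.
- apply: continuous_in_subspaceT => x /set_mem; rewrite /= in_itv /= => h.
  by apply: cf; exact: Fab.
- split.
  + move=> x; rewrite in_itv /= => /andP[h1 h2].
    by have [] := dG x; rewrite ?Fab ?(ltW h1) ?(ltW h2).
  + by apply: cvg_at_right_filter; apply: cG; apply: Fab; rewrite lexx ltW.
  + by apply: cvg_at_left_filter; apply: cG; apply: Fab; rewrite lexx ltW.
- move=> x; rewrite in_itv /= => /andP[h1 h2].
  by rewrite derive1E; have [] // := dG x; rewrite ?Fab ?(ltW h1) ?(ltW h2).
Qed.

(** The singularity that the integration in w leaves in z. *)
Lemma integrable_rsqrt (p a b : R) :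
  leb.-integrable `[a, b] (fun x => ((Num.sqrt `|x - p|)^-1)%:E).
Proof.
pose f x : R := (Num.sqrt `|x - p|)^-1.
have mf : measurable_fun [set: measurableTypeR R] f.
  apply: (measurableT_comp (@measurable_inv R)).
  apply: (@measurableT_comp _ _ _ _ _ _ (@Num.sqrt R)).
    by apply: continuous_measurable_fun; exact: sqrt_continuous.
  by apply: measurableT_comp => //; apply: measurable_funB.
have f0 x : 0 <= f x by rewrite invr_ge0 sqrtr_ge0.
pose L := `|a - p| + `|b - p| + 1.
have L0 : 0 < L by rewrite /L ltr_wpDl// addr_ge0.
have cf x : x != p -> {for x, continuous f}.
  move=> xp; apply: continuous_comp => /=; last first.
    apply: inv_continuous; rewrite sqrtr_eq0 -ltNge normr_gt0 subr_eq0 //.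
  apply: continuous_comp => /=; last exact: sqrt_continuous.
  apply: continuous_comp => /=; last exact: norm_continuous.
  by apply: cvgB; [exact: cvg_id|exact: cvg_cst].
have right : (\int[leb]_(x in `]p, (p + L)%R[) (f x)%:E <= (2 * (2 * Num.sqrt L))%:E)%E.
  apply: (@ge0_integral_primitive f (fun x => 2 * Num.sqrt (x - p))).
  - by rewrite ltrDl.
  - by move=> x _.
  - move=> x /andP[h1 h2]; have xp : 0 < x - p by rewrite subr_gt0.
    have hs : Num.sqrt (x - p) != 0 by rewrite sqrtr_eq0 -ltNge.
    have ds := @is_derive1_sqrt _ _ xp.
    have dc := @is_derive1_comp _ Num.sqrt (fun y => y - p) x _ _ ds _.
    apply: is_derive_eq; rewrite /f gtr0_norm// /GRing.scale /=.
    by field.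
  - by move=> x /andP[h1 h2]; apply: cf; rewrite gt_eqF.
  - move=> x /andP[h1 h2]; rewrite ger0_norm; last by rewrite mulr_ge0// sqrtr_ge0.
    by rewrite ler_pM2l// ler_wsqrtr// lerBlDl ltW.
have left : (\int[leb]_(x in `](p - L)%R, p[) (f x)%:E <= (2 * (2 * Num.sqrt L))%:E)%E.
  apply: (@ge0_integral_primitive f (fun x => - (2 * Num.sqrt (p - x)))).
  - by rewrite ltrBlDl ltrDr.
  - by move=> x _.
  - move=> x /andP[h1 h2]; have xp : 0 < p - x by rewrite subr_gt0.
    have hs : Num.sqrt (p - x) != 0 by rewrite sqrtr_eq0 -ltNge.
    have ds := @is_derive1_sqrt _ _ xp.
    have dc := @is_derive1_comp _ Num.sqrt (fun y => p - y) x _ _ ds _.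
    apply: is_derive_eq; rewrite /f distrC gtr0_norm// /GRing.scale /=.
    by field.
  - by move=> x /andP[h1 h2]; apply: cf; rewrite lt_eqF.
  - move=> x /andP[h1 h2]; rewrite normrN ger0_norm; last by rewrite mulr_ge0// sqrtr_ge0.
    by rewrite ler_pM2l// ler_wsqrtr// lerBlDl -lerBlDr ltW.
apply/integrableP; split; first by apply/measurable_EFinP; exact: measurable_funS mf.
have -> : (\int[leb]_(x in `[a, b]) `|((Num.sqrt `|x - p|)^-1)%:E| =
  \int[leb]_(x in `[a, b]) (f x)%:E)%E.
  by apply: eq_integral => x _; rewrite /= ger0_norm ?f0.
have sub : [set` `[a, b]] `<=` ([set` `](p - L)%R, p[] `|` [set p]) `|` [set` `]p, (p + L)%R[].
  move=> x; rewrite /= !in_itv /= => /andP[ax xb].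
  have ha := ler_norm (p - a); have hb := ler_norm (b - p); rewrite distrC in ha.
  have ha0 := normr_ge0 (a - p); have hb0 := normr_ge0 (b - p).
  have [h|h|->] := ltgtP x p.
  - by left; left; apply/andP; split => //; rewrite /L; lra.
  - by right; apply/andP; split => //; rewrite /L; lra.
  - by left; right.
have mS : measurable (([set` `](p - L)%R, p[] `|` [set p]) `|` [set` `]p, (p + L)%R[] : set (measurableTypeR R)).
  by apply: measurableU => //; apply: measurableU.
have mA : measurable ([set` `](p - L)%R, p[] `|` [set p] : set (measurableTypeR R)).
  by apply: measurableU.
have mE D : measurable_fun (D : set (measurableTypeR R)) (EFin \o f).
  by apply/measurable_EFinP; exact: measurable_funS mf.
apply: (@le_lt_trans _ _ (\int[leb]_(x in ([set` `](p - L)%R, p[] `|` [set p]) `|` [set` `]p, (p + L)%R[]) (f x)%:E)%E).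
  by apply: ge0_subset_integral => //; move=> x _; rewrite lee_fin.
have e1 : (\int[leb]_(x in ([set` `](p - L)%R, p[] `|` [set p]) `|` [set` `]p, (p + L)%R[]) (f x)%:E =
  \int[leb]_(x in [set` `](p - L)%R, p[] `|` [set p]) (f x)%:E +
  \int[leb]_(x in `]p, (p + L)%R[) (f x)%:E)%E.
  apply: ge0_integral_setU => //; try exact mA; try exact (mE _);
    try by move=> x _; rewrite lee_fin.
  apply/disj_setPS => x /= [[|->]]; rewrite !in_itv /= ?ltxx//.
  by move=> /andP[_ h] /andP[h' _]; have := lt_trans h h'; rewrite ltxx.
have e2 : (\int[leb]_(x in [set` `](p - L)%R, p[] `|` [set p]) (f x)%:E =
  \int[leb]_(x in `](p - L)%R, p[) (f x)%:E + \int[leb]_(x in [set p]) (f x)%:E)%E.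
  apply: ge0_integral_setU => //; try exact mA; try exact (mE _);
    try by move=> x _; rewrite lee_fin.
  by apply/disj_setPS => x /= [] /[swap] ->; rewrite in_itv /= ltxx andbF.
rewrite e1 e2 integral_set1 adde0.
by apply: (le_lt_trans (leeD left right)); rewrite -EFinD ltry.
Qed.

End elementary_bounds.

(** * Integrability on the torus *)

Section fubini_complex.
Context {R : realType}.
Notation leb := (@lebesgue_measure R).
Notation T := (measurableTypeR R).

Lemma ae_neq (p : R) : {ae leb, forall x : T, x != p}.
Proof.
exists [set p]; split; [exact: measurable_set1|exact: lebesgue_measure_set1|].
by move=> x /= /negP/negPn/eqP.
Qed.

(** The bound kappa on the inner integrals gives integrability on the product,
    by Tonelli's theorem, although the integrand is unbounded. *)
Lemma Rfubini (f : T * T -> R) (A B : set T) (kappa H : T -> R) :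
  measurable A -> measurable B -> measurable_fun [set: T * T] f ->
  leb.-integrable A (EFin \o kappa) ->
  {ae leb, forall x, A x ->
    (\int[leb]_(y in B) `|(f (x, y))%:E| <= (kappa x)%:E)%E} ->
  measurable_fun A H ->
  {ae leb, forall x, A x -> \int[leb]_(y in B) f (x, y) = H x} ->
  (leb \x leb)%E.-integrable (A `*` B) (EFin \o f) /\
  \int[(leb \x leb)%E]_(z in A `*` B) f z =
  \int[leb]_(x in A) H x.
Proof.
move=> mA mB mf ik hk mH hH.
have mAB : measurable (A `*` B) by exact: measurableX.
pose g := (EFin \o f) \_ (A `*` B).
have mg : measurable_fun setT g.
  apply/(measurable_restrictT _ mAB); apply/measurable_EFinP.
  exact: measurable_funS mf.
have gE x : (fun y => g (x, y)) = if x \in A then (fun y => (f (x, y))%:E) \_ B else cst 0%E.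
  apply/funext => y; rewrite /g patchE; case: ifPn => [/set_mem [xA yB]|].
    by rewrite (mem_set xA) patchE mem_set.
  rewrite notin_setE /= => h; case: ifPn => // xA; rewrite patchE ifF//.
  by apply/negbTE; rewrite notin_setE => yB; apply: h; split => //; exact: set_mem.
have mpair x : measurable_fun B (fun y => f (x, y)).
  by apply: measurable_funS (measurableT_comp mf (pair1_measurable x)).
have intg : (leb \x leb)%E.-integrable setT g.
  apply: ((@integrable12ltyP _ _ _ _ _ leb leb g mg).2).
  pose h x := (\int[leb]_y `|g (x, y)|)%E.
  have mh : measurable_fun setT h.
    apply: (@measurable_fun_fubini_tonelli_F _ _ _ _ _ _ (abse \o g)) => //.
      exact: measurableT_comp.
    by move=> x; exact: abse_ge0.
  have hE x : h x = ((fun x => \int[leb]_(y in B) `|(f (x, y))%:E|) \_ A)%E x.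
    rewrite patchE /h.
    have -> : (fun y => `|g (x, y)|)%E = abse \o (fun y => g (x, y)) by [].
    rewrite gE; case: ifPn => xA.
      rewrite [RHS]integral_mkcond; apply: eq_integral => y _ /=.
      by rewrite !patchE; case: ifP => //=; rewrite normr0.
    by under eq_integral do rewrite /= normr0; rewrite integral0.
  have kA := (integrable_mkcond _ mA).1 ik.
  have mkA : measurable_fun setT ((EFin \o kappa) \_ A) := measurable_int _ kA.
  have /integrableP[_] := kA; apply: le_lt_trans.
  apply: ae_ge0_le_integral => //.
  - by move=> x _; exact: integral_ge0.
  - by apply: measurableT_comp.
  apply: filterS hk => x hx _.
  rewrite -/(h x) hE !patchE; case: ifPn => [/set_mem xA|_].
    by apply: (le_trans (hx xA)); rewrite lee_fin ler_norm.
  by rewrite abse0.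
have intf : (leb \x leb)%E.-integrable (A `*` B) (EFin \o f).
  exact/(integrable_mkcond _ mAB).
split => //.
rewrite /Rintegral integral_mkcond -/g -integral12_prod_meas1//.
rewrite [in RHS]integral_mkcond; congr fine.
have iF := integrable_fubini_F intg.
have FE x : fubini_F leb g x = ((fun x => \int[leb]_(y in B) (f (x, y))%:E) \_ A)%E x.
  rewrite /fubini_F patchE; have -> : (fun y => g (x, y)) = fun y => g (x, y) by [].
  rewrite gE; case: ifPn => xA; last by rewrite integral0.
  by rewrite [RHS]integral_mkcond.
have mF := measurable_int _ iF.
apply: ae_eq_integral => //.
  by apply/(measurable_restrictT _ mA); exact/measurable_EFinP.
have := integrable_ae measurableT iF; apply: filterS2 hH => x hx h _.
have := h I; rewrite FE !patchE; case: ifPn => //= /set_mem Ax fin.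
by rewrite -(hx Ax) /Rintegral fineK.
Qed.

Lemma cfubini (f : T * T -> R[i]) (A B : set T) (kappa : T -> R) (H : T -> R[i]) :
  measurable A -> measurable B -> cmeasurable [set: T * T] f ->
  leb.-integrable A (EFin \o kappa) ->
  {ae leb, forall x, A x ->
    (\int[leb]_(y in B) (cabs (f (x, y)))%:E <= (kappa x)%:E)%E} ->
  cmeasurable A H ->
  {ae leb, forall x, A x -> cintegral leb B (fun y => f (x, y)) = H x} ->
  cintegral (leb \x leb)%E (A `*` B) f =
  cintegral leb A H.
Proof.
move=> mA mB [f1 f2] ik hk [H1 H2] hH.
have mc : measurable_fun setT (fun z => cabs (f z)) by apply: measurable_cabs.
have mpair (u : T * T -> R) x : measurable_fun setT u -> measurable_fun B (fun y => u (x, y)).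
  by move=> mu; apply: measurable_funS (measurableT_comp mu (pair1_measurable x)).
apply/eqP; rewrite eq_complex /=; apply/andP; split; apply/eqP.
  apply: (Rfubini (f := fun z => complex.Re (f z)) mA mB f1 ik _ H1 _).2; last first.
    by apply: filterS hH => x h /h /(congr1 (@complex.Re R)).
  apply: filterS hk => x h Ax; apply: le_trans (h Ax).
  have m1 := mpair (fun z => complex.Re (f z)) x f1.
  have m2 := mpair (fun z => cabs (f z)) x mc.
  apply: ge0_le_integral => //; try (by move=> y _; rewrite lee_fin ?cabs_ge0).
  - by apply/measurable_EFinP; apply: measurableT_comp.
  - exact/measurable_EFinP.
  - by move=> y _; rewrite lee_fin Re_le_cabs.
apply: (Rfubini (f := fun z => complex.Im (f z)) mA mB f2 ik _ H2 _).2; last first.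
    by apply: filterS hH => x h /h /(congr1 (@complex.Im R)).
apply: filterS hk => x h Ax; apply: le_trans (h Ax).
have m1 := mpair (fun z => complex.Im (f z)) x f2.
have m2 := mpair (fun z => cabs (f z)) x mc.
apply: ge0_le_integral => //; try (by move=> y _; rewrite lee_fin ?cabs_ge0).
- by apply/measurable_EFinP; apply: measurableT_comp.
- exact/measurable_EFinP.
- by move=> y _; rewrite lee_fin Im_le_cabs.
Qed.

End fubini_complex.

Section pole_bounds.
Context {R : realType}.
Notation leb := (@lebesgue_measure R).
Notation circle := ([set` `[0, 2 * pi]] : set (measurableTypeR R)).
Variables (t : R) (a : R[i]).
Hypotheses (t0 : 0 < t) (at_ : cabs a != t).

Let D (th : R) : R[i] := t%:C + (expi th)^-1 * a.

Let cmeasD : cmeasurable [set: measurableTypeR R] D.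
Proof.
apply: cmeasD; first exact: cmeas_cst.
apply: cmeasM; last exact: cmeas_cst.
by apply: cmeasV; apply: cmeas_expi.
Qed.

Let D_ge th : `|t - cabs a| <= cabs (D th).
Proof.
have h1 : cabs ((expi th)^-1 * a) = cabs a by rewrite cabsM cabsV cabs_expi invr1 mul1r.
have h2 : t <= cabs (D th) + cabs a.
  have := cabsD (D th) (- ((expi th)^-1 * a)).
  by rewrite cabsN h1 /D addrK cabsR gtr0_norm.
have h3 : cabs a <= cabs (D th) + t.
  have := cabsD (D th) (- t%:C).
  by rewrite cabsN cabsR gtr0_norm// {1}/D addrC addKr h1.
by rewrite ler_norml; apply/andP; split; lra.
Qed.

Let gap : 0 < `|t - cabs a|.
Proof. by rewrite normr_gt0 subr_eq0 eq_sym. Qed.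

Let Dinv_le th : cabs (D th)^-1 <= `|t - cabs a|^-1.
Proof. by rewrite cabsV lef_pV2 ?posrE// (lt_le_trans gap (D_ge _)). Qed.

Let p0 : 0 <= 2 * pi :> R.
Proof. by rewrite mulr_ge0// pi_ge0. Qed.

Let iDinv : cintegrable leb circle (fun th => (D th)^-1).
Proof.
apply: (@cintegrable_bounded _ _ _ `|t - cabs a|^-1) => [|x _]; last exact: Dinv_le.
by apply: cmeasV; apply: cmeasS cmeasD.
Qed.

(** The normalization of the Poisson kernel. *)
Let poisson : \int[leb]_(th in circle) (cabs (D th) ^+ 2)^-1 =
  2 * pi / `|t ^+ 2 - cabs a ^+ 2|.
Proof.
have d0 : t ^+ 2 - cabs a ^+ 2 != 0.
  have tp : 0 < t + cabs a by rewrite ltr_pwDl ?cabs_ge0.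
  by rewrite subr_sqr mulf_neq0 ?(gt_eqF tp)// subr_eq0 eq_sym.
have := cintegral_pole 0 t0 at_ => /(congr1 (@complex.Re R)).
under eq_cintegral do rewrite expr0z mul1r.
rewrite [LHS]/= => h.
have iR := iDinv.1.
have E : \int[leb]_(th in circle) ((t ^+ 2 - cabs a ^+ 2) * (cabs (D th) ^+ 2)^-1) =
    \int[leb]_(th in circle) (2 * t * complex.Re (D th)^-1 - 1).
  apply: eq_Rintegral => th _.
  have D0 : cabs (D th) ^+ 2 != 0.
    by rewrite expf_neq0// gt_eqF// (lt_le_trans gap (D_ge _)).
  rewrite ReV; apply: (mulIf D0); rewrite mulfVK// mulrBl mul1r mulrA mulfVK//.
  have -> : cabs a ^+ 2 = cabs ((expi th)^-1 * a) ^+ 2.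
    by rewrite cabsM cabsV cabs_expi invr1 mul1r.
  rewrite !cabs2E /D ReD ImD /=; ring.
have i2 : leb.-integrable circle (EFin \o (fun th => (cabs (D th) ^+ 2)^-1)).
  apply: measurable_bounded_integrable => //; first exact: leb_itv_lty.
    apply: (measurableT_comp (@measurable_inv R)); apply: measurable_funX.
    by apply: measurable_cabs; apply: cmeasS cmeasD.
  exists (`|t - cabs a|^-1 ^+ 2); split; first exact: num_real.
  move=> y hy th _; apply: ltW; apply: le_lt_trans hy.
  rewrite ger0_norm ?invr_ge0 ?sqr_ge0// -exprVn -cabsV.
  by rewrite lerXn2r ?nnegrE ?cabs_ge0 ?invr_ge0// ?normr_ge0//.
have iRe : leb.-integrable circle (EFin \o (fun th => complex.Re (D th)^-1)) by [].
have iRe2 : leb.-integrable circle (EFin \o (fun th => 2 * t * complex.Re (D th)^-1)).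
  rewrite (_ : _ \o _ = (fun x => (2 * t)%:E * (complex.Re (D x)^-1)%:E)%E)//.
  exact: integrableZl.
have EB := @RintegralB _ _ R leb circle (fun th => 2 * t * complex.Re (D th)^-1) (cst 1)
  (measurable_itv _) iRe2 (integrable_cst_itv _ _ _).
move: E; rewrite EB RintegralZl//.
rewrite RintegralZl// Rintegral_cst_itv// subr0 h mul1r.
have -> : complex.Re ((2 * pi)%:C * (t%:C^-1 * (- a / t%:C) ^ 0 *
    (if 0 <= (0 : int) then if cabs a < t then 1 else 0
     else if t < cabs a then -1 else 0))) = 2 * pi / t * (if cabs a < t then 1 else 0).
  rewrite lexx expr0z mulr1 -fmorphV /=; case: ifP => _.
    by rewrite mulr1 /=; ring.
  by rewrite mulr0 /=; ring.
move=> E.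
have d0' : 0 < cabs a + t by rewrite ltr_wpDl// cabs_ge0.
apply: (mulfI d0); rewrite E.
have -> : 2 * t * (2 * pi / t * (if cabs a < t then 1 else 0)) =
  4 * pi * (if cabs a < t then 1 else 0).
  by field; rewrite gt_eqF.
have [alt|agt] := ltP (cabs a) t.
  rewrite gtr0_norm; first by field.
  by rewrite subr_sqr mulr_gt0// ?subr_gt0// addrC.
rewrite ltr0_norm; first by rewrite invrN !mulrN mulrCA mulfV//; ring.
have tp : 0 < t + cabs a by rewrite addrC.
by rewrite subr_sqr pmulr_llt0// subr_lt0 lt_neqAle eq_sym at_.
Qed.

Lemma pole_inv_le th :
  cabs (t%:C + (expi th)^-1 * a)^-1 <= `|t - cabs a|^-1.
Proof. exact: Dinv_le. Qed.

(** The square root makes the singularities at |a| = t integrable in the other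
    variable. *)
Lemma integral_pole_le :
  (\int[leb]_(th in circle) (cabs (t%:C + (expi th)^-1 * a)^-1)%:E <=
   (2 * pi * (Num.sqrt `|t ^+ 2 - cabs a ^+ 2|)^-1)%:E)%E.
Proof.
set De := `|t ^+ 2 - cabs a ^+ 2|.
have De0 : 0 < De.
  have tp : 0 < t + cabs a by rewrite ltr_pwDl ?cabs_ge0.
  by rewrite normr_gt0 subr_sqr mulf_neq0 ?(gt_eqF tp)// subr_eq0 eq_sym.
set k := (Num.sqrt De)^-1.
have k0 : 0 < k by rewrite invr_gt0 sqrtr_gt0.
have i1 : leb.-integrable circle (fun th => (cabs (D th)^-1)%:E).
  exact: integrable_cabs iDinv.
have m2 : measurable_fun circle (fun th : measurableTypeR R => (cabs (D th) ^+ 2)^-1).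
  apply: (measurableT_comp (@measurable_inv R)); apply: measurable_funX.
  by apply: measurable_cabs; apply: cmeasS cmeasD.
have i2 : leb.-integrable circle (EFin \o (fun th => (cabs (D th) ^+ 2)^-1)).
  apply: measurable_bounded_integrable => //; first exact: leb_itv_lty.
  exists (`|t - cabs a|^-1 ^+ 2); split; first exact: num_real.
  move=> y hy th _; apply: ltW; apply: le_lt_trans hy.
  rewrite ger0_norm ?invr_ge0 ?sqr_ge0// -exprVn -cabsV.
  by rewrite lerXn2r ?nnegrE ?cabs_ge0 ?invr_ge0// ?normr_ge0//.
have i3 : leb.-integrable circle (EFin \o (fun th => (2 * k)^-1 * (cabs (D th) ^+ 2)^-1)).
  rewrite (_ : _ \o _ = (fun x => ((2 * k)^-1)%:E * ((cabs (D x) ^+ 2)^-1)%:E)%E)//.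
  exact: integrableZl.
have i4 := integrable_cst_itv 0 (2 * pi) (k / 2).
have -> : (2 * pi * k)%:E = (\int[leb]_(th in circle)
    ((k / 2 + (2 * k)^-1 * (cabs (D th) ^+ 2)^-1))%:E)%E.
  rewrite -[RHS]fineK; last first.
    by apply: integrable_fin_num => //; apply: integrableD i4 i3.
  congr EFin; rewrite -/(Rintegral _ _ _) RintegralD// Rintegral_cst_itv//.
  rewrite RintegralZl// poisson -/De subr0.
  have -> : De = (k ^+ 2)^-1 by rewrite /k exprVn invrK sqr_sqrtr// ltW.
  by field; rewrite gt_eqF.
have pos x : 0 <= k / 2 + (2 * k)^-1 * (cabs (D x) ^+ 2)^-1.
  apply: addr_ge0; first by rewrite divr_ge0// ltW.
  by apply: mulr_ge0; rewrite invr_ge0 ?sqr_ge0// mulr_ge0// ltW.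
have m1 := measurable_int _ i1.
have m34 : measurable_fun circle
    (fun x => (k / 2 + (2 * k)^-1 * (cabs (D x) ^+ 2)^-1)%:E).
  by apply/measurable_EFinP; apply: measurable_funD => //; exact: measurable_funM.
apply: ge0_le_integral => //; try (by move=> x _; rewrite lee_fin ?cabs_ge0 ?pos).
move=> th _; rewrite lee_fin cabsV -exprVn -/(D th).
set u := (cabs (D th))^-1.
have -> : k / 2 + (2 * k)^-1 * u ^+ 2 = u + (k - u) ^+ 2 / (2 * k).
  by field; rewrite gt_eqF.
by rewrite lerDl divr_ge0 ?sqr_ge0// mulr_ge0// ltW.
Qed.

End pole_bounds.

(** * The inverse Kasteleyn matrix as a single integral *)

Section torus_kernel.
Context {R : realType}.
Notation leb := (@lebesgue_measure R).
Notation T := (measurableTypeR R).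
Notation circle := ([set` `[0, 2 * pi]] : set (measurableTypeR R)).
Variables (t c : R).
Hypotheses (t0 : 0 < t) (c0 : 0 < c) (tri : strict_triangle t 1 c).

Definition circ_a (th : R) : R[i] := 1 + expi th * c%:C.

Lemma circ_aE (th : R) : t ^+ 2 - cabs (circ_a th) ^+ 2 =
  - (2 * c * (cos th + (1 + c ^+ 2 - t ^+ 2) / (2 * c))).
Proof.
rewrite cabs2E ReD ImD ReM ImM /=.
have h := cos2Dsin2 th; have -> : t ^+ 2 - ((1 + (cos th * c - sin th * 0)) ^+ 2 +
  (0 + (cos th * 0 + sin th * c)) ^+ 2) =
  t ^+ 2 - (1 + 2 * c * cos th + c ^+ 2 * (cos th ^+ 2 + sin th ^+ 2)) by ring.
by rewrite h; field; rewrite gt_eqF.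
Qed.

(** The strict triangle inequalities place the two zeros of t - |a| strictly
    inside the two half-circles, where the cosine is strictly monotone. *)
Lemma circ_a_gap : exists p C : R, [/\ 0 < C, 0 < p < pi &
  forall th, 0 <= th <= 2 * pi ->
    (C * `|th - p| <= `|t ^+ 2 - cabs (circ_a th) ^+ 2|) \/
    (C * `|th - (2 * pi - p)| <= `|t ^+ 2 - cabs (circ_a th) ^+ 2|)].
Proof.
case: tri => t1 t2 t3.
pose u := - ((1 + c ^+ 2 - t ^+ 2) / (2 * c)).
have u1 : -1 < u < 1.
  have c20 : 0 < 2 * c by rewrite mulr_gt0.
  rewrite /u ltrNl opprK ltrNl ltr_pdivrMr// ltr_pdivlMr//.
  by apply/andP; split; nra.
have [u1a u1b] := andP u1.
pose p := acos u.
have cp : cos p = u by rewrite /p acosK// in_itv /= !ltW.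
have p1 : 0 < p < pi by apply/andP; split; [apply: acos_gt0|apply: acos_ltpi];
  rewrite ?u1b ?u1a ?ltW.
pose m := Num.min p (pi - p).
have m0 : 0 < m by rewrite lt_min subr_gt0.
have [p1a p1b] := andP p1.
exists p, (2 * c * (m / 4 / 4 * 2)); split => //.
  by rewrite !mulr_gt0.
have gapE th : `|t ^+ 2 - cabs (circ_a th) ^+ 2| = 2 * c * `|cos th - cos p|.
  by rewrite circ_aE normrN normrM gtr0_norm ?mulr_gt0// cp /u opprK.
move=> th /andP[h1 h2]; rewrite gapE.
have c20 : 0 < 2 * c by rewrite mulr_gt0.
have [h3|h3] := leP th pi.
  left; rewrite -mulrA ler_pM2l//.
  have := @cosB_lower R th p; rewrite h1 h3 p1 -/m => /(_ isT isT); lra.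
right; rewrite -mulrA ler_pM2l//.
have -> : cos th = cos (2 * pi - th).
  rewrite mulr_natl cosB sin_mulr2n cos_mulr2n sinpi cospi mulr0 mul0rn mul0r addr0.
  by rewrite expr2 mulrNN mulr1 mulr2n addrK mul1r.
have h4 : 0 <= 2 * pi - th <= pi by apply/andP; split; lra.
have := @cosB_lower R (2 * pi - th) p; rewrite h4 p1 -/m => /(_ isT isT).
have -> : `|2 * pi - th - p| = `|th - (2 * pi - p)| by rewrite -normrN; congr `|_|; ring.
lra.
Qed.

Definition pole_term (x : int) (a : R[i]) : R[i] :=
  t%:C^-1 * (- a / t%:C) ^ x *
    (if 0 <= x then if cabs a < t then 1 else 0
     else if t < cabs a then -1 else 0).

Lemma pole_term_le (x : int) (a : R[i]) : cabs (pole_term x a) <= t^-1.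
Proof.
rewrite /pole_term !cabsM cabsV cabsR gtr0_norm//.
rewrite -mulrA ler_piMr ?invr_ge0 ?(ltW t0)//.
rewrite cabsXz cabsM cabsN cabsV cabsR gtr0_norm//.
have q0 : 0 <= cabs a / t by rewrite divr_ge0 ?cabs_ge0// ltW.
case: x => n.
  case: ifPn => h; last by rewrite cabs0 mulr0.
  by rewrite cabs1 mulr1 -exprnP exprn_ile1// ler_pdivrMr// mul1r ltW.
case: ifPn => h; last by rewrite cabs0 mulr0.
have q1 : 1 < cabs a / t by rewrite ltr_pdivlMr// mul1r.
rewrite cabsN cabs1 mulr1 NegzE -exprnN invf_le1 ?exprn_ege1//; first exact: ltW.
by rewrite exprn_gt0// (lt_trans ltr01).
Qed.

Lemma cmeas_pole (D : set T) (x y : int) : measurable D ->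
  cmeasurable D (fun th : T => expi (- (th * y%:~R)) * pole_term x (circ_a th)).
Proof.
move=> mD; have ma : cmeasurable D (fun th : T => circ_a th).
  apply: cmeasD; first exact: cmeas_cst.
  by apply: cmeasM; [exact: cmeas_expi|exact: cmeas_cst].
have mabs := measurable_cabs ma.
have mpole : cmeasurable D (fun th : T => pole_term x (circ_a th)).
  have m1 : cmeasurable D (fun th : T => t%:C^-1 * (- circ_a th / t%:C) ^ x).
    apply: cmeasM; first exact: cmeas_cst.
    apply: cmeasXz; apply: cmeasM; last exact: cmeas_cst.
    exact: cmeasN.
  rewrite /pole_term; case: (0 <= x); apply: cmeasM => //;
    apply: cmeas_if => //; try exact: cmeas_cst; exact: measurable_fun_ltr.
apply: cmeasM => //; apply: cmeas_expi; apply: measurableT_comp => //.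
by apply: measurable_funM.
Qed.

(** The integrand is unbounded near the two points of the torus where its
    denominator vanishes; the bound on the inner integral of the modulus and the
    first-order vanishing of t - |a| make it integrable. *)
Lemma torus_integralE (x y : int) :
  torus_integral (fun z w => z ^ (- y) * w ^ x / (t%:C + w^-1 * (1 + z * c%:C))) =
  (2 * pi)%:C^-1 *
  cintegral leb circle (fun th => expi (- (th * y%:~R)) * pole_term x (circ_a th)).
Proof.
have [p [C [C0 /andP[p1 p2] gap]]] := circ_a_gap.
pose G (th : T * T) : R[i] := expi th.1 ^ (- y) * expi th.2 ^ x /
  (t%:C + (expi th.2)^-1 * (1 + expi th.1 * c%:C)).
have mG : cmeasurable [set: T * T] G.
  have m1 : cmeasurable [set: T * T] (fun th => expi th.1) by apply: cmeas_expi.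
  have m2 : cmeasurable [set: T * T] (fun th => expi th.2) by apply: cmeas_expi.
  apply: cmeasM; first by apply: cmeasM; exact: cmeasXz.
  apply: cmeasV; apply: cmeasD; first exact: cmeas_cst.
  apply: cmeasM; first exact: cmeasV.
  apply: cmeasD; first exact: cmeas_cst.
  by apply: cmeasM => //; exact: cmeas_cst.
pose kappa (th : T) : R := 2 * pi * (Num.sqrt C)^-1 *
  ((Num.sqrt `|th - p|)^-1 + (Num.sqrt `|th - (2 * pi - p)|)^-1).
have ik : leb.-integrable circle (EFin \o kappa).
  rewrite (_ : _ \o _ = (fun th => (2 * pi * (Num.sqrt C)^-1)%:E *
    ((Num.sqrt `|th - p|)^-1%:E + (Num.sqrt `|th - (2 * pi - p)|)^-1%:E))%E)//.
  apply: integrableZl => //; apply: integrableD => //; exact: integrable_rsqrt.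
have gap' (th : T) : th != p -> th != 2 * pi - p -> circle th ->
    cabs (circ_a th) != t /\
    2 * pi * (Num.sqrt `|t ^+ 2 - cabs (circ_a th) ^+ 2|)^-1 <= kappa th.
  move=> n1 n2; rewrite /= in_itv /= => hth.
  have aux q De : th != q -> C * `|th - q| <= De ->
      0 < De /\ (Num.sqrt De)^-1 <= (Num.sqrt C)^-1 * (Num.sqrt `|th - q|)^-1.
    move=> nq hq; have d0 : 0 < C * `|th - q| by rewrite mulr_gt0// normr_gt0 subr_eq0.
    have De0 := lt_le_trans d0 hq.
    have -> : (Num.sqrt C)^-1 * (Num.sqrt `|th - q|)^-1 = (Num.sqrt (C * `|th - q|))^-1.
      by rewrite sqrtrM ?invfM// ltW.
    by split => //; rewrite lef_pV2 ?posrE ?sqrtr_gt0//; exact: ler_wsqrtr.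
  have nt De : De = `|t ^+ 2 - cabs (circ_a th) ^+ 2| -> 0 < De -> cabs (circ_a th) != t.
    move=> ->; rewrite normr_gt0; apply: contraNneq => ->; by rewrite subrr.
  have pi2 : 0 <= 2 * pi :> R by rewrite mulr_ge0// pi_ge0.
  have [h|h] := gap th hth.
    have [De0 h'] := aux _ _ n1 h; split; first exact: nt De0.
    rewrite /kappa -[leRHS]mulrA; apply: ler_wpM2l => //; apply: (le_trans h').
    by rewrite ler_wpM2l ?invr_ge0 ?sqrtr_ge0// lerDl invr_ge0 sqrtr_ge0.
  have [De0 h'] := aux _ _ n2 h; split; first exact: nt De0.
  rewrite /kappa -[leRHS]mulrA; apply: ler_wpM2l => //; apply: (le_trans h').
  by rewrite ler_wpM2l ?invr_ge0 ?sqrtr_ge0// lerDr invr_ge0 sqrtr_ge0.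
have aeg : {ae leb, forall th : T, circle th -> cabs (circ_a th) != t /\
    2 * pi * (Num.sqrt `|t ^+ 2 - cabs (circ_a th) ^+ 2|)^-1 <= kappa th}.
  by apply: filterS2 (ae_neq p) (ae_neq (2 * pi - p)) => th; exact: gap'.
have Gabs th : cabs (G th) =
    cabs (t%:C + (expi th.2)^-1 * circ_a th.1)^-1.
  by rewrite /G !cabsM !cabsXz !cabs_expi !exp1rz !mul1r.
have inner th1 : cabs (circ_a th1) != t -> cintegral leb circle (fun th2 => G (th1, th2)) =
    (2 * pi)%:C * (expi (- (th1 * y%:~R)) * pole_term x (circ_a th1)).
  move=> h.
  have -> : (fun th2 => G (th1, th2)) = (fun th2 => expi (- (th1 * y%:~R)) *
      (expi th2 ^ x / (t%:C + (expi th2)^-1 * circ_a th1))).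
    apply/funext => th2; rewrite /G /=.
    by rewrite expiXz rmorphN mulrN mulrA.
  rewrite cintegralZ ?cintegral_pole// -/(pole_term _ _); first by rewrite mulrCA.
  apply: (@cintegrable_bounded _ _ _ (`|t - cabs (circ_a th1)|^-1)).
    apply: cmeasM; first by apply: cmeasXz; exact: cmeas_expi.
    apply: cmeasV; apply: cmeasD; first exact: cmeas_cst.
    apply: cmeasM; last exact: cmeas_cst.
    by apply: cmeasV; exact: cmeas_expi.
  move=> th2 _; rewrite cabsM cabsXz cabs_expi exp1rz mul1r.
  exact: pole_inv_le.
pose H (th : T) := (2 * pi)%:C * (expi (- (th * y%:~R)) * pole_term x (circ_a th)).
have mH0 := cmeas_pole x y (measurable_itv `[0, 2 * pi]).
have GI : cintegral (leb \x leb)%E (circle `*` circle) G = cintegral leb circle H.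
  apply: (@cfubini _ G circle circle kappa) => //.
  - apply: filterS aeg => th h cth; have [h1 h2] := h cth.
    under eq_integral do rewrite Gabs.
    apply: (le_trans (integral_pole_le t0 h1)).
    by rewrite lee_fin.
  - by apply: cmeasM => //; exact: cmeas_cst.
  - by apply: filterS aeg => th h cth; apply: inner; case: (h cth).
have pi0 := @pi_gt0 R.
have iH : cintegrable leb circle (fun th : T => expi (- (th * y%:~R)) * pole_term x (circ_a th)).
  apply: (@cintegrable_bounded _ _ _ t^-1) => // th _.
  by rewrite cabsM cabs_expi mul1r pole_term_le.
rewrite /torus_integral.
have -> : cintegral (leb \x leb)%E (`[0, 2 * pi] `*` `[0, 2 * pi])
    (fun theta : R * R => expi theta.1 ^ (- y) * expi theta.2 ^ x /
      (t%:C + (expi theta.2)^-1 * (1 + expi theta.1 * c%:C))) =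
    cintegral (leb \x leb)%E (circle `*` circle) G by [].
rewrite GI /H cintegralZ// mulrAC; congr (_ * _).
rewrite -fmorphV -rmorphM -fmorphV; congr (_%:C).
by rewrite expr2 invfM mulrA divff ?mul1r// mulf_neq0// gt_eqF.
Qed.

End torus_kernel.

(** * The rescaled kernel *)

Section scaled_kernel.
Context {R : realType}.
Notation leb := (@lebesgue_measure R).
Notation T := (measurableTypeR R).
Notation circle := ([set` `[0, 2 * pi]] : set (measurableTypeR R)).
Variable gamma : R.
Hypothesis hgamma : -1 < gamma < 1.

Definition sg : R := Num.sqrt (1 - gamma ^+ 2).

Lemma sg2 : sg ^+ 2 = 1 - gamma ^+ 2.
Proof. by rewrite sqr_sqrtr// ; case/andP: hgamma => h1 h2; nra. Qed.

Lemma sg_gt0 : 0 < sg.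
Proof. by rewrite sqrtr_gt0; case/andP: hgamma => h1 h2; nra. Qed.

(** The quotient - (1 + z e^(gamma t)) / t at z = - e^(i t sg phi). *)
Definition qdisc (t phi : R) : R[i] :=
  (expi (t * sg * phi) * (expR (gamma * t))%:C - 1) / t%:C.

Definition qlim (phi : R) : R[i] := gamma +i* (phi * sg).

(** Which side of the unit circle the pole lies on. *)
Definition chi (x : int) (q : R[i]) : R[i] :=
  if 0 <= x then if cabs q < 1 then 1 else 0
  else if 1 < cabs q then -1 else 0.

Definition kint (t : R) (x y : int) (phi : R) : R[i] :=
  if `|phi| <= pi / (t * sg) then
    expi (- (t * sg * y%:~R * phi)) * (qdisc t phi ^ x * chi x (qdisc t phi))
  else 0.

Definition kscal (t : R) (x y : int) : R[i] :=
  (2 * pi)%:C^-1 * cintegral leb setT (kint t x y).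

Lemma expi_piz (y : int) : expi (- (pi * y%:~R)) = (-1) ^ y :> R[i].
Proof.
by rewrite expiN -expiXz expi_pi invr_expz -exprz_inv invrN1.
Qed.

Lemma cmeas_qdisc t : cmeasurable [set: T] (qdisc t).
Proof.
apply: cmeasM; last exact: cmeas_cst.
apply: cmeasD; last exact: cmeas_cst.
apply: cmeasM; last exact: cmeas_cst.
exact: cmeas_expi_lin0.
Qed.

Lemma cmeas_chi x (q : T -> R[i]) : cmeasurable [set: T] q ->
  cmeasurable [set: T] (fun phi => chi x (q phi)).
Proof.
move=> mq; have mabs := measurable_cabs mq.
rewrite /chi; case: (0 <= x); apply: cmeas_if => //; try exact: cmeas_cst;
  exact: measurable_fun_ltr.
Qed.

Lemma measurable_normr_le (r : R) : measurable_fun [set: T] (fun phi : T => `|phi| <= r).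
Proof. by apply: measurable_fun_ler => //; exact: measurableT_comp. Qed.

Lemma cmeas_kint t x y : cmeasurable [set: T] (kint t x y).
Proof.
have hm := measurable_normr_le (pi / (t * sg)).
apply: cmeas_if => //; try exact: hm; try by apply: cmeas_cst.
apply: cmeasM.
  under [X in cmeasurable _ X]eq_fun do rewrite -mulNr.
  exact: cmeas_expi_lin0.
apply: cmeasM; first by apply: cmeasXz; exact: cmeas_qdisc.
by apply: cmeas_chi; exact: cmeas_qdisc.
Qed.

Lemma cabs_pow_chi x q : cabs (q ^ x * chi x q) <= 1.
Proof.
rewrite cabsM cabsXz /chi; case: x => n.
  case: ifPn => h; last by rewrite cabs0 mulr0 ler01.
  by rewrite cabs1 mulr1 -exprnP exprn_ile1// ?cabs_ge0// ltW.
case: ifPn => h; last by rewrite cabs0 mulr0 ler01.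
rewrite cabsN cabs1 mulr1 NegzE -exprnN invf_le1 ?exprn_ege1//; first exact: ltW.
by rewrite exprn_gt0// (lt_trans ltr01).
Qed.

Lemma kint_le1 t x y phi : cabs (kint t x y phi) <= 1.
Proof.
rewrite /kint; case: ifP => _; last by rewrite cabs0 ler01.
by rewrite cabsM cabs_expi mul1r cabs_pow_chi.
Qed.

Lemma cintegrable_kint t x y : cintegrable leb setT (kint t x y).
Proof.
have -> : kint t x y = cpatch (`[- (pi / (t * sg)), pi / (t * sg)]) (kint t x y).
  apply/funext => phi; rewrite /cpatch mem_setE in_itv /= -ler_norml /kint.
  by case: ifP.
apply/(cintegrable_mkcond _ (measurable_itv _)).
apply: (@cintegrable_bounded _ _ _ 1) => [|phi _]; last exact: kint_le1.
by apply: cmeasS (cmeas_kint t x y).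
Qed.

(** The substitution z = - e^(i t sg phi). The sign (-1)^y is a gauge factor,
    which determinants do not see. *)
Lemma K_invE (t : R) (x y : int) : 0 < t -> strict_triangle t 1 (expR (gamma * t)) ->
  K_inv gamma t x y = (-1) ^ y * (sg%:C * kscal t x y).
Proof.
move=> t0 tri; set c := expR (gamma * t).
have c0 : 0 < c by exact: expR_gt0.
have s0 := sg_gt0; have h0 : 0 < t * sg by rewrite mulr_gt0.
rewrite /K_inv (torus_integralE t0 c0 tri x y).
pose f th := expi (- (th * y%:~R)) * pole_term t x (circ_a c th).
have tC0 : t%:C != 0 :> R[i] by rewrite eq_complex /= negb_and lt0r_neq0.
have pi0 := @pi_gt0 R.
have mf : cmeasurable circle (f : T -> R[i]) by exact: cmeas_pole.
have iF : cintegrable leb circle (f : T -> R[i]).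
  apply: (@cintegrable_bounded _ _ _ t^-1) => // th _.
  by rewrite cabsM cabs_expi mul1r pole_term_le.
rewrite -/f cintegral_mkcond (cintegral_affine pi h0); last first.
  exact/(cintegrable_mkcond _ (measurable_itv _)).
have -> : (fun x0 => cpatch circle f (t * sg * x0 + pi)) =
    (fun phi => ((-1) ^ y * t%:C^-1) * kint t x y phi).
  apply/funext => phi; rewrite /cpatch /kint.
  have -> : (t * sg * phi + pi \in circle) = (`|phi| <= pi / (t * sg)).
    rewrite mem_setE in_itv /= ler_norml ler_pdivlMr// -mulNr ler_pdivrMr//.
    by apply/andP/andP => -[h1 h2]; split; lra.
  case: ifP => _; last by rewrite mulr0.
  have aE : - circ_a c (t * sg * phi + pi) / t%:C = qdisc t phi.
    by rewrite /circ_a expiD expi_pi /qdisc; congr (_ / _); ring.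
  rewrite /f /pole_term aE mulrDl opprD expiD expi_piz.
  have -> : (if 0 <= x then if cabs (circ_a c (t * sg * phi + pi)) < t then 1 else 0
      else if t < cabs (circ_a c (t * sg * phi + pi)) then -1 else 0) = chi x (qdisc t phi).
    rewrite -aE /chi cabsM cabsN cabsV cabsR gtr0_norm//.
    by rewrite ltr_pdivrMr// ltr_pdivlMr// mul1r.
  have -> : t * sg * phi * y%:~R = t * sg * y%:~R * phi by ring.
  ring.
rewrite cintegralZ//; last exact: cintegrable_kint.
have p0 : (2 * pi)%:C != 0 :> R[i] by rewrite eq_complex /= negb_and mulf_neq0// gt_eqF.
have -> : (t * sg)%:C = t%:C * sg%:C :> R[i] by rewrite rmorphM.
rewrite /kscal; move: (cintegral _ _ _) ((2 * pi)%:C) p0 (sg%:C) ((-1) ^ y).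
by move=> I P p0 S A; field; rewrite tC0 p0.
Qed.

(** * Uniform bounds on the rescaled kernel *)

Lemma cabs_qdisc2 t phi : 0 < t ->
  cabs (qdisc t phi) ^+ 2 = ((expR (gamma * t) - 1) ^+ 2 +
    4 * expR (gamma * t) * sin (t * sg * phi / 2) ^+ 2) / t ^+ 2.
Proof.
move=> t0; rewrite /qdisc cabsM cabsV cabsR gtr0_norm// exprMn exprVn; congr (_ / _).
rewrite cabs2E ReD ImD ReM ImM /=.
set th := t * sg * phi; set c := expR _.
have h1 : cos th = 1 - 2 * sin (th / 2) ^+ 2.
  have -> : cos th = cos ((th / 2) *+ 2) by congr cos; rewrite mulr2n; field.
  by rewrite cos_mulr2n cos2sin2 mulr2n; ring.
have h2 := cos2Dsin2 th.
have -> : (cos th * c - sin th * 0 - 1) ^+ 2 + (cos th * 0 + sin th * c - 0) ^+ 2 =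
    c ^+ 2 * (cos th ^+ 2 + sin th ^+ 2) - 2 * c * cos th + 1 by ring.
by rewrite h2 h1; ring.
Qed.

Definition qlow : R := sg * Num.sqrt (expR (-1)) / 2.

Lemma qlow_gt0 : 0 < qlow.
Proof. by rewrite /qlow divr_gt0// mulr_gt0 ?sg_gt0// sqrtr_gt0 expR_gt0. Qed.

Lemma expR_gt_ge t : 0 < t <= 1 -> expR (-1) <= expR (gamma * t) <= expR 1.
Proof.
move=> /andP[t0 t1]; have [g1 g2] := andP hgamma.
by rewrite !ler_expR; apply/andP; split; nra.
Qed.

(** The growth, uniform in t, behind the integrability of the powers q^x. *)
Lemma qdisc_low t phi : 0 < t <= 1 -> `|phi| <= pi / (t * sg) ->
  qlow * `|phi| <= cabs (qdisc t phi).
Proof.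
move=> t01 hphi; have [t0 t1] := andP t01; have s0 := sg_gt0.
have h0 : 0 < t * sg by rewrite mulr_gt0.
rewrite -(@ler_pXn2r _ 2)// ?nnegrE ?cabs_ge0 ?mulr_ge0 ?(ltW qlow_gt0)//.
rewrite cabs_qdisc2// exprMn real_normK ?num_real//.
set u := t * sg * phi / 2.
have u1 : `|u| <= pi / 2.
  rewrite /u normrM [X in _ * X]ger0_norm// ler_pM2r// normrM gtr0_norm//.
  by rewrite mulrC -ler_pdivlMr.
have := normr_sin_ge_half u1 => hs.
have hs2 : (u / 2) ^+ 2 <= sin u ^+ 2.
  rewrite -(real_normK (num_real (sin u))) -(real_normK (num_real (u / 2))).
  rewrite ler_pXn2r ?nnegrE// normrM [X in _ * X]ger0_norm//.
rewrite ler_pdivlMr ?exprn_gt0//.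
have e1 : qlow ^+ 2 = sg ^+ 2 * expR (-1) / 4.
  have e0 := sqr_sqrtr (expR_ge0 (-1 : R)).
  by rewrite /qlow -[in RHS]e0; field.
have [e2 e3] := andP (expR_gt_ge t01).
have em := expR_gt0 (-1 : R).
apply: (@le_trans _ _ (4 * expR (-1) * (u / 2) ^+ 2)).
  by rewrite e1 /u le_eqVlt; apply/orP; left; apply/eqP; field.
apply: (@le_trans _ _ (4 * expR (gamma * t) * sin u ^+ 2)).
  apply: ler_pM; [by rewrite mulr_ge0 ?expR_ge0|exact: sqr_ge0|by rewrite ler_pM2l|exact: hs2].
by rewrite lerDr sqr_ge0.
exact: ltW.
Qed.

Definition dom (phi : R) : R := (1 + qlow ^- 2) * (oneDsqr phi)^-1.

Lemma dom_ge0 phi : 0 <= dom phi.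
Proof.
have o0 : 0 < oneDsqr phi by rewrite (lt_le_trans ltr01)// oneDsqr_ge1.
have C0 : 0 < 1 + qlow ^- 2 by rewrite addr_gt0// invr_gt0 exprn_gt0// qlow_gt0.
by rewrite /dom mulr_ge0// ?invr_ge0 ltW.
Qed.

(** For x >= 0 the factor chi confines phi to a bounded set; for x <= -2 the
    power decays like phi^-2. *)
Lemma pow_chi_dom x phi (q : R[i]) : x != -1 -> qlow * `|phi| <= cabs q ->
  cabs (q ^ x * chi x q) <= dom phi.
Proof.
move=> x1 hq; have q0 := qlow_gt0.
have o0 : 0 < oneDsqr phi by rewrite (lt_le_trans ltr01)// oneDsqr_ge1.
rewrite /dom ler_pdivlMr// /oneDsqr mulrDr mulr1; apply: lerD; first exact: cabs_pow_chi.
have hq2 : qlow ^+ 2 * phi ^+ 2 <= cabs q ^+ 2.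
  rewrite -(real_normK (num_real phi)) -exprMn ler_pXn2r ?nnegrE ?cabs_ge0//.
  by rewrite mulr_ge0// ltW.
suff : cabs (q ^ x * chi x q) * cabs q ^+ 2 <= 1.
  move=> h; rewrite -[leRHS]mul1r ler_pdivlMr ?exprn_gt0//; apply: le_trans h.
  by rewrite -mulrA ler_wpM2l ?cabs_ge0// mulrC.
case: x x1 => [n _|n].
  rewrite /chi; case: ifPn => h; last by rewrite mulr0 cabs0 mul0r.
  rewrite mulr1 cabsXz -exprnP -exprD exprn_ile1 ?cabs_ge0//; exact: ltW.
case: n => [//|n _]; rewrite /chi; case: ifPn => h; last by rewrite mulr0 cabs0 mul0r.
rewrite cabsM cabsN cabs1 mulr1 cabsXz NegzE -exprnN mulrC ler_pdivrMr; last first.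
  by rewrite exprn_gt0// (lt_trans ltr01).
by rewrite mul1r ler_eXn2l.
Qed.

Lemma kint_dom t x y phi : 0 < t <= 1 -> x != -1 ->
  cabs (kint t x y phi) <= dom phi.
Proof.
move=> t01 x1; rewrite /kint; case: ifPn => hphi; last by rewrite cabs0 dom_ge0.
by rewrite cabsM cabs_expi mul1r pow_chi_dom// qdisc_low.
Qed.

Lemma integrable_dom : leb.-integrable setT (EFin \o dom).
Proof.
have pos (x : R) : 0 <= (oneDsqr x)^-1.
  by rewrite invr_ge0 (le_trans ler01)// oneDsqr_ge1.
have mo (D : set T) : measurable_fun D (fun x : T => ((oneDsqr x)^-1)%:E).
  apply/measurable_EFinP; apply: (measurable_funS measurableT) => //.
  exact: (continuous_measurable_fun (@continuous_oneDsqrV R)).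
have io : leb.-integrable setT (fun x => ((oneDsqr x)^-1)%:E).
  apply/integrableP; split; first exact: mo.
  have -> : (fun x => `|((oneDsqr x)^-1)%:E|)%E = (fun x : T => ((oneDsqr x)^-1)%:E).
    by apply/funext => x; rewrite /= ger0_norm.
  pose F n : set T := `]- n.+1%:R, n.+1%:R[%classic.
  have UF : \bigcup_n F n = setT.
    apply/seteqP; split => // x _; exists (Num.truncn `|x|) => //.
    rewrite /F /= in_itv /= -ltr_norml; exact: truncnS_gt.
  have cF := @ge0_nondecreasing_set_cvg_integral _ _ R F
    (fun x : T => ((oneDsqr x)^-1)%:E) leb.
  rewrite -UF; apply: (@le_lt_trans _ _ (2 * (pi / 2))%:E); last exact: ltry.
  have ndF : nondecreasing_seq F.
    move=> m n mn; apply/subsetPset => x; rewrite /F /= !in_itv /= => /andP[h1 h2].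
    have mn' : m.+1%:R <= n.+1%:R :> R by rewrite ler_nat.
    by apply/andP; split; lra.
  apply: (cvge_le _ (cF ndF (fun n => measurable_itv _) (fun n => mo _) _)); last first.
    by move=> n x _; rewrite lee_fin.
  apply: nearW => n; apply: (@ge0_integral_primitive _ _ atan) => //.
  - by rewrite gtrN.
  - by move=> x _; exact: continuous_oneDsqrV.
  - move=> x _; rewrite ler_norml; apply/andP; split; apply: ltW.
      exact: atan_gtNpi2.
    exact: atan_ltpi2.
rewrite (_ : _ \o _ = (fun x => (1 + qlow ^- 2)%:E * ((oneDsqr x)^-1)%:E)%E)//.
exact: integrableZl.
Qed.

(** * The limit of the rescaled kernel for x <> -1 *)

Lemma cvg_quotient (f : R -> R) (l : R) (u : nat -> R) : is_derive (0 : R) (1 : R) f l ->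
  (forall n, u n != 0) -> u n @[n --> \oo] --> 0 ->
  (f (u n) - f 0) / u n @[n --> \oo] --> l.
Proof.
move=> [df <-] u0 uc.
have : h^-1 *: ((f \o shift 0) (h *: (1 : R)) - f 0) @[h --> 0^'] --> 'D_1 f 0 by exact: df.
have uc' : u n @[n --> \oo] --> 0^'.
  move=> A hA; have : \forall n \near \oo, u n != 0 -> A (u n) := uc _ hA.
  by apply: filterS => n; apply; exact: u0.
move=> /(cvg_comp _ _ uc'); apply: cvg_trans; apply: near_eq_cvg; apply: nearW => n.
by rewrite /= /GRing.scale /= mulr1 addr0 mulrC.
Qed.

Lemma ccvg_qdisc (t : nat -> R) phi : (forall n, 0 < t n <= 1) ->
  t n @[n --> \oo] --> 0 -> ccvg (fun n => qdisc (t n) phi) (qlim phi).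
Proof.
move=> t01 tc; have tn0 n : t n != 0 by rewrite gt_eqF//; case/andP: (t01 n).
split.
  pose f u : R := cos (u * (sg * phi)) * expR (gamma * u).
  have df : is_derive (0 : R) (1 : R) f gamma.
    rewrite /f; apply: is_derive_eq; rewrite /GRing.scale /= !mul0r !mulr0 sin0 cos0 expR0.
    by ring.
  have := cvg_quotient df tn0 tc; apply: cvg_trans; apply: near_eq_cvg; apply: nearW => n.
  rewrite /f mul0r cos0 mulr0 expR0 mul1r /qdisc -fmorphV ReM ReD /= .
  by rewrite !mulr0 !subr0 mulrA.
pose f u : R := sin (u * (sg * phi)) * expR (gamma * u).
have df : is_derive (0 : R) (1 : R) f (phi * sg).
  rewrite /f; apply: is_derive_eq; rewrite /GRing.scale /= !mul0r !mulr0 sin0 cos0 expR0.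
  by ring.
have := cvg_quotient df tn0 tc; apply: cvg_trans; apply: near_eq_cvg; apply: nearW => n.
rewrite /f mul0r sin0 mul0r subr0 /qdisc -fmorphV ImM ImD /= .
by rewrite mulr0 add0r subr0 mulrA; ring.
Qed.

Lemma cabs_qlim2 phi : cabs (qlim phi) ^+ 2 = 1 + sg ^+ 2 * (phi ^+ 2 - 1).
Proof. by rewrite cabs2E /= exprMn mulrBr mulr1 sg2; ring. Qed.

(** Since |qlim phi|^2 - 1 = (1 - gamma^2) (phi^2 - 1), the interval [-1, 1] in
    the limit kernel is the set of phi whose pole lies inside the unit circle. *)
Lemma cabs_qlim_lt1 phi : (cabs (qlim phi) < 1) = (`|phi| < 1).
Proof.
rewrite -(@ltr_pXn2r _ 2)// ?nnegrE ?cabs_ge0// expr1n cabs_qlim2.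
rewrite gtrDl pmulr_rlt0 ?exprn_gt0 ?sg_gt0// subr_lt0.
by rewrite -[in RHS](@ltr_pXn2r _ 2)// ?nnegrE// expr1n real_normK ?num_real.
Qed.

Lemma cabs_qlim_gt1 phi : (1 < cabs (qlim phi)) = (1 < `|phi|).
Proof.
rewrite -(@ltr_pXn2r _ 2)// ?nnegrE ?cabs_ge0// expr1n cabs_qlim2.
rewrite ltrDl pmulr_rgt0 ?exprn_gt0 ?sg_gt0// subr_gt0.
by rewrite -[in RHS](@ltr_pXn2r _ 2)// ?nnegrE// expr1n real_normK ?num_real.
Qed.

Definition jint (x : int) (xi phi : R) : R[i] :=
  expi (- (xi * phi)) * (qlim phi ^ x * chi x (qlim phi)).

Lemma ccvg_near (u v : nat -> R[i]) l : (\forall n \near \oo, u n = v n) ->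
  ccvg v l -> ccvg u l.
Proof.
move=> uv [v1 v2]; split.
  by apply: cvg_trans v1; apply: near_eq_cvg; near=> n; rewrite (near uv n).
by apply: cvg_trans v2; apply: near_eq_cvg; near=> n; rewrite (near uv n).
Unshelve. all: by end_near. Qed.

Lemma ccvg_pow_chi (t : nat -> R) x phi : (forall n, 0 < t n <= 1) ->
  t n @[n --> \oo] --> 0 -> `|phi| != 1 ->
  ccvg (fun n => qdisc (t n) phi ^ x * chi x (qdisc (t n) phi))
       (qlim phi ^ x * chi x (qlim phi)).
Proof.
move=> t01 tc phi1; have qc := ccvg_qdisc phi t01 tc; have ac := ccvg_cabs qc.
have [h|h] := ltP `|phi| 1.
  have l1 : cabs (qlim phi) < 1 by rewrite cabs_qlim_lt1.
  have nl : \forall n \near \oo, cabs (qdisc (t n) phi) < 1 by apply: (cvgr_lt _ ac).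
  apply: (@ccvg_near _ (fun n => if 0 <= x then qdisc (t n) phi ^ x else 0)).
    near=> n; have hn : cabs (qdisc (t n) phi) < 1 by near: n.
    by rewrite /chi hn ltNge (ltW hn) /=; case: ifP => _; rewrite ?mulr1 ?mulr0.
  rewrite /chi l1 ltNge (ltW l1) /=; case: x => n; last by rewrite mulr0; exact: ccvg_cst.
  by rewrite /= mulr1; exact: ccvgX.
have l1 : 1 < cabs (qlim phi) by rewrite cabs_qlim_gt1 lt_neqAle eq_sym phi1.
have nl : \forall n \near \oo, 1 < cabs (qdisc (t n) phi) by apply: (cvgr_gt _ ac).
have q0 : qlim phi != 0 by rewrite -cabs_eq0 gt_eqF// (lt_trans ltr01).
apply: (@ccvg_near _ (fun n => if 0 <= x then 0 else - qdisc (t n) phi ^ x)).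
  near=> n; have hn : 1 < cabs (qdisc (t n) phi) by near: n.
  by rewrite /chi hn ltNge (ltW hn) /=; case: ifP => _; rewrite ?mulrN1 ?mulr0.
rewrite /chi l1 ltNge (ltW l1) /=; case: ifP => _; rewrite ?mulr0 ?mulrN1.
  exact: ccvg_cst.
by apply: ccvgN; exact: ccvgXz.
Unshelve. all: by end_near. Qed.

Lemma near_le_pi (t : nat -> R) r : (forall n, 0 < t n <= 1) ->
  t n @[n --> \oo] --> 0 -> \forall n \near \oo, r <= pi / (t n * sg).
Proof.
move=> t01 tc; have s0 := sg_gt0.
have : t n * sg * `|r| @[n --> \oo] --> 0 * sg * `|r|.
  by apply: cvgMl; apply: cvgMl.
rewrite !mul0r => /cvgr_lt /(_ _ (@pi_gt0 R)) H; near=> n.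
have h0 : 0 < t n * sg by rewrite mulr_gt0//; case/andP: (t01 n).
rewrite ler_pdivlMr//; apply: (le_trans (_ : _ <= t n * sg * `|r|)).
  by rewrite mulrC ler_pM2l// ler_norm.
by apply: ltW; near: n.
Unshelve. all: by end_near. Qed.

Lemma ccvg_kint (t : nat -> R) (y : nat -> int) xi x phi :
  (forall n, 0 < t n <= 1) -> t n @[n --> \oo] --> 0 ->
  t n * sg * (y n)%:~R @[n --> \oo] --> xi -> `|phi| != 1 ->
  ccvg (fun n => kint (t n) x (y n) phi) (jint x xi phi).
Proof.
move=> t01 tc yc phi1.
apply: (@ccvg_near _ (fun n => expi (- (t n * sg * (y n)%:~R * phi)) *
    (qdisc (t n) phi ^ x * chi x (qdisc (t n) phi)))).
  have := near_le_pi `|phi| t01 tc; apply: filterS => n hn.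
  by rewrite /kint hn.
apply: ccvgM; last exact: ccvg_pow_chi.
by apply: ccvg_expi; apply: cvgN; exact: cvgMl.
Qed.

Lemma cmeas_qlim : cmeasurable [set: T] qlim.
Proof. by split => /=; [exact: measurable_cst|exact: measurable_funM]. Qed.

Lemma cmeas_jint x xi : cmeasurable [set: T] (jint x xi).
Proof.
apply: cmeasM.
  under [X in cmeasurable _ X]eq_fun do rewrite -mulNr.
  exact: cmeas_expi_lin0.
apply: cmeasM; first by apply: cmeasXz; exact: cmeas_qlim.
by apply: cmeas_chi; exact: cmeas_qlim.
Qed.

Lemma ae_norm_neq1 : {ae leb, forall phi : T, `|phi| != 1}.
Proof.
apply: filterS2 (ae_neq 1) (ae_neq (-1)) => phi h1 h2.
by rewrite eqr_norml negb_and negb_or h1 h2.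
Qed.

Lemma ccvg_kscal (t : nat -> R) (y : nat -> int) xi x :
  (forall n, 0 < t n <= 1) -> t n @[n --> \oo] --> 0 ->
  t n * sg * (y n)%:~R @[n --> \oo] --> xi -> x != -1 ->
  ccvg (fun n => kscal (t n) x (y n)) ((2 * pi)%:C^-1 * cintegral leb setT (jint x xi)).
Proof.
move=> t01 tc yc x1; apply: ccvgM; first exact: ccvg_cst.
apply: (@cdominated_convergence _ _ _ leb setT measurableT _ _ dom) => //.
- by move=> n; exact: cmeas_kint.
- exact: cmeas_jint.
- by apply: filterS ae_norm_neq1 => phi h _; exact: ccvg_kint.
- exact: integrable_dom.
- by move=> n phi _; exact: kint_dom.
Qed.

Lemma kscal_bounded : exists C, forall t x y, 0 < t <= 1 -> x != -1 ->
  cabs (kscal t x y) <= C.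
Proof.
exists ((2 * pi)^-1 * (2 * \int[leb]_phi dom phi)) => t x y t01 x1.
rewrite /kscal cabsM cabsV cabsR ger0_norm ?mulr_ge0 ?pi_ge0// ler_wpM2l//.
  by rewrite invr_ge0 mulr_ge0// pi_ge0.
apply: cabs_cintegral_le => //; first exact: cintegrable_kint.
- exact: integrable_dom.
- by move=> phi _; exact: kint_dom.
Qed.

End scaled_kernel.

(** * The limit kernel *)

Section limit_kernel.
Context {R : realType}.
Notation leb := (@lebesgue_measure R).
Notation T := (measurableTypeR R).
Variable gamma : R.
Hypothesis hgamma : -1 < gamma < 1.
Notation sg := (sg gamma).
Notation qlim := (qlim gamma).

Definition outer_right (A : R) : set T := `]1, A]%classic.
Definition outer_left (A : R) : set T := `[- A, (-1)[%classic.

Lemma couter_integralE (f : R -> R[i]) (a b : R[i]) :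
  (forall A : nat -> R, A n @[n --> \oo] --> +oo ->
    ccvg (fun n => cintegral leb (outer_right (A n)) f) a /\
    ccvg (fun n => cintegral leb (outer_left (A n)) f) b) ->
  couter_integral f = a + b.
Proof.
move=> h.
have hr (g : R -> R) (D : R -> set T) l :
    (forall A : nat -> R, A n @[n --> \oo] --> +oo ->
      \int[leb]_(x in D (A n)) g x @[n --> \oo] --> l) ->
    lim ((\int[leb]_(x in D A) g x) @[A --> +oo]) = l.
  by move=> hA; apply: cvg_lim => //; apply/cvg_pinftyP.
rewrite /couter_integral /outer_integral.
rewrite (hr (fun x => complex.Re (f x)) outer_right (complex.Re a)); last first.
  by move=> A /h [[]].
rewrite (hr (fun x => complex.Re (f x)) outer_left (complex.Re b)); last first.
  by move=> A /h [_ []].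
rewrite (hr (fun x => complex.Im (f x)) outer_right (complex.Im a)); last first.
  by move=> A /h [[]].
rewrite (hr (fun x => complex.Im (f x)) outer_left (complex.Im b)); last first.
  by move=> A /h [_ []].
by rewrite -ReD -ImD; case: (a + b).
Qed.

Definition pintegrand (x : int) (xi phi : R) : R[i] :=
  expi (- (xi * phi)) * qlim phi ^ x.

Definition upper (c : R) : set T := `]c, +oo[%classic.
Definition lower (c : R) : set T := `]-oo, (- c)[%classic.

Lemma cmeas_pintegrand x xi : cmeasurable [set: T] (pintegrand x xi).
Proof.
apply: cmeasM; last by apply: cmeasXz; exact: cmeas_qlim.
under [X in cmeasurable _ X]eq_fun do rewrite -mulNr.
exact: cmeas_expi_lin0.
Qed.

Lemma qlim_ge phi : sg * `|phi| <= cabs (qlim phi).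
Proof. by apply: le_trans (Im_le_cabs _); rewrite /= normrM mulrC (gtr0_norm (sg_gt0 hgamma)). Qed.

Lemma qlim_neq0 phi : 0 < `|phi| -> qlim phi != 0.
Proof.
move=> p0; rewrite -cabs_eq0 gt_eqF// (lt_le_trans _ (qlim_ge _))//.
by rewrite mulr_gt0// sg_gt0.
Qed.

Lemma measurable_mem (D : set T) : measurable D ->
  measurable_fun [set: T] (fun x : T => x \in D).
Proof.
move=> mD; apply: (@measurable_fun_bool _ _ _ _ true) => //.
by rewrite setTI (_ : _ @^-1` _ = D)//; apply/seteqP; split => x /=; [move/set_mem|move/mem_set].
Qed.

Lemma cmeas_cpatch (D : set T) (f : T -> R[i]) : measurable D ->
  cmeasurable [set: T] f -> cmeasurable [set: T] (cpatch D f).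
Proof.
move=> mD mf; have mm := measurable_mem mD.
by rewrite /cpatch; apply: cmeas_if => //; exact: cmeas_cst.
Qed.

Lemma cabs_cpatch (D : set T) (f : T -> R[i]) (x : T) (b : R) : 0 <= b ->
  (D x -> cabs (f x) <= b) -> cabs (cpatch D f x) <= b.
Proof.
by move=> b0 h; rewrite /cpatch; case: ifPn => [/set_mem/h|_]; rewrite ?cabs0.
Qed.

Lemma cintegral_ae (f g : T -> R[i]) : cmeasurable [set: T] f -> cmeasurable [set: T] g ->
  {ae leb, forall x, f x = g x} -> cintegral leb setT f = cintegral leb setT g.
Proof.
move=> [f1 f2] [g1 g2] fg; congr (_ +i* _); congr fine; apply: ae_eq_integral => //;
  try exact/measurable_EFinP; by apply: filterS fg => x ->.
Qed.

(** Exchanges the improper integrals that define J with absolutely convergent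
    ones. *)
Lemma ccvg_exhaust (f : T -> R[i]) (b : T -> R) (D : nat -> set T) (E : set T) :
  cmeasurable [set: T] f -> leb.-integrable setT (EFin \o b) ->
  (forall x, 0 <= b x) -> (forall x, E x -> cabs (f x) <= b x) ->
  (forall n, measurable (D n)) -> measurable E -> (forall n, D n `<=` E) ->
  (forall x, E x -> \forall n \near \oo, x \in D n) ->
  ccvg (fun n => cintegral leb (D n) f) (cintegral leb E f).
Proof.
move=> mf ib b0 fb mD mE sDE DE.
have -> : (fun n => cintegral leb (D n) f) = (fun n => cintegral leb setT (cpatch (D n) f)).
  by apply/funext => n; rewrite cintegral_mkcond.
rewrite cintegral_mkcond.
apply: (@cdominated_convergence _ _ _ leb setT measurableT _ _ b) => //.
- by move=> n; exact: cmeas_cpatch.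
- exact: cmeas_cpatch.
- apply: aeW => x _; apply: (@ccvg_near _ _ (fun=> cpatch E f x)); last exact: ccvg_cst.
  have [Ex|nEx] := pselect (E x).
    by have := DE x Ex; apply: filterS => n hn; rewrite /cpatch hn mem_set.
  apply: nearW => n; rewrite /cpatch (memNset nEx) memNset//.
  by move=> /sDE.
- by move=> n x _; apply: cabs_cpatch => // /sDE; exact: fb.
Qed.

Lemma qlow_le : qlow gamma <= sg.
Proof.
have s0 := sg_gt0 hgamma; rewrite /qlow ler_pdivrMr// ler_pM2l//.
apply: (@le_trans _ _ 1) => //; last by lra.
rewrite -sqrtr1 ler_wsqrtr// -expR0 ler_expR; lra.
Qed.

Lemma qlim_low phi : qlow gamma * `|phi| <= cabs (qlim phi).
Proof. by apply: le_trans (qlim_ge phi); rewrite ler_wpM2r// qlow_le. Qed.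

Lemma jint_dom x xi phi : x != -1 -> cabs (jint gamma x xi phi) <= dom gamma phi.
Proof.
by move=> x1; rewrite /jint cabsM cabs_expi mul1r pow_chi_dom// qlim_low.
Qed.

Lemma cintegrable_jint x xi : x != -1 -> cintegrable leb setT (jint gamma x xi).
Proof.
move=> x1; apply: (@cintegrable_le _ _ _ leb setT measurableT _ (dom gamma)) => //.
- exact: cmeas_jint.
- exact: integrable_dom.
- by move=> phi _; exact: jint_dom.
Qed.

Lemma JE x xi : J gamma x xi =
  if 0 <= x then cintegral leb `[-1, 1] (fun phi => (2 * pi)%:C^-1 * pintegrand x xi phi)
  else - couter_integral (fun phi => (2 * pi)%:C^-1 * pintegrand x xi phi).
Proof.
have fE : (fun phi : R => expi (- (xi * phi)) *
    (gamma +i* (phi * Num.sqrt (1 - gamma ^+ 2))) ^ x / (2 * pi)%:C) =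
    (fun phi => (2 * pi)%:C^-1 * pintegrand x xi phi).
  by apply/funext => phi; rewrite mulrC.
by rewrite /J fE.
Qed.

Lemma J_regular x xi : x != -1 ->
  J gamma x xi = (2 * pi)%:C^-1 * cintegral leb setT (jint gamma x xi).
Proof.
move=> x1; rewrite JE.
have ij := cintegrable_jint xi x1.
have mj := cmeas_jint gamma x xi.
have mp := cmeas_pintegrand x xi.
rewrite -cintegralZ//.
case: ifPn => x0.
  rewrite cintegral_mkcond; apply: cintegral_ae.
  - by apply: cmeas_cpatch => //; apply: cmeasM => //; exact: cmeas_cst.
  - by apply: cmeasM => //; exact: cmeas_cst.
  apply: filterS (@ae_norm_neq1 R) => phi h.
  rewrite /cpatch mem_setE in_itv /= -ler_norml le_eqVlt (negbTE h) /=.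
  rewrite /jint /chi x0 cabs_qlim_lt1//; case: ifP => _; last by rewrite !mulr0.
  by rewrite mulr1.
have mf : cmeasurable [set: T] (fun phi => (2 * pi)%:C^-1 * pintegrand x xi phi).
  by apply: cmeasM => //; exact: cmeas_cst.
have bnd phi : 1 < `|phi| -> cabs ((2 * pi)%:C^-1 * pintegrand x xi phi) <=
    (2 * pi)^-1 * dom gamma phi.
  move=> h; have p0 : 0 < 2 * pi :> R by rewrite mulr_gt0// pi_gt0.
  rewrite cabsM cabsV cabsR gtr0_norm// ler_pM2l ?invr_gt0//.
  apply: le_trans (jint_dom xi phi x1).
  by rewrite /jint /chi (negbTE x0) cabs_qlim_gt1// h mulrN1 mulrN cabsN.
have ib : leb.-integrable setT (EFin \o (fun phi => (2 * pi)^-1 * dom gamma phi)).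
  rewrite (_ : _ \o _ = (fun x => ((2 * pi)^-1)%:E * (dom gamma x)%:E)%E)//.
  by apply: integrableZl => //; exact: integrable_dom.
have b0 phi : 0 <= (2 * pi)^-1 * dom gamma phi.
  by rewrite mulr_ge0 ?dom_ge0// invr_ge0 mulr_ge0// pi_ge0.
have bu phi : upper 1 phi -> 1 < `|phi|.
  by rewrite /upper /= in_itv /= andbT => h; rewrite gtr0_norm// (lt_trans ltr01).
have bl phi : lower 1 phi -> 1 < `|phi|.
  by rewrite /lower /= in_itv /= => h; rewrite ltr0_norm; lra.
have iE (E : set T) : measurable E -> (forall phi, E phi -> 1 < `|phi|) ->
    cintegrable leb setT (cpatch E (fun phi => (2 * pi)%:C^-1 * pintegrand x xi phi)).
  move=> mE hE; apply: (@cintegrable_le _ _ _ leb setT measurableT _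
    (fun phi => (2 * pi)^-1 * dom gamma phi)) => //; first exact: cmeas_cpatch.
  by move=> phi _; apply: cabs_cpatch => // /hE; exact: bnd.
have mu1 : measurable (upper 1) by exact: measurable_itv.
have ml1 : measurable (lower 1) by exact: measurable_itv.
have nj : - ((2 * pi)%:C^-1 * cintegral leb setT (jint gamma x xi)) =
    cintegral leb (upper 1) (fun phi => (2 * pi)%:C^-1 * pintegrand x xi phi) +
    cintegral leb (lower 1) (fun phi => (2 * pi)%:C^-1 * pintegrand x xi phi).
  rewrite (cintegral_mkcond (upper 1)) (cintegral_mkcond (lower 1)) -cintegralD//; [|exact: iE|exact: iE].
  rewrite -mulNr -cintegralZ//; apply: eq_cintegral => phi _.
  rewrite /cpatch /upper /lower !mem_setE !in_itv /= andbT.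
  rewrite /jint /chi (negbTE x0) cabs_qlim_gt1// /pintegrand.
  have [h|h] := ltP 1 phi.
    have h1 : 1 < `|phi| by rewrite gtr0_norm// (lt_trans ltr01).
    have h2 : (phi < -1) = false by apply/negbTE; rewrite -leNgt; lra.
    by rewrite h1 h2 addr0; ring.
  rewrite add0r; have [h'|h'] := ltP phi (-1).
    have h1 : 1 < `|phi| by rewrite ltr0_norm; lra.
    by rewrite h1; ring.
  have h1 : (1 < `|phi|) = false by apply/negbTE; rewrite -leNgt ler_norml h'.
  by rewrite h1 !mulr0.
rewrite cintegralZ// -[RHS]opprK nj; congr (- _).
apply: couter_integralE => A Ac.
split; apply: (ccvg_exhaust mf ib b0) => //; try by move=> n; exact: measurable_itv.
- by move=> phi /bu; exact: bnd.
- by move=> n phi; rewrite /outer_right /upper /= !in_itv /= andbT => /andP[].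
- move=> phi; rewrite /upper /= in_itv /= andbT => h.
  have : \forall n \near \oo, phi <= A n by move/cvgryPge : Ac; apply.
  apply: filterS => n hn.
  by rewrite mem_setE in_itv /= h.
- by move=> phi /bl; exact: bnd.
- by move=> n phi; rewrite /outer_left /lower /= !in_itv /= => /andP[].
- move=> phi; rewrite /lower /= in_itv /= => h.
  have : \forall n \near \oo, - phi <= A n by move/cvgryPge : Ac; apply.
  apply: filterS => n hn.
  by rewrite mem_setE in_itv /= h andbT lerNl.
Qed.

(** * Integration by parts *)

Lemma cintegral_obnd (a b : R) (f : T -> R[i]) : cintegrable leb `[a, b] f ->
  cintegral leb `]a, b] f = cintegral leb `[a, b] f.
Proof.
move=> [f1 f2]; congr (_ +i* _); apply: Rintegral_itv_obnd_cbnd.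
  by apply: integrableS f1 => //; exact: subset_itv_oc_cc.
by apply: integrableS f2 => //; exact: subset_itv_oc_cc.
Qed.

Lemma cintegral_bndo (a b : R) (f : T -> R[i]) : cintegrable leb `[a, b] f ->
  cintegral leb `[a, b[ f = cintegral leb `[a, b] f.
Proof.
move=> [f1 f2]; congr (_ +i* _); apply: Rintegral_itv_bndo_bndc.
  by apply: integrableS f1 => //; exact: subset_itv_co_cc.
by apply: integrableS f2 => //; exact: subset_itv_co_cc.
Qed.

Definition ibp_bdry (xi : R) (D : R -> R[i]) (x : R) : R[i] :=
  'i * xi%:C^-1 * (expi (- (xi * x)) * (D x)^-1).

Lemma cintegral_by_parts (xi a b : R) (D D' : R -> R[i]) : xi != 0 -> a < b ->
  (forall x, a <= x <= b -> D x != 0) ->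
  (forall x, a <= x <= b -> cderive D (D' x) x) ->
  (forall x, a <= x <= b -> forall u : nat -> R, u n @[n --> \oo] --> x ->
     ccvg (fun n => D (u n)) (D x) /\ ccvg (fun n => D' (u n)) (D' x)) ->
  cintegrable leb `[a, b] (fun x => expi (- (xi * x)) * (D x)^-1) ->
  cintegrable leb `[a, b] (fun x => expi (- (xi * x)) * (D' x / D x ^+ 2)) ->
  cintegral leb `[a, b] (fun x => expi (- (xi * x)) * (D x)^-1) =
  ibp_bdry xi D b - ibp_bdry xi D a +
  'i * xi%:C^-1 * cintegral leb `[a, b] (fun x => expi (- (xi * x)) * (D' x / D x ^+ 2)).
Proof.
move=> xi0 ab D0 dD cD i1 i2.
have xiC : xi%:C != 0 :> R[i] by rewrite eq_complex /= negb_and xi0.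
pose k : R[i] := 'i * xi%:C^-1.
have ii : 'i * 'i = -1 :> R[i] by rewrite -expr2 sqr_i.
have ce x (u : nat -> R) : u n @[n --> \oo] --> x ->
    ccvg (fun n => expi (- (xi * u n))) (expi (- (xi * x))).
  by move=> ux; apply: ccvg_expi; apply: cvgN; exact: cvgMr.
rewrite -(@cintegral_FTC _ (ibp_bdry xi D)
  (fun x => expi (- (xi * x)) * (D x)^-1 + - k * (expi (- (xi * x)) * (D' x / D x ^+ 2)))) //.
- rewrite cintegralD// ?cintegralZ//; last by apply: cintegrableZ.
  by rewrite -/k mulNr subrK.
- move=> x xab.
  have := cderiveM (cderive_cst k x) (cderiveM (cderive_expi (- xi) 0 x) (cderiveV (D0 x xab) (dD x xab))).
  rewrite mul0r add0r addr0 mulNr.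
  have -> : k * ('i * (- xi)%:C * expi (- (xi * x)) / D x +
      expi (- (xi * x)) * - (D' x / D x ^+ 2)) =
      expi (- (xi * x)) * (D x)^-1 + - k * (expi (- (xi * x)) * (D' x / D x ^+ 2)).
    rewrite mulrDr mulrN mulrN mulNr; congr (_ + _).
    rewrite /k rmorphN /= -[RHS]mul1r -(mulfV xiC) -[X in _ = X * _]opprK -[- (_ / _)]mulN1r -ii.
    by ring.
  rewrite /ibp_bdry -/k; congr cderive; apply/funext => z.
  by rewrite addr0 mulNr.
- move=> x xab u ux; have [c1 c2] := cD x xab u ux.
  apply: ccvgD; first by apply: ccvgM; [exact: ce|apply: ccvgV => //; exact: D0].
  apply: ccvgM; first exact: ccvg_cst.
  apply: ccvgM; first exact: ce.
  apply: ccvgM => //; apply: ccvgV; first by rewrite expf_neq0// D0.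
  exact: ccvgX.
Qed.

End limit_kernel.

(** * The conditionally convergent case x = -1 *)

Section conditional_case.
Context {R : realType}.
Notation leb := (@lebesgue_measure R).
Notation T := (measurableTypeR R).
Variable gamma : R.
Hypothesis hgamma : -1 < gamma < 1.
Notation sg := (sg gamma).
Notation qlim := (qlim gamma).
Notation qdisc := (qdisc gamma).

Let s0 : 0 < sg := sg_gt0 hgamma.

(** Beyond this value, and within the period, |q| >= 1 for all t: chi is constant. *)
Definition cut : R := (qlow gamma)^-1.

Let l0 : 0 < qlow gamma := qlow_gt0 hgamma.

Lemma cut_ge1 : 1 <= cut.
Proof.
rewrite /cut invf_ge1//; apply: le_trans (qlow_le hgamma) _.
rewrite -sqrtr1 /sg ler_wsqrtr// gerBl sqr_ge0 //.
Qed.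

Let cut0 : 0 < cut.
Proof. exact: lt_le_trans ltr01 cut_ge1. Qed.

Lemma cut_lt (phi : R) : cut <= `|phi| -> 1 <= qlow gamma * `|phi|.
Proof. by move=> h; rewrite mulrC -ler_pdivrMr// mul1r. Qed.

Lemma cut_lt' (phi : R) : cut < `|phi| -> 1 < qlow gamma * `|phi|.
Proof. by move=> h; rewrite mulrC -ltr_pdivrMr// mul1r. Qed.

Lemma cintegral_split (S S1 S2 : set T) (f : T -> R[i]) :
  cintegrable leb setT (cpatch S1 f) -> cintegrable leb setT (cpatch S2 f) ->
  (forall x, cpatch S f x = cpatch S1 f x + cpatch S2 f x) ->
  cintegral leb S f = cintegral leb S1 f + cintegral leb S2 f.
Proof.
move=> i1 i2 h; rewrite (cintegral_mkcond S) (cintegral_mkcond S1) (cintegral_mkcond S2).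
by rewrite -cintegralD//; apply: eq_cintegral => x _; exact: h.
Qed.

Lemma cpatch_setU (S S1 S2 : set T) (f : T -> R[i]) x :
  S = S1 `|` S2 -> S1 `&` S2 = set0 -> cpatch S f x = cpatch S1 f x + cpatch S2 f x.
Proof.
move=> -> d; rewrite /cpatch in_setU; have [x1|x1] := boolP (x \in S1).
  rewrite /= ifF ?addr0//; apply/negbTE; rewrite notin_setE => x2.
  have h : (S1 `&` S2) x := conj (set_mem x1) x2.
  by rewrite d in h.
by rewrite /= add0r.
Qed.

Definition tail : set T := [set phi | cut < `|phi|].
Definition tailB (B : R) : set T := [set phi | cut < `|phi| <= B].

Lemma tailBE B : tailB B = `]cut, B]%classic `|` `[- B, - cut[%classic.
Proof.
apply/seteqP; split => phi; rewrite /tailB /= !in_itv /=.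
  move=> /andP[]; have [h|h] := leP 0 phi.
    by rewrite ger0_norm// => h1 h2; left; rewrite h1.
  by rewrite ltr0_norm// => h1 h2; right; apply/andP; split; lra.
case=> /andP[h1 h2].
  by rewrite gtr0_norm ?h1 ?h2// (lt_trans cut0).
have h3 : phi < 0 by rewrite (lt_trans h2)// oppr_lt0.
by rewrite ltr0_norm//; apply/andP; split; lra.
Qed.

Lemma tailE : tail = `]cut, +oo[%classic `|` `]-oo, - cut[%classic.
Proof.
apply/seteqP; split => phi; rewrite /tail /= !in_itv /= andbT.
  have [h|h] := leP 0 phi; first by rewrite ger0_norm//; left.
  by rewrite ltr0_norm// => h1; right; lra.
case=> h1; first by rewrite gtr0_norm// (lt_trans cut0).
by have c0 := cut0; rewrite ltr0_norm; lra.
Qed.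

Lemma measurable_tail : measurable tail.
Proof. by rewrite tailE; apply: measurableU; exact: measurable_itv. Qed.

Lemma measurable_tailB B : measurable (tailB B).
Proof. by rewrite tailBE; apply: measurableU; exact: measurable_itv. Qed.

Lemma disj_tail (B : R) : `]cut, B]%classic `&` `[- B, - cut[%classic = set0 :> set T.
Proof.
have c0 := cut0; apply/seteqP; split => // phi []; rewrite /= !in_itv /= => /andP[h1 _] /andP[_ h2]; lra.
Qed.

Lemma disj_tail' : `]cut, +oo[%classic `&` `]-oo, - cut[%classic = set0 :> set T.
Proof.
have c0 := cut0; apply/seteqP; split => // phi []; rewrite /= !in_itv /= andbT => h1 h2; lra.
Qed.

Definition qder t phi : R[i] :=
  'i * (t * sg)%:C * expi (t * sg * phi) * (expR (gamma * t))%:C / t%:C.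

Lemma cderive_qdisc t phi : cderive (qdisc t) (qder t phi) phi.
Proof.
have h := cderiveM (cderiveD (cderiveM (cderive_expi (t * sg) 0 phi)
  (cderive_cst (expR (gamma * t))%:C phi)) (cderive_cst (-1) phi))
  (cderive_cst (t%:C^-1) phi).
have -> : qder t phi = ('i * (t * sg)%:C * expi (t * sg * phi + 0) * (expR (gamma * t))%:C +
         expi (t * sg * phi + 0) * 0 + 0) * t%:C^-1 +
        (expi (t * sg * phi + 0) * (expR (gamma * t))%:C + -1) * 0.
  by rewrite /qder !addr0 !mulr0 !addr0.
by move: h; congr cderive; apply/funext => x; rewrite /qdisc addr0.
Qed.

Lemma cabs_qder t phi : 0 < t <= 1 -> cabs (qder t phi) <= sg * expR 1.
Proof.
move=> t01; have [t0 _] := andP t01.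
have [_ e2] := andP (expR_gt_ge hgamma t01).
rewrite /qder !cabsM cabsV !cabsR cabs_expi mulr1.
have -> : cabs ('i : R[i]) = 1 by rewrite cabsE /= expr0n expr1n add0r sqrtr1.
rewrite mul1r !gtr0_norm ?expR_gt0 ?mulr_gt0//.
have -> : t * sg * expR (gamma * t) / t = sg * expR (gamma * t) by field; rewrite gt_eqF.
by rewrite ler_pM2l.
Qed.

Lemma cmeas_qder t : cmeasurable [set: T] (qder t).
Proof.
apply: cmeasM; last exact: cmeas_cst.
apply: cmeasM; last exact: cmeas_cst.
apply: cmeasM; first exact: cmeas_cst.
exact: cmeas_expi_lin0.
Qed.

Lemma ccvg_qdisc_cont t phi (u : nat -> R) : u n @[n --> \oo] --> phi ->
  ccvg (fun n => qdisc t (u n)) (qdisc t phi) /\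
  ccvg (fun n => qder t (u n)) (qder t phi).
Proof.
move=> uc.
have ec : ccvg (fun n => expi (t * sg * u n)) (expi (t * sg * phi)).
  by apply: ccvg_expi; exact: cvgMr.
split.
  apply: ccvgM; last exact: ccvg_cst.
  apply: ccvgD; last exact: ccvg_cst.
  by apply: ccvgM => //; exact: ccvg_cst.
do 2 (apply: ccvgM; last exact: ccvg_cst).
by apply: ccvgM => //; exact: ccvg_cst.
Qed.

Definition tauf (xi : R) (D D' : R -> R[i]) (phi : R) : R[i] :=
  expi (- (xi * phi)) * (D' phi / D phi ^+ 2).

Lemma cmeas_tauf xi D D' : cmeasurable [set: T] D -> cmeasurable [set: T] D' ->
  cmeasurable [set: T] (tauf xi D D').
Proof.
move=> mD mD'; apply: cmeasM.
  under [X in cmeasurable _ X]eq_fun do rewrite -mulNr.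
  exact: cmeas_expi_lin0.
by apply: cmeasM => //; apply: cmeasV; exact: cmeasX.
Qed.

Lemma cmeas_einv xi D : cmeasurable [set: T] D ->
  cmeasurable [set: T] (fun phi => expi (- (xi * phi)) * (D phi)^-1).
Proof.
move=> mD; apply: cmeasM; last exact: cmeasV.
under [X in cmeasurable _ X]eq_fun do rewrite -mulNr.
exact: cmeas_expi_lin0.
Qed.

(** Away from [-cut, cut] one integration by parts, on each half-line, trades the
    conditionally convergent integral of 1/q for that of q'/q^2. *)
Lemma tail_by_parts (xi B M : R) (D D' : R -> R[i]) : xi != 0 -> cut < B ->
  cmeasurable [set: T] D -> cmeasurable [set: T] D' ->
  (forall phi, cut <= `|phi| <= B -> 1 <= cabs (D phi)) ->
  (forall phi, cabs (D' phi) <= M) ->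
  (forall phi, cderive D (D' phi) phi) ->
  (forall phi (u : nat -> R), u n @[n --> \oo] --> phi ->
     ccvg (fun n => D (u n)) (D phi) /\ ccvg (fun n => D' (u n)) (D' phi)) ->
  [/\ cintegral leb `]cut, B] (fun phi => expi (- (xi * phi)) * (D phi)^-1) =
      ibp_bdry xi D B - ibp_bdry xi D cut +
      'i * xi%:C^-1 * cintegral leb `]cut, B] (tauf xi D D'),
      cintegral leb `[- B, - cut[ (fun phi => expi (- (xi * phi)) * (D phi)^-1) =
      ibp_bdry xi D (- cut) - ibp_bdry xi D (- B) +
      'i * xi%:C^-1 * cintegral leb `[- B, - cut[ (tauf xi D D') &
      [/\ cintegrable leb setT (cpatch `]cut, B] (fun phi => expi (- (xi * phi)) * (D phi)^-1)),
          cintegrable leb setT (cpatch `[- B, - cut[ (fun phi => expi (- (xi * phi)) * (D phi)^-1)),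
          cintegrable leb setT (cpatch `]cut, B] (tauf xi D D')) &
          cintegrable leb setT (cpatch `[- B, - cut[ (tauf xi D D'))]].
Proof.
move=> xi0 cB mD mD' D1 DM dD cD.
have M0 : 0 <= M by apply: le_trans (DM 0); exact: cabs_ge0.
have D0 phi : cut <= `|phi| <= B -> D phi != 0.
  by move=> /D1 h; rewrite -cabs_eq0 gt_eqF// (lt_le_trans ltr01).
have bE phi : cut <= `|phi| <= B -> cabs (expi (- (xi * phi)) * (D phi)^-1) <= 1.
  move=> /D1 h; rewrite cabsM cabs_expi mul1r cabsV invf_le1//.
  by rewrite (lt_le_trans ltr01).
have bt phi : cut <= `|phi| <= B -> cabs (tauf xi D D' phi) <= M.
  move=> /D1 h; rewrite /tauf cabsM cabs_expi mul1r cabsM cabsV cabsX.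
  rewrite ler_pdivrMr; last by rewrite exprn_gt0// (lt_le_trans ltr01).
  by apply: (le_trans (DM phi)); rewrite ler_peMr// exprn_ege1.
have mE := cmeas_einv xi mD.
have mt := cmeas_tauf xi mD mD'.
have abp phi : cut <= phi <= B -> cut <= `|phi| <= B.
  by move=> /andP[h1 h2]; rewrite ger0_norm ?h1// (le_trans (ltW cut0)).
have abn phi : - B <= phi <= - cut -> cut <= `|phi| <= B.
  move=> /andP[h1 h2]; have h3 : phi < 0 by rewrite (le_lt_trans h2)// oppr_lt0.
  by rewrite ltr0_norm//; apply/andP; split; lra.
have iE1 : cintegrable leb `[cut, B] (fun phi => expi (- (xi * phi)) * (D phi)^-1).
  by apply: (@cintegrable_bounded _ _ _ 1) => [|phi /abp]; [exact: cmeasS mE|exact: bE].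
have iE2 : cintegrable leb `[- B, - cut] (fun phi => expi (- (xi * phi)) * (D phi)^-1).
  by apply: (@cintegrable_bounded _ _ _ 1) => [|phi /abn]; [exact: cmeasS mE|exact: bE].
have it1 : cintegrable leb `[cut, B] (tauf xi D D').
  by apply: (@cintegrable_bounded _ _ _ M) => [|phi /abp]; [exact: cmeasS mt|exact: bt].
have it2 : cintegrable leb `[- B, - cut] (tauf xi D D').
  by apply: (@cintegrable_bounded _ _ _ M) => [|phi /abn]; [exact: cmeasS mt|exact: bt].
have sub (f : T -> R[i]) (S S' : set T) : measurable S -> measurable S' -> S' `<=` S ->
    cintegrable leb S f -> cintegrable leb setT (cpatch S' f).
  move=> mS mS' SS [f1 f2]; apply/(cintegrable_mkcond _ mS').
  by split; [apply: integrableS f1|apply: integrableS f2].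
have m1 := measurable_itv `]cut, B]. have m2 := measurable_itv `[- B, - cut[.
have m3 := measurable_itv `[cut, B]. have m4 := measurable_itv `[- B, - cut].
split.
- rewrite !cintegral_obnd//; apply: cintegral_by_parts => //.
  + by move=> x /abp; exact: D0.
  + by move=> x _ u; exact: cD.
- rewrite !cintegral_bndo//; apply: cintegral_by_parts => //.
  + by rewrite ltrN2.
  + by move=> x /abn; exact: D0.
  + by move=> x _ u; exact: cD.
split.
- by apply: sub iE1 => //; exact: subset_itv_oc_cc.
- by apply: sub iE2 => //; exact: subset_itv_co_cc.
- by apply: sub it1 => //; exact: subset_itv_oc_cc.
- by apply: sub it2 => //; exact: subset_itv_co_cc.
Qed.

Definition mid : set T := `[- cut, cut]%classic.

(** The boundary terms at the two ends of the period cancel. *)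
Lemma kint_split t (y : int) : 0 < t <= 1 -> cut < pi / (t * sg) ->
  t * sg * y%:~R != 0 ->
  cintegral leb setT (kint gamma t (-1) y) =
  cintegral leb mid (kint gamma t (-1) y) -
  (ibp_bdry (t * sg * y%:~R) (qdisc t) (- cut) - ibp_bdry (t * sg * y%:~R) (qdisc t) cut +
   'i * (t * sg * y%:~R)%:C^-1 *
   cintegral leb (tailB (pi / (t * sg))) (tauf (t * sg * y%:~R) (qdisc t) (qder t))).
Proof.
move=> t01; set B := pi / (t * sg); set xi := t * sg * y%:~R => cB xi0.
have [t0 t1] := andP t01.
have h0 : 0 < t * sg by rewrite mulr_gt0.
have q1 phi : cut <= `|phi| <= B -> 1 <= cabs (qdisc t phi).
  move=> /andP[h1 h2]; apply: le_trans (qdisc_low hgamma t01 h2).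
  exact: cut_lt.
have [e1 e2 [i1 i2 i3 i4]] := tail_by_parts xi0 cB (cmeas_qdisc gamma t) (cmeas_qder t)
  q1 (fun phi => cabs_qder phi t01) (cderive_qdisc t) (@ccvg_qdisc_cont t).
pose E phi := expi (- (xi * phi)) * (qdisc t phi)^-1.
have ik := cintegrable_kint gamma t (-1) y.
have mmid : measurable mid by exact: measurable_itv.
have imid : cintegrable leb setT (cpatch mid (kint gamma t (-1) y)).
  case: ik => k1 k2; apply/(cintegrable_mkcond _ mmid).
  by split; [apply: integrableS k1|apply: integrableS k2].
have bdry : ibp_bdry xi (qdisc t) B = ibp_bdry xi (qdisc t) (- B).
  have hB : t * sg * B = pi by rewrite /B mulrC mulfVK// gt_eqF.
  have hxi : xi * B = pi * y%:~R by rewrite /xi mulrAC hB.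
  rewrite /ibp_bdry /qdisc !mulrN hB hxi opprK expi_piz.
  have -> : expi (pi * y%:~R) = (-1) ^ y :> R[i] by rewrite -expiXz expi_pi.
  by rewrite expiN expi_pi invrN1.
have tE : cintegral leb (tailB B) (tauf xi (qdisc t) (qder t)) =
    cintegral leb `]cut, B] (tauf xi (qdisc t) (qder t)) +
    cintegral leb `[- B, - cut[ (tauf xi (qdisc t) (qder t)).
  apply: cintegral_split => // x; apply: cpatch_setU; [exact: tailBE|exact: disj_tail].
rewrite tE.
transitivity (cintegral leb mid (kint gamma t (-1) y) -
    (cintegral leb `]cut, B] E + cintegral leb `[- B, - cut[ E)).
  have iEE := cintegrableD measurableT i1 i2.
  rewrite (cintegral_mkcond mid) (cintegral_mkcond `]cut, B]) (cintegral_mkcond `[- B, - cut[).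
  have iN : cintegrable leb setT (fun x => - (cpatch `]cut, B] E x + cpatch `[- B, - cut[ E x)).
    have := cintegrableZ measurableT (-1) iEE; congr cintegrable; apply/funext => x.
    by rewrite mulN1r.
  rewrite -cintegralD// -cintegralN// -cintegralD//.
  apply: eq_cintegral => phi _.
  rewrite -(@cpatch_setU (tailB B) _ _ E phi (tailBE B) (disj_tail B)).
  have -> : cpatch (tailB B) E phi = if cut < `|phi| <= B then E phi else 0.
    rewrite /cpatch; case: ifPn => [/set_mem ->//|].
    by rewrite notin_setE /tailB /= => /negP/negbTE ->.
  rewrite /cpatch mem_setE in_itv /= -ler_norml.
  have [h|h] := leP `|phi| cut; first by rewrite subr0.
  rewrite add0r /= /kint -/B; case: ifP => hB; last by rewrite oppr0.
  have q1' : 1 < cabs (qdisc t phi).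
    by apply: lt_le_trans (qdisc_low hgamma t01 hB); exact: cut_lt'.
  by rewrite /chi q1' /E /= mulrN1 mulrN.
congr (_ - _); rewrite e1 e2 bdry mulrDr; ring.
Qed.

(** J (-1) xi after the integration by parts: the discrete kernels tend to this
    form by dominated convergence. *)
Definition m1_limit (xi : R) : R[i] := (2 * pi)%:C^-1 *
  (cintegral leb mid (jint gamma (-1) xi) -
   (ibp_bdry xi qlim (- cut) - ibp_bdry xi qlim cut +
    'i * xi%:C^-1 * cintegral leb tail (tauf xi qlim (fun=> 'i * sg%:C)))).

Definition tail_dom (phi : R) : R := sg * expR 1 * dom gamma phi.

Lemma integrable_tail_dom : leb.-integrable setT (EFin \o tail_dom).
Proof.
rewrite (_ : _ \o _ = (fun x => (sg * expR 1)%:E * (dom gamma x)%:E)%E)//.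
by apply: integrableZl => //; exact: integrable_dom.
Qed.

Lemma tauf_dom xi (D D' : R -> R[i]) phi : cut < `|phi| ->
  qlow gamma * `|phi| <= cabs (D phi) -> cabs (D' phi) <= sg * expR 1 ->
  cabs (tauf xi D D' phi) <= tail_dom phi.
Proof.
move=> hc hD hD'; rewrite /tauf cabsM cabs_expi mul1r cabsM.
apply: ler_pM; rewrite ?cabs_ge0//.
have h1 : 1 < cabs (D phi) by apply: lt_le_trans hD; exact: cut_lt'.
have := pow_chi_dom (x := -2) hgamma isT hD.
by rewrite /chi h1 /= cabsM cabsN cabs1 mulr1 -exprnN.
Qed.

Lemma ccvg_kscal_m1 (t : nat -> R) (y : nat -> int) xi :
  (forall n, 0 < t n <= 1) -> t n @[n --> \oo] --> 0 ->
  t n * sg * (y n)%:~R @[n --> \oo] --> xi -> xi != 0 ->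
  ccvg (fun n => kscal gamma (t n) (-1) (y n)) (m1_limit xi).
Proof.
move=> t01 tc yc xi0.
have xiC : xi%:C != 0 :> R[i] by rewrite eq_complex /= negb_and xi0.
pose x n := t n * sg * (y n)%:~R.
have nx : \forall n \near \oo, x n != 0.
  by have := cvgr_neq0 _ yc xi0; apply.
have nB := near_le_pi hgamma (cut + 1) t01 tc.
apply: ccvgM; first exact: ccvg_cst.
apply: (@ccvg_near _ _ (fun n => cintegral leb mid (kint gamma (t n) (-1) (y n)) -
  (ibp_bdry (x n) (qdisc (t n)) (- cut) - ibp_bdry (x n) (qdisc (t n)) cut +
   'i * (x n)%:C^-1 *
   cintegral leb (tailB (pi / (t n * sg))) (tauf (x n) (qdisc (t n)) (qder (t n)))))).
  apply: filterS2 nx nB => n h1 h2; apply: kint_split => //.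
  by rewrite (lt_le_trans _ h2)// ltrDl.
have mmid : measurable mid by exact: measurable_itv.
have cb phi : `|phi| = cut -> ccvg (fun n => ibp_bdry (x n) (qdisc (t n)) phi) (ibp_bdry xi qlim phi).
  move=> hp; apply: ccvgM.
    by apply: ccvgM; [exact: ccvg_cst|apply: ccvgV => //; exact: ccvg_real].
  apply: ccvgM; first by apply: ccvg_expi; apply: cvgN; exact: cvgMl.
  by apply: ccvgV; [apply: qlim_neq0; rewrite ?hp|exact: ccvg_qdisc].
apply: ccvgD; last (apply: ccvgN; apply: ccvgD; [apply: ccvgD; [|apply: ccvgN]|apply: ccvgM]).
- apply: (@cdominated_convergence _ _ _ leb mid mmid _ _ (cst 1)).
  + by move=> n; apply: cmeasS (cmeas_kint gamma _ _ _).
  + by apply: cmeasS (cmeas_jint _ _ _).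
  + by apply: filterS (@ae_norm_neq1 R) => phi h _; exact: ccvg_kint.
  + exact: integrable_cst_itv.
  + by move=> n phi _; exact: kint_le1.
- by apply: cb; rewrite normrN gtr0_norm.
- by apply: cb; rewrite gtr0_norm.
- by apply: ccvgM; [exact: ccvg_cst|apply: ccvgV => //; exact: ccvg_real].
rewrite (cintegral_mkcond tail).
have -> : (fun n => cintegral leb (tailB (pi / (t n * sg))) (tauf (x n) (qdisc (t n)) (qder (t n)))) =
  (fun n => cintegral leb setT (cpatch (tailB (pi / (t n * sg))) (tauf (x n) (qdisc (t n)) (qder (t n))))).
  by apply/funext => n; rewrite cintegral_mkcond.
have td0 phi : 0 <= tail_dom phi.
  by rewrite /tail_dom mulr_ge0 ?dom_ge0// mulr_ge0 ?expR_ge0// ltW.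
apply: (@cdominated_convergence _ _ _ leb setT measurableT _ _ tail_dom) => //.
- move=> n; apply: cmeas_cpatch; first exact: measurable_tailB.
  by apply: cmeas_tauf; [exact: cmeas_qdisc|exact: cmeas_qder].
- apply: cmeas_cpatch; first exact: measurable_tail.
  by apply: cmeas_tauf; [exact: cmeas_qlim|exact: cmeas_cst].
- apply: aeW => phi _; have [hp|hp] := ltP cut `|phi|; last first.
    have h1 : phi \in tail = false by apply/negbTE; rewrite notin_setE /tail /= => /(le_lt_trans hp); rewrite ltxx.
    rewrite /cpatch h1; apply: (@ccvg_near _ _ (fun=> 0)); last exact: ccvg_cst.
    apply: nearW => n; rewrite ifF//; apply/negbTE; rewrite notin_setE /tailB /= => /andP[].
    by move=> /(le_lt_trans hp); rewrite ltxx.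
  rewrite /cpatch (mem_set (hp : tail phi)).
  apply: (@ccvg_near _ _ (fun n => tauf (x n) (qdisc (t n)) (qder (t n)) phi)).
    have := near_le_pi hgamma `|phi| t01 tc; apply: filterS => n hn.
    by rewrite mem_set// /tailB /= hp hn.
  have q0 : qlim phi != 0 by apply: qlim_neq0; rewrite ?(lt_trans cut0).
  apply: ccvgM; first by apply: ccvg_expi; apply: cvgN; exact: cvgMl.
  apply: ccvgM; last by apply: ccvgV; [rewrite expf_neq0|apply: ccvgX; exact: ccvg_qdisc].
  apply: (@ccvg_near _ _ (fun n => 'i * sg%:C * expi (t n * sg * phi) * (expR (gamma * t n))%:C)).
    apply: nearW => n; rewrite /qder rmorphM /=.
    have tn0 : (t n)%:C != 0 :> R[i].
      by rewrite eq_complex /= negb_and gt_eqF//; case/andP: (t01 n).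
    by field.
  rewrite -[X in ccvg _ X]mulr1 -[X in ccvg _ X]mulr1.
  apply: ccvgM; last first.
    have -> : (1 : R[i]) = (expR (gamma * 0))%:C by rewrite mulr0 expR0.
    apply: ccvg_real; apply: continuous_cvg; first exact: continuous_expR.
    exact: cvgMr.
  apply: ccvgM; first exact: ccvg_cst.
  have -> : (1 : R[i]) = expi (0 * sg * phi) by rewrite !mul0r expi0.
  by apply: ccvg_expi; apply: cvgMl; apply: cvgMl.
- exact: integrable_tail_dom.
- move=> n phi _; apply: cabs_cpatch => // /andP[h1 h2].
  by apply: tauf_dom => //; [exact: qdisc_low|exact: cabs_qder].
Qed.

End conditional_case.

(** * Convergence of the kernel *)

Section kernel_limit.
Context {R : realType}.
Notation leb := (@lebesgue_measure R).
Notation T := (measurableTypeR R).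
Variable gamma : R.
Hypothesis hgamma : -1 < gamma < 1.
Notation sg := (sg gamma).
Notation qlim := (qlim gamma).
Notation qdisc := (qdisc gamma).
Notation cut := (cut gamma).
Notation mid := (mid gamma).
Notation tail := (tail gamma).
Notation J := (J gamma).
Notation kscal := (kscal gamma).

Let s0 : 0 < sg := sg_gt0 hgamma.
Let cut0 : 0 < cut.
Proof. exact: lt_le_trans ltr01 (cut_ge1 hgamma). Qed.

Lemma qlim_ge1 phi : 1 <= `|phi| -> 1 <= cabs (qlim phi).
Proof.
rewrite le_eqVlt => /predU1P[h|h]; last by rewrite ltW// cabs_qlim_gt1.
rewrite leNgt cabs_qlim_lt1// -h ltxx//.
Qed.

Lemma J_conditional xi : xi != 0 -> J (-1) xi = m1_limit gamma xi.
Proof.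
move=> xi0; rewrite JE /=.
pose c : R[i] := (2 * pi)%:C^-1.
pose p (phi : R) := expi (- (xi * phi)) * (qlim phi)^-1.
pose tf := tauf xi qlim (fun=> 'i * sg%:C).
pose k : R[i] := 'i * xi%:C^-1.
have pE phi : pintegrand gamma (-1) xi phi = p phi by rewrite /pintegrand exprN1.
have mp : cmeasurable [set: T] (p : T -> R[i]) by apply: cmeas_einv; exact: cmeas_qlim.
have mtf : cmeasurable [set: T] (tf : T -> R[i]).
  by apply: cmeas_tauf; [exact: cmeas_qlim|exact: cmeas_cst].
have bp phi : 1 <= `|phi| -> cabs (p phi) <= 1.
  move=> h; have h1 := qlim_ge1 h.
  by rewrite /p cabsM cabs_expi mul1r cabsV invf_le1// (lt_le_trans ltr01).
have sgC : cabs ('i * sg%:C : R[i]) <= sg * expR 1.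
  rewrite cabsM cabsR (gtr0_norm s0).
  have -> : cabs ('i : R[i]) = 1 by rewrite cabsE /= expr0n expr1n add0r sqrtr1.
  rewrite mul1r ler_peMr ?(ltW s0)//.
  by rewrite -expR0 ler_expR.
have btf phi : tail phi -> cabs (tf phi) <= tail_dom gamma phi.
  by move=> h; apply: tauf_dom => //; exact: qlim_low.
have td0 phi : 0 <= tail_dom gamma phi.
  by rewrite /tail_dom mulr_ge0 ?dom_ge0// mulr_ge0 ?expR_ge0// ltW.
have itd := integrable_tail_dom gamma.
have itf (E : set T) : measurable E -> E `<=` tail -> cintegrable leb setT (cpatch E tf).
  move=> mE hE; apply: (@cintegrable_le _ _ _ leb setT measurableT _ (tail_dom gamma)) => //.
    exact: cmeas_cpatch.
  by move=> phi _; apply: cabs_cpatch => // /hE; exact: btf.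
have ip (E : set T) (a b : R) : measurable E -> E `<=` `[a, b] -> (forall phi, E phi -> 1 <= `|phi|) ->
    cintegrable leb setT (cpatch E p).
  move=> mE hE hE1; have -> : cpatch E p = cpatch `[a, b] (cpatch E p).
    apply/funext => x; rewrite /cpatch; case: ifPn => [/set_mem/hE xE|_].
      by rewrite mem_set.
    by case: ifP.
  apply/(cintegrable_mkcond _ (measurable_itv _)).
  apply: (@cintegrable_bounded _ _ _ 1); first by apply: cmeasS (cmeas_cpatch mE mp).
  by move=> x _; apply: cabs_cpatch => // /hE1; exact: bp.
pose tr := `]cut, +oo[%classic : set T. pose tl := `]-oo, (- cut)[%classic : set T.
have mtr : measurable tr by exact: measurable_itv.
have mtl : measurable tl by exact: measurable_itv.
have trS : tr `<=` tail by rewrite (tailE hgamma); exact: subsetUl.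
have tlS : tl `<=` tail by rewrite (tailE hgamma); exact: subsetUr.
pose ir := `]1, cut]%classic : set T. pose il := `[- cut, (-1)[%classic : set T.
have c1 := cut_ge1 hgamma.
have by_parts (B : R) : cut < B -> [/\ cintegral leb `]cut, B] p =
      ibp_bdry xi qlim B - ibp_bdry xi qlim cut + k * cintegral leb `]cut, B] tf &
      cintegral leb `[- B, - cut[ p =
      ibp_bdry xi qlim (- cut) - ibp_bdry xi qlim (- B) + k * cintegral leb `[- B, - cut[ tf].
  move=> cB; have [] := @tail_by_parts _ _ hgamma xi B (sg * expR 1) qlim (fun=> 'i * sg%:C) xi0 cB
    (cmeas_qlim gamma) (cmeas_cst _ _) _ _ _ _ => //.
  - by move=> phi /andP[h _]; apply: qlim_ge1; exact: le_trans h.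
  - move=> phi; split => /=.
      apply: is_derive_eq; rewrite /GRing.scale /= ?mul0r ?mul1r ?subr0//.
    apply: is_derive_eq; rewrite /GRing.scale /=; ring.
  move=> phi u uc; split; last exact: ccvg_cst.
  by split => /=; [exact: cvg_cst|exact: cvgMl].
have bd0 (A : nat -> R) (e : R) : `|e| = 1 -> A n @[n --> \oo] --> +oo ->
    ccvg (fun n => ibp_bdry xi qlim (e * A n)) 0.
  move=> e1 Ac.
  have h0 : cabs (ibp_bdry xi qlim (e * A n)) @[n --> \oo] --> 0.
    apply: (@squeeze_cvgr _ _ _ _ (fun=> 0) (fun n => `|xi|^-1 * (sg^-1 * (A n)^-1))); last 2 first.
    - exact: cvg_cst.
    - rewrite -[X in _ --> X](mulr0 `|xi|^-1); apply: cvgMr.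
      rewrite -[X in _ --> X](mulr0 sg^-1); apply: cvgMr.
      apply/gtr0_cvgV0 => //; move/cvgryPgt : Ac; apply.
    have : \forall n \near \oo, 0 < A n by move/cvgryPgt : Ac; apply.
    apply: filterS => n An; apply/andP; split; first exact: cabs_ge0.
    rewrite /ibp_bdry; rewrite cabsM; rewrite cabsM cabsM !cabsV; rewrite cabs_expi cabsR; rewrite mul1r.
    have -> : cabs ('i : R[i]) = 1 by rewrite cabsE /= expr0n expr1n add0r sqrtr1.
    rewrite mul1r ler_wpM2l ?invr_ge0// -invfM lef_pV2 ?posrE ?mulr_gt0//.
      apply: le_trans (qlim_ge hgamma _).
      by rewrite normrM e1 mul1r gtr0_norm.
    apply: lt_le_trans (qlim_ge hgamma _).
    by rewrite normrM e1 mul1r mulr_gt0// normr_gt0 gt_eqF.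
  have sq (g : nat -> R) : (forall n, `|g n| <= cabs (ibp_bdry xi qlim (e * A n))) ->
      g n @[n --> \oo] --> 0.
    move=> gb; apply: norm_cvg0; apply: (@squeeze_cvgr _ _ _ _ (fun=> 0)
      (fun n => cabs (ibp_bdry xi qlim (e * A n)))) => //; last exact: cvg_cst.
    by apply: nearW => n; rewrite normr_ge0 gb.
  by split; apply: sq => n; [exact: Re_le_cabs|exact: Im_le_cabs].
have mir : measurable ir by exact: measurable_itv.
have mil : measurable il by exact: measurable_itv.
have iir : cintegrable leb setT (cpatch ir p).
  apply: (ip _ 1 cut) => //; first exact: subset_itv_oc_cc.
  by move=> phi; rewrite /ir /= in_itv /= => /andP[h _]; rewrite gtr0_norm ?ltW// (lt_trans ltr01).
have iil : cintegrable leb setT (cpatch il p).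
  apply: (ip _ (- cut) (-1)) => //; first exact: subset_itv_co_cc.
  by move=> phi; rewrite /il /= in_itv /= => /andP[_ h]; rewrite ltr0_norm; lra.
have icr (A : R) : cintegrable leb setT (cpatch `]cut, A] p).
  apply: (ip _ cut A) => //; first exact: subset_itv_oc_cc.
  by move=> phi; rewrite /= in_itv /= => /andP[h _]; rewrite gtr0_norm; lra.
have icl (A : R) : cintegrable leb setT (cpatch `[- A, - cut[ p).
  apply: (ip _ (- A) (- cut)) => //; first exact: subset_itv_co_cc.
  by move=> phi; rewrite /= in_itv /= => /andP[_ h]; rewrite ltr0_norm; lra.
have splr (A : R) : cut < A -> cintegral leb (outer_right A) p =
    cintegral leb ir p + cintegral leb `]cut, A] p.
  move=> cA; apply: cintegral_split => // x; apply: cpatch_setU.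
    apply/seteqP; split => z; rewrite /outer_right /ir /= !in_itv /=.
      move=> /andP[h1 h2]; have [h|h] := leP z cut; [left|right]; apply/andP; split => //.
    by case=> /andP[h1 h2]; apply/andP; split => //; lra.
  apply/seteqP; split => // z []; rewrite /ir /= !in_itv /= => /andP[_ h1] /andP[h2 _].
  by have := lt_le_trans h2 h1; rewrite ltxx.
have spll (A : R) : cut < A -> cintegral leb (outer_left A) p =
    cintegral leb il p + cintegral leb `[- A, - cut[ p.
  move=> cA; apply: cintegral_split => // x; apply: cpatch_setU.
    apply/seteqP; split => z; rewrite /outer_left /il /= !in_itv /=.
      move=> /andP[h1 h2]; have [h|h] := leP (- cut) z; [left|right]; apply/andP; split => //.
    by case=> /andP[h1 h2]; apply/andP; split => //; lra.
  apply/seteqP; split => // z []; rewrite /il /= !in_itv /= => /andP[h1 _] /andP[_ h2].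
  by have := le_lt_trans h1 h2; rewrite ltxx.
pose a := c * (cintegral leb ir p + (- ibp_bdry xi qlim cut + k * cintegral leb tr tf)).
pose b := c * (cintegral leb il p + (ibp_bdry xi qlim (- cut) + k * cintegral leb tl tf)).
have iscal (E : set T) : measurable E -> cintegrable leb setT (cpatch E p) ->
    cintegral leb E (fun phi => c * pintegrand gamma (-1) xi phi) = c * cintegral leb E p.
  move=> mE iE; rewrite -cintegralZ//; last exact/(cintegrable_mkcond _ mE).
have couterE : couter_integral (fun phi => c * pintegrand gamma (-1) xi phi) = a + b.
  apply: couter_integralE => A Ac.
  have nA : \forall n \near \oo, cut < A n by move/cvgryPgt : Ac; apply.
  have exr : ccvg (fun n => cintegral leb `]cut, A n] tf) (cintegral leb tr tf).
    apply: (ccvg_exhaust mtf itd td0) => //; first by move=> x /trS; exact: btf.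
      by move=> n x; rewrite /tr /= !in_itv /= andbT => /andP[].
    move=> x; rewrite /tr /= in_itv /= andbT => h.
    have : \forall n \near \oo, x <= A n by move/cvgryPge : Ac; apply.
    by apply: filterS => n hn; rewrite mem_setE in_itv /= h.
  have exl : ccvg (fun n => cintegral leb `[- A n, - cut[ tf) (cintegral leb tl tf).
    apply: (ccvg_exhaust mtf itd td0) => //; first by move=> x /tlS; exact: btf.
      by move=> n x; rewrite /tl /= !in_itv /= => /andP[].
    move=> x; rewrite /tl /= in_itv /= => h.
    have : \forall n \near \oo, - x <= A n by move/cvgryPge : Ac; apply.
    by apply: filterS => n hn; rewrite mem_setE in_itv /= h andbT lerNl.
  split.
    apply: (@ccvg_near _ _ (fun n => c * (cintegral leb ir p +
      (ibp_bdry xi qlim (1 * A n) - ibp_bdry xi qlim cut + k * cintegral leb `]cut, A n] tf)))).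
      apply: filterS nA => n hn; rewrite mul1r -(by_parts _ hn).1 -splr//.
      apply: iscal; first exact: measurable_itv.
      apply: (ip _ 1 (A n)); [exact: measurable_itv|exact: subset_itv_oc_cc|].
      by move=> phi; rewrite /outer_right /= in_itv /= => /andP[h _]; rewrite gtr0_norm ?ltW// (lt_trans ltr01).
    apply: ccvgM; first exact: ccvg_cst.
    apply: ccvgD; first exact: ccvg_cst.
    apply: ccvgD; last by apply: ccvgM => //; exact: ccvg_cst.
    rewrite -[X in ccvg _ X]add0r; apply: ccvgD; last exact: ccvg_cst.
    by apply: bd0; rewrite ?normr1.
  apply: (@ccvg_near _ _ (fun n => c * (cintegral leb il p +
    (ibp_bdry xi qlim (- cut) - ibp_bdry xi qlim (-1 * A n) + k * cintegral leb `[- A n, - cut[ tf)))).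
    apply: filterS nA => n hn; rewrite mulN1r -(by_parts _ hn).2 -spll//.
    apply: iscal; first exact: measurable_itv.
    apply: (ip _ (- A n) (-1)); [exact: measurable_itv|exact: subset_itv_co_cc|].
    by move=> phi; rewrite /outer_left /= in_itv /= => /andP[_ h]; rewrite ltr0_norm; lra.
  apply: ccvgM; first exact: ccvg_cst.
  apply: ccvgD; first exact: ccvg_cst.
  apply: ccvgD; last by apply: ccvgM => //; exact: ccvg_cst.
  rewrite -[X in ccvg _ X]subr0; apply: ccvgD; first exact: ccvg_cst.
  by apply: ccvgN; apply: bd0; rewrite ?normrN ?normr1.
rewrite couterE /m1_limit -/c /a /b.
have mmid : measurable mid by exact: measurable_itv.
have midE : cintegral leb mid (jint gamma (-1) xi) =
    - (cintegral leb ir p + cintegral leb il p).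
  rewrite (cintegral_mkcond mid) (cintegral_mkcond ir) (cintegral_mkcond il) -cintegralD//.
  rewrite -cintegralN//; last exact: cintegrableD.
  apply: eq_cintegral => phi _; rewrite /cpatch !mem_setE !in_itv /= -ler_norml.
  rewrite /jint /chi /= cabs_qlim_gt1// exprN1 -/(p phi).
  have [h|h] := ltP 1 `|phi|; last first.
    have -> : (1 < phi) = false by apply/negbTE; rewrite -leNgt (le_trans (ler_norm _)).
    have -> : (phi < -1) = false.
      by apply/negbTE; rewrite -leNgt; move: h; rewrite ler_norml => /andP[].
    by rewrite /= andbF addr0 oppr0 !mulr0; case: ifP.
  have [p0|p0] := leP 0 phi.
    rewrite ger0_norm// in h *; rewrite h /=.
    have -> : (phi < -1) = false by apply/negbTE; rewrite -leNgt; lra.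
    by rewrite andbF addr0; case: ifP; rewrite ?oppr0// mulrN1 mulrN.
  rewrite ltr0_norm// in h *.
  have -> : (1 < phi) = false by apply/negbTE; rewrite -leNgt; lra.
  have -> : phi < -1 by lra.
  by rewrite /= add0r andbT lerNl; case: ifP; rewrite ?oppr0// mulrN1 mulrN.
have tailEE : cintegral leb tail tf = cintegral leb tr tf + cintegral leb tl tf.
  apply: cintegral_split; [exact: itf|exact: itf|].
  by move=> x; apply: cpatch_setU; [exact: tailE|exact: disj_tail'].
by rewrite midE -/k -/tf tailEE; ring.
Qed.

Lemma kscal_cvg (t : nat -> R) (y : nat -> int) xi x :
  (forall n, 0 < t n <= 1) -> t n @[n --> \oo] --> 0 ->
  t n * sg * (y n)%:~R @[n --> \oo] --> xi -> (x != -1) || (xi != 0) ->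
  ccvg (fun n => kscal (t n) x (y n)) (J x xi).
Proof.
move=> t01 tc yc; have [->/= xi0|x1 _] := eqVneq x (-1).
  by rewrite J_conditional//; exact: ccvg_kscal_m1.
by rewrite J_regular//; exact: ccvg_kscal.
Qed.

(** * A recurrence in the height for x = -1 *)

(** Since e^(gamma t) e^(i t sg phi) = 1 + t q, the combination replaces 1/q by
    -t, whose integral over the period vanishes; what is left is an integral
    over a bounded set of phi. *)
Lemma kscal_m1_rec : exists C, 0 <= C /\ forall t (y : int), 0 < t <= 1 -> y != 0 ->
  cabs (kscal t (-1) y - (expR (gamma * t))%:C * kscal t (-1) (y - 1)) <= C * t.
Proof.
have pi0 := @pi_gt0 R; have pp : 0 < 2 * pi :> R by rewrite mulr_gt0.
exists ((2 * pi)^-1 * (2 * (1 * (cut - - cut)))); split.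
  by rewrite mulr_ge0 ?invr_ge0 ?(ltW pp)// !mulr_ge0// opprK addr_ge0// ltW.
move=> t y t01 y0; have [t0 t1] := andP t01.
have h0 : 0 < t * sg by rewrite mulr_gt0.
set B := pi / (t * sg); set c := expR (gamma * t); set xi := t * sg * y%:~R.
have B0 : 0 < B by rewrite divr_gt0.
have tC0 : t%:C != 0 :> R[i] by rewrite eq_complex /= negb_and gt_eqF.
pose e phi : R[i] := expi (- xi * phi).
have me : cmeasurable [set: T] (e : T -> R[i]) by exact: cmeas_expi_lin0.
pose full := `[- B, B]%classic : set T.
pose small : set T := [set phi | `|phi| <= B /\ cabs (qdisc t phi) <= 1].
have msmall : measurable small.
  have -> : small = full `&` ((fun phi : T => cabs (qdisc t phi) <= 1) @^-1` [set true]).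
    by apply/seteqP; split => phi; rewrite /small /full /= in_itv /= -ler_norml => -[h1 h2].
  apply: measurableI; first exact: measurable_itv.
  rewrite -[X in measurable X]setTI; apply: measurable_fun_ler => //.
  by apply: measurable_cabs; exact: cmeas_qdisc.
have smallS : small `<=` `[- cut, cut]%classic.
  move=> phi [h1 h2]; rewrite /= in_itv /= -ler_norml leNgt; apply/negP => /cut_lt' h.
  have := lt_le_trans (lt_le_trans (h hgamma) (qdisc_low hgamma t01 h1)) h2.
  by rewrite ltxx.
have ifull : cintegrable leb setT (cpatch full e).
  apply/(cintegrable_mkcond _ (measurable_itv _)).
  apply: (@cintegrable_bounded _ _ _ 1); first exact: cmeasS me.
  by move=> phi _; rewrite cabs_expi.
have ismall' : cintegrable leb `[- cut, cut] (cpatch small e).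
  apply: (@cintegrable_bounded _ _ _ 1); first by apply: cmeasS (cmeas_cpatch msmall me).
  by move=> phi _; apply: cabs_cpatch => // _; rewrite cabs_expi.
have smE : cpatch small e = cpatch `[- cut, cut] (cpatch small e).
  apply/funext => phi; rewrite /cpatch; case: ifPn => [/set_mem/smallS h|_].
    by rewrite mem_set.
  by case: ifP.
have ismall : cintegrable leb setT (cpatch small e).
  by rewrite smE; exact/(cintegrable_mkcond _ (measurable_itv _)).
have ik z := cintegrable_kint gamma t (-1) z.
have E : cintegral leb setT (kint gamma t (-1) y) -
    c%:C * cintegral leb setT (kint gamma t (-1) (y - 1)) =
    t%:C * (cintegral leb full e - cintegral leb small e).
  rewrite (cintegral_mkcond full) (cintegral_mkcond small) -!cintegralZ// -!cintegralN//; last first.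
    exact: cintegrableZ.
  have iN (f : T -> R[i]) : cintegrable leb setT f -> cintegrable leb setT (fun x => - f x).
    move=> hf; have := cintegrableZ measurableT (-1) hf; congr cintegrable.
    by apply/funext => x; rewrite mulN1r.
  rewrite -!cintegralD//; try (by apply: iN); try (by apply: iN; exact: cintegrableZ).
  rewrite -cintegralZ//; last by apply: cintegrableD => //; exact: iN.
  apply: eq_cintegral => phi _.
  rewrite /kint -/B /cpatch mem_setE in_itv /= -ler_norml.
  have smm : (phi \in small) = (`|phi| <= B) && (cabs (qdisc t phi) <= 1).
    by apply/idP/andP => [/set_mem[]//|[h1 h2]]; exact: mem_set.
  rewrite smm; case: (`|phi| <= B) => /=; last by rewrite !mulr0 !subr0 mulr0.
  have ey : expi (- (t * sg * (y - 1)%:~R * phi)) = e phi * expi (t * sg * phi).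
    by rewrite /e -expiD rmorphB /=; congr expi; rewrite /xi; ring.
  have ey' : expi (- (t * sg * y%:~R * phi)) = e phi by rewrite /e mulNr.
  rewrite ey ey' /chi /= exprN1.
  have [h|h] := leP (cabs (qdisc t phi)) 1; first by rewrite !mulr0 subr0 subrr mulr0.
  have q0 : qdisc t phi != 0 by rewrite -cabs_eq0 gt_eqF// (lt_trans ltr01).
  have qE : expi (t * sg * phi) * c%:C = t%:C * qdisc t phi + 1.
    by rewrite /qdisc mulrCA mulfV// mulr1 subrK.
  rewrite subr0.
  have -> : e phi * ((qdisc t phi)^-1 * -1) -
     c%:C * (e phi * expi (t * sg * phi) * ((qdisc t phi)^-1 * -1)) =
     e phi * (qdisc t phi)^-1 * (expi (t * sg * phi) * c%:C - 1) by ring.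
  by rewrite qE addrK; field.
have full0 : cintegral leb full e = 0.
  have xi0 : xi != 0 by rewrite mulf_neq0 ?intr_eq0// gt_eqF.
  have xC0 : 'i * (- xi)%:C != 0 :> R[i].
    by rewrite eq_complex /= !mul0r !mul1r subr0 add0r eqxx /= oppr_eq0.
  rewrite (@cintegral_FTC _ (fun x => ('i * (- xi)%:C)^-1 * expi (- xi * x + 0))).
  - rewrite !addr0 mulrN mulNr opprK.
    have -> : xi * B = pi * y%:~R by rewrite /xi /B mulrAC mulrCA mulfV ?gt_eqF// mulr1.
    by rewrite expi_piz -expiXz expi_pi subrr.
  - by rewrite gtrN.
  - move=> x _.
    have -> : e x = 0 * expi (- xi * x + 0) + ('i * (- xi)%:C)^-1 *
        ('i * (- xi)%:C * expi (- xi * x + 0)).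
      by rewrite mul0r add0r mulrA mulVf// mul1r addr0.
    by apply: cderiveM; [exact: cderive_cst|exact: cderive_expi].
  - by move=> x _ u ux; apply: ccvg_expi; exact: cvgMr.
rewrite /kscal mulrCA -mulrBr E full0 sub0r cabsM cabsV !cabsM cabsN !cabsR.
rewrite !gtr0_norm// -mulrA ler_pM2l ?invr_gt0// mulrC ler_pM2r//.
rewrite cintegral_mkcond smE -cintegral_mkcond.
apply: cintegral_bound.
- by rewrite ge0_cp// ltW.
- by apply: cmeasS (cmeas_cpatch msmall me).
- by move=> phi _; apply: cabs_cpatch => // _; rewrite cabs_expi.
Qed.

End kernel_limit.

(** * Local bounds on the kernels *)

Section countable_first_factor.
Context d (S : measurableType d) d' (S' : measurableType d').

Lemma measurable_to_int (f : S -> int) :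
  (forall y, measurable (f @^-1` [set y])) -> measurable_fun [set: S] f.
Proof.
move=> mf _ Y _; rewrite setTI.
have -> : f @^-1` Y = \bigcup_y (f @^-1` [set y] `&` [set _ | Y y]).
  apply/seteqP; split => [s Ys|s [y _ /= [-> ]]//]; by exists (f s).
apply: countable_bigcupT_measurable => // y.
have [Yy|nYy] := pselect (Y y).
  by rewrite (_ : [set _ | _] = setT) ?setIT//; apply/seteqP; split.
by rewrite (_ : [set _ | _] = set0) ?setI0//; apply/seteqP; split.
Qed.

Lemma measurable_int_prod (f : int * S -> S') :
  (forall x, measurable_fun [set: S] (fun s => f (x, s))) ->
  measurable_fun [set: int * S] f.
Proof.
move=> mf _ Y mY; rewrite setTI.
have -> : f @^-1` Y = \bigcup_x ([set x] `*` ((fun s => f (x, s)) @^-1` Y)).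
  apply/seteqP; split => [[x s] Ys|[x s] [y _ /= [-> ]]//]; by exists x.
apply: countable_bigcupT_measurable => // x; apply: measurableX => //.
by rewrite -[X in measurable X]setTI; exact: mf.
Qed.

End countable_first_factor.

Section kernel_bounds.
Context {R : realType}.
Notation T := (measurableTypeR R).

Lemma floor_div_itv (h xi : R) : 0 < h ->
  h * (Num.floor (xi / h))%:~R <= xi < h * (Num.floor (xi / h))%:~R + h.
Proof.
move=> h0; have /andP[h1 h2] := floor_itv (xi / h).
apply/andP; split; first by rewrite mulrC -ler_pdivlMr.
by rewrite -[X in _ + X]mulr1 -mulrDr mulrC -ltr_pdivrMr// (lt_le_trans h2)// intrD.
Qed.

Lemma cvg_floor_div (h : nat -> R) (xi : R) : (forall n, 0 < h n) ->
  h n @[n --> \oo] --> 0 -> h n * (Num.floor (xi / h n))%:~R @[n --> \oo] --> xi.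
Proof.
move=> h0 hc; apply: (@squeeze_cvgr _ _ _ _ (fun n => xi - h n) (fun=> xi)); last exact: cvg_cst.
  apply: nearW => n; have /andP[h1 h2] := floor_div_itv xi (h0 n).
  by rewrite h1 andbT lerBlDr ltW.
by rewrite -[X in _ --> X]subr0; apply: cvgB => //; exact: cvg_cst.
Qed.

Lemma recurrence_le (a : nat -> R) (r d : R) m : 1 <= r -> 0 <= d ->
  (forall j, (j < m)%N -> a j.+1 <= r * (a j + d)) -> a m <= r ^+ m * (a 0%N + m%:R * d).
Proof.
move=> r1 d0; have r0 : 0 <= r by exact: le_trans r1.
elim: m => [|m ih] h; first by rewrite expr0 mul1r mul0r addr0.
apply: le_trans (h m (ltnSn _)) _; rewrite exprS -mulrA; apply: ler_wpM2l => //.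
have := ih (fun j jm => h j (ltnW jm)) => {}ih.
apply: le_trans (_ : r ^+ m * (a 0%N + m%:R * d) + r ^+ m * d <= _).
  by apply: lerD => //; rewrite ler_peMl// exprn_ege1.
by rewrite -mulrDr -addrA -[X in m%:R * d + X]mul1r -mulrDl -natr1.
Qed.

Lemma measurable_floor : measurable_fun [set: T] (fun x : T => Num.floor x).
Proof.
apply: (@measurable_to_int _ T (fun x : T => Num.floor x)) => y.
rewrite (_ : _ @^-1` _ = `[(y%:~R : R), (y + 1)%:~R[%classic); first exact: measurable_itv.
by apply/seteqP; split => x /=; rewrite in_itv /= -floor_eq => /eqP.
Qed.

Variable gamma : R.
Hypothesis hgamma : -1 < gamma < 1.
Notation sg := (sg gamma).
Notation J := (J gamma).
Notation kscal := (kscal gamma).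

Let s0 : 0 < sg := sg_gt0 hgamma.

(** At x = -1 no integrable function dominates all the integrands; the bound is
    carried from one height to the next by the recurrence. *)
Lemma kscal_m1_walk : exists C, 0 <= C /\ forall t (y b : int), 0 < t <= 1 ->
  (0 <= y) = (0 <= b) ->
  cabs (kscal t (-1) y) <=
  expR t ^+ `|y - b|%N * (cabs (kscal t (-1) b) + `|y - b|%N%:R * (C * t)).
Proof.
have [C [C0 hC]] := kscal_m1_rec hgamma; exists C; split => // t y b t01 yb.
have [t0 t1] := andP t01; have [g1 g2] := andP hgamma.
have e1 : 1 <= expR t by rewrite -expR0 ler_expR ltW.
have Ct : 0 <= C * t by rewrite mulr_ge0// ltW.
have ce : expR (gamma * t) <= expR t by rewrite ler_expR ler_piMl// ltW.
have ce' : (expR (gamma * t))^-1 <= expR t.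
  by rewrite -expRN ler_expR -mulNr ler_piMl ?(ltW t0)//; lra.
have up z : z != 0 -> cabs (kscal t (-1) z) <= expR t * (cabs (kscal t (-1) (z - 1)) + C * t).
  move=> z0; have h := hC t z t01 z0.
  rewrite -[kscal t (-1) z](subrK ((expR (gamma * t))%:C * kscal t (-1) (z - 1))).
  apply: le_trans (cabsD _ _) _; rewrite mulrDr addrC; apply: lerD.
    by rewrite cabsM cabsR gtr0_norm ?expR_gt0// ler_wpM2r// cabs_ge0.
  by apply: le_trans h _; rewrite ler_peMl.
have down z : z != 0 -> cabs (kscal t (-1) (z - 1)) <= expR t * (cabs (kscal t (-1) z) + C * t).
  move=> z0; have h := hC t z t01 z0; have c0 := expR_gt0 (gamma * t).
  have kle : cabs ((expR (gamma * t))%:C * kscal t (-1) (z - 1)) <= cabs (kscal t (-1) z) + C * t.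
    have -> : (expR (gamma * t))%:C * kscal t (-1) (z - 1) = kscal t (-1) z +
      - (kscal t (-1) z - (expR (gamma * t))%:C * kscal t (-1) (z - 1)) by ring.
    by apply: le_trans (cabsD _ _) _; rewrite cabsN lerD2l.
  rewrite -[kscal t (-1) (z - 1)](@mulKf _ (expR (gamma * t))%:C); last first.
    by rewrite eq_complex /= negb_and gt_eqF.
  rewrite cabsM cabsV cabsR (gtr0_norm c0); apply: ler_pM => //; rewrite ?cabs_ge0// invr_ge0 ltW//.
have [hyb|hyb] := leP b y.
  pose a j := cabs (kscal t (-1) (b + j%:Z)).
  have := @recurrence_le a (expR t) (C * t) `|y - b|%N e1 Ct; rewrite /a addr0 gez0_abs ?subr_ge0//.
  rewrite (addrC b) subrK; apply => j hj.
  have -> : b + j%:Z = b + j.+1%:Z - 1 by clear; lia.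
  by apply: up; move: yb hyb hj; clear; lia.
pose a j := cabs (kscal t (-1) (b - j%:Z)).
have := @recurrence_le a (expR t) (C * t) `|y - b|%N e1 Ct; rewrite /a subr0.
have -> : b - `|y - b|%N%:Z = y by move: hyb; clear; lia.
apply => j hj.
have -> : b - j.+1%:Z = b - j%:Z - 1 by clear; lia.
by apply: down; move: yb hyb hj; clear; lia.
Qed.

Section along_sequence.
Variables (t : nat -> R).
Hypothesis t01 : forall n, 0 < t n <= 1.
Hypothesis tc : t n @[n --> \oo] --> 0.

Let h n := t n * sg.

Let h0 n : 0 < h n. Proof. by rewrite mulr_gt0//; case/andP: (t01 n). Qed.

Let hc : h n @[n --> \oo] --> 0.
Proof. by rewrite -[X in _ --> X](mul0r sg); apply: cvgMl. Qed.

(** At x = -1, a height is joined in O(1/t) steps, each with an error O(t), to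
    one near which the kernel converges. *)
Lemma kscal_locally_bounded (M : R) : 0 <= M -> exists C, \forall n \near \oo, forall x y,
  `|t n * sg * y%:~R| <= M -> cabs (kscal (t n) x y) <= C.
Proof.
move=> M0; have [C1 hC1] := kscal_bounded hgamma; have [C2 [C20 hC2]] := kscal_m1_walk.
have base (e : R) : e != 0 -> exists B, \forall n \near \oo,
    cabs (kscal (t n) (-1) (Num.floor (e / h n))) <= B.
  move=> e0; exists (cabs (J (-1) e) + 1).
  have /ccvg_cabs := @kscal_cvg R gamma hgamma t (fun n => Num.floor (e / h n)) e (-1) t01 tc
    (cvg_floor_div h0 hc) e0.
  move=> /cvgrPdist_le/(_ 1 ltr01); apply: filterS => n; rewrite ler_norml => /andP[h1 h2]; lra.
have [B1 hB1] := base 1 (oner_neq0 _); have [|B2 hB2] := base (-1).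
  by rewrite oppr_eq0 oner_neq0.
pose B := Num.max B1 B2; pose m := (M + 2) / sg.
have m0 : 0 <= m by rewrite divr_ge0 ?addr_ge0// ltW.
exists (Num.max C1 (expR m * (B + m * C2))).
have h1n : \forall n \near \oo, h n <= 1.
  move/cvgrPdist_le : hc => /(_ 1 ltr01); apply: filterS => n.
  by rewrite sub0r normrN gtr0_norm.
apply: filterS3 hB1 hB2 h1n => n b1 b2 hn x y yM.
have [->|x1] := eqVneq x (-1); last by rewrite le_max hC1.
rewrite le_max; apply/orP; right.
have [e [be eb ey]] : exists e : R, [/\ cabs (kscal (t n) (-1) (Num.floor (e / h n))) <= B,
    `|e| = 1 & (0 <= y) = (0 <= Num.floor (e / h n))].
  have [y0|y0] := leP 0 y.
    exists 1; split; rewrite ?normr1// ?le_max ?b1//; apply/esym.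
    by rewrite floor_ge0 divr_ge0// ltW.
  exists (-1); split; rewrite ?normrN ?normr1// ?le_max ?b2 ?orbT//; apply/esym/negbTE.
  by rewrite floor_ge0 -ltNge mulN1r oppr_lt0 invr_gt0.
set b := Num.floor (e / h n) in be ey *.
have yb : `|y - b|%N%:R * t n <= m.
  rewrite /m ler_pdivlMr// -mulrA -/(h n) natr_absz intr_norm.
  rewrite -(gtr0_norm (h0 n)) -normrM rmorphB /= mulrBl mulrC /h.
  apply: le_trans (ler_normB _ _) _; apply: lerD => //.
  have /andP[f1 f2] := floor_div_itv e (h0 n); rewrite -/b in f1 f2.
  rewrite mulrC -/(h n) -[X in `|X|](subKr e); apply: le_trans (ler_normB _ _) _.
  have -> : 2 = 1 + 1 :> R by [].
  rewrite eb lerD2l ger0_norm ?subr_ge0// lerBlDl; apply/ltW/(lt_le_trans f2).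
  by rewrite lerD2l.
have t0 : 0 < t n by case/andP: (t01 n).
apply: le_trans (hC2 (t n) y b (t01 n) ey) _.
have B0 : 0 <= B by apply: le_trans be; exact: cabs_ge0.
apply: ler_pM; rewrite ?exprn_ge0 ?expR_ge0 ?addr_ge0 ?cabs_ge0// ?mulr_ge0// ?(ltW t0)//.
  by rewrite -expRM_natl ler_expR.
by apply: lerD => //; rewrite [C2 * _]mulrC mulrA ler_wpM2r.
Qed.

Lemma kscal_floor_cvg x xi : (x != -1) || (xi != 0) ->
  ccvg (fun n => kscal (t n) x (Num.floor (xi / h n))) (J x xi).
Proof. by move=> xx; apply: kscal_cvg => //; exact: cvg_floor_div. Qed.

Lemma J_bounded_seq (M : R) : exists C, forall x xi, `|xi| <= M -> (x != -1) || (xi != 0) ->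
  cabs (J x xi) <= C.
Proof.
have [M0|M0] := leP 0 M; last first.
  by exists 0 => x xi hM; have := le_trans (normr_ge0 _) hM; rewrite leNgt M0.
have [|C hC] := @kscal_locally_bounded (M + 1); first by rewrite addr_ge0.
exists C => x xi xiM xx; apply: (cvgr_to_le (ccvg_cabs (kscal_floor_cvg xx))).
have hn1 : \forall n \near \oo, h n <= 1.
  move/cvgrPdist_le : hc => /(_ 1 ltr01); apply: filterS => n.
  by rewrite sub0r normrN gtr0_norm.
apply: filterS2 hC hn1 => n hC h1; apply: hC; rewrite -/(h n).
have /andP[f1 f2] := floor_div_itv xi (h0 n).
rewrite -[X in `|X|](subKr xi); apply: le_trans (ler_normB _ _) _; apply: lerD => //.
by rewrite ger0_norm; lra.
Qed.

End along_sequence.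

Let th n : R := n.+1%:R^-1.

Let th01 n : 0 < th n <= 1.
Proof. by rewrite invr_gt0 ltr0n /= invf_le1 ?ltr0n// ler1n. Qed.

Lemma J_bounded (M : R) : exists C, forall x xi, `|xi| <= M -> (x != -1) || (xi != 0) ->
  cabs (J x xi) <= C.
Proof. exact: (J_bounded_seq th01 cvg_harmonic). Qed.

Lemma cmeas_J x : cmeasurable [set: T] (J x : T -> R[i]).
Proof.
pose f n (xi : T) : R[i] := if xi == 0 then J x 0 else kscal (th n) x (Num.floor (xi / (th n * sg))).
have mf n : cmeasurable [set: T] (f n).
  apply: cmeas_if => //; first exact: measurable_fun_eqr.
  suff mk (g : int -> R) : measurable_fun [set: T] (fun xi : T => g (Num.floor (xi / (th n * sg)))).
    by split; [apply: (mk (fun y => complex.Re (kscal (th n) x y)))|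
               apply: (mk (fun y => complex.Im (kscal (th n) x y)))].
  apply: (@measurableT_comp _ _ _ _ _ _ (g : int -> T)) => //.
  apply: measurableT_comp; first exact: measurable_floor.
  exact: measurable_funM.
have fc xi : ccvg (f ^~ xi) (J x xi).
  rewrite /f; case: eqVneq => [->|xi0]; first exact: ccvg_cst.
  by apply: (kscal_floor_cvg th01 cvg_harmonic); rewrite xi0 orbT.
by split; [apply: (@measurable_fun_cvg _ _ _ _ (fun n xi => complex.Re (f n xi)))|
  apply: (@measurable_fun_cvg _ _ _ _ (fun n xi => complex.Im (f n xi)))];
  try (by move=> n; case: (mf n)); move=> xi _; case: (fc xi).
Qed.

End kernel_bounds.

(** * Hadamard's inequality *)

Section hadamard.
Local Open Scope sesquilinear_scope.

(** The inequality of the arithmetic and geometric means for the eigenvalues of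
    A A^*: their product is |det A|^2, and their sum is the sum of the squared
    moduli of the entries. *)
Lemma det_bound_closed (C : numClosedFieldType) n (A : 'M[C]_n) (c : C) :
  (forall i j, `|A i j| ^+ 2 <= c) -> `|\det A| ^+ 2 <= (c *+ n) ^+ n.
Proof.
move=> Ac; pose B := A *m A^t*; pose P := spectralmx B.
have BH : B^t* = B by rewrite /B trmx_mul map_mxM trmxCK.
have /orthomx_spectralP BE : B \is normalmx by apply/normalmxP; rewrite BH.
have PU : P \is unitarymx by exact: spectral_unitarymx.
have Pu : P \in unitmx by exact: spectral_unit.
have DE : diag_mx (spectral_diag B) = (P *m A) *m (P *m A)^t*.
  rewrite trmx_mul map_mxM mulmxA -(mulmxA P A) -/B {2}BE -/P !mulmxA mulmxV// mul1mx.
  by rewrite mulmxtVK.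
have D0 i : 0 <= spectral_diag B 0 i.
  have /matrixP/(_ i i) := DE; rewrite !mxE eqxx mulr1n => ->.
  by apply: sumr_ge0 => j _; rewrite !mxE -normCK exprn_ge0.
have detB : \det B = \prod_i spectral_diag B 0 i.
  rewrite [in LHS]BE !det_mulmx det_inv det_diag mulrC mulrA mulfV ?mul1r//.
  by rewrite -unitfE -unitmxE.
have trB : \tr B = \sum_i spectral_diag B 0 i.
  by rewrite [in LHS]BE -mulmxA mxtrace_mulC -mulmxA mulmxV// mulmx1 mxtrace_diag.
have trBE : \tr B <= (c *+ n) *+ n.
  have -> : \tr B = \sum_i \sum_j `|A i j| ^+ 2.
    apply: eq_bigr => i _; rewrite mxE; apply: eq_bigr => j _.
    by rewrite !mxE normCK.
  have hi i : \sum_j `|A i j| ^+ 2 <= c *+ n.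
    apply: le_trans (ler_sum _ (fun j _ => Ac i j)) _.
    by rewrite sumr_const card_ord.
  apply: le_trans (ler_sum _ (fun i _ => hi i)) _.
  by rewrite sumr_const card_ord.
have detBE : `|\det A| ^+ 2 = \det B.
  by rewrite /B det_mulmx det_map_mx det_tr -normCK.
rewrite detBE detB.
have := @leif_AGM_scaled C 'I_n predT (fun i => spectral_diag B 0 i).
rewrite card_ord => /(_ _)/leifP; rewrite -trB => h.
have {h} : \prod_i (spectral_diag B 0 i *+ n) <= \tr B ^+ n.
  by have [] := @leif_AGM_scaled C 'I_n predT (fun i => spectral_diag B 0 i);
    rewrite ?card_ord -?trB// => i _; rewrite mulrn_wge0.
rewrite prodrMn prod_nat_const card_ord => h.
case: n => [|n] in A c Ac B P BH BE PU Pu DE D0 detB trB trBE detBE h *.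
  by rewrite big_ord0 expr0.
have n0 : 0 < (n.+1%:R : C) ^+ n.+1 by rewrite exprn_gt0// ltr0n.
rewrite -(ler_pM2r n0) -exprMn mulr_natr; apply: (@le_trans _ _ (\tr B ^+ n.+1)).
  by rewrite -natrX mulr_natr.
have tr0 : 0 <= \tr B by rewrite trB; apply: sumr_ge0 => i _.
by rewrite lerXn2r ?nnegrE// (le_trans tr0).
Qed.

End hadamard.

Lemma cabs_det_le (R : realType) n (A : 'M[R[i]]_n) (c : R) :
  (forall i j, cabs (A i j) <= c) -> cabs (\det A) ^+ 2 <= (c ^+ 2 *+ n) ^+ n.
Proof.
move=> Ac; pose C : numClosedFieldType := R[i].
have nE (z : C) : `|z| = (cabs z)%:C :> C by [].
have := @det_bound_closed C n A (c ^+ 2)%:C.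
have -> : ((c ^+ 2)%:C *+ n) ^+ n = ((c ^+ 2 *+ n) ^+ n)%:C :> C by rewrite -rmorphMn -rmorphXn.
rewrite nE -rmorphXn lecR; apply => i j; rewrite nE -rmorphXn lecR.
have c0 : 0 <= c := le_trans (cabs_ge0 _) (Ac i j).
by rewrite lerXn2r ?nnegrE ?cabs_ge0.
Qed.

(** * Iterated integrals over boxes *)

Section box_integral_theory.
Local Open Scope ereal_scope.
Context {R : realType} d (E : measurableType d).

(** Integration over E preserves measurability in parameters; the integrals that
    define the iterated integral over a box are then meaningful. *)
Definition parametric (mu : {measure set E -> \bar R}) : Prop :=
  forall d' (Y : measurableType d') (G : Y * E -> \bar R),
    measurable_fun [set: Y * E] G -> (forall p, 0 <= G p) ->
    measurable_fun [set: Y] (fun y => \int[mu]_x G (y, x)).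

Variable mu : {measure set E -> \bar R}.
Hypothesis mu_par : parametric mu.

Lemma measurable_partial_integral d' (Y : measurableType d') (D : set E) (G : Y * E -> \bar R) :
  measurable D -> measurable_fun [set: Y * E] G ->
  measurable_fun [set: Y] (fun y => \int[mu]_(x in D) G (y, x)).
Proof.
move=> mD mG; pose H := G \_ ([set: Y] `*` D).
have mH : measurable_fun [set: Y * E] H.
  by apply/measurable_restrict => //; [exact: measurableX|rewrite setTI; exact: measurable_funS mG].
rewrite (_ : (fun y => _) = (fun y => \int[mu]_x (H^\+ (y, x))) \- (fun y => \int[mu]_x (H^\- (y, x)))).
  apply: emeasurable_funB; apply: mu_par => //.
  - exact: measurable_funepos.
  - exact: measurable_funeneg.
apply/funext => y; rewrite integral_mkcond integralE.
congr (_ - _); apply: eq_integral => x _; rewrite ?funeposE ?funenegE /H /patch in_setX in_setT//.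
Qed.

Lemma measurable_box_integral n : forall d' (Y : measurableType d') (B : 'I_n -> set E)
    (F : Y -> n.-tuple E -> \bar R), (forall i, measurable (B i)) ->
  measurable_fun [set: Y * n.-tuple E] (fun p => F p.1 p.2) ->
  measurable_fun [set: Y] (fun y => box_integral mu B (F y)).
Proof.
elim: n => [|n ih] d' Y B F mB mF /=.
  apply: (@measurableT_comp _ _ _ _ _ _ (fun p => F p.1 p.2) _ (fun y : Y => (y, [tuple]))) => //.
apply: (@measurable_partial_integral _ Y _ (fun q : Y * E =>
  box_integral mu (fun i => B (lift ord0 i)) (fun s => F q.1 [tuple of q.2 :: s]))) => //.
apply: (ih _ (Y * E)%type _ (fun q s => F q.1 [tuple of q.2 :: s])) => //.
apply: (@measurableT_comp _ _ _ _ _ _ (fun p => F p.1 p.2) _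
  (fun p : Y * E * n.-tuple E => (p.1.1, [tuple of p.1.2 :: p.2]))) => //.
apply: measurable_fun_pair; first exact: measurableT_comp.
by apply: measurable_cons => //; exact: measurableT_comp.
Qed.

Lemma measurable_fun_consl n (f : n.+1.-tuple E -> \bar R) :
  measurable_fun [set: n.+1.-tuple E] f ->
  measurable_fun [set: E * n.-tuple E] (fun p => f [tuple of p.1 :: p.2]).
Proof. by move=> mf; apply: measurableT_comp => //; exact: measurable_cons. Qed.

Lemma measurable_fun_cons1 n (f : n.+1.-tuple E -> \bar R) x :
  measurable_fun [set: n.+1.-tuple E] f ->
  measurable_fun [set: n.-tuple E] (fun s => f [tuple of x :: s]).
Proof. by move=> mf; apply: measurableT_comp => //; exact: measurable_cons. Qed.

Lemma measurable_box_cons n (B : 'I_n -> set E) (f : n.+1.-tuple E -> \bar R) :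
  (forall i, measurable (B i)) -> measurable_fun [set: n.+1.-tuple E] f ->
  measurable_fun [set: E] (fun x => box_integral mu B (fun s => f [tuple of x :: s])).
Proof.
move=> mB mf; apply: (@measurable_box_integral n _ E B (fun x s => f [tuple of x :: s])) => //.
exact: measurable_fun_consl.
Qed.

Lemma box_integral_ge0 n (B : 'I_n -> set E) f : (forall s, 0 <= f s) -> 0 <= box_integral mu B f.
Proof.
elim: n B f => [|n ih] B f f0 //=.
by apply: integral_ge0 => x _; exact: ih.
Qed.

Lemma eq_box_integral n (B : 'I_n -> set E) f g :
  (forall s : n.-tuple E, (forall i, B i (tnth s i)) -> f s = g s) ->
  box_integral mu B f = box_integral mu B g.
Proof.
elim: n B f g => [|n ih] B f g fg /=; first by apply: fg; case.
apply: eq_integral => x /set_mem Bx; apply: ih => s Bs; apply: fg => i.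
by case: (unliftP ord0 i) => [j ->|->]; rewrite ?tnthS// tnth0.
Qed.

Definition with_side n (B : 'I_n -> set E) (j : 'I_n) (D : set E) : 'I_n -> set E :=
  fun i => if i == j then D else B i.

Lemma with_side_measurable n (B : 'I_n -> set E) j D : (forall i, measurable (B i)) ->
  measurable D -> forall i, measurable (with_side B j D i).
Proof. by move=> mB mD i; rewrite /with_side; case: ifP. Qed.

Lemma box_integral_bigcup n (B : 'I_n -> set E) j (D : (set E)^nat) f :
  (forall i, measurable (B i)) -> (forall k, measurable (D k)) -> trivIset setT D ->
  measurable_fun [set: n.-tuple E] f -> (forall s, 0 <= f s) ->
  box_integral mu (with_side B j (\bigcup_k D k)) f =
  \sum_(k <oo) box_integral mu (with_side B j (D k)) f.
Proof.
elim: n B j f => [|n ih] B j f mB mD tD mf f0; first by case: j.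
rewrite /=; case: (unliftP ord0 j) => [i ->|->].
  have wE C : (fun i' => with_side B (lift ord0 i) C (lift ord0 i')) =
      with_side (fun i' => B (lift ord0 i')) i C.
    by apply/funext => i'; rewrite /with_side (inj_eq (@lift_inj _ _)).
  have w0 C : with_side B (lift ord0 i) C ord0 = B ord0 by [].
  rewrite w0 wE; under eq_eseriesr do rewrite w0 wE.
  rewrite -integral_nneseries//; last 2 first.
  - move=> k; apply: measurable_funTS; apply: measurable_box_cons => //.
    by apply: with_side_measurable.
  - by move=> k x _; exact: box_integral_ge0.
  apply: eq_integral => x _; apply: ih => //; exact: measurable_fun_cons1.
apply: ge0_integral_bigcup => //.
- rewrite (_ : (fun i : 'I_n => with_side B ord0 (\bigcup_k D k) (lift ord0 i)) =
    (fun i => B (lift ord0 i)))//.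
  by apply: measurable_funTS; exact: measurable_box_cons.
- by move=> x _; exact: box_integral_ge0.
Qed.

Variable pr : E -> R.
Hypothesis mpr : forall r, measurable (pr @^-1` [set r]).
Hypothesis pr_null : forall r, mu (pr @^-1` [set r]) = 0.

(** A tuple whose heights are distinct and avoid a given finite set: almost every
    tuple is of this form, and the kernel is only controlled there. *)
Definition generic (A : seq R) n (s : n.-tuple E) := uniq (map pr s) && all (fun r => r \notin A) (map pr s).

Lemma generic_cons A n x (s : n.-tuple E) : pr x \notin A -> generic (pr x :: A) s ->
  generic A [tuple of x :: s].
Proof.
rewrite /generic /= => xA /andP[-> /allP h]; rewrite xA /= andbT; apply/andP; split.
  by apply/negP => /h; rewrite inE eqxx.
by apply/allP => y /h; rewrite inE negb_or => /andP[].
Qed.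

Lemma ae_avoid (A : seq R) : {ae mu, forall x, pr x \notin A}.
Proof.
pose N (A : seq R) := [set x | pr x \in A].
have NE a s : N (a :: s) = pr @^-1` [set a] `|` N s.
  by apply/seteqP; split => x; rewrite /N /= inE; [move/predU1P|move/predU1P].
have N0 : N [::] = set0 by apply/seteqP; split.
have mN s : measurable (N s).
  by elim: s => [|a s ih]; rewrite ?N0// NE; exact: measurableU.
exists (N A); split => //; last by move=> x /= /negP; rewrite negbK.
elim: A => [|a A ih]; first by rewrite N0 measure0.
rewrite NE; apply: (null_set_setU (mpr a) (mN A)) => //; exact: pr_null.
Qed.

(** Each new entry avoids almost surely the finitely many heights of the
    previous ones. *)
Lemma box_integral_generic (A : seq R) n (B : 'I_n -> set E) f g :
  (forall i, measurable (B i)) ->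
  measurable_fun [set: n.-tuple E] f -> measurable_fun [set: n.-tuple E] g ->
  (forall s, generic A s -> f s = g s) -> box_integral mu B f = box_integral mu B g.
Proof.
elim: n A B f g => [|n ih] A B f g mB mf mg fg /=; first exact: fg.
apply: ae_eq_integral => //; try by apply: measurable_funTS; exact: measurable_box_cons.
apply: filterS (ae_avoid A) => x xA _.
apply: (ih (pr x :: A)) => //; try exact: measurable_fun_cons1.
by move=> s hs; apply: fg; exact: generic_cons.
Qed.

Lemma box_integral_bound (A : seq R) n (B : 'I_n -> set E) (f : n.-tuple E -> \bar R) (C L : R) :
  (0 <= C)%R -> (0 <= L)%R -> (forall i, measurable (B i)) -> (forall i, mu (B i) <= L%:E) ->
  measurable_fun [set: n.-tuple E] f ->
  (forall s, generic A s -> `|f s| <= C%:E) -> `|box_integral mu B f| <= (C * L ^+ n)%:E.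
Proof.
move=> C0 L0; elim: n A B f => [|n ih] A B f mB BL mf fC /=.
  by rewrite expr0 mulr1; exact: fC.
have mg := measurable_box_cons (fun i => mB (lift ord0 i)) mf.
apply: le_trans (le_abse_integral _ _ _) _ => //; first exact: measurable_funTS.
apply: (@le_trans _ _ (\int[mu]_(x in B ord0) (C * L ^+ n)%:E)).
  apply: ae_ge0_le_integral => //.
  - by apply: measurable_funTS; exact: measurableT_comp.
  - by move=> x _; rewrite lee_fin mulr_ge0// exprn_ge0.
  apply: filterS (ae_avoid A) => x xA _.
  apply: (ih (pr x :: A)) => //; first exact: measurable_fun_cons1.
  by move=> s hs; apply: fC; exact: generic_cons.
rewrite integral_cst// exprSr mulrA [leRHS]EFinM; apply: lee_wpmul2l; [by rewrite lee_fin mulr_ge0// exprn_ge0|exact: BL].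
Qed.

Lemma cvg_box_integral (A : seq R) n (B : 'I_n -> set E)
    (F : nat -> n.-tuple E -> \bar R) (f : n.-tuple E -> \bar R) (C L : R) :
  (0 <= C)%R -> (0 <= L)%R -> (forall i, measurable (B i)) -> (forall i, mu (B i) <= L%:E) ->
  (forall k, measurable_fun [set: n.-tuple E] (F k)) -> measurable_fun [set: n.-tuple E] f ->
  (forall k s, generic A s -> `|F k s| <= C%:E) ->
  (forall s, generic A s -> F k s @[k --> \oo] --> f s) ->
  box_integral mu B (F k) @[k --> \oo] --> box_integral mu B f.
Proof.
move=> C0 L0; elim: n A B F f => [|n ih] A B F f mB BL mF mf FC Ff /=; first exact: Ff.
have finB : mu (B ord0) < +oo by apply: le_lt_trans (BL _) _; rewrite ltry.
have [] := @dominated_convergence _ _ _ mu (B ord0) (mB _)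
  (fun k x => box_integral mu (fun i => B (lift ord0 i)) (fun s => F k [tuple of x :: s]))
  (fun x => box_integral mu (fun i => B (lift ord0 i)) (fun s => f [tuple of x :: s]))
  (fun=> (C * L ^+ n)%:E) => //.
- by move=> k; apply: measurable_funTS; exact: measurable_box_cons.
- by apply: measurable_funTS; exact: measurable_box_cons.
- apply: filterS (ae_avoid A) => x xA _; apply: (ih (pr x :: A)) => //.
  + by move=> k; exact: measurable_fun_cons1.
  + exact: measurable_fun_cons1.
  + by move=> k s hs; apply: FC; exact: generic_cons.
  + by move=> s hs; apply: Ff; exact: generic_cons.
- apply: measurable_bounded_integrable => //.
  exists (C * L ^+ n)%R; split; first by rewrite num_real.
  by move=> y hy x _; rewrite ger0_norm; [exact: ltW|rewrite mulr_ge0// exprn_ge0].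
apply: filterS (ae_avoid A) => x xA k _; apply: (@box_integral_bound (pr x :: A)) => //.
  exact: measurable_fun_cons1.
by move=> s hs; apply: FC; exact: generic_cons.
Qed.

End box_integral_theory.

(** * Counting measure times Lebesgue measure *)

Lemma finite_ball_int (M : nat) : finite_set [set x : int | (`|x|%N <= M)%N].
Proof.
apply: (@sub_finite_set _ _ ((fun n : nat => n%:Z - M%:Z) @` `I_(2 * M).+1)).
  move=> x /= h; exists `|(x + M%:Z)%R|%N; lia.
exact/finite_image/finite_II.
Qed.

Lemma sigma_finite_counting_int (R : realType) : sigma_finite [set: int] (@counting int R).
Proof.
exists (fun M : nat => [set x : int | (`|x|%N <= M)%N]).
  by apply/seteqP; split => // x _; exists `|x|%N => /=.
by move=> M; split => //; rewrite /counting /= asboolT ?ltry//; exact: finite_ball_int.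
Qed.

HB.instance Definition _ (R : realType) :=
  @Measure_isSigmaFinite.Build _ _ R (@counting int R) (@sigma_finite_counting_int R).

Lemma parametric_lebesgue (R : realType) :
  parametric (@lebesgue_measure R : {measure set (measurableTypeR R) -> \bar R}).
Proof. by move=> d' Y G mG G0; exact: (measurable_fun_fubini_tonelli_F G). Qed.

Section counting_lebesgue_theory.
Context {R : realType}.
Local Notation leb := (@lebesgue_measure R).
Local Notation T := (measurableTypeR R).
Local Notation E := (int * T)%type.
Local Notation cl := (@counting_lebesgue R).

Definition window (M : nat) : set E := [set p | (`|p.1|%N <= M)%N /\ `|p.2| <= M%:R].

Lemma window_rect M : window M = [set x | (`|x|%N <= M)%N] `*` `[- M%:R, M%:R]%classic.
Proof. by apply/seteqP; split => -[x xi] /=; rewrite /window /= in_itv /= -ler_norml. Qed.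

Lemma measurable_window M : measurable (window M).
Proof. by rewrite window_rect; apply: measurableX => //; exact: measurable_itv. Qed.

Lemma window_homo M N : (M <= N)%N -> window M `<=` window N.
Proof.
move=> MN p [h1 h2]; split; first exact: leq_trans MN.
by apply: le_trans h2 _; rewrite ler_nat.
Qed.

Lemma bigcup_window : \bigcup_M window M = [set: E].
Proof.
apply/seteqP; split => // -[x xi] _.
exists (maxn `|x|%N (Num.bound `|xi|)) => //; split => /=; first exact: leq_maxl.
apply: le_trans (ltW (archi_boundP (normr_ge0 _))) _.
by rewrite ler_nat leq_maxr.
Qed.

Lemma counting_lebesgueX (A : set int) (B : set T) : measurable B ->
  cl (A `*` B) = (counting A * leb B)%E.
Proof. by move=> mB; apply: product_measure1E. Qed.

Lemma counting_set1 (x : int) : @counting int R [set x] = 1%E.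
Proof.
rewrite /counting /= asboolT; last exact: finite_set1.
by rewrite fset_set1 finmap.cardfs1.
Qed.

Lemma counting_lebesgue_window M : (cl (window M) < +oo)%E.
Proof.
rewrite window_rect counting_lebesgueX; last exact: measurable_itv.
apply: lte_mul_pinfty => //.
  by rewrite /counting /= asboolT//; exact: finite_ball_int.
by rewrite lebesgue_measure_itv /=; case: ifP => // _; rewrite -EFinD ltry.
Qed.

Lemma counting_lebesgue_null (r : R) : cl (snd @^-1` [set (r : T)]) = 0%E.
Proof.
rewrite (_ : _ @^-1` _ = setT `*` [set r]); last by apply/seteqP; split => -[x xi] //= [].
by rewrite counting_lebesgueX// lebesgue_measure_set1 mule0.
Qed.

Lemma integral_thread (x : int) (B : set T) (g : E -> \bar R) : measurable B ->
  measurable_fun [set: E] g ->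
  (\int[cl]_(p in [set x] `*` B) g p = \int[leb]_(xi in B) g (x, xi))%E.
Proof.
move=> mB.
have ge0 (f : E -> \bar R) : measurable_fun [set: E] f -> (forall p, 0 <= f p)%E ->
    (\int[cl]_(p in [set x] `*` B) f p = \int[leb]_(xi in B) f (x, xi))%E.
  move=> mf f0; have mD : measurable ([set x] `*` B : set E) by exact: measurableX.
  rewrite integral_mkcond fubini_tonelli1; last 2 first.
  - by apply/measurable_restrict => //; rewrite setTI; exact: measurable_funS mf.
  - by move=> p; rewrite /patch; case: ifP.
  rewrite /fubini_F (_ : (fun z => _) = (fun z : int => (if z == x then
      \int[leb]_(xi in B) f (x, xi) else 0)%E)); last first.
    apply/funext => z; case: eqVneq => [->|zx].
      rewrite [RHS]integral_mkcond; apply: eq_integral => xi _.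
      by rewrite /patch in_setX /= mem_set.
    rewrite (eq_integral (cst 0%E)) ?integral0// => xi _.
    by rewrite /patch in_setX /= (_ : (z \in [set x]) = false)//; apply/negbTE/negP => /set_mem/= /eqP; exact/negP.
  rewrite (_ : (fun z => _) = (cst (\int[leb]_(xi in B) f (x, xi))%E) \_ [set x]); last first.
    by apply/funext => z; rewrite /patch; case: eqVneq => [->|/eqP zx]; [rewrite mem_set|rewrite memNset].
  rewrite -integral_mkcond integral_cst//.
  by have /= -> := counting_set1 x; rewrite mule1.
move=> mg; rewrite integralE [RHS]integralE; congr (_ - _)%E.
  rewrite ge0//; first by apply: eq_integral => xi _; rewrite !funeposE.
  exact: measurable_funepos.
rewrite ge0//; first by apply: eq_integral => xi _; rewrite !funenegE.
exact: measurable_funeneg.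
Qed.

Definition site (h : R) (p : E) : int * int := (p.1, Num.floor (p.2 / h)).

Lemma measurable_site h : measurable_fun [set: E] (site h).
Proof.
apply: measurable_fun_pair => //; apply: measurableT_comp; first exact: measurable_floor.
exact: measurable_funM.
Qed.

Lemma measurable_of_sites k h (Phi : k.-tuple (int * int) -> R) :
  measurable_fun [set: k.-tuple E] (fun s => Phi [tuple of map (site h) s] : T).
Proof.
have all (Y : set (k.-tuple (int * int))) : measurable Y.
  apply: countable_measurable => [t|]; last exact: countableP.
  rewrite (_ : [set t] = \bigcap_(i in [set: 'I_k]) ((fun s => tnth s i) @^-1` [set tnth t i])).
    apply: fin_bigcap_measurable => // i _; rewrite -[X in measurable X]setTI.
    apply: (measurable_tnth i) => //.
    rewrite (_ : [set tnth t i] = [set (tnth t i).1] `*` [set (tnth t i).2]); first exact: measurableX.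
    by apply/seteqP; split => [[a b] /= <-//|[a b] /= [-> ->]]; case: (tnth t i).
  apply/seteqP; split => [s -> //|s h1]; apply: eq_from_tnth => i; exact: h1.
apply: (@measurableT_comp _ _ _ _ _ _ (Phi : _ -> T) _ (fun s : k.-tuple E => [tuple of map (site h) s])).
  by move=> _ Y _; exact: all.
apply/measurable_fun_tnthP => i.
rewrite (_ : _ \o _ = site h \o (fun s : k.-tuple E => tnth s i)); last first.
  by apply/funext => s /=; rewrite tnth_map.
by apply: measurableT_comp; [exact: measurable_site|exact: measurable_tnth].
Qed.

Lemma parametric_counting_lebesgue : parametric cl.
Proof.
move=> d' Y G mG G0.
rewrite (_ : (fun y => _) = (fun y => \int[@counting int R]_z \int[leb]_xi G (y, (z, xi)))%E).
  apply: (measurable_fun_fubini_tonelli_F (fun q : Y * int => \int[leb]_xi G (q.1, (q.2, xi)))%E); last first.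
    by move=> q; exact: integral_ge0.
  apply: (measurable_fun_fubini_tonelli_F (fun q : Y * int * T => G (q.1.1, (q.1.2, q.2)))) => //.
  apply: measurableT_comp => //; apply: measurable_fun_pair; first exact: measurableT_comp.
  by apply: measurable_fun_pair => //; exact: measurableT_comp.
apply/funext => y; rewrite fubini_tonelli1//.
by apply: measurableT_comp => //; exact: measurable_fun_pair.
Qed.

(** The density of a union of sites is constant on each cell {x} x [h y, h (y+1)[. *)
Lemma integral_sites h (D : set E) (L : seq (int * int)) (G : int * int -> R) : 0 < h ->
  measurable D -> uniq L -> (forall q, 0 <= G q) -> (forall q, q \notin L -> G q = 0) ->
  (forall p, site h p \in L -> D p) ->
  (\int[cl]_(p in D) (G (site h p))%:E = (h * \sum_(q <- L) G q)%:E)%E.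
Proof.
move=> h0 mD uL G0 GL LD.
pose cell (q : int * int) : set E := [set q.1] `*` `[h * q.2%:~R, h * q.2%:~R + h[%classic.
have cellE q p : cell q p <-> site h p = q.
  case: p q => [x xi] [x' y]; rewrite /cell /site /= in_itv /=.
  have := floor_div_itv xi h0; split => [[-> hy]|[-> <-]]//.
  congr (_, _); apply: floor_def; rewrite ler_pdivlMr// ltr_pdivrMr// intrD mulrDl mul1r.
  by rewrite ![_%:~R * h]mulrC.
have mcell q : measurable (cell q) by apply: measurableX => //; exact: measurable_itv.
have clcell q : cl (cell q) = h%:E.
  rewrite counting_lebesgueX; last exact: measurable_itv.
  rewrite counting_set1 mul1e lebesgue_measure_itv /= lte_fin ltrDl h0 -EFinD.
  by rewrite addrAC subrr add0r.
have GE p : (G (site h p))%:E = (\sum_(q <- L) (G q)%:E * (\1_(cell q) p)%:E)%E.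
  have [pL|pL] := boolP (site h p \in L).
    rewrite (bigD1_seq (site h p))//= big1 ?adde0 => [|q qp].
      by rewrite indicE mem_set ?mule1//; exact/cellE.
    rewrite indicE memNset ?mule0// => /cellE pq; by rewrite pq eqxx in qp.
  rewrite GL// big_seq big1// => q qL; rewrite indicE memNset ?mule0// => /cellE pq.
  by rewrite pq qL in pL.
rewrite (eq_integral (fun p => \sum_(q <- L) (G q)%:E * (\1_(cell q) p)%:E)%E); last by move=> p _.
rewrite ge0_integral_sum//; last 2 first.
- by move=> q; apply: measurable_funeM; apply/measurable_EFinP; exact: measurable_funTS.
- by move=> q p _; rewrite mule_ge0// lee_fin.
rewrite mulr_sumr -sumEFin; apply: eq_big_seq => q qL.
rewrite ge0_integralZl//; last 2 first.
- by apply/measurable_EFinP; exact: measurable_funTS.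
rewrite ?lee_fin//.
rewrite integral_indic// setIidl ?clcell; first by rewrite -EFinM mulrC.
by move=> p /cellE pq; apply: LD; rewrite pq.
Qed.

End counting_lebesgue_theory.

(** * Counting tuples of points *)

Section tuple_sums.

(** Iterated like the integral over a box, to which it is compared entry by entry. *)
Fixpoint tuple_sum (E : Type) (V : nmodType) (L : seq E) k : (k.-tuple E -> V) -> V :=
  match k with
  | 0 => fun Phi => Phi [tuple]
  | k'.+1 => fun Phi => \sum_(p <- L) tuple_sum L (fun s : k'.-tuple E => Phi [tuple of p :: s])
  end.

Lemma eq_tuple_sum (E : eqType) (V : nmodType) (L : seq E) k (Phi Psi : k.-tuple E -> V) :
  (forall s : k.-tuple E, {subset s <= L} -> Phi s = Psi s) -> tuple_sum L Phi = tuple_sum L Psi.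
Proof.
elim: k Phi Psi => [|k ih] Phi Psi h /=; first exact: h.
apply: eq_big_seq => p pL; apply: ih => s sL; apply: h => q.
by rewrite inE => /predU1P[->//|/sL].
Qed.

Lemma tuple_sum_map (E F : Type) (V : nmodType) (f : E -> F) (L : seq E) k (Phi : k.-tuple F -> V) :
  tuple_sum (map f L) Phi = tuple_sum L (fun s => Phi [tuple of map f s]).
Proof.
elim: k Phi => [|k ih] Phi /=; first by congr Phi; exact: val_inj.
rewrite big_map; apply: eq_bigr => p _; rewrite ih; congr (tuple_sum _ _).
by apply/funext => s; congr Phi; exact: val_inj.
Qed.

Lemma tuple_sum_natr (E : Type) (R : pzSemiRingType) (L : seq E) k (Phi : k.-tuple E -> nat) :
  (tuple_sum L Phi)%:R = tuple_sum L (fun s => (Phi s)%:R) :> R.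
Proof.
elim: k Phi => [//|k ih] Phi /=; rewrite natr_sum.
by apply: eq_bigr => p _; rewrite ih.
Qed.

Lemma tuple_sum_ge0 (E : Type) (R : numDomainType) (L : seq E) k (Phi : k.-tuple E -> R) :
  (forall s, 0 <= Phi s) -> 0 <= tuple_sum L Phi.
Proof.
elim: k Phi => [|k ih] Phi h /=; first exact: h.
by apply: sumr_ge0 => p _; apply: ih.
Qed.

Lemma tuple_sumZ (E : Type) (R : pzSemiRingType) (L : seq E) k (Phi : k.-tuple E -> R) c :
  c * tuple_sum L Phi = tuple_sum L (fun s => c * Phi s).
Proof.
elim: k Phi => [//|k ih] Phi /=; rewrite mulr_sumr.
by apply: eq_bigr => p _; rewrite ih.
Qed.

(** Slicing by the first entry. *)
Lemma card_tuples (E : choiceType) (L : seq E) k (S : set (k.-tuple E)) : uniq L ->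
  (forall s, S s -> {subset s <= L}) ->
  finite_set S /\ #|` fset_set S| = tuple_sum L (fun s => `[< S s >] : nat).
Proof.
move=> uL; elim: k S => [|k ih] S SL /=.
  have [St|St] := pselect (S [tuple]).
    have -> : S = [set [tuple]] by apply/seteqP; split => s; rewrite (tuple0 s).
    by split; [exact: finite_set1|rewrite fset_set1 finmap.cardfs1 asboolT].
  have -> : S = set0 by apply/seteqP; split => s //; rewrite (tuple0 s).
  by split; [exact: finite_set0|rewrite fset_set0 finmap.cardfs0 asboolF].
pose Sp p : set (k.-tuple E) := [set s : k.-tuple E | S [tuple of p :: s]].
have SpL p s : Sp p s -> {subset s <= L}.
  by move=> /SL h q qs; apply: h; rewrite inE qs orbT.
have fS : finite_set S.
  rewrite (_ : S = \bigcup_(p in [set` L]) ((fun s : k.-tuple E => [tuple of p :: s]) @` Sp p)).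
    apply: bigcup_finite; first exact: finite_seq.
    by move=> p _; apply: finite_image; case: (ih (Sp p) (SpL p)).
  apply/seteqP; split => [s Ss|s [p pL [s' Ss' <-]]//].
  exists (thead s); first by apply: (SL s Ss); rewrite [s]tuple_eta inE eqxx.
  by exists [tuple of behead s]; rewrite /Sp /= -?tuple_eta.
split => //; rewrite -sum1_size.
transitivity (\sum_(s <- fset_set S) \sum_(p <- L) (thead s == p : nat))%N.
  rewrite big_seq [RHS]big_seq; apply: eq_bigr => s; rewrite in_fset_set// => /set_mem Ss.
  rewrite (bigD1_seq (thead s))//= ?eqxx; first by rewrite big1// => p; rewrite eq_sym => /negbTE ->.
  by apply: (SL s Ss); rewrite [s]tuple_eta inE eqxx.
rewrite exchange_big /=; apply: eq_big_seq => p pL.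
have [fSp <-] := ih (Sp p) (SpL p).
rewrite -big_mkcond /= sum1_count -size_filter.
rewrite -(size_map (fun s : k.-tuple E => [tuple of p :: s])).
apply/perm_size/uniq_perm; rewrite ?filter_uniq ?fset_uniq//.
  rewrite map_inj_uniq ?fset_uniq// => s1 s2 /(congr1 val) /= [] h; exact: val_inj.
move=> s; rewrite mem_filter in_fset_set//; apply/andP/mapP => [[/eqP ps /set_mem Ss]|[s' s'S ->]].
  subst p; exists [tuple of behead s]; last by rewrite -tuple_eta.
  rewrite in_fset_set//.
  have h : Sp (thead s) [tuple of behead s] by rewrite /Sp /= -tuple_eta.
  by rewrite (mem_set h).
have : s' \in fset_set (Sp p) := s'S.
rewrite in_fset_set// => /set_mem h; rewrite theadE eqxx; split => //.
Qed.

Lemma counting_tuples (R : realType) d (E : measurableType d) (L : seq E) k (S : set (k.-tuple E)) :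
  uniq L -> (forall s, S s -> {subset s <= L}) ->
  (@counting _ R S = (tuple_sum L (fun s => `[< S s >]%:R))%:E)%E.
Proof.
move=> uL SL; have [fS cS] := card_tuples uL SL.
by rewrite /counting asboolT// cS tuple_sum_natr.
Qed.

Lemma tuple_sum_uniq (E : eqType) (L D : seq E) k : uniq L -> uniq D -> {subset D <= L} ->
  tuple_sum L (fun s : k.-tuple E => uniq s && all [predC D] s : nat) = (size L - size D) ^_ k.
Proof.
move=> uL; elim: k D => [|k ih] D uD DL /=; first by rewrite ffactn0.
have pE p : p \in L -> tuple_sum L (fun s : k.-tuple E =>
      [&& p \notin s & uniq s] && [predC D] p && all [predC D] s : nat) =
    ((p \notin D) * (size L - size D).-1 ^_ k)%N.
  move=> pL; have [pD|pD] := boolP (p \in D).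
    rewrite mul0n; transitivity (tuple_sum L (fun _ : k.-tuple E => 0%N)).
      by apply: eq_tuple_sum => s _ /=; rewrite pD andbF.
    by elim: (k) => [//|j ihj] /=; rewrite big1.
  rewrite mul1n; have := ih (p :: D); rewrite /= pD uD subnS => /(_ isT) <-.
    apply: eq_tuple_sum => s _ /=; rewrite andbT -andbA andbCA; congr (nat_of_bool (_ && _)).
    rewrite -has_pred1 -all_predC -all_predI; apply: eq_all => q /=.
    by rewrite inE negb_or.
  by move=> q; rewrite inE => /predU1P[->|/DL].
transitivity (\sum_(p <- L) ((p \notin D) * (size L - size D).-1 ^_ k))%N.
  by apply: eq_big_seq => p pL; rewrite -pE//; apply: eq_tuple_sum => s _ /=; rewrite !andbA.
rewrite -big_distrl /= ffactnS; congr (_ * _)%N.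
have cD : count (mem D) L = size D.
  rewrite -size_filter; apply/perm_size/uniq_perm => //; first exact: filter_uniq.
  by move=> q; rewrite mem_filter /=; case: (boolP (q \in D)) => //= /DL.
rewrite -[in RHS](count_predC (mem D)) cD addKn -sum1_count [RHS]big_mkcond /=.
by apply: eq_bigr => p _; case: (p \in D).
Qed.

End tuple_sums.

Section tuples_of_configuration.
Context {R : realType} d (E : measurableType d).

Definition tuples (A : set E) n (B : 'I_n -> set E) : set (n.-tuple E) :=
  [set s : n.-tuple E | uniq s /\ forall i, (A `&` B i) (tnth s i)].

Lemma tuples_sub (A : set E) n (B : 'I_n -> set E) (L : seq E) :
  (forall i p, (A `&` B i) p -> p \in L) -> forall s, tuples A B s -> {subset s <= L}.
Proof. by move=> BL s [_ h] q /tnthP[i ->]; apply: BL (h i). Qed.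

Lemma counting_tuples_diag (A W : set E) n : finite_set (A `&` W) ->
  (@counting _ R (tuples A (fun _ : 'I_n => W)) =
   (#|` fset_set (A `&` W)| ^_ n)%:R%:E)%E.
Proof.
move=> fA; have uL := fset_uniq (fset_set (A `&` W)).
rewrite (counting_tuples R uL); last first.
  apply: tuples_sub => i p Ap; rewrite in_fset_set//; exact: mem_set.
congr (_%:E)%E; rewrite -[X in (X ^_ _)%N]subn0 -(@tuple_sum_uniq _ _ [::] n uL)// tuple_sum_natr.
apply: eq_tuple_sum => s sL; congr (_%:R); congr (nat_of_bool _).
rewrite (_ : all _ _); last by apply/allP => q.
rewrite andbT; apply/asboolP/idP => [[]//|us]; split => // i.
by have := sL _ (mem_tnth i s); rewrite in_fset_set// => /set_mem.
Qed.

End tuples_of_configuration.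

Section bonferroni.
Context {R : realType}.

Lemma alternating_binomial (N m : nat) :
  \sum_(k < m.+1) (-1) ^+ k * 'C(N.+1, k)%:R = (-1) ^+ m * 'C(N, m)%:R :> R.
Proof.
elim: m => [|m ih]; first by rewrite big_ord_recr big_ord0 /= !bin0 add0r.
rewrite big_ord_recr /= ih binS natrD exprS; ring.
Qed.

(** Bonferroni's inequalities, in the symmetric form that the truncated
    inclusion-exclusion for the absence of points errs by at most its first
    omitted term. *)
Lemma bonferroni (N m : nat) :
  `|(N == 0)%:R - \sum_(k < m) (-1) ^+ k * (N ^_ k)%:R / k`!%:R| <= (N ^_ m)%:R / m`!%:R :> R.
Proof.
have fE k : (N ^_ k)%:R / k`!%:R = 'C(N, k)%:R :> R.
  by rewrite -bin_ffact natrM mulfK// pnatr_eq0 -lt0n fact_gt0.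
rewrite fE (eq_bigr (fun k : 'I_m => (-1) ^+ k * 'C(N, k)%:R)); last first.
  by move=> k _; rewrite -mulrA fE.
case: m => [|m]; first by rewrite big_ord0 subr0 bin0; case: eqP; rewrite ?normr1 ?normr0.
case: N {fE} => [|N].
  rewrite big_ord_recl /= bin0 expr0 mulr1 big1 ?addr0 ?subrr ?normr0// => k _.
  by rewrite bin_small ?mulr0.
rewrite alternating_binomial /= sub0r normrN normrM normrX normrN1 expr1n mul1r ger0_norm//.
by rewrite ler_nat binS leq_addl.
Qed.

End bonferroni.

(** * Factorial moments of the beads *)

Section sums_as_integrals.
Context {R : realType}.
Local Notation T := (measurableTypeR R).
Local Notation E := (int * T)%type.
Local Notation cl := (@counting_lebesgue R).

Lemma box_integral_sites h (D : set E) (L : seq (int * int)) k (Phi : k.-tuple (int * int) -> R) :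
  0 < h -> measurable D -> uniq L -> (forall p, site h p \in L -> D p) ->
  (forall s, 0 <= Phi s) -> (forall s : k.-tuple (int * int), ~ {subset s <= L} -> Phi s = 0) ->
  (box_integral cl (fun _ : 'I_k => D) (fun s => (Phi [tuple of map (site h) s])%:E) =
   (h ^+ k * tuple_sum L Phi)%:E)%E.
Proof.
move=> h0 mD uL LD; elim: k Phi => [|k ih] Phi Phi0 PhiL /=.
  by rewrite expr0 mul1r; congr (_%:E)%E; congr Phi; exact: val_inj.
pose G q := h ^+ k * tuple_sum L (fun s : k.-tuple (int * int) => Phi [tuple of q :: s]).
rewrite (eq_integral (fun p => (G (site h p))%:E)) => [|p _]; last first.
  rewrite /G -ih => [|s|s hs]; last 2 first.
  - exact: Phi0.
  - by apply: PhiL => hs'; apply: hs => q qs; apply: hs'; rewrite inE qs orbT.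
  congr (box_integral _ _ _); apply/funext => s; congr (_%:E)%E; congr Phi; exact: val_inj.
rewrite (integral_sites h0 mD uL) => //; last 2 first.
- by move=> q; rewrite mulr_ge0 ?exprn_ge0 ?(ltW h0)//; apply: tuple_sum_ge0.
- move=> q qL; rewrite /G (_ : tuple_sum _ _ = 0) ?mulr0//.
  transitivity (tuple_sum L (fun _ : k.-tuple (int * int) => 0 : R)).
    apply: eq_tuple_sum => s _; apply: PhiL => /(_ q); rewrite inE eqxx => /(_ isT).
    by apply/negP.
  by elim: (k) => [//|j ihj] /=; rewrite big1.
by rewrite -mulr_sumr mulrA exprS.
Qed.

Lemma integral_tuple_sum d (Omega : measurableType d) (mu : {measure set Omega -> \bar R}) (I : Type)
    (L : seq I) k (F : Omega -> k.-tuple I -> R) :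
  (forall s, measurable_fun [set: Omega] (fun o => F o s : T)) -> (forall o s, 0 <= F o s) ->
  (forall s, \int[mu]_o (F o s)%:E \is a fin_num)%E ->
  (\int[mu]_o (tuple_sum L (F o))%:E = (tuple_sum L (fun s => fine (\int[mu]_o (F o s)%:E)))%:E)%E /\
  measurable_fun [set: Omega] (fun o => tuple_sum L (F o) : T).
Proof.
elim: k F => [|k ih] F mF F0 fF /=; first by split; [rewrite fineK|exact: mF].
have ihp p := ih (fun o s => F o [tuple of p :: s]) (fun s => mF _) (fun o s => F0 _ _) (fun s => fF _).
split; last by apply: measurable_sum => p; case: (ihp p).
under eq_integral do rewrite -sumEFin.
rewrite ge0_integral_sum//; last 2 first.
- by move=> p; apply/measurable_EFinP; case: (ihp p).
- by move=> p o _; rewrite lee_fin; apply: tuple_sum_ge0.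
by rewrite -sumEFin; apply: eq_bigr => p _; case: (ihp p).
Qed.

End sums_as_integrals.

Section restricted_box.
Context {R : realType} d (E : measurableType d) (mu : {measure set E -> \bar R}).
Local Open Scope ereal_scope.

Lemma box_integral0 n (B : 'I_n -> set E) : box_integral mu B (fun=> 0) = 0.
Proof.
elim: n B => [//|n ih] B /=.
by rewrite (eq_integral (cst 0)) ?integral0// => x _; rewrite ih.
Qed.

Lemma box_integral_restrict n (V W : 'I_n -> set E) f : (forall i, measurable (V i)) ->
  (forall i, measurable (W i)) -> (forall i, W i `<=` V i) ->
  box_integral mu V (fun s => if `[< forall i, W i (tnth s i) >] then f s else 0) =
  box_integral mu W f.
Proof.
elim: n V W f => [|n ih] V W f mV mW WV /=; first by rewrite asboolT//; case.
rewrite -(setIidr (WV ord0)) integral_mkcondr; apply: eq_integral => x _.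
have consP (s : n.-tuple E) : (forall i, W i (tnth [tuple of x :: s] i)) <->
    W ord0 x /\ (forall i, W (lift ord0 i) (tnth s i)).
  split => [h|[h0 h] i].
    by split => [|i]; [have := h ord0|have := h (lift ord0 i)]; rewrite ?tnth0 ?tnthS.
  by case: (unliftP ord0 i) => [j ->|->]; rewrite ?tnthS ?tnth0.
rewrite /patch; case: ifPn => [/set_mem Wx|Wx].
  rewrite -[RHS](ih (fun i => V (lift ord0 i)))//.
  apply: eq_box_integral => s _.
  suff -> : `[< forall i, W i (tnth [tuple of x :: s] i) >] =
    `[< forall i, W (lift ord0 i) (tnth s i) >] by [].
  by apply: asbool_equiv_eq; rewrite consP; tauto.
transitivity (box_integral mu (fun i => V (lift ord0 i)) (fun=> 0)); last exact: box_integral0.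
congr (box_integral _ _ _); apply/funext => s; rewrite asboolF// consP => -[Wx' _].
by rewrite mem_set in Wx.
Qed.

End restricted_box.

Section bead_moments.
Context {R : realType}.
Local Notation T := (measurableTypeR R).
Local Notation E := (int * T)%type.
Local Notation cl := (@counting_lebesgue R).
Variable gamma : R.
Hypothesis hgamma : -1 < gamma < 1.
Local Notation sg := (sg gamma).

(** The determinants of the kernel freed from its gauge factor (-1)^(y-y') and
    normalized by the mesh. *)
Definition det_kscal (t : R) k (q : k.-tuple (int * int)) : R[i] :=
  \det (\matrix_(i, j) kscal gamma t ((tnth q i).1 - (tnth q j).1) ((tnth q i).2 - (tnth q j).2)).

Lemma det_kscal_repeat t k (q : k.-tuple (int * int)) : ~~ uniq q -> det_kscal t q = 0.
Proof.
move=> /tuple_uniqP nq; apply: contrapT => d0; apply: nq => i j qij; apply: contrapT => ij.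
apply: d0; apply: (@determinant_alternate _ _ _ i j); first exact/eqP.
by move=> l; rewrite !mxE qij.
Qed.

Variable t : R.
Hypothesis t01 : 0 < t <= 1.
Hypothesis htri : strict_triangle t 1 (expR (gamma * t)).
Variables (d : measure_display) (Omega : measurableType d) (P : probability Omega R).
Variable omega : Omega -> set (int * int).
Hypothesis homega : discrete_bead_model gamma t P omega.

Let h := t * sg.
Let t0 : 0 < t. Proof. by case/andP: t01. Qed.
Let h0 : 0 < h. Proof. by rewrite mulr_gt0// sg_gt0. Qed.

(** The gauge factors cancel between rows and columns, and each row contributes
    a factor t sg. *)
Lemma probability_beads k (q : k.-tuple (int * int)) : uniq q ->
  (fine (P [set o | forall i, omega o (tnth q i)]))%:C = (h ^+ k)%:C * det_kscal t q.
Proof.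
move=> /tuple_uniqP uq; have [_ /(_ k (tnth q) uq) ->] := homega.
set A := (X in \det X).
pose B := \matrix_(i, j) kscal gamma t ((tnth q i).1 - (tnth q j).1) ((tnth q i).2 - (tnth q j).2).
pose u : 'rV[R[i]]_k := \row_i (-1) ^ (tnth q i).2.
pose v : 'rV[R[i]]_k := \row_i (-1) ^ (- (tnth q i).2).
have AE : A = diag_mx u *m (sg%:C *: B) *m diag_mx v.
  apply/matrixP => i j; rewrite mul_mx_diag mxE mul_diag_mx !mxE K_invE//.
  by rewrite expfzDr ?oppr_eq0 ?oner_neq0// mulrAC.
have uv : \prod_i u 0 i * \prod_i v 0 i = 1.
  rewrite -big_split /= big1// => i _; rewrite !mxE -expfzDr ?oppr_eq0 ?oner_neq0//.
  by rewrite subrr expr0z.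
rewrite AE !det_mulmx !det_diag detZ -/(det_kscal t q).
rewrite mulrAC uv mul1r /h exprMn rmorphM /= !rmorphXn /= mulrA//.
Qed.

Definition lattice_point (q : int * int) : E := (q.1, h * q.2%:~R).

Lemma lattice_point_inj : injective lattice_point.
Proof.
move=> [x y] [x' y'] [-> /(mulfI _) e]; congr (_, _); apply/eqP.
by rewrite -(eqr_int R) e// gt_eqF.
Qed.

Lemma rescaled_beadsE o q : rescaled_beads gamma t (omega o) (lattice_point q) <-> omega o q.
Proof.
have lE p : (p.1, t * p.2%:~R * Num.sqrt (1 - gamma ^+ 2)) = lattice_point p.
  by rewrite /lattice_point /h mulrAC.
split => [[p op]|oq]; last by exists q => //; rewrite lE.
by rewrite lE => /lattice_point_inj <-.
Qed.

Lemma rescaled_beads_lattice o p : rescaled_beads gamma t (omega o) p ->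
  exists2 q, p = lattice_point q & omega o q.
Proof. by case=> q oq <-; exists q => //; rewrite /lattice_point /h mulrAC. Qed.

Lemma finite_lattice_window M : finite_set [set q | window M (lattice_point q)].
Proof.
apply: (@sub_finite_set _ _ ([set x : int | (`|x|%N <= M)%N] `*`
    [set y : int | (`|y|%N <= Num.bound (M%:R / h))%N])).
  move=> [x y] [/= hx hy]; split => //=.
  rewrite -(ler_nat R) natr_absz intr_norm; apply/ltW/(le_lt_trans _ (archi_boundP _)); last first.
    by rewrite divr_ge0// ltW.
  by rewrite ler_pdivlMr// mulrC -{1}(gtr0_norm h0) -normrM.
by apply: finite_setX; exact: finite_ball_int.
Qed.

(** A sum over sites is the integral of a function that is constant on the cells
    of the rescaled lattice. *)
Lemma bead_moment M k (W : 'I_k -> set E) : (forall i, W i `<=` window M) ->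
  (\int[P]_o @counting (k.-tuple E) R (tuples (rescaled_beads gamma t (omega o)) W) =
   box_integral cl (fun=> window M.+1) (fun s =>
     (if `[< forall i, W i (lattice_point (site h (tnth s i))) >]
      then complex.Re (det_kscal t [tuple of map (site h) s]) else 0)%:E))%E.
Proof.
move=> WM; have fL := finite_lattice_window M.
pose L : seq (int * int) := fset_set [set q | window M (lattice_point q)].
have uL : uniq L by exact: fset_uniq.
have LE q : (q \in L) <-> window M (lattice_point q).
  by rewrite /L in_fset_set//; split => [/set_mem|hq]//; exact: mem_set.
pose Phi (q : k.-tuple (int * int)) : R :=
  if `[< forall i, W i (lattice_point (tnth q i)) >] then complex.Re (det_kscal t q) else 0.
have hk : 0 < h ^+ k by rewrite exprn_gt0.
have PE (q : k.-tuple (int * int)) : uniq q ->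
    fine (P [set o | forall i, omega o (tnth q i)]) = h ^+ k * complex.Re (det_kscal t q).
  by move=> /probability_beads /(congr1 (@complex.Re R)) /=; rewrite ReM /= mul0r subr0.
have Phi0 q : 0 <= Phi q.
  rewrite /Phi; case: ifP => // _.
  have [uq|uq] := boolP (uniq q); last by rewrite det_kscal_repeat.
  by rewrite -(pmulr_rge0 _ hk) -PE// fine_ge0.
have -> : (fun s : k.-tuple E => (if `[< forall i, W i (lattice_point (site h (tnth s i))) >]
      then complex.Re (det_kscal t [tuple of map (site h) s]) else 0)%:E) =
    (fun s => (Phi [tuple of map (site h) s])%:E).
  apply/funext => s; rewrite /Phi; congr (_%:E)%E; congr (if _ then _ else _).
  by apply: asbool_equiv_eq; split => hs i; have := hs i; rewrite tnth_map.
rewrite (@box_integral_sites _ h (window M.+1) L)//; last 3 first.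
- exact: measurable_window.
- move=> p /LE [h1 h2]; split; first exact: leqW.
  have /andP[f1 f2] := floor_div_itv p.2 h0.
  have h1' : h <= 1.
    rewrite /h mulr_ile1 ?(ltW t0) ?(ltW (sg_gt0 hgamma))//; first by case/andP: t01.
    by rewrite /sg -[leRHS]sqrtr1 ler_wsqrtr// gerBl sqr_ge0.
  move: h2; rewrite /= !ler_norml -natr1 => /andP[h3 h4]; apply/andP; split; lra.
- move=> q nq; rewrite /Phi asboolF// => hW; apply: nq => p /tnthP[i ->].
  by apply/LE/WM.
have FE o : (@counting (k.-tuple E) R (tuples (rescaled_beads gamma t (omega o)) W) =
    (tuple_sum L (fun q => `[< uniq q /\ (forall i, W i (lattice_point (tnth q i))) /\
       forall i, omega o (tnth q i) >]%:R))%:E)%E.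
  rewrite (counting_tuples R (L := map lattice_point L)); last 2 first.
  - by rewrite map_inj_uniq//; exact: lattice_point_inj.
  - apply: tuples_sub => i p [/rescaled_beads_lattice[q -> oq] Wq].
    by apply: map_f; apply/LE/WM/Wq.
  rewrite tuple_sum_map; congr (_%:E)%E; congr (tuple_sum _ _); apply/funext => q.
  congr ((nat_of_bool _)%:R); apply: asbool_equiv_eq; rewrite /tuples /= map_inj_uniq; last first.
    exact: lattice_point_inj.
  split => [[uq hq]|[uq [h1 h2]]].
    split => //; split => i; have := hq i; rewrite tnth_map => -[]// /rescaled_beadsE//.
  by split => // i; rewrite tnth_map; split => //; exact/rescaled_beadsE.
under eq_integral do rewrite FE.
have mo (q : k.-tuple (int * int)) : measurable [set o | forall i, omega o (tnth q i)].
  rewrite (_ : mkset _ = \bigcap_(i in [set: 'I_k]) [set o | omega o (tnth q i)]).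
    by apply: fin_bigcap_measurable => // i _; case: homega.
  by apply/seteqP; split => [z ho i _|z ho i]; exact: ho.
have indE (q : k.-tuple (int * int)) : (fun o => (`[< uniq q /\
    (forall i, W i (lattice_point (tnth q i))) /\ forall i, omega o (tnth q i) >]%:R : R)) =
    (fun o => `[< uniq q /\ forall i, W i (lattice_point (tnth q i)) >]%:R *
       \1_[set o | forall i, omega o (tnth q i)] o).
  apply/funext => o; rewrite indicE -natrM mulnb; congr ((nat_of_bool _)%:R).
  apply/asboolP/andP => [[h1 [h2 h3]]|[/asboolP[h1 h2] /set_mem h3]]//.
  by split; [exact/asboolP|exact: mem_set].
have intE (q : k.-tuple (int * int)) : (\int[P]_o (`[< uniq q /\ (forall i, W i (lattice_point (tnth q i))) /\
    forall i, omega o (tnth q i) >]%:R)%:E = (h ^+ k * Phi q)%:E)%E.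
  under eq_integral do rewrite (congr1 (fun f => f _) (indE q)) EFinM.
  rewrite ge0_integralZl ?lee_fin//; last first.
    by apply/measurable_EFinP; exact: measurable_indic.
  rewrite integral_indic// setIT -[X in (_ * X)%E]fineK ?fin_num_measure//.
  rewrite -EFinM /Phi; congr (_%:E)%E.
  case: asboolP => [[uq hW]|hW]; first by rewrite mul1r PE// asboolT.
  rewrite mul0r; case: asboolP => hW'; last by rewrite mulr0.
  by rewrite det_kscal_repeat ?mulr0//; apply/negP => uq; apply: hW.
pose F o (q : k.-tuple (int * int)) : R := `[< uniq q /\
  (forall i, W i (lattice_point (tnth q i))) /\ forall i, omega o (tnth q i) >]%:R.
have mF q : measurable_fun [set: Omega] (fun o => F o q : T).
  rewrite /F indE; apply: measurable_funM; first exact: measurable_cst.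
  exact: measurable_indic.
have F0 o q : 0 <= F o q by rewrite /F ler0n.
have fF q : (\int[P]_o (F o q)%:E \is a fin_num)%E by rewrite intE.
have [-> _] := integral_tuple_sum L mF F0 fF.
rewrite tuple_sumZ; congr (_%:E)%E; congr (tuple_sum _ _); apply/funext => q.
by rewrite intE.
Qed.

End bead_moments.

(** * Convergence of the factorial moments *)

Section determinants_of_the_limit_kernel.
Context {R : realType}.
Local Notation T := (measurableTypeR R).
Local Notation E := (int * T)%type.
Local Notation cl := (@counting_lebesgue R).
Variable gamma : R.
Hypothesis hgamma : -1 < gamma < 1.

Lemma cmeas_comp d1 (T1 : measurableType d1) d2 (T2 : measurableType d2)
    (f : T2 -> R[i]) (g : T1 -> T2) : cmeasurable setT f -> measurable_fun [set: T1] g ->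
  cmeasurable setT (fun x => f (g x)).
Proof. by move=> [f1 f2] mg; split; [exact: (measurableT_comp f1 mg)|exact: (measurableT_comp f2 mg)]. Qed.

Lemma cmeas_det d1 (T1 : measurableType d1) k (A : T1 -> 'M[R[i]]_k) :
  (forall i j, cmeasurable setT (fun x => A x i j)) -> cmeasurable setT (fun x => \det (A x)).
Proof.
move=> mA; rewrite /determinant.
elim: (index_enum _) => [|s r ih].
  by under eq_fun do rewrite big_nil; exact: cmeas_cst.
under eq_fun do rewrite big_cons; apply: cmeasD => //; apply: cmeasM; first exact: cmeas_cst.
elim: (index_enum _) => [|i l ihl].
  by under eq_fun do rewrite big_nil; exact: cmeas_cst.
by under eq_fun do rewrite big_cons; apply: cmeasM.
Qed.

Definition det_J k (s : k.-tuple E) : R[i] :=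
  \det (\matrix_(i, j) J gamma ((tnth s i).1 - (tnth s j).1) ((tnth s i).2 - (tnth s j).2)).

Lemma measurable_int_sub : measurable_fun [set: int * int] (fun p : int * int => p.1 - p.2).
Proof. by apply: measurable_int_prod => x. Qed.

Lemma cmeas_J_prod : cmeasurable [set: E] (fun p : E => J gamma p.1 p.2).
Proof. by split; apply: measurable_int_prod => x; case: (cmeas_J hgamma x). Qed.

Lemma cmeas_det_J k : cmeasurable [set: k.-tuple E] (@det_J k).
Proof.
apply: cmeas_det => i j; under eq_fun do rewrite mxE.
have m1 l : measurable_fun [set: k.-tuple E] (fun s : k.-tuple E => (tnth s l).1).
  by apply: (measurableT_comp measurable_fst); exact: measurable_tnth.
have m2 l : measurable_fun [set: k.-tuple E] (fun s : k.-tuple E => (tnth s l).2).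
  by apply: (measurableT_comp measurable_snd); exact: measurable_tnth.
pose g (s : k.-tuple E) : E := ((tnth s i).1 - (tnth s j).1, (tnth s i).2 - (tnth s j).2).
suff mg : measurable_fun [set: k.-tuple E] g by exact: (cmeas_comp cmeas_J_prod mg).
apply: measurable_fun_pair.
  apply: (measurableT_comp measurable_int_sub
    (g := fun s : k.-tuple E => ((tnth s i).1, (tnth s j).1))).
  exact: measurable_fun_pair.
exact: (measurable_funB (m2 i) (m2 j)).
Qed.

Lemma generic_neq (A : seq R) k (s : k.-tuple E) i j : generic snd A s -> i != j ->
  (tnth s i).2 != (tnth s j).2.
Proof.
case/andP => us _ ij.
have := us; rewrite -[map _ _]/(val (map_tuple snd s)) => /tuple_uniqP inj.
by apply/negP => /eqP h; move/negP: ij; apply; apply/eqP/inj; rewrite !tnth_map.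
Qed.

Lemma generic_off_diagonal (A : seq R) k (s : k.-tuple E) i j : generic snd A s ->
  ((tnth s i).1 - (tnth s j).1 != -1) || ((tnth s i).2 - (tnth s j).2 != 0).
Proof.
move=> gs; have [->|ij] := eqVneq i j; first by rewrite subrr.
by rewrite subr_eq0 (generic_neq gs ij) orbT.
Qed.

(** Hadamard's bound on a k-point density with kernel bounded by C. *)
Definition hadamard_bound (C : R) (k : nat) : R := Num.sqrt ((C ^+ 2 *+ k) ^+ k).

Lemma Re_det_le k (A : 'M[R[i]]_k) C : (forall i j, cabs (A i j) <= C) ->
  `|complex.Re (\det A)| <= hadamard_bound C k.
Proof.
move=> AC; apply: le_trans (Re_le_cabs _) _.
by rewrite -[leLHS]ger0_norm ?cabs_ge0// -sqrtr_sqr ler_wsqrtr// cabs_det_le.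
Qed.

(** The factorial beats Hadamard's bound: (C^2 k)^(k/2) L^k / k! tends to 0. *)
Lemma hadamard_bound_decay (C L : R) : 0 <= L ->
  hadamard_bound C k * L ^+ k / k`!%:R @[k --> \oo] --> 0.
Proof.
move=> L0; pose x := (C * L) ^+ 2 * expR 1.
have kk k : (k%:R : R) ^+ k <= expR 1 ^+ k * k`!%:R.
  elim: k => [|k ih]; first by rewrite !expr0 mul1r.
  rewrite exprS factS natrM mulrCA; apply: ler_wpM2l => //.
  case: k ih => [|k] ih; first by rewrite expr0 expr1 mulr1 -[leLHS]expR0 ler_expR.
  have k0 : 0 < (k.+1%:R : R) by rewrite ltr0n.
  have -> : (k.+2%:R : R) = k.+1%:R * (1 + k.+1%:R^-1).
    by rewrite mulrDr mulr1 mulfV ?gt_eqF// natr1.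
  rewrite exprMn mulrC [expR 1 ^+ _]exprS -mulrA; apply: ler_pM => //; rewrite ?exprn_ge0 ?addr_ge0 ?invr_ge0//.
  rewrite [X in _ <= expR X](_ : 1 = k.+1%:R * k.+1%:R^-1); last by rewrite mulfV// gt_eqF.
  rewrite expRM_natl lerXn2r ?nnegrE ?addr_ge0 ?invr_ge0 ?expR_ge0//.
  exact: expR_ge1Dx.
have bnd k : (hadamard_bound C k * L ^+ k / k`!%:R) ^+ 2 <= exp_coeff x k.
  have f0 : 0 < (k`!%:R : R) by rewrite ltr0n fact_gt0.
  have aE : hadamard_bound C k ^+ 2 = (C ^+ 2) ^+ k * k%:R ^+ k.
    rewrite /hadamard_bound sqr_sqrtr; last by rewrite exprn_ge0// mulrn_wge0// sqr_ge0.
    by rewrite -(mulr_natr (C ^+ 2)) exprMn.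
  have -> : (hadamard_bound C k * L ^+ k / k`!%:R) ^+ 2 =
      ((C ^+ 2) ^+ k * (L ^+ 2) ^+ k / k`!%:R) * (k%:R ^+ k / k`!%:R).
    rewrite exprMn exprMn aE -[(L ^+ k) ^+ 2]exprM -[(L ^+ 2) ^+ k]exprM [(k * 2)%N]mulnC.
    move: ((C ^+ 2) ^+ k) (k%:R ^+ k) (L ^+ (2 * k)) (k`!%:R^-1) => a b c e; ring.
  have -> : exp_coeff x k = ((C ^+ 2) ^+ k * (L ^+ 2) ^+ k / k`!%:R) * expR 1 ^+ k.
    rewrite /exp_coeff /= /x exprMn [(C * L) ^+ 2]exprMn [(C ^+ 2 * L ^+ 2) ^+ k]exprMn.
    move: ((C ^+ 2) ^+ k) ((L ^+ 2) ^+ k) (k`!%:R^-1) (expR 1 ^+ k) => a b c e; ring.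
  apply: ler_wpM2l; last by rewrite ler_pdivrMr.
  by rewrite divr_ge0// mulr_ge0// exprn_ge0// sqr_ge0.
have sq : (hadamard_bound C k * L ^+ k / k`!%:R) ^+ 2 @[k --> \oo] --> 0.
  apply: (@squeeze_cvgr _ _ _ _ (fun=> 0) (exp_coeff x)).
  - by apply: nearW => k; rewrite sqr_ge0 bnd.
  - exact: cvg_cst.
  - exact: cvg_exp_coeff.
have : Num.sqrt ((hadamard_bound C k * L ^+ k / k`!%:R) ^+ 2) @[k --> \oo] --> Num.sqrt (0 : R).
  by apply: (cvg_comp _ _ sq); exact: sqrt_continuous.
rewrite sqrtr0; apply: cvg_trans; apply: near_eq_cvg; apply: nearW => k.
by rewrite sqrtr_sqr ger0_norm// divr_ge0// mulr_ge0 ?sqrtr_ge0// exprn_ge0.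
Qed.

Lemma Re_det_J_bounded M : exists C, forall k (s : k.-tuple E), generic snd [::] s ->
  (forall i, window M (tnth s i)) -> `|complex.Re (det_J s)| <= hadamard_bound C k.
Proof.
have [C hC] := J_bounded hgamma (M%:R + M%:R).
exists C => k s gs Ms; apply: Re_det_le => i j; rewrite mxE; apply: hC.
  by apply: le_trans (ler_normB _ _) (lerD _ _); case: (Ms i) => //; case: (Ms j).
exact: generic_off_diagonal gs.
Qed.

(** Bounded sets whose threads are locally constant off finitely many heights:
    their indicators are continuous almost everywhere. *)
Definition nice (W : set E) := [/\ measurable W, exists M, W `<=` window M &
  exists A : seq R, forall x xi, xi \notin A ->
    \forall z \near xi, W (x, z) <-> W (x, xi)].

Section along_a_sequence.
Variable t : nat -> R.
Hypothesis t01 : forall n, 0 < t n <= 1.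
Hypothesis tri : forall n, strict_triangle (t n) 1 (expR (gamma * t n)).
Hypothesis tc : t n @[n --> \oo] --> 0.
Variables (d : nat -> measure_display) (Omega : forall n, measurableType (d n)).
Variables (P : forall n, probability (Omega n) R) (omega : forall n, Omega n -> set (int * int)).
Hypothesis homega : forall n, discrete_bead_model gamma (t n) (P n) (@omega n).

Let h n := t n * sg gamma.
Let h0 n : 0 < h n. Proof. by rewrite mulr_gt0 ?sg_gt0//; case/andP: (t01 n). Qed.
Let hc : h n @[n --> \oo] --> 0.
Proof. by rewrite -[X in _ --> X](mul0r (sg gamma)); apply: cvgMl. Qed.

Lemma ccvg_det_kscal (A : seq R) k (s : k.-tuple E) : generic snd A s ->
  ccvg (fun n => det_kscal gamma (t n) [tuple of map (site (h n)) s]) (det_J s).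
Proof.
move=> gs; apply: ccvg_det => i j; rewrite mxE; under eq_fun do rewrite mxE !tnth_map /=.
apply: kscal_cvg => //; last exact: generic_off_diagonal gs.
under eq_fun do rewrite -/(h _) rmorphB /= mulrBr.
by apply: cvgB; exact: cvg_floor_div.
Qed.

Lemma near_uniq_sites (A : seq R) k (s : k.-tuple E) : generic snd A s ->
  \forall n \near \oo, uniq [tuple of map (site (h n)) s].
Proof.
move=> gs; have : \forall n \near \oo, forall ij : 'I_k * 'I_k, ij.1 != ij.2 ->
    site (h n) (tnth s ij.1) != site (h n) (tnth s ij.2).
  apply: filter_forall => -[i j] /=; have [->|ij] := eqVneq i j; first exact: nearW.
  have d0 : 0 < `|(tnth s i).2 - (tnth s j).2| by rewrite normr_gt0 subr_eq0 (generic_neq gs).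
  move/cvgrPdist_lt : hc => /(_ _ d0); apply: filterS => n; rewrite sub0r normrN gtr0_norm// => hn _.
  apply/negP => /eqP [_ e].
  have /andP[a1 a2] := floor_div_itv (tnth s i).2 (h0 n).
  have /andP[b1 b2] := floor_div_itv (tnth s j).2 (h0 n).
  rewrite e in a1 a2; move: hn; apply/negP; rewrite -leNgt ler_norml; apply/andP; split; lra.
apply: filterS => n hn; apply/tuple_uniqP => i j; rewrite !tnth_map => ij.
by apply: contrapT => /eqP nij; have := hn (i, j) nij; rewrite ij eqxx.
Qed.

(** Densities of probabilities: the determinants are limits of nonnegative
    numbers. *)
Lemma det_J_real_ge0 (A : seq R) k (s : k.-tuple E) : generic snd A s ->
  0 <= complex.Re (det_J s) /\ complex.Im (det_J s) = 0.
Proof.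
move=> gs; have [c1 c2] := ccvg_det_kscal gs.
have real_ge0 : \forall n \near \oo,
    0 <= complex.Re (det_kscal gamma (t n) [tuple of map (site (h n)) s]) /\
    complex.Im (det_kscal gamma (t n) [tuple of map (site (h n)) s]) = 0.
  apply: filterS (near_uniq_sites gs) => n us.
  have := probability_beads hgamma (t01 n) (tri n) (homega n) us.
  have hk : 0 < h n ^+ k by rewrite exprn_gt0.
  move=> e; have /= := congr1 (@complex.Re R) e; have /= := congr1 (@complex.Im R) e.
  rewrite ReM ImM /= !mul0r subr0 addr0 => /esym/eqP; rewrite mulf_eq0 gt_eqF// => /eqP e1 e2.
  by split => //; rewrite -(pmulr_rge0 _ hk) -e2 fine_ge0.
split; first by apply: (cvgr_to_ge c1); apply: filterS real_ge0 => n [].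
apply: (cvg_unique _ c2) => //; apply: (@cvg_near_cst _ _ _ _ _ _).
by apply: filterS real_ge0 => n [].
Qed.

(** Dominated convergence: Hadamard's inequality bounds the densities, which
    converge at generic tuples, since these avoid the singularity of J (-1) at 0
    and the boundaries of the sides. *)
Lemma bead_moment_cvg k (W : 'I_k -> set E) : (forall i, nice (W i)) ->
  (\int[P n]_o @counting (k.-tuple E) R (tuples (rescaled_beads gamma (t n) (@omega n o)) W)
    @[n --> \oo] --> box_integral cl W (fun s => (complex.Re (det_J s))%:E))%E.
Proof.
move=> nW.
have [M WM] : exists M, forall i, W i `<=` window M.
  have /choice[m hm] : forall i, exists M, W i `<=` window M by move=> i; case: (nW i).
  exists (\max_i m i)%N => i; apply: subset_trans (hm i) (window_homo _); exact: leq_bigmax.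
have [A hA] : exists A : seq R, forall i x xi, xi \notin A ->
    \forall z \near xi, W i (x, z) <-> W i (x, xi).
  have /choice[a ha] : forall i, exists A : seq R, forall x xi, xi \notin A ->
    \forall z \near xi, W i (x, z) <-> W i (x, xi) by move=> i; case: (nW i).
  exists (flatten [seq a i | i <- enum 'I_k]) => i x xi xiA; apply: ha.
  apply: contra xiA => xia; apply/flattenP; exists (a i) => //; exact/map_f/mem_enum.
have mW i : measurable (W i) by case: (nW i).
pose F n (s : k.-tuple E) : \bar R :=
  (if `[< forall i, W i (lattice_point gamma (t n) (site (h n) (tnth s i))) >]
   then complex.Re (det_kscal gamma (t n) [tuple of map (site (h n)) s]) else 0)%:E.
have mE n : (\int[P n]_o @counting (k.-tuple E) R (tuples (rescaled_beads gamma (t n) (@omega n o)) W) =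
    box_integral cl (fun=> window M.+1) (F n))%E.
  exact: (bead_moment hgamma (t01 n) (tri n) (homega n) WM).
rewrite (funext mE).
have WM1 i : W i `<=` window M.+1 by apply: subset_trans (WM i) (window_homo _).
rewrite -(@box_integral_restrict R _ E cl k (fun=> window M.+1) W _ (fun=> measurable_window M.+1) mW WM1).
have [|C hC] := @kscal_locally_bounded R gamma hgamma t t01 tc (M%:R + M%:R).
  by rewrite addr_ge0.
case: hC => N _ hC.
have := counting_lebesgue_window (R := R) M.+1; rewrite -ge0_fin_numE// => /fineK finL.
rewrite -(cvg_shiftn N) /=.
apply: (@cvg_box_integral R _ E cl parametric_counting_lebesgue snd _ counting_lebesgue_null A k _ (fun n => F (n + N)%N) _
  (hadamard_bound C k) (fine (cl (window M.+1)))).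
- by move=> r; rewrite -[X in measurable X]setTI; exact: measurable_snd.
- exact: sqrtr_ge0.
- exact: fine_ge0.
- by move=> _; exact: measurable_window.
- by move=> _; rewrite finL.
- move=> n; apply/measurable_EFinP.
  pose Phi (q : k.-tuple (int * int)) : R :=
    if `[< forall i, W i (lattice_point gamma (t (n + N)%N) (tnth q i)) >]
    then complex.Re (det_kscal gamma (t (n + N)%N) q) else 0.
  rewrite /F (_ : (fun s => _) = (fun s : k.-tuple E => Phi [tuple of map (site (h (n + N)%N)) s])).
    exact: (measurable_of_sites (h (n + N)%N) Phi).
  apply/funext => s; rewrite /Phi; set b := asbool _; set c := asbool _; suff -> : b = c by [].
  by apply: asbool_equiv_eq; split => hs i; have := hs i; rewrite tnth_map.
- have mWs : measurable [set s : k.-tuple E | forall i, W i (tnth s i)].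
    rewrite (_ : mkset _ = \bigcap_(i in [set: 'I_k]) ((fun s => tnth s i) @^-1` W i)).
      apply: fin_bigcap_measurable => // i _; rewrite -[X in measurable X]setTI.
      exact: (measurable_tnth i).
    by apply/seteqP; split => [s hs i _|s hs i]; exact: hs.
  rewrite (_ : (fun s => _) = (fun s => (complex.Re (det_J s))%:E) \_ [set s | forall i, W i (tnth s i)]).
    apply/(measurable_restrictT _ mWs)/measurable_funTS/measurable_EFinP.
    by case: (cmeas_det_J k).
  apply/funext => s; rewrite /patch; case: asboolP => hs; first by rewrite mem_set.
  by rewrite memNset.
- move=> n s gs; rewrite /F; case: asboolP => hs; last by rewrite abse0 lee_fin sqrtr_ge0.
  rewrite lee_fin; apply: Re_det_le => i j; rewrite mxE; apply: hC; first exact: leq_addl.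
  rewrite rmorphB /= mulrBr; apply: le_trans (ler_normB _ _) (lerD _ _); rewrite tnth_map.
    by case: (WM _ _ (hs i)).
  by case: (WM _ _ (hs j)).
- move=> s gs.
  suff Fc : F n s @[n --> \oo] --> (if `[< forall i, W i (tnth s i) >]
      then (complex.Re (det_J s))%:E else 0)%E by rewrite (cvg_shiftn N (fun n => F n s)).
  have ev : \forall n \near \oo, forall i, W i (lattice_point gamma (t n) (site (h n) (tnth s i))) <->
      W i (tnth s i).
    apply: filter_forall => i.
    have xiA : (tnth s i).2 \notin A.
      by case/andP: gs => _ /allP; apply; apply/map_f/mem_tnth.
    have := cvg_floor_div (xi := (tnth s i).2) h0 hc (hA i (tnth s i).1 _ xiA).
    by apply: (@filterS _ \oo) => n /=; rewrite /lattice_point /site /=; case: (tnth s i).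
  case: asboolP => hs; last first.
    apply: (@cvg_near_cst _ _ _ (fun n => F n s) \oo _).
    apply: filterS ev => n hn; rewrite /F asboolF// => hs'.
    by apply: hs => i; apply/hn.
  apply: cvg_EFin; first exact: nearW.
  have [c1 _] := ccvg_det_kscal gs.
  apply: cvg_trans c1; apply: near_eq_cvg; apply: filterS ev => n hn /=.
  by rewrite asboolT// => i; apply/hn.
Qed.

End along_a_sequence.

End determinants_of_the_limit_kernel.

(** * Void probabilities from factorial moments *)

Section alternating_limits.
Context {R : realType}.
Implicit Types (p : nat -> R) (a : nat -> nat -> R) (b : nat -> R).

Definition alt_sum b (m : nat) : R := \sum_(k < m) (-1) ^+ k * b k / k`!%:R.

Lemma cvg_alt_sum a b m : (forall k, a n k @[n --> \oo] --> b k) ->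
  alt_sum (a n) m @[n --> \oo] --> alt_sum b m.
Proof.
move=> ab; rewrite /alt_sum; elim: m => [|m ih].
  by under eq_fun do rewrite big_ord0; rewrite big_ord0; exact: cvg_cst.
under eq_fun do rewrite big_ord_recr /=; rewrite big_ord_recr /=.
by apply: cvgD => //; apply: cvgMl; apply: cvgMr; exact: ab.
Qed.

Lemma alternating_unique b (q q' : R) : b k / k`!%:R @[k --> \oo] --> 0 ->
  (forall m, `|q - alt_sum b m| <= b m / m`!%:R) ->
  (forall m, `|q' - alt_sum b m| <= b m / m`!%:R) -> q = q'.
Proof.
move=> b0 hq hq'.
have lim1 r : (forall m, `|r - alt_sum b m| <= b m / m`!%:R) -> alt_sum b m @[m --> \oo] --> r.
  move=> hr; apply/cvgrPdist_le => e e0; move/cvgrPdist_le : b0 => /(_ e e0).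
  apply: filterS => m; rewrite sub0r normrN => hm.
  by apply: le_trans (hr m) (le_trans (ler_norm _) hm).
exact: cvg_unique (lim1 q hq) (lim1 q' hq').
Qed.

(** Partial sums of fixed order converge, and their errors vanish with the
    order, uniformly in n. *)
Lemma alternating_limit p a b :
  (forall n m, `|p n - alt_sum (a n) m| <= a n m / m`!%:R) ->
  (forall k, a n k @[n --> \oo] --> b k) -> b k / k`!%:R @[k --> \oo] --> 0 ->
  exists q, p n @[n --> \oo] --> q /\ forall m, `|q - alt_sum b m| <= b m / m`!%:R.
Proof.
move=> hp ab b0.
have hb m l : `|alt_sum b l - alt_sum b m| <= b l / l`!%:R + b m / m`!%:R.
  have c1 : `|alt_sum (a n) l - alt_sum (a n) m| @[n --> \oo] --> `|alt_sum b l - alt_sum b m|.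
    by apply: cvg_norm; apply: cvgB; exact: cvg_alt_sum.
  have c2 : a n l / l`!%:R + a n m / m`!%:R @[n --> \oo] --> b l / l`!%:R + b m / m`!%:R.
    by apply: cvgD; apply: cvgMl.
  rewrite -subr_ge0; apply: (cvgr_to_ge (cvgB c2 c1)); apply: nearW => n; rewrite subr_ge0.
  rewrite (_ : _ - _ = (p n - alt_sum (a n) m) - (p n - alt_sum (a n) l)); last by ring.
  by apply: le_trans (ler_normB _ _) _; rewrite addrC lerD.
have cc : cvgn (alt_sum b : R^nat).
  apply: cauchy_cvg; apply: cauchy_exP => e e0.
  have e20 : 0 < e / 2 by rewrite divr_gt0.
  have near_small : \forall m \near \oo, b m / m`!%:R < e / 2.
    move/cvgrPdist_lt : b0 => /(_ _ e20); apply: filterS => m; rewrite sub0r normrN.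
    exact: le_lt_trans (ler_norm _).
  case: near_small => m _ hm; exists (alt_sum b m).
  exists m => // l /= ml; rewrite -ball_normE /ball_ /=.
  rewrite distrC; apply: le_lt_trans (hb m l) _.
  by rewrite [e](splitr) ltrD// hm//=.
exists (limn (alt_sum b : R^nat)).
have hq m : `|limn (alt_sum b : R^nat) - alt_sum b m| <= b m / m`!%:R.
  have c1 : `|alt_sum b l - alt_sum b m| @[l --> \oo] --> `|limn (alt_sum b : R^nat) - alt_sum b m|.
    by apply: cvg_norm; apply: cvgB => //; exact: cvg_cst.
  have c2 : b l / l`!%:R + b m / m`!%:R @[l --> \oo] --> 0 + b m / m`!%:R.
    by apply: cvgD => //; exact: cvg_cst.
  rewrite -[leRHS]add0r -subr_ge0; apply: (cvgr_to_ge (cvgB c2 c1)).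
  by apply: nearW => l; rewrite subr_ge0.
split => //; apply/cvgrPdist_le => e e0.
have e40 : 0 < e / 4 by rewrite divr_gt0.
have [m hm] : exists m, b m / m`!%:R < e / 4.
  move/cvgrPdist_lt : b0 => /(_ _ e40) [m _ hm]; exists m.
  by have := hm m (leqnn m); rewrite /= sub0r normrN; exact: le_lt_trans (ler_norm _).
have c1 : a n m / m`!%:R @[n --> \oo] --> b m / m`!%:R by apply: cvgMl.
have ev1 : \forall n \near \oo, a n m / m`!%:R < e / 4 by move/cvgr_lt : c1; apply.
have := @cvg_alt_sum a b m ab => /cvgrPdist_lt /(_ _ e40); apply: filterS2 ev1 => n h1 h2.
rewrite (_ : _ - _ = (limn (alt_sum b : R^nat) - alt_sum b m) + (alt_sum b m - alt_sum (a n) m) -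
  (p n - alt_sum (a n) m)); last by ring.
apply: le_trans (ler_normB _ _) _; apply: le_trans (lerD (ler_normD _ _) (lexx _)) _.
have := hq m; have := hp n m; move: h1 h2 hm; lra.
Qed.

End alternating_limits.

Section point_processes.
Context {R : realType}.
Local Notation T := (measurableTypeR R).
Local Notation E := (int * T)%type.

Definition npts (A : set E) : nat := #|` fset_set A|.

(** A point process with the measurability that counting requires; all sets are
    taken inside windows, where configurations are finite. *)
Definition process d (Omega : measurableType d) (X : Omega -> set E) : Prop :=
  (forall M o, finite_set (X o `&` window M)) /\
  (forall M B, measurable B -> B `<=` window M ->
    forall m, measurable [set o | npts (X o `&` B) = m]).

Section one_process.
Context d (Omega : measurableType d) (P : probability Omega R) (X : Omega -> set E).
Hypothesis pX : process X.

Lemma process_finite M W o : W `<=` window M -> finite_set (X o `&` W).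
Proof. by move=> WM; apply: sub_finite_set (pX.1 M o); exact: setIS. Qed.

Lemma measurable_of_nat (f : Omega -> nat) (g : nat -> R) :
  (forall m, measurable [set o | f o = m]) -> measurable_fun [set: Omega] (fun o => g (f o) : T).
Proof.
move=> mf _ Y mY; rewrite setTI.
have -> : (fun o => g (f o)) @^-1` Y = \bigcup_(m in [set m | Y (g m)]) [set o | f o = m].
  apply/seteqP; split => [z Yz|z [m /= Ym fm]]; first by exists (f z).
  by rewrite /preimage /= fm.
by apply: bigcup_measurable.
Qed.

Lemma npts_eq0 M W o : W `<=` window M -> (npts (X o `&` W) = 0%N) <-> X o `&` W = set0.
Proof.
move=> WM; rewrite /npts; split => [/cardfs0_eq h|->]; last by rewrite fset_set0 cardfs0.
by rewrite -(fset_setK (process_finite o WM)) h; apply/seteqP; split.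
Qed.

Definition void (W : set E) := [set o | X o `&` W = set0].

Lemma measurable_void M W : measurable W -> W `<=` window M -> measurable (void W).
Proof.
move=> mW WM; rewrite (_ : void W = [set o | npts (X o `&` W) = 0%N]); first exact: pX.2 WM _.
by apply/seteqP; split => z /(npts_eq0 z WM).
Qed.

(** The k-th factorial moment of the number of points of W. *)
Definition moment (W : set E) k : \bar R :=
  (\int[P]_o @counting (k.-tuple E) R (tuples (X o) (fun _ : 'I_k => W)))%E.

Lemma void_bonferroni M W : measurable W -> W `<=` window M ->
  (forall k, moment W k \is a fin_num) -> forall m,
  `|fine (P (void W)) - alt_sum (fun k => fine (moment W k)) m| <= fine (moment W m) / m`!%:R.
Proof.
move=> mW WM fm m.
pose N o := npts (X o `&` W).
have mN k : measurable [set o | N o = k] by exact: pX.2 WM _.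
have momE k : moment W k = (\int[P]_o ((N o ^_ k)%:R)%:E)%E.
  apply: eq_integral => o _; apply: counting_tuples_diag; exact: process_finite WM.
have iN k : P.-integrable setT (EFin \o (fun o => (N o ^_ k)%:R)).
  apply/integrableP; split.
    by apply/measurable_EFinP; exact: (measurable_of_nat (fun n => (n ^_ k)%:R) mN).
  under eq_integral do rewrite /= normr_nat.
  by rewrite -momE ltey_eq fm.
have RE k : fine (moment W k) = \int[P]_o (N o ^_ k)%:R by rewrite momE.
have iZ c k : P.-integrable setT (EFin \o (fun o => c * (N o ^_ k)%:R)).
  rewrite (_ : _ \o _ = (fun o => c%:E * ((N o ^_ k)%:R)%:E)%E)//.
  exact: (integrableZl measurableT _ (iN k)).
have altE l : P.-integrable setT (EFin \o (fun o => alt_sum (fun k => (N o ^_ k)%:R) l)) /\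
    \int[P]_o alt_sum (fun k => (N o ^_ k)%:R) l = alt_sum (fun k => fine (moment W k)) l.
  elim: l => [|l [ihi ihe]].
    rewrite /alt_sum big_ord0; under eq_fun do rewrite big_ord0.
    by split; [exact: integrable0|rewrite /Rintegral integral0].
  have cE o : alt_sum (fun k => (N o ^_ k)%:R : R) l.+1 =
      alt_sum (fun k => (N o ^_ k)%:R) l + (-1) ^+ l / l`!%:R * (N o ^_ l)%:R.
    by rewrite /alt_sum big_ord_recr /= mulrAC.
  rewrite (funext cE) /alt_sum [in RHS]big_ord_recr /=; split.
    exact: (integrableD measurableT ihi (iZ _ l)).
  by rewrite RintegralD// -/(alt_sum _ _) ihe RintegralZl// -RE mulrAC.
have [ialt <-] := altE m.
have mV := measurable_void mW WM.
have VE : fine (P (void W)) = \int[P]_o (N o == 0%N)%:R.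
  rewrite /Rintegral; congr fine.
  rewrite -[in LHS](setIT (void W)) -integral_indic//.
  apply: eq_integral => o _; rewrite indicE; congr ((nat_of_bool _)%:R%:E)%E.
  by apply/idP/eqP => [/set_mem/(npts_eq0 o WM)//|/(npts_eq0 o WM) h]; apply: mem_set.
have iV : P.-integrable setT (EFin \o (fun o => (N o == 0%N)%:R)).
  have Pfin : (P [set: Omega] < +oo)%E by rewrite probability_setT ltry.
  apply: (measurable_bounded_integrable measurableT Pfin).
    exact: (measurable_of_nat (fun n => (n == 0%N)%:R) mN).
  exists 1; split; first by rewrite num_real.
  move=> y y1 o _ /=; case: eqP => _ /=; first by rewrite normr1 ltW.
  by rewrite normr0 ltW// (lt_trans _ y1).
rewrite VE -RintegralB//.
have iD : P.-integrable setT (EFin \o (fun o => (N o == 0%N)%:R - alt_sum (fun k => (N o ^_ k)%:R) m)).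
  exact: (integrableB measurableT iV ialt).
apply: le_trans (le_normr_Rintegral _ _) _ => //.
rewrite RE mulrC -RintegralZl//; apply: le_Rintegral => //; first exact: integrable_norm.
by move=> o _; rewrite mulrC; exact: bonferroni.
Qed.

End one_process.

End point_processes.

(** * Inclusion-exclusion for hits *)

Section patterns.
Context {R : realType}.
Local Notation T := (measurableTypeR R).
Local Notation E := (int * T)%type.

Lemma nice_set0 : nice (set0 : set E).
Proof. by split => //; [exists 0%N|exists [::] => x xi _; apply: (@nearW _ (nbhs (xi : R)))]. Qed.

Lemma nice_setU (A B : set E) : nice A -> nice B -> nice (A `|` B).
Proof.
move=> [mA [M AM] [a ha]] [mB [N BN] [b hb]]; split; first exact: measurableU.
  exists (maxn M N) => p [/AM|/BN]; apply: window_homo; [exact: leq_maxl|exact: leq_maxr].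
exists (a ++ b) => x xi; rewrite mem_cat negb_or => /andP[/(ha x) h1 /(hb x) h2].
by apply: filterS2 h1 h2 => z h1 h2; split => -[/h1|/h2]; [left|right|left|right].
Qed.

Lemma nice_setI (A B : set E) : nice A -> nice B -> nice (A `&` B).
Proof.
move=> [mA [M AM] [a ha]] [mB [N BN] [b hb]]; split; first exact: measurableI.
  by exists M => p [/AM].
exists (a ++ b) => x xi; rewrite mem_cat negb_or => /andP[/(ha x) h1 /(hb x) h2].
by apply: filterS2 h1 h2 => z h1 h2; split => -[/h1 ? /h2 ?].
Qed.

Fixpoint every (G : set E -> Prop) (Q : seq (set E)) : Prop :=
  if Q is q :: Q' then G q /\ every G Q' else True.

Lemma every_map (I : Type) (G : set E -> Prop) (c : I -> set E) (r : seq I) :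
  (forall i, G (c i)) -> every G (map c r).
Proof. by move=> Gc; elim: r => //= i r ih. Qed.

(** Inclusion-exclusion: the probability that a configuration hits the sets of
    Q marked true and misses those marked false and U, from the probabilities V
    of missing a set. *)
Fixpoint hit_miss (V : set E -> R) (Q : seq (set E)) (w : seq bool) (U : set E) : R :=
  match Q, w with
  | [::], [::] => V U
  | q :: Q', true :: w' => hit_miss V Q' w' U - hit_miss V Q' w' (U `|` q)
  | q :: Q', false :: w' => hit_miss V Q' w' (U `|` q)
  | _, _ => 0
  end.

Lemma cvg_hit_miss (Vn : nat -> set E -> R) (V : set E -> R) Q w U :
  (forall W, nice W -> Vn n W @[n --> \oo] --> V W) -> every nice Q -> nice U ->
  hit_miss (Vn n) Q w U @[n --> \oo] --> hit_miss V Q w U.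
Proof.
move=> hV; elim: Q w U => [|q Q ih] [|b w] U /= nQ nU; try exact: cvg_cst.
  exact: hV.
have nUq : nice (U `|` q) by apply: nice_setU => //; case: nQ.
by case: b; [apply: cvgB; apply: ih|apply: ih]; case: nQ.
Qed.

Section one_process.
Context d (Omega : measurableType d) (P : probability Omega R) (X : Omega -> set E).
Hypothesis pX : process X.

Definition bits (Q : seq (set E)) (o : Omega) : seq bool :=
  [seq `[< X o `&` q !=set0 >] | q <- Q].

Lemma measurable_void_nice W : nice W -> measurable (void X W).
Proof. by case=> mW [M WM] _; exact: (measurable_void pX mW WM). Qed.

Lemma bits_probability Q w U : every nice Q -> nice U ->
  measurable [set o | bits Q o = w /\ void X U o] /\
  fine (P [set o | bits Q o = w /\ void X U o]) =
  hit_miss (fun W => fine (P (void X W))) Q w U.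
Proof.
have emp (A : set Omega) : (forall o, ~ A o) -> measurable A /\ fine (P A) = 0.
  by move=> hA; rewrite (_ : A = set0) ?measure0//; apply/seteqP; split.
elim: Q w U => [|q Q ih] [|b w] U /= nQ nU.
- rewrite (_ : mkset _ = void X U); first by split => //; exact: measurable_void_nice.
  by apply/seteqP; split => [z []|z].
- by apply: emp => o [].
- by apply: emp => o [].
have [nq nQ'] := nQ; have nUq := nice_setU nU nq.
have [m1 e1] := ih w U nQ' nU; have [m2 e2] := ih w (U `|` q) nQ' nUq.
have voidU z : void X (U `|` q) z <-> void X U z /\ ~ (X z `&` q !=set0).
  rewrite /void /= setIUr setU_eq0; split => [[-> h]|[-> /nonemptyPn h]]//.
  by split => //; exact/nonemptyPn.
case: b.
  rewrite -e1 -e2 (_ : mkset _ = [set o | bits Q o = w /\ void X U o] `\`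
      [set o | bits Q o = w /\ void X (U `|` q) o]).
    split; first exact: measurableD.
    rewrite measureD//; last by apply: le_lt_trans (probability_le1 P m1) _; rewrite ltry.
    rewrite fineB ?fin_num_measure//; last exact: measurableI.
    by congr (_ - fine (P _)); apply/seteqP; split => [z [_ ?]//|z [h /voidU[h1 h2]]]; split => //; split => //; apply/voidU.
  apply/seteqP; split => [z [[/asboolP h1 h2] h3]|z [[h1 h2] h3]]; first split => //.
    by move=> [_ /voidU[_]].
  split => //; congr (_ :: _) => //; apply/asboolP; apply: contrapT => h.
  by apply: h3; split => //; apply/voidU.
rewrite -e2 (_ : mkset _ = [set o | bits Q o = w /\ void X (U `|` q) o])//.
apply/seteqP; split => [z [[/asboolPn h1 h2] h3]|z [h1 /voidU[h2 h3]]]; split => //.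
  exact/voidU.
by congr (_ :: _) => //; apply/asboolPn.
Qed.

End one_process.

Lemma finite_expectation d (Omega : measurableType d) (P : probability Omega R)
    N (f : Omega -> N.-tuple bool) (g : N.-tuple bool -> R) :
  (forall w, measurable [set o | f o = w]) ->
  P.-integrable setT (EFin \o (g \o f)) /\
  \int[P]_o g (f o) = \sum_w g w * fine (P [set o | f o = w]).
Proof.
move=> mf.
have gE : g \o f = (fun o => \sum_w g w * \1_[set o | f o = w] o).
  apply/funext => o /=; rewrite (bigD1 (f o))//= big1 ?addr0.
    by rewrite indicE mem_set ?mulr1.
  by move=> w wf; rewrite indicE memNset ?mulr0// => /eqP; rewrite eq_sym (negbTE wf).
have i0 w : P.-integrable setT (EFin \o (\1_[set o | f o = w] : Omega -> R)).
  exact: integrable_indic.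
have i1 w : P.-integrable setT (EFin \o (fun o => g w * \1_[set o | f o = w] o)).
  exact: (integrableZl measurableT (g w) (i0 w)).
have isum (r : seq (N.-tuple bool)) :
    P.-integrable setT (EFin \o (fun o => \sum_(w <- r) g w * \1_[set o | f o = w] o)) /\
    \int[P]_o (\sum_(w <- r) g w * \1_[set o | f o = w] o) =
    \sum_(w <- r) g w * fine (P [set o | f o = w]).
  elim: r => [|w r [ih1 ih2]].
    under eq_fun do rewrite big_nil; rewrite big_nil.
    by split; [exact: integrable0|rewrite /Rintegral integral0].
  under eq_fun do rewrite big_cons; rewrite big_cons; split.
    exact: (integrableD measurableT (i1 w) ih1).
  rewrite RintegralD// ih2; congr (_ + _).
  rewrite (RintegralZl (f := \1_[set o | f o = w]))//.
  by rewrite /Rintegral integral_indic// setIT.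
by have [h1 h2] := isum (index_enum _); rewrite -gE in h1 h2.
Qed.

End patterns.

(** * Random bits with a prescribed law *)

Section unit_interval.
Context {R : realType}.
Local Notation T := (measurableTypeR R).
Local Notation leb := (@lebesgue_measure R).

Definition unit_measure : set T -> \bar R := mrestr leb (measurable_itv `[(0:R), 1[).

HB.instance Definition _ := Measure.on unit_measure.

Let unit_measure_setT : unit_measure setT = 1%E.
Proof.
rewrite /unit_measure /mrestr setTI lebesgue_measure_itv /= lte_fin ltr01.
by rewrite oppr0 adde0.
Qed.

HB.instance Definition _ := Measure_isProbability.Build _ _ _ unit_measure unit_measure_setT.

(** Random bits with prescribed finite-dimensional laws: q w is the probability
    of the word w, most recent bit first; the words of length N index a partition
    of [0, 1[ into consecutive intervals of these lengths, and the N-th partition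
    refines the previous ones. *)
Variable q : seq bool -> R.
Hypothesis q_ge0 : forall w, 0 <= q w.
Hypothesis q_nil : q [::] = 1.
Hypothesis q_cons : forall w, q w = q (false :: w) + q (true :: w).

Fixpoint left_end (w : seq bool) : R :=
  if w is b :: w' then left_end w' + (if b then q (false :: w') else 0) else 0.

Fixpoint digits (N : nat) (u : R) : seq bool :=
  if N is N'.+1 then (left_end (digits N' u) + q (false :: digits N' u) <= u) :: digits N' u
  else [::].

Lemma digitsP w u : 0 <= u < 1 -> digits (size w) u = w <-> left_end w <= u < left_end w + q w.
Proof.
move=> u01; elim: w => [|b w [ih1 ih2]] /=; first by rewrite q_nil add0r.
have h0 := q_ge0 (false :: w); have h1 := q_ge0 (true :: w); have hw := q_cons w.
split.
  case=> + e; rewrite e; have /andP[l1 l2] := ih1 e.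
  by case: b => [h|/negbT]; rewrite -?ltNge => *; apply/andP; split; lra.
move=> /andP[l1 l2]; have e : digits (size w) u = w.
  by apply: ih2; move: l1 l2; case: b => l1 l2; apply/andP; split; lra.
rewrite e; congr (_ :: _); apply/idP/idP; move: l1 l2; case: b => // l1 l2; lra.
Qed.

Lemma measurable_digits N w : measurable [set u : T | digits N u = w].
Proof.
elim: N w => [|N ih] [|b w] /=.
- by rewrite (_ : mkset _ = setT)//; apply/seteqP; split.
- by rewrite (_ : mkset _ = set0)//; apply/seteqP; split.
- by rewrite (_ : mkset _ = set0)//; apply/seteqP; split.
rewrite (_ : mkset _ = [set u : T | digits N u = w] `&`
    (if b then `[left_end w + q (false :: w), +oo[%classic
     else `]-oo, left_end w + q (false :: w)[%classic)).
  by apply: measurableI => //; case: b; exact: measurable_itv.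
apply/seteqP; split => u /=.
  case=> + e; rewrite e; case: b => /=; rewrite in_itv /= ?andbT => h; split => //.
  by rewrite ltNge h.
case=> e; rewrite e; case: b => /=; rewrite in_itv /= ?andbT => h; congr (_ :: _) => //.
by apply/negbTE; rewrite -ltNge.
Qed.

Lemma unit_measure_digits w : unit_measure [set u : T | digits (size w) u = w] = (q w)%:E.
Proof.
have bnd : 0 <= left_end w /\ left_end w + q w <= 1.
  elim: w => [|b w [ih1 ih2]] /=; first by rewrite q_nil add0r.
  have h0 := q_ge0 (false :: w); have h1 := q_ge0 (true :: w); have hw := q_cons w.
  by case: b; split; lra.
rewrite /unit_measure /mrestr.
rewrite (_ : _ `&` _ = `[left_end w, left_end w + q w[%classic).
  rewrite lebesgue_measure_itv /= lte_fin ltrDl; case: ltP => hq.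
    by rewrite -EFinD addrAC subrr add0r.
  by congr (_%:E)%E; apply/esym/eqP; rewrite eq_le hq q_ge0.
apply/seteqP; split => u /=; rewrite !in_itv /= => -[].
  by move=> e u01; apply/digitsP.
move=> h; have u01 : 0 <= u < 1 by case: bnd => b1 b2; move/andP: h => [h1 h2]; apply/andP; split; lra.
by split => //; apply/digitsP.
Qed.

Definition random_bit (u : R) (i : nat) : bool := head false (digits i.+1 u).

Lemma rev_digits N u : rev (digits N u) = map (random_bit u) (iota 0 N).
Proof.
elim: N => [//|N ih]; rewrite -addn1 iotaD map_cat -ih /= add0n addn1.
by rewrite cats1 -rev_cons.
Qed.

End unit_interval.

Section limit_law.
Context {R : realType}.
Local Notation T := (measurableTypeR R).
Local Notation E := (int * T)%type.
Variables (d : nat -> measure_display) (Omega : forall n, measurableType (d n)).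
Variables (P : forall n, probability (Omega n) R) (X : forall n, Omega n -> set E).
Hypothesis pX : forall n, process (@X n).
Variable V : set E -> R.
Hypothesis hV : forall W, nice W -> fine (P n (void (@X n) W)) @[n --> \oo] --> V W.
Variable cell : nat -> set E.
Hypothesis nice_cell : forall i, nice (cell i).

Definition word_law (w : seq bool) : R := hit_miss V (map cell (iota 0 (size w))) w set0.

Let mbits n N w : measurable [set o | bits (@X n) (map cell (iota 0 N)) o = w].
Proof.
have [h _] := bits_probability (P n) (pX n) w (every_map (iota 0 N) nice_cell) nice_set0.
rewrite (_ : mkset _ = [set o | bits (@X n) (map cell (iota 0 N)) o = w /\ void (@X n) set0 o])//.
by apply/seteqP; split => [z h1|z []//]; split => //; rewrite /void /= setI0.
Qed.

Let lim_bits w : fine (P n [set o | bits (@X n) (map cell (iota 0 (size w))) o = w])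
  @[n --> \oo] --> word_law w.
Proof.
have e n : fine (P n [set o | bits (@X n) (map cell (iota 0 (size w))) o = w]) =
    hit_miss (fun W => fine (P n (void (@X n) W))) (map cell (iota 0 (size w))) w set0.
  have [_ <-] := bits_probability (P n) (pX n) w (every_map (iota 0 (size w)) nice_cell) nice_set0.
  congr (fine (P n _)); apply/seteqP; split => [z h1|z []//]; split => //.
  by rewrite /void /= setI0.
rewrite (funext e); apply: cvg_hit_miss => //; [exact: every_map|exact: nice_set0].
Qed.

Lemma word_law_ge0 w : 0 <= word_law w.
Proof. by apply: (cvgr_to_ge (lim_bits (w := w))); apply: nearW => n; exact: fine_ge0. Qed.

Lemma word_law_nil : word_law [::] = 1.
Proof.
apply: (cvg_unique _ (lim_bits (w := [::]))) => //.
rewrite (_ : (fun n => _) = fun=> 1); first exact: cvg_cst.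
apply/funext => n; rewrite (_ : mkset _ = setT) ?probability_setT//; exact/seteqP.
Qed.

Lemma word_law_rcons w : word_law w = word_law (rcons w false) + word_law (rcons w true).
Proof.
have iotaS N : iota 0 N.+1 = rcons (iota 0 N) N by rewrite -addn1 iotaD cats1.
apply: (cvg_unique _ (lim_bits (w := w))) => //.
suff e n : fine (P n [set o | bits (@X n) (map cell (iota 0 (size w))) o = w]) =
    fine (P n [set o | bits (@X n) (map cell (iota 0 (size (rcons w false)))) o = rcons w false]) +
    fine (P n [set o | bits (@X n) (map cell (iota 0 (size (rcons w true)))) o = rcons w true]).
  rewrite (funext e); exact: cvgD (lim_bits (w := rcons w false)) (lim_bits (w := rcons w true)).
rewrite !size_rcons -fineD; [|by rewrite fin_num_measure//; exact: mbits..].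
rewrite -measureU; [|exact: mbits|exact: mbits|]; last first.
  by apply/seteqP; split => // z [/= -> /eqP]; rewrite eqseq_rcons andbF.
congr (fine (P n _)); rewrite iotaS map_rcons.
have bE z : bits (@X n) (rcons (map cell (iota 0 (size w))) (cell (size w))) z =
    rcons (bits (@X n) (map cell (iota 0 (size w))) z) `[< @X n z `&` cell (size w) !=set0 >].
  by rewrite /bits map_rcons.
apply/seteqP; split => z /=; rewrite bE.
  by move=> ->; case: `[< _ >]; [right|left].
by case=> /eqP; rewrite eqseq_rcons => /andP[/eqP ->].
Qed.

Definition limit_bit (u : T) (i : nat) : bool := random_bit (word_law \o rev) u i.

(** The law of the random bits is the limit of the laws of the hits. *)
Lemma limit_bit_expectation N (g : (nat -> bool) -> R) :
  (forall z z', (forall i, (i < N)%N -> z i = z' i) -> g z = g z') ->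
  [/\ unit_measure.-integrable setT (EFin \o (fun u => g (limit_bit u))),
      forall n, (P n).-integrable setT
        (EFin \o (fun o => g (fun i => `[< @X n o `&` cell i !=set0 >]))) &
      \int[P n]_o g (fun i => `[< @X n o `&` cell i !=set0 >]) @[n --> \oo]
        --> \int[unit_measure]_u g (limit_bit u)].
Proof.
move=> gN.
have sz (z : nat -> bool) : size (map z (iota 0 N)) == N by rewrite size_map size_iota.
pose f (z : nat -> bool) : N.-tuple bool := Tuple (sz z).
pose g' (w : N.-tuple bool) := g (nth false w).
have gE z : g z = g' (f z).
  apply: gN => i iN; rewrite /= (nth_map 0%N) ?size_iota// nth_iota//.
pose fn n o := f (fun i => `[< @X n o `&` cell i !=set0 >]).
have fnE n w : [set o | fn n o = w] = [set o | bits (@X n) (map cell (iota 0 N)) o = w].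
  have e o : bits (@X n) (map cell (iota 0 N)) o = fn n o by rewrite /bits -map_comp.
  apply/seteqP; split => [z <-|z]; rewrite /= e//; exact: val_inj.
have fnE' w : [set u | f (limit_bit u) = w] = [set u : T | digits (word_law \o rev) N u = rev w].
  have e u : f (limit_bit u) = rev (digits (word_law \o rev) N u) :> seq bool.
    by rewrite rev_digits /f /=; apply: eq_map => i.
  apply/seteqP; split => [u <-|u] /=; rewrite ?e ?revK// => h; apply: val_inj.
  by have := e u; rewrite h revK.
have szw (w : N.-tuple bool) : size (rev w) = N by rewrite size_rev size_tuple.
have mf n w : measurable [set o | fn n o = w] by rewrite fnE; exact: mbits.
have mf' w : measurable [set u | f (limit_bit u) = w] by rewrite fnE'; exact: measurable_digits.
have [i' e'] := finite_expectation unit_measure g' mf'.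
have lim w : fine (P n [set o | fn n o = w]) @[n --> \oo] -->
    fine (unit_measure [set u | f (limit_bit u) = w]).
  under eq_fun do rewrite fnE.
  rewrite fnE' -{1}(szw w) unit_measure_digits /=; last 3 first.
  - by move=> v; exact: word_law_ge0.
  - exact: word_law_nil.
  - by move=> v /=; rewrite !rev_cons; exact: word_law_rcons.
  have := lim_bits (w := w); rewrite size_tuple revK; exact.
split.
- by rewrite (_ : _ \o _ = EFin \o (g' \o (fun u => f (limit_bit u))))//; apply/funext => u /=; rewrite gE.
- move=> n; have [h _] := finite_expectation (P n) g' (mf n).
  by rewrite (_ : _ \o _ = EFin \o (g' \o fn n))//; apply/funext => o /=; rewrite gE.
have eg : \int[unit_measure]_u g (limit_bit u) = \int[unit_measure]_u g' (f (limit_bit u)).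
  by congr Rintegral; apply/funext => u; rewrite gE.
have egn n : \int[P n]_o g (fun i => `[< @X n o `&` cell i !=set0 >]) =
    \sum_w g' w * fine (P n [set o | fn n o = w]).
  have [_ <-] := finite_expectation (P n) g' (mf n).
  by congr Rintegral; apply/funext => o; rewrite gE.
rewrite eg e' (funext egn); elim: (index_enum _) => [|w r ih].
  by under eq_fun do rewrite big_nil; rewrite big_nil; exact: cvg_cst.
under eq_fun do rewrite big_cons; rewrite big_cons.
by apply: cvgD => //; apply: cvgMr; exact: lim.
Qed.

End limit_law.

(** * Dyadic cells *)

Section nice_threads.
Context {R : realType}.
Local Notation T := (measurableTypeR R).
Local Notation E := (int * T)%type.

Lemma near_side (a xi : R) : xi != a ->
  \forall z \near xi, (a < z) = (a < xi) /\ (a <= z) = (a <= xi).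
Proof.
move=> xa; have e0 : 0 < `|xi - a| by rewrite normr_gt0 subr_eq0.
apply: filterS (nbhsx_ballx (xi : R^o) _ e0) => z /= h.
have {}h : `|xi - z| < `|xi - a| by [].
have [ax|ax] := ltP a xi.
  move: h; rewrite (gtr0_norm (x := xi - a)) ?subr_gt0// ltr_norml => /andP[_ h].
  have az : a < z by lra.
  by rewrite az !ltW.
have {}ax : xi < a by rewrite lt_neqAle xa.
move: h; rewrite (ltr0_norm (x := xi - a)) ?subr_lt0// ltr_norml => /andP[h _].
have za : z < a by lra.
by split; [rewrite ltNge (ltW za)|rewrite !leNgt za ax].
Qed.

Lemma nice_strip (C : set int) (K : nat) (I : interval R) : (forall x, C x -> (`|x|%N <= K)%N) ->
  bounded_set [set` I] -> nice (C `*` [set` I] : set E).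
Proof.
move=> CK bI; split; first by apply: measurableX => //; exact: measurable_itv.
  have [B [_ hB]] := bI; have {}hB := hB (B + 1) ltac:(by rewrite ltrDl).
  exists (maxn K (Num.bound `|B + 1|)) => -[y xi] [/= /CK Cy /hB h]; split => /=.
    exact: leq_trans Cy (leq_maxl _ _).
  apply: le_trans h (le_trans (ler_norm _) _).
  apply: le_trans (ltW (archi_boundP (normr_ge0 _))) _.
  by rewrite ler_nat leq_maxr.
have side (b : itv_bound R) : exists A : seq R, forall xi, xi \notin A ->
    \forall z \near xi, (b <= BLeft z)%O = (b <= BLeft xi)%O /\ (BRight z <= b)%O = (BRight xi <= b)%O.
  case: b => [b a|b]; last first.
    by exists [::] => xi _; apply: (@nearW _ (nbhs (xi : R))) => z; case: b.
  exists [:: a] => xi; rewrite inE => /near_side; apply: filterS => z [h1 h2].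
  case: b; rewrite !bnd_simp ?h1 ?h2//.
  - by split => //; rewrite !ltNge h2.
  - by split => //; rewrite !leNgt h1.
case: I {bI} => l u; have [A hA] := side l; have [B hB] := side u.
exists (A ++ B) => y xi; rewrite mem_cat negb_or => /andP[/hA h1 /hB h2].
apply: filterS2 h1 h2 => z [h1 _] [_ h2]; rewrite /= !itv_boundlr h1 h2.
by [].
Qed.

Lemma nice_thread (x : int) (I : interval R) : bounded_set [set` I] ->
  nice ([set x] `*` [set` I] : set E).
Proof. by apply: (@nice_strip _ `|x|%N) => y ->. Qed.

End nice_threads.

Section dyadic_configurations.
Context {R : realType}.
Local Notation T := (measurableTypeR R).
Local Notation E := (int * T)%type.
Implicit Types (p : E) (A W : set E).

Definition lev (n : nat) p : int * int := (p.1, Num.floor (p.2 * 2 ^+ n)).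
Definition corner (n : nat) (c : int * int) : E := (c.1, c.2%:~R / 2 ^+ n).
Definition round n p : E := corner n (lev n p).

Definition cell (c : int * int * nat) : set E := [set p | lev c.2 p = c.1].

Let two0 n : 0 < (2 ^+ n : R). Proof. by rewrite exprn_gt0. Qed.

Lemma lev_corner n c : lev n (corner n c) = c.
Proof.
case: c => x k; rewrite /lev /corner /= divfK ?gt_eqF//.
by congr (_, _); exact: intrKfloor.
Qed.

Lemma corner_inj n : injective (corner n).
Proof. exact: can_inj (lev_corner n). Qed.

Lemma lev_round n p : lev n (round n p) = lev n p. Proof. exact: lev_corner. Qed.

Lemma cellE c : cell c = [set c.1.1] `*`
  `[c.1.2%:~R / 2 ^+ c.2, (c.1.2 + 1)%:~R / 2 ^+ c.2[%classic.
Proof.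
case: c => [[x k] n]; apply/seteqP; split => -[y xi]; rewrite /cell /lev /= in_itv /=.
  case=> -> /eqP; rewrite floor_eq => /andP[h1 h2]; split => //.
  by rewrite ler_pdivrMr// h1 ltr_pdivlMr.
case=> -> /andP[h1 h2]; congr (_, _); apply/eqP; rewrite floor_eq.
by rewrite -ler_pdivrMr// h1 -ltr_pdivlMr.
Qed.

Lemma nice_cell c : nice (cell c).
Proof.
rewrite cellE; apply: nice_thread.
exists (`|c.1.2%:~R / 2 ^+ c.2| + `|(c.1.2 + 1)%:~R / 2 ^+ c.2|); split; first by rewrite num_real.
move=> y hy xi /=; rewrite in_itv /= => /andP[h1 h2]; apply: le_trans (ltW hy).
rewrite ler_norml; apply/andP; split.
  rewrite lerNl; apply: le_trans (_ : - (c.1.2%:~R / 2 ^+ c.2) <= _); first by rewrite lerN2.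
  by apply: le_trans (ler_norm _) _; rewrite normrN lerDl.
by apply: le_trans (ltW h2) (le_trans (ler_norm _) _); rewrite lerDr.
Qed.

(** Half-open windows: unions of cells of every level. *)
Definition dwindow (M : nat) : set E := [set p | (`|p.1|%N <= M)%N /\ - M%:R <= p.2 < M%:R].

Definition saturated n W := forall p, W (round n p) <-> W p.

Lemma dwindow_window M : dwindow M `<=` window M.
Proof. by move=> p [h /andP[h1 h2]]; split => //; rewrite ler_norml h1 ltW. Qed.

Lemma saturated_dwindow n M : saturated n (dwindow M).
Proof.
move=> p; rewrite /dwindow /round /corner /lev /=.
have -> : (- M%:R <= (Num.floor (p.2 * 2 ^+ n))%:~R / 2 ^+ n :> R) = (- M%:R <= p.2 :> R).
  rewrite ler_pdivlMr// -[RHS](ler_pM2r (two0 n)).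
  have -> : - M%:R * 2 ^+ n = (- (M%:Z * (2 ^ n)%N%:Z))%:~R :> R.
    by rewrite rmorphN rmorphM /= -!pmulrn natrX mulNr.
  by rewrite ler_int floor_ge_int.
have -> // : ((Num.floor (p.2 * 2 ^+ n))%:~R / 2 ^+ n < M%:R :> R) = (p.2 < M%:R :> R).
rewrite ltr_pdivrMr// -[RHS](ltr_pM2r (two0 n)).
have -> : M%:R * 2 ^+ n = (M%:Z * (2 ^ n)%N%:Z)%:~R :> R by rewrite rmorphM /= -!pmulrn natrX.
by rewrite ltr_int floor_lt_int.
Qed.

Lemma lev_succ n p : (lev n.+1 p).2 = 2 * (lev n p).2 \/ (lev n.+1 p).2 = 2 * (lev n p).2 + 1.
Proof.
rewrite /lev /= exprS mulrCA; set y := p.2 * 2 ^+ n.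
have /andP[h1 h2] := floor_itv y; have [h|h] := ltP (2 * y) (2 * Num.floor y + 1)%:~R.
  left; apply: floor_def; rewrite h andbT intrM ler_pM2l//.
right; apply: floor_def; rewrite h /= -addrA intrD intrM.
by move: h2; rewrite intrD; lra.
Qed.

Lemma round_saturated n m W : (n <= m)%N -> saturated n W -> saturated m W.
Proof.
move=> nm sW p; suff e : lev n (round m p) = lev n p.
  by split => /sW h; apply/sW; move: h; rewrite /round e.

have lev_up k q : lev k q = ((lev k.+1 q).1, ((lev k.+1 q).2 %/ 2)%Z).
  by have := lev_succ k q; rewrite /lev /=; set a := Num.floor _; set b := Num.floor _ => -[] ->;
    congr (_, _); lia.
have down k l q q' : lev (k + l) q = lev (k + l) q' -> lev k q = lev k q'.
  elim: l => [|l ihl]; first by rewrite addn0.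
  by rewrite addnS => e; apply: ihl; rewrite lev_up e -lev_up.
by apply: (down n (m - n)%N); rewrite subnKC// lev_round.
Qed.

End dyadic_configurations.

(** * Configurations from marked cells *)

Section finite_counting.
Context {R : realType}.

Lemma counting_le_image d (S : measurableType d) d' (S' : measurableType d') (g : S -> S')
    (A : set S) (B : set S') : finite_set A -> B `<=` g @` A ->
  (@counting _ R B <= @counting _ R A)%E.
Proof.
move=> fA BA; have fB : finite_set B by apply: sub_finite_set BA _; exact: finite_image.
rewrite /counting !asboolT// lee_fin ler_nat.
apply: leq_trans (leq_imfset_card imfset_key g (mem (fset_set A))).
apply: fsubset_leq_card; apply/fsubsetP => y; rewrite in_fset_set// => /set_mem/BA[x Ax <-].
by apply: in_imfset; rewrite /= in_fset_set// mem_set.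
Qed.

Lemma counting_ge_image d (S : measurableType d) d' (S' : measurableType d') (g : S -> S')
    (A : set S) (B : set S') : finite_set A -> finite_set B -> g @` A `<=` B ->
  {in A &, injective g} -> (@counting _ R A <= @counting _ R B)%E.
Proof.
move=> fA fB AB ginj; rewrite /counting !asboolT// lee_fin ler_nat.
rewrite -(@card_in_imfset imfset_key _ _ g (mem (fset_set A))); last first.
  by move=> x y /=; rewrite !in_fset_set//; exact: ginj.
apply: fsubset_leq_card; apply/fsubsetP => y /imfsetP[x /=]; rewrite in_fset_set// => /set_mem Ax ->.
by rewrite in_fset_set// mem_set//; apply: AB; exists x.
Qed.

End finite_counting.

Section rounded_configurations.
Context {R : realType}.
Local Notation T := (measurableTypeR R).
Local Notation E := (int * T)%type.
Implicit Types (A : set E).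

Definition rounded n A : set E := @round R n @` A.

Lemma near_seq (I : eqType) (L : seq I) (Q : nat -> I -> Prop) :
  (forall i, i \in L -> \forall n \near \oo, Q n i) ->
  \forall n \near \oo, forall i, i \in L -> Q n i.
Proof.
elim: L => [|a L ih] h; first exact: nearW.
have h1 := h a (mem_head _ _); have h2 := ih (fun i iL => h i (mem_behead (s := a :: L) iL)).
by apply: filterS2 h1 h2 => n h1 h2 i; rewrite inE => /predU1P[->|/h2].
Qed.

Lemma near_round_inj A : finite_set A -> \forall n \near \oo, {in A &, injective (@round R n)}.
Proof.
move=> fA; suff : \forall n \near \oo, forall pq : E * E,
    pq \in [seq (p, q) | p <- fset_set A, q <- fset_set A] -> pq.1 != pq.2 -> round n pq.1 != round n pq.2.
  apply: filterS => n h p q pA qA pq; apply: contrapT => /eqP npq.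
  have := h (p, q) _ npq; rewrite pq eqxx => /(_ _)/notF; apply.
  by apply/allpairsP; exists (p, q); split => //=; rewrite in_fset_set.
apply: near_seq => -[p q] _ /=; have [->|pq] := eqVneq p q; first exact: nearW.
have [p1|p1] := eqVneq p.1 q.1; last first.
  apply: nearW => n _; apply/negP => /eqP /(congr1 fst) /= h; by rewrite h eqxx in p1.
have d0 : 0 < `|p.2 - q.2|.
  rewrite normr_gt0 subr_eq0; apply: contra pq => /eqP p2.
  by rewrite [p]surjective_pairing [q]surjective_pairing p1 p2.
have := @cvg_expr R (2^-1); rewrite ger0_norm// => /(_ _)/cvgrPdist_lt/(_ _ d0) h.
have {}h : \forall n \near \oo, `|0 - 2^-1 ^+ n| < `|p.2 - q.2| by apply: h; lra.
apply: filterS h => n; rewrite sub0r normrN ger0_norm ?exprn_ge0// => hn _.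
apply/negP => /eqP /(@corner_inj R n) [_ e].
have two0 : 0 < (2 ^+ n : R) by rewrite exprn_gt0.
have /andP[a1 a2] := floor_itv (p.2 * 2 ^+ n); have /andP[b1 b2] := floor_itv (q.2 * 2 ^+ n).
rewrite e in a1 a2; have : `|(p.2 - q.2) * 2 ^+ n| < 1.
  by rewrite mulrBl ltr_norml; move: a1 a2 b1 b2; rewrite intrD => *; apply/andP; split; lra.
rewrite normrM (gtr0_norm two0) -ltr_pdivlMr// div1r -exprVn => h.
by have := lt_trans h hn; rewrite ltxx.
Qed.

Section tuples_of_rounded.
Variables (A : set E) (M n k : nat) (W : 'I_k -> set E).
Hypothesis fA : finite_set (A `&` dwindow M).
Hypothesis sW : forall i, saturated n (W i).
Hypothesis WM : forall i, W i `<=` dwindow M.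

Let fS : finite_set (tuples A W).
Proof.
have uL := fset_uniq (fset_set (A `&` dwindow M)).
have sub : forall s, tuples A W s -> {subset s <= fset_set (A `&` dwindow M)}.
  apply: tuples_sub => i p [Ap Wp].
  by rewrite in_fset_set//; apply: mem_set; split => //; exact: WM Wp.
exact: (card_tuples uL sub).1.
Qed.

Let g (s : k.-tuple E) : k.-tuple E := [tuple of map (@round R n) s].

Let lift_tuple : tuples (rounded n A) W `<=` g @` tuples A W.
Proof.
move=> s [us hs]; have /choice[f hf] i : exists p, A p /\ round n p = tnth s i.
  by have [[p Ap <-] _] := hs i; exists p.
have gE : g (mktuple f) = s.
  by apply: eq_from_tnth => i; rewrite tnth_map tnth_mktuple; case: (hf i).
exists (mktuple f) => //; split.
  by move: us; rewrite -gE => /map_uniq.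
move=> i; rewrite tnth_mktuple; have [Ap e] := hf i; split => //.
by apply/sW; rewrite e; case: (hs i).
Qed.

Lemma tuples_rounded_le :
  (@counting _ R (tuples (rounded n A) W) <= @counting _ R (tuples A W))%E.
Proof. exact: (counting_le_image fS lift_tuple). Qed.

Lemma tuples_rounded_eq : {in A `&` dwindow M &, injective (@round R n)} ->
  (@counting _ R (tuples (rounded n A) W) = @counting _ R (tuples A W))%E.
Proof.
move=> inj; apply/eqP; rewrite eq_le tuples_rounded_le /=.
have AM s i : tuples A W s -> (tnth s i) \in A `&` dwindow M.
  by move=> [_ /(_ i) [h1 h2]]; apply: mem_set; split => //; exact: WM h2.
have gs s : tuples A W s -> tuples (rounded n A) W (g s).
  move=> hs; have [us h] := hs; split; last first.
    move=> i; have [h1 h2] := h i; rewrite tnth_map; split; first by exists (tnth s i).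
    exact/sW.
  apply/tuple_uniqP => i j; rewrite !tnth_map => /inj e; move/tuple_uniqP : us; apply.
  by apply: e; exact: AM.
apply: (counting_ge_image (g := g)) => //.
- exact: (sub_finite_set lift_tuple (finite_image _ fS)).
- by move=> _ [s hs <-]; exact: gs.
move=> s s' /set_mem hs /set_mem hs' e; apply: eq_from_tnth => i.
have := congr1 (fun s => tnth s i) e; rewrite !tnth_map => /inj; apply; exact: AM.
Qed.

End tuples_of_rounded.

End rounded_configurations.

Section limit_configurations.
Context {R : realType}.
Local Notation T := (measurableTypeR R).
Local Notation E := (int * T)%type.
Variable z : int * int * nat -> bool.

Definition marked n : set E := [set corner n c | c in [set c | z (c, n)]].

(** What makes z the trace, on dyadic cells, of a locally finite configuration:
    a cell is marked when one of its halves is; the numbers of marked cells of a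
    window do not tend to infinity; and no chain of marked cells shrinks to the
    excluded upper end of a cell. *)
Definition consistent := forall c n,
  z (c, n) = z ((c.1, 2 * c.2), n.+1) || z ((c.1, 2 * c.2 + 1), n.+1).
Definition recurrently_bounded := forall M, exists K, forall m, exists2 n, (m <= n)%N &
  (npts (marked n `&` dwindow M) <= K)%N.
Definition no_escape := forall c n, exists m : nat, ~~ z ((c.1, (c.2 + 1) * 2 ^+ m - 1), (n + m)%N).
Definition trace := [/\ consistent, recurrently_bounded & no_escape].

(** Empty when z is not a trace. *)
Definition limit_config : set E := [set p | trace /\ forall n, z (lev n p, n)].

Hypothesis tr : trace.

(** A marked cell has a marked half; the nested halves shrink to a point, which
    lies in all of them because they do not accumulate at an upper end. *)
Lemma limit_config_cell c n : z (c, n) -> exists2 p, limit_config p & lev n p = c.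
Proof.
have [z1 z2 z3] := tr; move=> zc.
pose ks := fix ks m := if m is m'.+1 then
  (if z ((c.1, 2 * ks m'), (n + m').+1) then 2 * ks m' else 2 * ks m' + 1) else c.2.
have zks m : z ((c.1, ks m), (n + m)%N).
  elim: m => [|m ih]; first by rewrite addn0 /=; case: c zc {ks}.
  rewrite addnS /=; case: ifPn => // h; have := z1 (c.1, ks m) (n + m)%N.
  by rewrite ih /= (negbTE h).
have ksS m : ks m.+1 = 2 * ks m \/ ks m.+1 = 2 * ks m + 1 by rewrite /=; case: ifP; [left|right].
have range m j : ks m * 2 ^+ j <= ks (m + j)%N < (ks m + 1) * 2 ^+ j.
  elim: j => [|j /andP[i1 i2]]; first by rewrite addn0 expr0 !mulr1 lexx ltzD1 lexx.
  by rewrite addnS exprS; case: (ksS (m + j)%N) => ->; apply/andP; split; lia.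
pose a m : R := (ks m)%:~R / 2 ^+ (n + m); pose b m : R := (ks m + 1)%:~R / 2 ^+ (n + m).
have two0 j : 0 < (2 ^+ j : R) by rewrite exprn_gt0.
have divE m j (y : int) : y%:~R / 2 ^+ (n + m) = (y * 2 ^+ j)%:~R / 2 ^+ (n + (m + j)) :> R.
  by rewrite addnA [in RHS]exprD intrM rmorphXn /= -mulf_div divff ?mulr1// gt_eqF.
have am m j : a m <= a (m + j)%N.
  by rewrite /a (divE m j) ler_pM2r ?invr_gt0// ler_int; case/andP: (range m j).
have bm m j : b (m + j)%N <= b m.
  by rewrite /b (divE m j) ler_pM2r ?invr_gt0// ler_int; case/andP: (range m j) => _; lia.
have ab m : a m <= b m by rewrite /a /b ler_pM2r ?invr_gt0// ler_int; lia.
have amb m j : a j <= b m.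
  have [mj|/ltnW jm] := leqP m j; first by rewrite -(subnKC mj) (le_trans (ab _)).
  by apply: le_trans (ab m); rewrite -(subnKC jm).

have hs : has_sup [set a m | m in [set: nat]].
  by split; [exists (a 0%N), 0%N|exists (b 0%N) => _ [m _ <-]].
pose xi := sup [set a m | m in [set: nat]].
have axi m : a m <= xi by apply: ub_le_sup; [case: hs|exists m].
have xib m : xi <= b m by apply: ge_sup; [case: hs|move=> _ [j _ <-]].
have xib' m : xi < b m.
  have [j hj] := z3 (c.1, ks m) (n + m)%N.
  apply: le_lt_trans (xib (m + j)%N) _; rewrite /b (divE m j) ltr_pM2r ?invr_gt0// ltr_int.
  have /andP[_ h] := range m j; have := zks (m + j)%N; rewrite addnA => zj.
  have nk : ks (m + j)%N != (ks m + 1) * 2 ^+ j - 1.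
    by apply/negP => /eqP e; move: hj; rewrite /= -e zj.
  by move: h nk; set u := ks _; set v := _ * _; lia.
pose p : E := (c.1, xi).
have levE m : lev (n + m) p = (c.1, ks m).
  congr (_, _); apply: floor_def; rewrite -ler_pdivrMr// -ltr_pdivlMr//.
  by rewrite axi xib'.
have up i : z (lev i.+1 p, i.+1) -> z (lev i p, i).
  move=> zi; rewrite z1; move: zi.
  by case: (lev_succ i p) => e; rewrite [lev i.+1 p]surjective_pairing e => ->; rewrite ?orbT.
have down i j : z (lev (i + j) p, (i + j)%N) -> z (lev i p, i).
  by elim: j => [|j ih]; [rewrite addn0|rewrite addnS => /up/ih].
exists p; last by have := levE 0%N; rewrite addn0 /= => ->; rewrite -surjective_pairing.
by split => // i; apply: (down i n); rewrite addnC levE zks.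
Qed.

Lemma rounded_limit_config n : rounded n limit_config = marked n.
Proof.
apply/seteqP; split => [q [p [_ hp] <-]|q [c /= zc <-]].
  by exists (lev n p) => //; exact: hp.
have [p hp e] := limit_config_cell zc.
by exists p => //; rewrite /round e.
Qed.

(** Distinct points lie in distinct cells at fine levels, so that too many
    points would force too many marked cells at all fine levels. *)
Lemma limit_config_finite M : finite_set (limit_config `&` dwindow M).
Proof.
apply: contrapT => inf; have [_ z2 _] := tr; have [K hK] := z2 M.
have [F FA KF] := infinite_set_fset K.+1 inf.
have [m _ hm] := near_round_inj (finite_fset F).
have [n mn] := hK m; apply/negP; rewrite -ltnNge.
apply: leq_trans KF _.
have fm : finite_set (marked n `&` dwindow M).
  apply: (@sub_finite_set _ _ (corner n @` ([set x : int | (`|x|%N <= M)%N] `*`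
    [set y : int | (`|y|%N <= M * 2 ^ n)%N]))).
    move=> _ [[c _ <-] [h1 /andP[h2 h3]]]; exists c => //; split => //=.
    move: h2 h3; rewrite /corner /= ler_pdivlMr ?exprn_gt0// ltr_pdivrMr ?exprn_gt0// => h2 h3.
    rewrite -(ler_nat R) natr_absz intr_norm natrM natrX ler_norml -mulNr h2 /=.
    exact: ltW.
  by apply: finite_image; apply: finite_setX; exact: finite_ball_int.
have inj : {in F &, injective (@round R n)}.
  by move=> p q pF qF; apply: (hm n mn); exact: mem_set.
rewrite -(@card_in_imfset imfset_key _ _ (@round R n) (mem F))//.
apply: fsubset_leq_card; apply/fsubsetP => y /imfsetP[p /= pF ->].
rewrite in_fset_set//; apply: mem_set; have [hp Mp] := FA _ pF; split.
  by rewrite -rounded_limit_config; exists p.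
exact/(saturated_dwindow n).
Qed.

End limit_configurations.

(** * Processes with converging factorial moments *)

Section densities.
Context {R : realType}.
Local Notation T := (measurableTypeR R).
Local Notation E := (int * T)%type.
Local Notation cl := (@counting_lebesgue R).

(** Correlation densities bounded, at generic tuples of a window, by constants
    that the factorial beats. *)
Definition density (rho : forall k, k.-tuple E -> R) : Prop :=
  [/\ forall k, measurable_fun [set: k.-tuple E] (rho k : _ -> T),
      forall k s, 0 <= rho k s &
      forall M, exists D : nat -> R, [/\ forall k, 0 <= D k,
        forall k (s : k.-tuple E), generic snd [::] s -> (forall i, window M (tnth s i)) ->
          rho k s <= D k &
        forall L, 0 <= L -> D k * L ^+ k / k`!%:R @[k --> \oo] --> 0]].

Variable rho : forall k, k.-tuple E -> R.
Hypothesis hrho : density rho.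

(** What the mean number of k-tuples of distinct points with entries in W is, for
    a process with correlation functions rho. *)
Definition mean k (W : 'I_k -> set E) : \bar R := box_integral cl W (fun s => (rho s)%:E).

Lemma mean_ge0 k (W : 'I_k -> set E) : (0 <= mean W)%E.
Proof. by apply: box_integral_ge0 => s; rewrite lee_fin; case: hrho. Qed.

Lemma mrho_EFin k : measurable_fun [set: k.-tuple E] (fun s : k.-tuple E => (rho s)%:E).
Proof. by case: hrho => mr _ _; apply/measurable_EFinP; exact: mr. Qed.

Lemma mean_bound M : exists D : nat -> R, [/\ forall k, 0 <= D k,
  forall k (W : 'I_k -> set E) L, 0 <= L -> (forall i, measurable (W i)) ->
    (forall i, W i `<=` window M) -> (forall i, cl (W i) <= L%:E)%E ->
    (mean W <= (D k * L ^+ k)%:E)%E &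
  forall L, 0 <= L -> D k * L ^+ k / k`!%:R @[k --> \oo] --> 0].
Proof.
have [mr r0 /(_ M) [D [D0 hD dec]]] := hrho; exists D; split => // k W L L0 mW WM WL.
have mWs : measurable [set s : k.-tuple E | forall i, W i (tnth s i)].
  rewrite (_ : mkset _ = \bigcap_(i in [set: 'I_k]) ((fun s => tnth s i) @^-1` W i)).
    apply: fin_bigcap_measurable => // i _; rewrite -[X in measurable X]setTI.
    exact: (measurable_tnth i).
  by apply/seteqP; split => [s hs i _|s hs i]; exact: hs.
pose f := (fun s : k.-tuple E => (rho s)%:E) \_ [set s | forall i, W i (tnth s i)].
have -> : mean W = box_integral cl W f.
  by apply: eq_box_integral => s hs; rewrite /f /patch mem_set.
apply: le_trans (lee_abs _) _.
apply: (@box_integral_bound R _ E cl parametric_counting_lebesgue snd _ counting_lebesgue_null [::]) => //.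
- by move=> r; rewrite -[X in measurable X]setTI; exact: measurable_snd.
- by apply/(measurable_restrictT _ mWs)/measurable_funTS; exact: mrho_EFin.
move=> s gs; rewrite /f /patch; case: ifPn => [/set_mem hs|_]; last by rewrite abse0 lee_fin.
by rewrite gee0_abs ?lee_fin//; apply: hD => // i; apply: WM.
Qed.

Lemma cl_le (A B : set E) : measurable A -> measurable B -> A `<=` B -> (cl A <= cl B)%E.
Proof. by move=> mA mB AB; exact: (le_measure cl (mem_set mA) (mem_set mB) AB). Qed.

Lemma mean_fin k (W : 'I_k -> set E) M : (forall i, measurable (W i)) ->
  (forall i, W i `<=` window M) -> mean W \is a fin_num.
Proof.
move=> mW WM; have [D [D0 hD _]] := mean_bound M.
rewrite ge0_fin_numE ?mean_ge0//.
apply: le_lt_trans (hD k W (fine (cl (window M))) _ mW WM _) (ltry _); first exact: fine_ge0.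
move=> i; rewrite fineK; last by rewrite ge0_fin_numE// counting_lebesgue_window.
by apply: cl_le => //; exact: measurable_window.
Qed.

Lemma nice_fin k (W : 'I_k -> set E) : (forall i, nice (W i)) -> mean W \is a fin_num.
Proof.
move=> nW; have /choice[m hm] : forall i, exists M, W i `<=` window M by move=> i; case: (nW i).
apply: (@mean_fin _ _ (\max_i m i)%N); first by move=> i; case: (nW i).
by move=> i; apply: subset_trans (hm i) (window_homo _); exact: leq_bigmax.
Qed.

Lemma mean_decay (W : set E) : nice W ->
  fine (mean (fun _ : 'I_k => W)) / k`!%:R @[k --> \oo] --> 0.
Proof.
move=> nW; have [mW [M WM] _] := nW; have [D [D0 hD dec]] := mean_bound M.
have fW : cl W \is a fin_num.
  rewrite ge0_fin_numE//; apply: le_lt_trans (counting_lebesgue_window M).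
  by apply: cl_le => //; exact: measurable_window.
apply: (@squeeze_cvgr _ _ _ _ (fun=> 0) (fun k => D k * fine (cl W) ^+ k / k`!%:R)).
- apply: nearW => k; rewrite divr_ge0 ?fine_ge0 ?mean_ge0//= ler_wpM2r ?invr_ge0//.
  rewrite -lee_fin fineK; last exact: nice_fin.
  by apply: (hD k (fun=> W)) => //; [exact: fine_ge0|move=> _; rewrite fineK].
- exact: cvg_cst.
- by apply: dec; exact: fine_ge0.
Qed.

End densities.

Section converging_processes.
Context {R : realType}.
Local Notation T := (measurableTypeR R).
Local Notation E := (int * T)%type.
Variable rho : forall k, k.-tuple E -> R.
Hypothesis hrho : density rho.
Variables (d : nat -> measure_display) (Omega : forall n, measurableType (d n)).
Variables (P : forall n, probability (Omega n) R) (X : forall n, Omega n -> set E).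

(** Stronger than the notion of process; it holds for the beads, which have
    finitely many configurations in a window, and makes the measurability of every
    functional of these immediate. *)
Definition finitary d' (O : measurableType d') (Y : O -> set E) : Prop :=
  (forall M o, finite_set (Y o `&` window M)) /\
  (forall M (S : set (set E)), measurable [set o | S (Y o `&` window M)]).

Lemma finitary_process d' (O : measurableType d') (Y : O -> set E) : finitary Y -> process Y.
Proof.
move=> [fY mY]; split => // M B mB BM m.
rewrite (_ : mkset _ = [set o | (fun A => npts (A `&` B) = m) (Y o `&` window M)]); first exact: (mY M (fun A => npts (A `&` B) = m)).
by apply/seteqP; split => z /=; rewrite -setIA (setIidr BM).
Qed.

Hypothesis fX : forall n, finitary (@X n).
Hypothesis X_fin : forall n k W, nice W -> moment (P n) (@X n) W k \is a fin_num.
Hypothesis X_cvg : forall k (W : 'I_k -> set E), (forall i, nice (W i)) ->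
  (\int[P n]_o @counting (k.-tuple E) R (tuples (@X n o) W) @[n --> \oo] --> mean rho W)%E.

Lemma moment_cvg W k : nice W ->
  fine (moment (P n) (@X n) W k) @[n --> \oo] --> fine (mean rho (fun _ : 'I_k => W)).
Proof.
move=> nW; have h := X_cvg (fun _ : 'I_k => nW).
by apply: fine_cvg; rewrite fineK //; exact: nice_fin.
Qed.

Lemma void_limit : exists V : set E -> R, forall W, nice W ->
  fine (P n (void (@X n) W)) @[n --> \oo] --> V W /\
  forall m, `|V W - alt_sum (fun k => fine (mean rho (fun _ : 'I_k => W))) m| <=
    fine (mean rho (fun _ : 'I_m => W)) / m`!%:R.
Proof.
have /choice[V hV] : forall W : set E, exists v, nice W ->
    fine (P n (void (@X n) W)) @[n --> \oo] --> v /\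
    forall m, `|v - alt_sum (fun k => fine (mean rho (fun _ : 'I_k => W))) m| <=
      fine (mean rho (fun _ : 'I_m => W)) / m`!%:R.
  move=> W; have [nW|nW] := pselect (nice W); last by exists 0.
  have [mW [M WM] _] := nW.
  have [v hv] := @alternating_limit R (fun n => fine (P n (void (@X n) W)))
    (fun n k => fine (moment (P n) (@X n) W k)) (fun k => fine (mean rho (fun _ : 'I_k => W)))
    (fun n m => void_bonferroni (finitary_process (fX n)) mW WM (fun k => X_fin n k nW) m)
    (fun k => moment_cvg nW) (mean_decay hrho nW).
  by exists v.
by exists V.
Qed.

End converging_processes.

(** * The limit process on the unit interval *)

Section almost_sure_events.
Context {R : realType} d (T : measurableType d) (mu : probability T R).

Definition sure (A : set T) := measurable A /\ mu (~` A) = 0%E.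

Lemma measurable_forall (C : countType) (A : C -> set T) : (forall i, measurable (A i)) ->
  measurable [set u | forall i, A i u].
Proof.
move=> mA; pose B n := if choice.unpickle n is Some i then A i else setT.
rewrite (_ : mkset _ = \bigcap_n B n); first by apply: bigcapT_measurable => n; rewrite /B; case: choice.unpickle.
apply/seteqP; split => [u h n _|u h i]; first by rewrite /B; case: choice.unpickle.
by have := h (choice.pickle i) I; rewrite /B choice.pickleK.
Qed.

Lemma measurable_exists (C : countType) (A : C -> set T) : (forall i, measurable (A i)) ->
  measurable [set u | exists i, A i u].
Proof.
move=> mA; rewrite (_ : mkset _ = ~` [set u | forall i, (~` A i) u]).
  by apply/measurableC/measurable_forall => i; exact: measurableC.
apply/seteqP; split => [u [i h] /(_ i)//|u /= /existsNP[i /contrapT h]]; by exists i.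
Qed.

Lemma sure_forall (C : countType) (A : C -> set T) : (forall i, sure (A i)) ->
  sure [set u | forall i, A i u].
Proof.
move=> sA; split; first by apply: measurable_forall => i; case: (sA i).
pose B n := if choice.unpickle n is Some i then A i else setT.
have mB n : measurable (~` B n) by apply: measurableC; rewrite /B; case: choice.unpickle => // i; case: (sA i).
apply: measure_negligible; first by apply/measurableC/measurable_forall => i; case: (sA i).
apply: (@negligibleS _ _ _ _ (\bigcup_n ~` B n)).
  move=> u /= /existsNP[i hi]; exists (choice.pickle i) => //=; by rewrite /B choice.pickleK.
apply: negligible_bigcup => n; exists (~` B n); split => //.
rewrite /B; case: choice.unpickle => [i|]; first by case: (sA i).
by rewrite setCT measure0.
Qed.

Lemma sureI (A B : set T) : sure A -> sure B -> sure (A `&` B).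
Proof.
move=> [mA A0] [mB B0]; split; first exact: measurableI.
by rewrite setCI null_set_setU//; exact: measurableC.
Qed.

Lemma measure_le_eps (A : set T) : measurable A ->
  (forall e, 0 < e -> (mu A <= e%:E)%E) -> mu A = 0%E.
Proof.
move=> mA h; apply/eqP; rewrite eq_le measure_ge0 andbT.
by apply/lee_addgt0Pr => e e0; rewrite add0e; exact: h.
Qed.

End almost_sure_events.

Section limit_process.
Context {R : realType}.
Local Notation T := (measurableTypeR R).
Local Notation E := (int * T)%type.
Local Notation cl := (@counting_lebesgue R).
Local Notation Pu := (@unit_measure R : probability T R).
Variable rho : forall k, k.-tuple E -> R.
Hypothesis hrho : density rho.
Variables (d : nat -> measure_display) (Omega : forall n, measurableType (d n)).
Variables (P : forall n, probability (Omega n) R) (X : forall n, Omega n -> set E).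
Hypothesis fX : forall n, finitary (@X n).
Hypothesis X_fin : forall n k W, nice W -> moment (P n) (@X n) W k \is a fin_num.
Hypothesis X_cvg : forall k (W : 'I_k -> set E), (forall i, nice (W i)) ->
  (\int[P n]_o @counting (k.-tuple E) R (tuples (@X n o) W) @[n --> \oo] --> mean rho W)%E.
Variable V : set E -> R.
Hypothesis hV : forall W, nice W -> fine (P n (void (@X n) W)) @[n --> \oo] --> V W.

Let pX n : process (@X n) := finitary_process (fX n).

Let cells (i : nat) : set E := cell (odflt (0, 0, 0%N) (choice.unpickle i)).

Let nice_cells i : nice (cells i). Proof. exact: nice_cell. Qed.

Definition limit_mark (u : T) (c : int * int * nat) : bool := limit_bit V cells u (choice.pickle c).

Definition hits n (o : Omega n) (c : int * int * nat) : bool := `[< @X n o `&` cell c !=set0 >].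

Lemma limit_mark_expectation (cs : seq (int * int * nat)) (g : (int * int * nat -> bool) -> R) :
  (forall z z', (forall c, c \in cs -> z c = z' c) -> g z = g z') ->
  [/\ Pu.-integrable setT (EFin \o (fun u => g (limit_mark u))),
      forall n, (P n).-integrable setT (EFin \o (fun o => g (@hits n o))) &
      \int[P n]_o g (@hits n o) @[n --> \oo] --> \int[Pu]_u g (limit_mark u)].
Proof.
move=> gcs; pose N := (\max_(c <- cs) choice.pickle c).+1.
have [|h1 h2 h3] := limit_bit_expectation pX hV nice_cells (N := N)
  (g := fun z => g (fun c => z (choice.pickle c))).
  move=> z z' zz; apply: gcs => c ccs; apply: zz.
  by rewrite /N ltnS (big_rem c ccs) /= leq_maxl.
have hE n o : (fun c => `[< @X n o `&` cells (choice.pickle c) !=set0 >]) = @hits n o.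
  by apply/funext => c; rewrite /hits /cells choice.pickleK.
split => //.
- by move=> n; have := h2 n; congr integrable; apply/funext => o /=; rewrite hE.
- by move: h3; under eq_fun do under eq_Rintegral do rewrite hE.
Qed.

Lemma measurable_mark (cs : seq (int * int * nat)) (S : (int * int * nat -> bool) -> Prop) :
  (forall z z', (forall c, c \in cs -> z c = z' c) -> S z -> S z') ->
  measurable [set u | S (limit_mark u)].
Proof.
move=> Scs; have [|h1 _ _] := @limit_mark_expectation cs (fun z => `[< S z >]%:R).
  by move=> z z' zz; congr ((nat_of_bool _)%:R); apply: asbool_equiv_eq; split; apply: Scs => // c /zz.
have [m1 _] := integrableP _ _ _ h1; move/measurable_EFinP : m1 => m1.
rewrite (_ : mkset _ = [set: T] `&` (fun u => `[< S (limit_mark u) >]%:R : R) @^-1` [set 1]).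
  exact: m1.
rewrite setTI; apply/seteqP; split => u /=; first by move=> h; rewrite asboolT.
by case: asboolP => // _ /eqP; rewrite eq_sym oner_eq0.
Qed.

Lemma marked_hits n m (o : Omega n) : marked (@hits n o) m = rounded m (@X n o) :> set E.
Proof.
apply/seteqP; split => [q [c /= /asboolP[p [Xp pc]] <-]|q [p Xp <-]].
  by exists p => //; rewrite /round; have -> : lev m p = c by exact: pc.
by exists (lev m p) => //=; apply/asboolP; exists p.
Qed.

Definition int_range (m : nat) : seq int := [seq i%:Z - m%:Z | i <- iota 0 (2 * m).+1].

Definition grid M n : seq (int * int) := [seq (x, y) | x <- int_range M, y <- int_range (M * 2 ^ n)].

Lemma mem_int_range m (x : int) : (x \in int_range m) = (`|x|%N <= m)%N.
Proof.
apply/mapP/idP => [[j ]|xm]; first by rewrite mem_iota => ? ->; lia.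
by exists `|(x + m%:Z)%R|%N; [rewrite mem_iota|]; lia.
Qed.

Lemma size_grid M n : (size (grid M n) <= (2 * M).+1 * (2 * M).+1 * 2 ^ n)%N.
Proof.
rewrite size_allpairs !size_map !size_iota -mulnA; apply: leq_mul => //.
have : (0 < 2 ^ n)%N by rewrite expn_gt0.
by move: (2 ^ n)%N => e; nia.
Qed.

Lemma lev_grid M n (p : E) : dwindow M p -> lev n p \in grid M n.
Proof.
move=> Mp; have : dwindow M (round n p : E) by exact/saturated_dwindow.
rewrite /round /corner => -[/= h1 /andP[h2 h3]]; apply/allpairsP.
exists ((lev n p).1, (lev n p).2); split => //=; rewrite mem_int_range//.
move: h2 h3; rewrite ler_pdivlMr ?exprn_gt0// ltr_pdivrMr ?exprn_gt0// => h2 h3.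
rewrite -(ler_nat R) natr_absz intr_norm natrM natrX ler_norml -mulNr h2 /=.
exact: ltW.
Qed.

Lemma marked_local M n z z' : (forall c, c \in [seq (c, n) | c <- grid M n] -> z c = z' c) ->
  marked z n `&` dwindow M `<=` (marked z' n `&` dwindow M : set E).
Proof.
move=> zz _ [[c /= zc <-] Mc]; split => //; exists c => //=; rewrite -zz//.
by apply: map_f; rewrite -(lev_corner (R := R) n c); exact: lev_grid.
Qed.

Lemma marked_local_eq M n z z' : (forall c, c \in [seq (c, n) | c <- grid M n] -> z c = z' c) ->
  marked z n `&` dwindow M = (marked z' n `&` dwindow M : set E).
Proof. by move=> zz; apply/seteqP; split; apply: marked_local => c /zz. Qed.

Lemma tuples_local (A A' : set E) M k (W : 'I_k -> set E) : (forall i, W i `<=` dwindow M) ->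
  A `&` dwindow M = A' `&` dwindow M -> tuples A W = tuples A' W.
Proof.
move=> WM AA; have c B i : B `&` W i = (B `&` dwindow M) `&` W i by rewrite -setIA (setIidr (WM i)).
have e i : A `&` W i = A' `&` W i by rewrite c AA -c.
by apply/seteqP; split => s [us hs]; split => // i; have := hs i; rewrite e.
Qed.

Lemma nice_dwindow M : nice (dwindow M : set E).
Proof.
rewrite (_ : dwindow M = [set x | (`|x|%N <= M)%N] `*` `[- M%:R, M%:R[%classic); last first.
  by apply/seteqP; split => -[x xi] /=; rewrite /dwindow /= in_itv.
apply: (@nice_strip _ _ M) => //; exists M%:R; split; first by rewrite num_real.
move=> y hy xi /=; rewrite in_itv /= => /andP[h1 h2]; apply: le_trans (ltW hy).
by rewrite ler_norml h1 ltW.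
Qed.

Definition marked_count n k (W : 'I_k -> set E) (z : int * int * nat -> bool) : R :=
  fine (@counting (k.-tuple E) R (tuples (marked z n) W)).

Lemma marked_count_local n k (W : 'I_k -> set E) M z z' : (forall i, W i `<=` dwindow M) ->
  (forall c, c \in [seq (c, n) | c <- grid M n] -> z c = z' c) ->
  marked_count n W z = marked_count n W z'.
Proof. by move=> WM zz; rewrite /marked_count (tuples_local WM (marked_local_eq zz)). Qed.

Lemma counting_tuples_fin (A : set E) (B : set E) k (W : 'I_k -> set E) : finite_set (A `&` B) ->
  (forall i, W i `<=` B) -> @counting (k.-tuple E) R (tuples A W) \is a fin_num.
Proof.
move=> fA WB; have sub : forall s, tuples A W s -> {subset s <= fset_set (A `&` B)}.
  apply: tuples_sub => i p [Ap Wp]; rewrite in_fset_set//; apply: mem_set; split => //.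
  exact: WB Wp.
by rewrite /counting asboolT//; exact: (card_tuples (fset_uniq _) sub).1.
Qed.

Lemma finite_marked z n M : finite_set (marked z n `&` dwindow M : set E).
Proof.
apply: (@sub_finite_set _ _ (corner n @` [set` grid M n])).
  move=> _ [[c _ <-] hc]; exists c => //.
  by have := lev_grid n hc; rewrite lev_corner.
exact/finite_image/finite_seq.
Qed.

Lemma finite_X n B o : nice B -> finite_set (@X n o `&` B).
Proof. by case=> _ [M BM] _; apply: sub_finite_set ((fX n).1 M o); exact: setIS. Qed.

Lemma marked_count_cvg n k (W : 'I_k -> set E) M : (forall i, W i `<=` dwindow M) ->
  [/\ Pu.-integrable setT (EFin \o (fun u => marked_count n W (limit_mark u))),
      forall m, (P m).-integrable setT (EFin \o (fun o => marked_count n W (@hits m o))) &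
      \int[P m]_o marked_count n W (@hits m o) @[m --> \oo] -->
        \int[Pu]_u marked_count n W (limit_mark u)].
Proof. by move=> WM; apply: limit_mark_expectation => z z'; exact: marked_count_local. Qed.

(** Finite, hence real. *)
Definition X_count m k (W : 'I_k -> set E) (o : Omega m) : R :=
  fine (@counting (k.-tuple E) R (tuples (@X m o) W)).

Lemma X_count_diag m k B o : nice B ->
  X_count (fun _ : 'I_k => B) o = (npts (@X m o `&` B) ^_ k)%:R.
Proof. by move=> nB; rewrite /X_count counting_tuples_diag//; exact: finite_X. Qed.

Lemma X_count_le m k (W : 'I_k -> set E) B o : nice B -> (forall i, W i `<=` B) ->
  X_count W o <= X_count (fun _ : 'I_k => B) (o : Omega m).
Proof.
move=> nB WB; have fB := finite_X o nB.
rewrite /X_count fine_le//; [exact: counting_tuples_fin fB WB|exact: (counting_tuples_fin (k := k) fB (fun _ => @subset_refl _ _))|].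
apply: (counting_le_image (g := id)).
  have sub : forall s, tuples (@X m o) (fun _ : 'I_k => B) s -> {subset s <= fset_set (@X m o `&` B)}.
    by apply: tuples_sub => i p hp; rewrite in_fset_set//; exact: mem_set.
  exact: (card_tuples (fset_uniq _) sub).1.
move=> s [us hs]; exists s => //; split => // i; have [h1 h2] := hs i; split => //.
exact: WB h2.
Qed.

Lemma X_count_integrable m k (W : 'I_k -> set E) B : nice B -> (forall i, W i `<=` B) ->
  (P m).-integrable setT (EFin \o (fun o => X_count W o)).
Proof.
move=> nB WB; have [mB [M BM] _] := nB.
have eq1 o : tuples (@X m o) W = tuples (@X m o `&` window M) W.
  apply/seteqP; split => s [us hs]; split => // i; have [h1 h2] := hs i; split => //.
    by split => //; apply: BM; exact: (WB i).
  by case: h1.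
have mc : measurable_fun [set: Omega m] (fun o => X_count W o : T).
  move=> _ Y mY; rewrite setTI.
  rewrite (_ : _ @^-1` _ = [set o | (fun A => Y (fine (@counting (k.-tuple E) R (tuples A W))))
    (@X m o `&` window M)]).
    exact: ((fX m).2 M (fun A => Y (fine (@counting (k.-tuple E) R (tuples A W))))).
  by apply/seteqP; split => o /=; rewrite /X_count eq1.
apply/integrableP; split; first exact/measurable_EFinP.
have fm := X_fin m k nB.
apply: (@le_lt_trans _ _ (moment (P m) (@X m) B k)); last by rewrite ltey_eq fm.
apply: ge0_le_integral => //.
- by apply: measurableT_comp => //; exact/measurable_EFinP.
- rewrite (_ : (fun o => _) = (fun o => ((npts (@X m o `&` B) ^_ k)%:R)%:E)); last first.
    by apply/funext => o; exact: counting_tuples_diag (finite_X o nB).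
  apply/measurable_EFinP; apply: (measurable_of_nat (fun n => (n ^_ k)%:R)) => j.
  exact: ((pX m).2 M _ mB BM j).
move=> o _; rewrite /= ger0_norm ?fine_ge0//.
apply: le_trans (_ : (X_count (fun _ : 'I_k => B) o)%:E <= _)%E.
  by rewrite lee_fin; exact: X_count_le.
by rewrite /X_count fineK//; exact: (counting_tuples_fin (k := k) (finite_X o nB) (fun _ => @subset_refl _ _)).
Qed.

Lemma X_count_cvg k (W : 'I_k -> set E) B : nice B -> (forall i, W i `<=` B) ->
  (forall i, nice (W i)) -> \int[P m]_o X_count W o @[m --> \oo] --> fine (mean rho W).
Proof.
move=> nB WB nW; have h := X_cvg nW.
have e m : (\int[P m]_o @counting (k.-tuple E) R (tuples (@X m o) W))%E =
    (\int[P m]_o X_count W o)%:E.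
  have := X_count_integrable m nB WB => /(integrable_fin_num measurableT) fin.
  rewrite /Rintegral fineK//; apply: eq_integral => o _.
  by rewrite /X_count fineK//; exact: counting_tuples_fin (finite_X o nB) WB.
rewrite (funext e) in h; apply: (@fine_cvg _ _ _ _ (fun m => (\int[P m]_o X_count W o)%:E)).
by rewrite fineK//; exact: nice_fin.
Qed.

Lemma limit_event (cs : seq (int * int * nat)) (S : (int * int * nat -> bool) -> Prop) :
  (forall z z', (forall c, c \in cs -> z c = z' c) -> S z -> S z') ->
  [/\ measurable [set u | S (limit_mark u)],
      Pu [set u | S (limit_mark u)] = (\int[Pu]_u `[< S (limit_mark u) >]%:R)%:E,
      forall m, (P m).-integrable setT (EFin \o (fun o => `[< S (@hits m o) >]%:R)) &
      \int[P m]_o `[< S (@hits m o) >]%:R @[m --> \oo] --> \int[Pu]_u `[< S (limit_mark u) >]%:R].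
Proof.
move=> Sloc; have mS := measurable_mark Sloc.
have [|i1 i2 i3] := @limit_mark_expectation cs (fun z => `[< S z >]%:R).
  move=> z z' zz; congr ((nat_of_bool _)%:R); apply: asbool_equiv_eq.
  by split; apply: Sloc => c /zz.
split => //.
rewrite -[in LHS](setIT [set u | S (limit_mark u)]) -integral_indic//.
rewrite /Rintegral fineK; last exact: (integrable_fin_num measurableT i1).
by apply: eq_integral => u _; rewrite indicE.
Qed.

Lemma sure_of_hits (cs : seq (int * int * nat)) (S : (int * int * nat -> bool) -> Prop) :
  (forall z z', (forall c, c \in cs -> z c = z' c) -> S z -> S z') ->
  (forall m o, S (@hits m o)) -> sure Pu [set u | S (limit_mark u)].
Proof.
move=> Sloc Sh; have Sloc' z z' : (forall c, c \in cs -> z c = z' c) -> ~ S z -> ~ S z'.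
  by move=> zz h h'; apply: h; apply: Sloc h' => c ccs; rewrite zz.
split; first exact: (measurable_mark Sloc).
have [_ e _ c] := limit_event Sloc'.
rewrite (_ : ~` _ = [set u | ~ S (limit_mark u)])// e; congr (_%:E)%E.
apply: (cvg_unique _ c) => //; rewrite (_ : (fun m => _) = fun=> 0); first exact: cvg_cst.
apply/funext => m; rewrite /Rintegral (eq_integral (cst 0%E)) ?integral0// => o _.
by rewrite asboolF//; apply; exact: Sh.
Qed.

Lemma sure_consistent : sure Pu [set u | consistent (limit_mark u)].
Proof.
pose S (cn : (int * int) * nat) (z : int * int * nat -> bool) :=
  z (cn.1, cn.2) = z ((cn.1.1, 2 * cn.1.2), cn.2.+1) || z ((cn.1.1, 2 * cn.1.2 + 1), cn.2.+1).
rewrite (_ : mkset _ = [set u | forall cn, S cn (limit_mark u)]); last first.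
  by apply/seteqP; split => u h; [move=> [c n]; exact: h|move=> c n; exact: (h (c, n))].
apply: sure_forall => -[c n].
apply: (@sure_of_hits [:: (c, n); ((c.1, 2 * c.2), n.+1); ((c.1, 2 * c.2 + 1), n.+1)]).
  by move=> z z' zz; rewrite /S /= !zz// !inE eqxx ?orbT.
move=> m o; rewrite /S /hits /=; apply/asboolP/orP => [[p [Xp pc]]|[]/asboolP[p [Xp pc]]].
- have e1 : lev n p = c := pc.
  case: (lev_succ n p) => e2; [left|right]; apply/asboolP; exists p; split => //;
    by rewrite /cell /= [lev n.+1 p]surjective_pairing e2 -e1.
- have e1 : lev n.+1 p = (c.1, 2 * c.2) := pc; exists p; split => //.
  rewrite /cell /= [lev n p]surjective_pairing [c]surjective_pairing; congr (_, _).
    exact: (congr1 fst e1).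
  by have := congr1 snd e1; case: (lev_succ n p) => -> /=; lia.
- have e1 : lev n.+1 p = (c.1, 2 * c.2 + 1) := pc; exists p; split => //.
  rewrite /cell /= [lev n p]surjective_pairing [c]surjective_pairing; congr (_, _).
    exact: (congr1 fst e1).
  by have := congr1 snd e1; case: (lev_succ n p) => -> /=; lia.
Qed.

Lemma cl_cell c : cl (cell c) = ((2 ^+ c.2)^-1)%:E.
Proof.
rewrite cellE counting_lebesgueX; last exact: measurable_itv.
rewrite counting_set1 mul1e lebesgue_measure_itv /= lte_fin ltr_pM2r ?invr_gt0 ?exprn_gt0//.
rewrite ltr_int ltzD1 lexx -EFinD -mulrBl -intrB.
by rewrite addrAC subrr add0r mul1r.
Qed.

(** The cell of length 2^-(n + m) at the upper end of a cell of level n is hit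
    with a probability of order 2^-m. *)
Lemma sure_no_escape : sure Pu [set u | no_escape (limit_mark u)].
Proof.
pose r (cn : (int * int) * nat) (m : nat) : int * int * nat :=
  ((cn.1.1, (cn.1.2 + 1) * 2 ^+ m - 1), (cn.2 + m)%N).
rewrite (_ : mkset _ = [set u | forall cn, exists m, ~~ limit_mark u (r cn m)]); last first.
  by apply/seteqP; split => u h; [move=> [c n]; exact: h|move=> c n; exact: (h (c, n))].
apply: sure_forall => cn.
have loc m (z z' : int * int * nat -> bool) :
    (forall c, c \in [:: r cn m] -> z c = z' c) -> z (r cn m) -> z' (r cn m).
  by move=> zz; rewrite zz// inE.
have mA : measurable [set u | exists m, ~~ limit_mark u (r cn m)].
  apply: measurable_exists => m; apply: (@measurable_mark [:: r cn m] (fun z => ~~ z (r cn m))).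
  by move=> z z' zz; rewrite zz// inE.
split => //; apply: measure_le_eps; first exact: measurableC.
move=> e e0.
have [M cM] : exists M, (cell (cn.1, cn.2) : set E) `<=` window M by case: (@nice_cell R (cn.1, cn.2)).
have rc m : (cell (r cn m) : set E) `<=` cell (cn.1, cn.2).
  move=> p; rewrite /cell /lev /= => -[p1 p2]; rewrite [cn.1]surjective_pairing p1; congr (_, _).
  move/eqP: p2; rewrite floor_eq subrK exprD mulrA => /andP[h1 h2].
  have t0 : 0 < (2 ^+ m : R) by rewrite exprn_gt0.
  have t1 : 1 <= (2 ^+ m : R) by rewrite exprn_ege1// ler1n.
  apply: floor_def; rewrite -(ler_pM2r t0) -(ltr_pM2r t0).
  move: h1 h2; rewrite intrB intrM rmorphXn /= !intrD; set y := _ * _ * _.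
  by move=> h1 h2; apply/andP; split => //; move: h1; rewrite mulrDl mul1r; lra.
have [D [D0 hD _]] := mean_bound hrho M.
have [m hm] : exists m : nat, D 1%N * (2^-1) ^+ m <= e.
  have /cvgrPdist_le/(_ e e0)[m _ hm] : D 1%N * (2^-1) ^+ m @[m --> \oo] --> 0.
    rewrite -[X in _ --> X](mulr0 (D 1%N)); apply: cvgMr; apply: cvg_expr.
    by rewrite ger0_norm//; lra.
  exists m; have := hm m (leqnn m); rewrite /= sub0r normrN ger0_norm//.
  by rewrite mulr_ge0// exprn_ge0.
have [ms eS _ cS] := limit_event (S := fun z => z (r cn m)) (loc m).
apply: (@le_trans _ _ (Pu [set u | limit_mark u (r cn m)])).
  apply: (le_measure Pu (mem_set (measurableC mA)) (mem_set ms)).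
  by move=> u /= /forallNP/(_ m)/negP; rewrite negbK.
rewrite eS lee_fin; apply: le_trans hm.
have nr := @nice_cell R (r cn m).
have c2 := X_count_cvg nr (fun _ : 'I_1 => @subset_refl _ _) (fun _ => nr).
apply: le_trans (_ : fine (mean rho (fun _ : 'I_1 => cell (r cn m))) <= _).
  rewrite -subr_ge0; apply: (cvgr_to_ge (cvgB c2 cS)); apply: nearW => j; rewrite subr_ge0.
  have [_ _ iS _] := limit_event (S := fun z => z (r cn m)) (loc m).
  apply: le_Rintegral => //; first exact: (X_count_integrable j nr (fun _ => @subset_refl _ _)).
  move=> o _; rewrite X_count_diag// ffactn1.
  case: asboolP => [/asboolP[p hp]|//]; rewrite ler_nat lt0n; apply/negP => /eqP.
  have [mr [M' rM'] _] := nr.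
  by move=> /(npts_eq0 (pX j) o rM') h; rewrite h in hp.
rewrite -lee_fin fineK; last exact: nice_fin.
apply: le_trans (hD 1%N (fun _ => cell (r cn m)) ((2^-1) ^+ m) _ _ _ _) _.
- by rewrite exprn_ge0.
- by move=> _; case: nr.
- by move=> _; exact: subset_trans (rc m) cM.
- move=> _; rewrite cl_cell lee_fin /= exprVn lef_pV2 ?posrE ?exprn_gt0//.
  by rewrite ler_weXn2l ?ler1n// leq_addl.
by rewrite expr1.
Qed.

Lemma marked_count_le n m k (W : 'I_k -> set E) M (o : Omega m) : (forall i, saturated n (W i)) ->
  (forall i, W i `<=` dwindow M) -> marked_count n W (@hits m o) <= X_count W o.
Proof.
move=> sW WM; have fD := finite_X o (nice_dwindow M).
rewrite /marked_count /X_count; apply: fine_le.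
- exact: (counting_tuples_fin (finite_marked _ _ _) WM).
- exact: (counting_tuples_fin fD WM).
- by rewrite marked_hits; exact: (tuples_rounded_le fD sW WM).
Qed.

Lemma marked_mean_le n k (W : 'I_k -> set E) M : (forall i, saturated n (W i)) ->
  (forall i, W i `<=` dwindow M) -> (forall i, nice (W i)) ->
  \int[Pu]_u marked_count n W (limit_mark u) <= fine (mean rho W).
Proof.
move=> sW WM nW; have [_ i c] := marked_count_cvg n WM.
have c2 := X_count_cvg (nice_dwindow M) WM nW.
rewrite -subr_ge0; apply: (cvgr_to_ge (cvgB c2 c)); apply: nearW => j; rewrite subr_ge0.
apply: le_Rintegral => //; first exact: X_count_integrable (nice_dwindow M) WM.
by move=> o _; exact: marked_count_le sW WM.
Qed.

Lemma marked_count1 n M z : marked_count n (fun _ : 'I_1 => dwindow M) z =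
  (npts (marked z n `&` dwindow M : set E))%:R.
Proof. by rewrite /marked_count counting_tuples_diag ?ffactn1//; exact: finite_marked. Qed.

Lemma marked_overflow n M (K : nat) :
  (Pu [set u | (K < npts (marked (limit_mark u) n `&` dwindow M : set E))%N] <=
  (fine (mean rho (fun _ : 'I_1 => dwindow M)) / K.+1%:R)%:E)%E.
Proof.
have loc (z z' : int * int * nat -> bool) : (forall c, c \in [seq (c, n) | c <- grid M n] -> z c = z' c) ->
    (K < npts (marked z n `&` dwindow M : set E))%N -> (K < npts (marked z' n `&` dwindow M : set E))%N.
  by move=> zz; rewrite (marked_local_eq zz).
have [_ -> _ _] := limit_event loc.
have h := @marked_mean_le n 1 (fun=> dwindow M) M
  (fun _ => @saturated_dwindow R n M) (fun _ => @subset_refl _ _) (fun _ => nice_dwindow M).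
have [i1 _ _] := @marked_count_cvg n 1 (fun=> dwindow M) M (fun _ => @subset_refl _ _).
have [|i2 _ _] := @limit_mark_expectation [seq (c, n) | c <- grid M n]
  (fun z => `[< (K < npts (marked z n `&` dwindow M : set E))%N >]%:R).
  by move=> z z' zz; rewrite (marked_local_eq zz).
rewrite lee_fin ler_pdivlMr// mulrC; apply: le_trans h.
rewrite -RintegralZl//; apply: le_Rintegral => //.
  rewrite (_ : EFin \o _ = fun u => (K.+1%:R%:E * (EFin \o (fun u => `[< (K < npts (marked (limit_mark u) n `&` dwindow M : set E))%N >]%:R)) u)%E)//.
  exact: (integrableZl measurableT _ i2).
move=> u _; rewrite marked_count1; case: asboolP => [h|_]; last by rewrite mulr0.
by rewrite mulr1 ler_nat.
Qed.

(** If the numbers of marked cells tended to infinity, they would exceed K from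
    some level on, which Markov's inequality bounds uniformly in the level. *)
Lemma sure_recurrent : sure Pu [set u | @recurrently_bounded R (limit_mark u)].
Proof.
apply: sure_forall => M.
pose f n u := npts (marked (limit_mark u) n `&` dwindow M : set E).
have mf n (S : nat -> Prop) : measurable [set u | S (f n u)].
  apply: (@measurable_mark [seq (c, n) | c <- grid M n] (fun z => S (npts (marked z n `&` dwindow M : set E)))).
  by move=> z z' zz; rewrite (marked_local_eq zz).
pose B K m : set T := [set u | forall n, (m <= n)%N -> (K < f n u)%N].
have mB K m : measurable (B K m).
  by apply: measurable_forall => n; apply: (mf n (fun x => (m <= n)%N -> (K < x)%N)).
have mA : measurable [set u | exists K, forall m, exists2 n, (m <= n)%N & (f n u <= K)%N].
  apply: measurable_exists => K; apply: measurable_forall => m.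
  rewrite (_ : (fun u => _) = ~` B K m); first exact: measurableC.
  apply/seteqP; split => u /=; first by move=> [n mn h] /(_ n mn); rewrite ltnNge h.
  by move=> /existsNP[n /not_implyP[mn /negP h]]; exists n => //; rewrite leqNgt.
split => //; apply: measure_le_eps; first exact: measurableC.
move=> e e0; set C := fine (mean rho (fun _ : 'I_1 => dwindow M)).
have C0 : 0 <= C by rewrite fine_ge0// mean_ge0.
have [K hK] : exists K : nat, C / K.+1%:R <= e.
  exists (Num.truncn (C / e)); rewrite ler_pdivrMr// mulrC -ler_pdivrMr// ltW//.
  exact: truncnS_gt.
apply: (@le_trans _ _ (C / K.+1%:R)%:E); last by rewrite lee_fin.
apply: (@le_trans _ _ (Pu (\bigcup_m B K m))).
  apply: (le_measure Pu (mem_set (measurableC mA)) (mem_set (bigcupT_measurable _ (mB K)))).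
  move=> u /= /forallNP/(_ K)/existsNP[m hm]; exists m => // n mn; rewrite ltnNge.
  by apply/negP => h; apply: hm; exists n.
have ndB : nondecreasing_seq (B K).
  by move=> m m' mm; apply/subsetPset => u h n mn; apply: h; exact: leq_trans mn.
have cB := nondecreasing_cvg_mu (mu := Pu) (mB K) (bigcupT_measurable _ (mB K)) ndB.
apply: (cvge_to_le cB); apply: nearW => m /=; apply: le_trans (marked_overflow m M K).
apply: (le_measure Pu (mem_set (mB K m)) (mem_set (mf m (fun x => (K < x)%N)))).
by move=> u; apply.
Qed.

Lemma sure_trace : sure Pu [set u | @trace R (limit_mark u)].
Proof.
have h := sureI sure_consistent (sureI sure_recurrent sure_no_escape).
rewrite (_ : mkset _ = [set u | consistent (limit_mark u)] `&`
  ([set u | @recurrently_bounded R (limit_mark u)] `&` [set u | no_escape (limit_mark u)]))//.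
by apply/seteqP; split => u [h1] => [h2 h3|[h2 h3]]; split.
Qed.

Lemma expn_homo m n j : (m <= n -> m ^ j <= n ^ j)%N.
Proof. by case: j => // j; rewrite leq_exp2r. Qed.

Lemma ffact_ge n j : ((n - j) ^ j <= n ^_ j)%N.
Proof.
elim: j => [//|j ih]; rewrite ffactnSr expnSr leq_mul// ?leq_sub2l//.
by apply: leq_trans ih; apply: expn_homo; apply: leq_sub2l.
Qed.

(** Bounds powers of a count by its factorial moments. *)
Lemma expn_le_ffact n j : (n ^ j <= (2 * j) ^ j + 2 ^ j * n ^_ j)%N.
Proof.
have [nj|jn] := leqP n (2 * j); first by apply: leq_trans (leq_addr _ _); exact: expn_homo.
apply: leq_trans (leq_addl _ _); apply: leq_trans (leq_mul (leqnn _) (ffact_ge n j)).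
by rewrite -expnMn; apply: expn_homo; lia.
Qed.

(** When two points of a window share a cell, this cell contributes to the sum,
    which pays for K of the tuples lost; the square pays for the rest. *)
Lemma lost_tuples n m k (W : 'I_k -> set E) M (K : R) (o : Omega m) : 0 < K ->
  (forall i, saturated n (W i)) -> (forall i, W i `<=` dwindow M) ->
  X_count W o - marked_count n W (@hits m o) <=
  K * (\sum_(c <- grid M n) X_count (fun _ : 'I_2 => cell (c, n)) o) +
  ((4 * k) ^ (2 * k))%:R / K +
  (2 ^ (2 * k))%:R / K * X_count (fun _ : 'I_(2 * k) => dwindow M) o.
Proof.
move=> K0 sW WM; have nD := nice_dwindow M; have fD := finite_X o nD.
have S0 : 0 <= \sum_(c <- grid M n) X_count (fun _ : 'I_2 => cell (c, n)) o.
  by apply: sumr_ge0 => c _; exact: fine_ge0.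
have [inj|] := pselect {in @X m o `&` dwindow M &, injective (@round R n)}.
  have -> : marked_count n W (@hits m o) = X_count W o.
    by rewrite /X_count /marked_count marked_hits (tuples_rounded_eq fD sW WM inj).
  rewrite subrr; apply: addr_ge0; first apply: addr_ge0.
  - by rewrite mulr_ge0// ltW.
  - by rewrite divr_ge0// ltW.
  - by rewrite mulr_ge0 ?divr_ge0 ?(ltW K0)//; exact: fine_ge0.
move=> ninj.
have S1 : 1 <= \sum_(c <- grid M n) X_count (fun _ : 'I_2 => cell (c, n)) o.
  have [[p q] /not_implyP[Ap /not_implyP[Aq /not_implyP[epq npq]]]] :
      exists pq : E * E, ~ (pq.1 \in @X m o `&` dwindow M -> pq.2 \in @X m o `&` dwindow M ->
        round n pq.1 = round n pq.2 -> pq.1 = pq.2).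
    by apply: contrapT => /forallNP h; apply: ninj => p q Ap Aq e; apply: contrapT => npq; apply: (h (p, q)) => /(_ Ap Aq e).
  move: Ap Aq epq npq => /set_mem[/= Ap Mp] /set_mem[/= Aq Mq] epq npq.
  have elev : lev n p = lev n q by exact: (@corner_inj R n).
  rewrite (big_rem (lev n p) (lev_grid n Mp)) /=.
  have S2 : 0 <= \sum_(c <- rem (lev n p) (grid M n)) X_count (fun _ : 'I_2 => cell (c, n)) o.
    by apply: sumr_ge0 => c _; exact: fine_ge0.
  rewrite -[X in X <= _]addr0; apply: lerD S2.
  rewrite X_count_diag; last exact: nice_cell.
  rewrite ler1n ffact_gt0 /npts.
  have fc : finite_set (@X m o `&` cell (lev n p, n)) by apply: finite_X; exact: nice_cell.
  have -> : 2%N = size [:: p; q] by [].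
  apply: uniq_leq_size => /=; first by rewrite inE andbT; apply/eqP.
  move=> r; rewrite !inE in_fset_set// => /orP[/eqP ->|/eqP ->]; apply: mem_set; split => //.
set N := npts (@X m o `&` dwindow M).
have h1 : X_count W o <= (N ^ k)%:R.
  apply: le_trans (X_count_le o nD WM) _; rewrite X_count_diag// ler_nat -/N.
  elim: k {W sW WM} => [//|k ih]; rewrite ffactnSr expnSr leq_mul// leq_subr//.
have h2 : (N ^ k)%:R <= K + (N ^ (2 * k))%:R / K :> R.
  rewrite mulnC expnM [X in X / K]natrX; set F : R := (N ^ k)%:R.
  have [FK|KF] := leP F K; first by rewrite (le_trans FK)// lerDl divr_ge0 ?(ltW K0)// exprn_even_ge0.
  have FF : F <= F ^+ 2 / K by rewrite ler_pdivlMr// expr2 ler_wpM2l// ltW.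
  by apply: le_trans FF _; rewrite lerDr ltW.
have h3 : (N ^ (2 * k))%:R / K <= ((4 * k) ^ (2 * k))%:R / K +
    (2 ^ (2 * k))%:R / K * X_count (fun _ : 'I_(2 * k) => dwindow M) o.
  rewrite X_count_diag// -/N mulrAC -mulrDl ler_pM2r ?invr_gt0// -natrM -natrD ler_nat.
  by have := expn_le_ffact N (2 * k); rewrite mulnA.
have h4 : 0 <= marked_count n W (@hits m o) by exact: fine_ge0.
have h5 : K <= K * (\sum_(c <- grid M n) X_count (fun _ : 'I_2 => cell (c, n)) o).
  by rewrite ler_peMr// ltW.
by move: h1 h2 h3 h4 h5; lra.
Qed.

Lemma cell_window M n c : c \in grid M n -> cell (c, n) `<=` (window M.+1 : set E).
Proof.
case/allpairsP => -[x y] [/=]; rewrite !mem_int_range => xM yM -> [x' xi].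
have t0 : 0 < (2 ^+ n : R) by rewrite exprn_gt0.
have t1 : 1 <= (2 ^+ n : R) by rewrite exprn_ege1// ler1n.
rewrite cellE => -[/= ->]; rewrite in_itv /= => /andP[].
rewrite ler_pdivrMr// ltr_pdivlMr// intrD => h1 h2; split => /=; first exact: leqW.
move: yM; rewrite -(ler_nat R) natr_absz intr_norm natrM natrX !ler_norml => /andP[h3 h4].
have aux (m v t z : R) : 1 <= t -> - (m * t) <= z -> z <= m * t -> z <= v * t -> v * t < z + 1 ->
    - (m + 1) <= v <= m + 1.
  move=> ht hz1 hz2 hx1 hx2; have ht0 : 0 < t by lra.
  apply/andP; split; rewrite -(ler_pM2r ht0) ?mulNr mulrDl mul1r; lra.
by rewrite -(addn1 M) natrD; exact: (aux M%:R xi (2 ^+ n) y%:~R).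
Qed.

(** There are of the order of 2^n cells, each with a mean number of pairs of
    order 4^-n. *)
Lemma pairs_in_cells M : exists2 L : R, 0 <= L & forall n,
  \sum_(c <- grid M n) fine (mean rho (fun _ : 'I_2 => cell (c, n))) <= L * (2^-1) ^+ n.
Proof.
have [D [D0 hD _]] := mean_bound hrho M.+1.
exists (((2 * M).+1 * (2 * M).+1)%:R * D 2%N) => [|n]; first by rewrite mulr_ge0.
apply: (@le_trans _ _ (\sum_(c <- grid M n) D 2%N * ((2^-1) ^+ n) ^+ 2)).
  rewrite big_seq [leRHS]big_seq; apply: ler_sum => c cg.
  have nc : nice (cell (c, n) : set E) by exact: nice_cell.
  rewrite -lee_fin fineK; last exact: nice_fin.
  apply: (hD 2%N (fun _ => cell (c, n)) ((2^-1) ^+ n)); first by rewrite exprn_ge0.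
  - by move=> _; case: nc.
  - by move=> _; exact: cell_window.
  - by move=> _; rewrite cl_cell lee_fin /= exprVn.
rewrite big_const_seq count_predT iter_addr_0 -[leLHS]mulr_natl.
have := size_grid M n; rewrite -(ler_nat R) natrM natrX => hs.
apply: le_trans (ler_wpM2r _ hs) _; first by rewrite mulr_ge0// exprn_ge0// exprn_ge0.
rewrite exprVn expr2 mulrA -!mulrA ler_wpM2l// mulrCA ler_wpM2l//.
by rewrite mulrA divff ?mul1r// expf_neq0.
Qed.

(** The tuples lost by discretization have a small mean: choose K large, then n. *)
Lemma marked_mean_cvg k (W : 'I_k -> set E) M l : (forall i, saturated l (W i)) ->
  (forall i, W i `<=` dwindow M) -> (forall i, nice (W i)) ->
  \int[Pu]_u marked_count n W (limit_mark u) @[n --> \oo] --> fine (mean rho W).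
Proof.
move=> sW WM nW; have nD := nice_dwindow M; have [L L0 hL] := pairs_in_cells M.
pose Q := ((4 * k) ^ (2 * k))%:R +
  (2 ^ (2 * k))%:R * fine (mean rho (fun _ : 'I_(2 * k) => dwindow M)).
have Q0 : 0 <= Q by rewrite addr_ge0 ?mulr_ge0//; exact/fine_ge0/mean_ge0.
have est n (K : R) : (l <= n)%N -> 0 < K ->
    fine (mean rho W) - \int[Pu]_u marked_count n W (limit_mark u) <= K * (L * (2^-1) ^+ n) + Q / K.
  move=> ln K0; have sWn i : saturated n (W i) := round_saturated ln (sW i).
  have iX m : (P m).-integrable setT (EFin \o (fun o => @X_count m k W o)) :=
    X_count_integrable m nD WM.
  have [_ iH cH] := marked_count_cvg n WM.
  have nc c : nice (cell (c, n) : set E) by exact: nice_cell.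
  have iC m c : (P m).-integrable setT (EFin \o (fun o => @X_count m 2 (fun=> cell (c, n)) o)) :=
    X_count_integrable m (nc c) (fun _ => @subset_refl _ _).
  have iF m : (P m).-integrable setT (EFin \o (fun o => @X_count m (2 * k) (fun=> dwindow M) o)) :=
    X_count_integrable m nD (fun _ => @subset_refl _ _).
  have iS m (s : seq (int * int)) : (P m).-integrable setT
      (EFin \o (fun o => \sum_(c <- s) @X_count m 2 (fun=> cell (c, n)) o)) /\
      \int[P m]_o (\sum_(c <- s) @X_count m 2 (fun=> cell (c, n)) o) =
      \sum_(c <- s) \int[P m]_o @X_count m 2 (fun=> cell (c, n)) o.
    elim: s => [|c s [ih1 ih2]].
      rewrite (_ : (fun o => _) = cst 0); last by apply/funext => o; rewrite big_nil.
      by rewrite big_nil; split; [exact: integrable0|rewrite /Rintegral integral0].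
    rewrite (_ : (fun o => _) = (fun o => @X_count m 2 (fun=> cell (c, n)) o +
        \sum_(c <- s) @X_count m 2 (fun=> cell (c, n)) o)); last first.
      by apply/funext => o; rewrite big_cons.
    by rewrite big_cons RintegralD// ih2; split => //; exact: (integrableD measurableT (iC m c) ih1).
  pose e2 := (2 ^ (2 * k))%:R / K.
  have step m : \int[P m]_o @X_count m k W o - \int[P m]_o marked_count n W (@hits m o) <=
      K * (\sum_(c <- grid M n) \int[P m]_o @X_count m 2 (fun=> cell (c, n)) o) +
      ((4 * k) ^ (2 * k))%:R / K + e2 * \int[P m]_o @X_count m (2 * k) (fun=> dwindow M) o.
    have [iG eG] := iS m (grid M n).
    have iKG := integrableZl measurableT K iG.
    have iCst := finite_measure_integrable_cst (P m) (((4 * k) ^ (2 * k))%:R / K) measurableT.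
    have iE := integrableZl measurableT e2 (iF m).
    rewrite -eG.
    have -> : K * \int[P m]_o (\sum_(c <- grid M n) @X_count m 2 (fun=> cell (c, n)) o) =
      \int[P m]_o (K * (\sum_(c <- grid M n) @X_count m 2 (fun=> cell (c, n)) o)).
      by rewrite RintegralZl.
    have -> : e2 * \int[P m]_o @X_count m (2 * k) (fun=> dwindow M) o =
      \int[P m]_o (e2 * @X_count m (2 * k) (fun=> dwindow M) o) by rewrite RintegralZl.
    rewrite -RintegralB//.
    have -> : ((4 * k) ^ (2 * k))%:R / K = \int[P m]_o (((4 * k) ^ (2 * k))%:R / K).
      have pm : fine (P m [set: Omega m]) = 1 by rewrite probability_setT.
      by rewrite Rintegral_cst// -[LHS]mulr1; congr (_ * _); exact/esym/pm.
    have iA := integrableD measurableT iKG iCst.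
    rewrite -RintegralD// -RintegralD//; apply: le_Rintegral => //.
    - exact: (integrableB measurableT (iX m) (iH m)).
    - exact: (integrableD measurableT iA iE).
    - by move=> o _; exact: lost_tuples K0 sWn WM.
  have lim1 : (fun m => K * (\sum_(c <- grid M n) \int[P m]_o @X_count m 2 (fun=> cell (c, n)) o) +
      ((4 * k) ^ (2 * k))%:R / K + e2 * \int[P m]_o @X_count m (2 * k) (fun=> dwindow M) o) @ \oo -->
      K * (\sum_(c <- grid M n) fine (mean rho (fun _ : 'I_2 => cell (c, n)))) +
      ((4 * k) ^ (2 * k))%:R / K + e2 * fine (mean rho (fun _ : 'I_(2 * k) => dwindow M)).
    apply: cvgD; first apply: cvgD; [apply: cvgMr|exact: cvg_cst|apply: cvgMr].
      elim: (grid M n) => [|c s ih]; first by rewrite big_nil; under eq_fun do rewrite big_nil; exact: cvg_cst.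
      rewrite big_cons; under eq_fun do rewrite big_cons; apply: cvgD ih.
      exact: (X_count_cvg (nc c) (fun _ => @subset_refl _ _) (fun _ => nc c)).
    exact: (X_count_cvg nD (fun _ => @subset_refl _ _) (fun _ => nD)).
  have lim0 : (\int[P m]_o @X_count m k W o - \int[P m]_o marked_count n W (@hits m o)) @[m --> \oo] -->
      fine (mean rho W) - \int[Pu]_u marked_count n W (limit_mark u).
    by apply: cvgB => //; exact: X_count_cvg nD WM nW.
  have h1 : fine (mean rho W) - \int[Pu]_u marked_count n W (limit_mark u) <=
      K * (\sum_(c <- grid M n) fine (mean rho (fun _ : 'I_2 => cell (c, n)))) +
      ((4 * k) ^ (2 * k))%:R / K + e2 * fine (mean rho (fun _ : 'I_(2 * k) => dwindow M)).
    rewrite -subr_ge0; have lim2 := cvgB lim1 lim0.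
    apply: (cvgr_to_ge (lim2 _)).
    by apply: nearW => m; rewrite subr_ge0; exact: step.
  apply: le_trans h1 _.
  rewrite -addrA lerD//; last by rewrite /Q mulrDl /e2 mulrAC.
  by rewrite ler_wpM2l ?(ltW K0)//; exact: hL.
apply/cvgrPdist_le => e e0.
pose K := Q / (e / 2) + 1.
have K0 : 0 < K by rewrite ltr_wpDl ?divr_ge0// ltW// divr_gt0.
have QK : Q / K <= e / 2.
  rewrite ler_pdivrMr// mulrC -ler_pdivrMr; last by rewrite divr_gt0.
  by rewrite /K lerDl.
have : K * (L * (2^-1) ^+ n) @[n --> \oo] --> 0.
  rewrite -[X in _ --> X](mulr0 K) -(mulr0 L); apply: cvgMr; apply: cvgMr; apply: cvg_expr.
  by rewrite ger0_norm//; lra.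
move=> /cvgrPdist_le/(_ (e / 2) ltac:(by rewrite divr_gt0))[N _ hN].
exists (maxn N l) => // n /=; rewrite geq_max => /andP[Nn ln].
rewrite ger0_norm; last first.
  by rewrite subr_ge0; exact: marked_mean_le (fun i => round_saturated ln (sW i)) WM nW.
apply: le_trans (est n K ln K0) _; have := hN n Nn; rewrite /= sub0r normrN.
by move=> /(le_trans (ler_norm _)); move: QK; lra.
Qed.

Definition limit_process (u : T) : set E := limit_config (limit_mark u).

Lemma limit_process_finite M u : finite_set (limit_process u `&` dwindow M).
Proof.
have [tr|ntr] := pselect (@trace R (limit_mark u)); first exact: limit_config_finite.
by rewrite (_ : _ `&` _ = set0)//; apply/seteqP; split => // p [[/ntr]].
Qed.

(** Rounding is injective on a finite set at fine levels, so that the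
    discretized counts tend to the exact ones from below: Fatou's lemma gives
    one inequality between the means, monotonicity the other. *)
Lemma saturated_counts k (W : 'I_k -> set E) M l : (forall i, saturated l (W i)) ->
  (forall i, W i `<=` dwindow M) -> (forall i, nice (W i)) ->
  measurable_fun [set: T] (fun u => @counting (k.-tuple E) R (tuples (limit_process u) W)) /\
  (\int[Pu]_u @counting (k.-tuple E) R (tuples (limit_process u) W) = mean rho W)%E.
Proof.
move=> sW WM nW; set A := fun u => @counting (k.-tuple E) R (tuples (limit_process u) W).
have [mtr tr0] := sure_trace; set tr := [set u | @trace R (limit_mark u)] in mtr tr0.
pose a n (u : T) : \bar R := (marked_count n W (limit_mark u))%:E.
pose g n (u : T) := if u \in tr then a n u else @counting (k.-tuple E) R (tuples (set0 : set E) W).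
have ma n : measurable_fun [set: T] (a n).
  by have [h _ _] := marked_count_cvg n WM; case/integrableP: h.
have mg n : measurable_fun [set: T] (g n).
  apply: measurable_fun_ifT; [|exact: ma|exact: measurable_cst].
  apply: (measurable_fun_bool true); rewrite setTI (_ : _ @^-1` _ = tr)//.
  by apply/seteqP; split => u /=; [move/set_mem|exact: mem_set].
have aE n u : a n u = @counting (k.-tuple E) R (tuples (marked (limit_mark u) n) W).
  by rewrite /a /marked_count fineK//; exact: counting_tuples_fin (finite_marked _ _ M) WM.
have le_A n u : (l <= n)%N -> tr u -> (a n u <= A u)%E.
  move=> ln htr; rewrite aE -(rounded_limit_config htr).
  apply: tuples_rounded_le (limit_process_finite M u) _ WM.
  by move=> i; exact: round_saturated ln (sW i).
have eq_A u : tr u -> \forall n \near \oo, a n u = A u.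
  move=> htr; have [N _ hN] := near_round_inj (limit_process_finite M u).
  exists (maxn N l) => // n /=; rewrite geq_max => /andP[Nn ln].
  rewrite aE -(rounded_limit_config htr).
  apply: (tuples_rounded_eq (limit_process_finite M u) (fun i => round_saturated ln (sW i)) WM).
  exact: hN.
have out u : ~ tr u -> limit_process u = set0.
  by move=> ntr; apply/seteqP; split => // p [/ntr].
have g_cvg u : g^~ u @ \oo --> A u.
  have [htr|ntr] := pselect (tr u).
    apply: cvg_near_cst; have := eq_A u htr; apply: filterS => n <-.
    by rewrite /g mem_set.
  rewrite (_ : g^~ u = fun=> A u); first exact: cvg_cst.
  by apply/funext => n; rewrite /g memNset// /A out.
have mA : measurable_fun [set: T] A by exact: (emeasurable_fun_cvg g _ mg (fun u _ => g_cvg u)).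
split => //.
have fm : mean rho W \is a fin_num by exact: nice_fin.
have ia n : (\int[Pu]_u a n u = (\int[Pu]_u marked_count n W (limit_mark u))%:E)%E.
  have [h _ _] := marked_count_cvg n WM.
  by rewrite /Rintegral fineK//; exact: (integrable_fin_num measurableT h).
have ca : (\int[Pu]_u a n u @[n --> \oo] --> mean rho W)%E.
  by rewrite (funext ia) -(fineK fm); apply: cvg_EFin; [exact: nearW|exact: marked_mean_cvg sW WM nW].
have ntr0 : Pu.-negligible (~` tr) by exists (~` tr); split => //; exact: measurableC.
apply/eqP; rewrite eq_le; apply/andP; split.
  have -> : (\int[Pu]_u A u = \int[Pu]_u limn_einf (g^~ u))%E.
    by apply: eq_integral => u _; rewrite (cvg_limn_einf_sup (g_cvg u)).1.
  apply: le_trans (fatou _ measurableT mg _) _.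
    by move=> n u _; rewrite /g; case: ifP => // _; rewrite lee_fin fine_ge0.
  rewrite (_ : (fun n => _) = (fun n => \int[Pu]_u a n u)%E); first by rewrite (cvg_limn_einf_sup ca).1.
  apply/funext => n; apply: ae_eq_integral => //.
  apply: (negligibleS _ ntr0) => u /= h htr; apply: h => _.
  by rewrite /g mem_set.
apply: (cvge_to_le ca); exists l => // n /= ln.
apply: (ae_ge0_le_integral measurableT _ (ma n) _ mA) => //.
- by move=> u _; rewrite lee_fin fine_ge0.
- by apply: (negligibleS _ ntr0) => u /= h htr; apply: h => _; exact: le_A.
Qed.

End limit_process.

(** * Correlation functions of the limit process *)

Section box_counts.
Context {R : realType}.
Local Notation T := (measurableTypeR R).
Local Notation E := (int * T)%type.
Local Notation cl := (@counting_lebesgue R).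

Lemma dwindow_homo M N : (M <= N)%N -> dwindow M `<=` (dwindow N : set E).
Proof.
move=> MN p [h1 /andP[h2 h3]]; split; first exact: leq_trans MN.
have h : M%:R <= N%:R :> R by rewrite ler_nat.
by apply/andP; split; [apply: le_trans h2; rewrite lerN2|exact: lt_le_trans h].
Qed.

Lemma window_dwindow M : window M `<=` (dwindow M.+1 : set E).
Proof.
move=> p [h1 h2]; split; first exact: leqW.
have h : M%:R < M.+1%:R :> R by rewrite ltr_nat.
move: h2; rewrite ler_norml => /andP[h2 h3]; apply/andP; split; last exact: le_lt_trans h.
by apply: le_trans h2; rewrite lerN2 ltW.
Qed.

Lemma in_dwindow (p : E) : exists M, dwindow M p.
Proof.
have : (\bigcup_M window M) p by rewrite bigcup_window.
by case=> M _ /window_dwindow h; exists M.+1.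
Qed.

Lemma measurable_dwindow M : measurable (dwindow M : set E).
Proof. by case: (@nice_dwindow R M). Qed.

(** Dyadically saturated sets form a pi-system that generates the Borel sets. *)
Definition dyadic (B : set E) := nice B /\ exists l, saturated l B.

Lemma dyadic_setI : setI_closed dyadic.
Proof.
move=> A B [nA [l lA]] [nB [m mB]]; split; first exact: nice_setI.
exists (maxn l m) => p.
have hA := round_saturated (leq_maxl l m) lA p; have hB := round_saturated (leq_maxr l m) mB p.
by split => -[/hA ? /hB ?].
Qed.

Lemma dyadic_dwindow M : dyadic (dwindow M).
Proof. by split; [exact: nice_dwindow|exists 0%N; exact: saturated_dwindow]. Qed.

Lemma dyadic_cell c : dyadic (cell c).
Proof. by split; [exact: nice_cell|exists c.2 => p; rewrite /cell /round /= lev_corner]. Qed.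

Lemma dyadic_generates : @measurable _ E = <<s dyadic >>.
Proof.
apply/seteqP; split; last first.
  apply: smallest_sub; first exact: sigma_algebra_measurable.
  by move=> B [[mB _ _] _].
pose S := g_sigma_algebraType dyadic.
have mcell (c : int * int * nat) : measurable (cell c : set S) by apply: sub_sigma_algebra; exact: dyadic_cell.
have m1 n : measurable_fun [set: S] (fun p : S => (lev n p).1 : int).
  apply: measurable_to_int => y.
  rewrite (_ : _ @^-1` _ = [set p | exists b : int, cell ((y, b), n) p]).
    by apply: measurable_exists => b; exact: mcell.
  by apply/seteqP; split => [p h|p [b h]]; [exists (lev n p).2; rewrite /cell /= -[in RHS]h|exact: (congr1 fst h)].
have m2 n : measurable_fun [set: S] (fun p : S => (lev n p).2 : int).
  apply: measurable_to_int => y.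
  rewrite (_ : _ @^-1` _ = [set p | exists b : int, cell ((b, y), n) p]).
    by apply: measurable_exists => b; exact: mcell.
  by apply/seteqP; split => [p h|p [b h]]; [exists (lev n p).1; rewrite /cell /= -[in RHS]h|exact: (congr1 snd h)].
have m3 : measurable_fun [set: S] (fun p : S => p.2 : T).
  have m4 n : measurable_fun [set: S] (fun p : S => (2 ^- n * (lev n p).2%:~R : R)).
    move=> _ B mB; have := m2 n measurableT [set y : int | B (2 ^- n * y%:~R)] I.
    by rewrite !setTI.
  apply: (measurable_fun_cvg m4) => p _; rewrite /lev /=.
  have hp n : 0 < 2 ^- n :> R by rewrite invr_gt0 exprn_gt0.
  have hz : (2 ^- n : R) @[n --> \oo] --> (0 : R).
    rewrite (_ : (fun n => 2 ^- n : R) = (fun n => (2^-1) ^+ n)); last by apply/funext => n; rewrite exprVn.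
    by apply: cvg_expr; rewrite ger0_norm//; lra.
  have := cvg_floor_div (xi := p.2 : R) hp hz.
  by rewrite (_ : (fun n => _ * _) = (fun n => (2 ^- n * (Num.floor (p.2 * 2 ^+ n))%:~R : R)))//;
    apply/funext => n; rewrite invrK.
have m0 : measurable_fun [set: S] (fun p : S => (p.1, p.2) : E) := measurable_fun_pair (m1 0%N) m3.
move=> B mB; have := m0 measurableT B mB; rewrite setTI.
by rewrite (_ : _ @^-1` _ = B)//; apply/seteqP; split => -[x xi].
Qed.

Variable rho : forall k, k.-tuple E -> R.
Hypothesis hrho : density rho.
Context d (O : measurableType d) (P : probability O R).
Variable Y : O -> set E.
Hypothesis fY : forall M o, finite_set (Y o `&` dwindow M).
Hypothesis sY : forall k (W : 'I_k -> set E) M l, (forall i, saturated l (W i)) ->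
  (forall i, W i `<=` dwindow M) -> (forall i, nice (W i)) ->
  measurable_fun [set: O] (fun o => @counting (k.-tuple E) R (tuples (Y o) W)) /\
  (\int[P]_o @counting (k.-tuple E) R (tuples (Y o) W) = mean rho W)%E.

(** Campbell's formula for the box W, with the measurability that it requires. *)
Definition campbell k (W : 'I_k -> set E) :=
  measurable_fun [set: O] (fun o => @counting (k.-tuple E) R (tuples (Y o) W)) /\
  (\int[P]_o @counting (k.-tuple E) R (tuples (Y o) W) = mean rho W)%E.

Lemma measurable_finite_tuples k (S : set (k.-tuple E)) : finite_set S -> measurable S.
Proof.
move=> fS; rewrite (_ : S = \bigcup_(s in S) [set s]); last first.
  by apply/seteqP; split => [s Ss|s [_ h ->]//]; exists s.
apply: fin_bigcup_measurable => // s _.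
rewrite (_ : [set s] = \bigcap_(i in [set: 'I_k]) ((fun u => tnth u i) @^-1` [set tnth s i])).
  apply: fin_bigcap_measurable => // i _; rewrite -[X in measurable X]setTI.
  apply: (measurable_tnth i) => //; case: (tnth s i) => x xi.
  rewrite (_ : [set (x, xi)] = [set x] `*` [set xi]); first exact: measurableX.
  by apply/seteqP; split => -[y z] /= [-> ->].
by apply/seteqP; split => [_ -> //|u h]; apply: eq_from_tnth => i; exact: h.
Qed.

Lemma measurable_tuples k (W : 'I_k -> set E) o : measurable (tuples (Y o) W).
Proof.
rewrite (_ : tuples (Y o) W = \bigcup_M tuples (Y o) (fun i => W i `&` dwindow M)); last first.
  apply/seteqP; split => [s [us hs]|s [M _ [us hs]]]; last first.
    by split => // i; have [h1 [h2 _]] := hs i.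
  have /choice[m hm] := fun i => in_dwindow (tnth s i); exists (\max_i m i)%N => //; split => // i.
  have [h1 h2] := hs i; split => //; split => //.
  by apply: dwindow_homo (hm i); exact: leq_bigmax.
apply: bigcupT_measurable => M; apply: measurable_finite_tuples.
have sub : forall s, tuples (Y o) (fun i => W i `&` dwindow M) s -> {subset s <= fset_set (Y o `&` dwindow M)}.
  by apply: tuples_sub => i p [h1 [h2 h3]]; rewrite in_fset_set//; apply: mem_set.
exact: (card_tuples (fset_uniq _) sub).1.
Qed.

Lemma counting_bigcup k (W : 'I_k -> set E) j (F : (set E)^nat) o : trivIset setT F ->
  (@counting _ R (tuples (Y o) (with_side W j (\bigcup_n F n))) =
   \sum_(n <oo) @counting _ R (tuples (Y o) (with_side W j (F n))))%E.
Proof.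
move=> tF.
rewrite (_ : tuples _ _ = \bigcup_n tuples (Y o) (with_side W j (F n))).
  rewrite measure_bigcup//; first by apply: eq_eseriesl => n; rewrite in_setT.
    by move=> n _; exact: measurable_tuples.
  apply/trivIsetP => n m _ _ nm; apply/seteqP; split => // s [[_ /(_ j) [_ h1]] [_ /(_ j) [_ h2]]].
  move: h1 h2; rewrite /with_side eqxx => h1 h2.
  have /trivIsetP/(_ n m I I nm) e := tF.
  have : (F n `&` F m) (tnth s j) by split; [exact: h1|exact: h2].
  by rewrite e.
apply/seteqP; split => [s [us hs]|s [n _ [us hs]]].
  have [_] := hs j; rewrite /with_side eqxx => -[n _ hn]; exists n => //; split => // i.
  by have [h1 h2] := hs i; split => //; move: h2; rewrite /with_side; case: eqP => [->|].
split => // i; have [h1 h2] := hs i; split => //; move: h2; rewrite /with_side; case: eqP => // _ h.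
by exists n.
Qed.

Let mrho k := mrho_EFin hrho (k := k).
Let rho0 k (s : k.-tuple E) : (0 <= (rho s)%:E)%E. Proof. by rewrite lee_fin; case: hrho. Qed.

Lemma mean_bigcup k (W : 'I_k -> set E) j (F : (set E)^nat) : (forall i, measurable (W i)) ->
  (forall n, measurable (F n)) -> trivIset setT F ->
  (mean rho (with_side W j (\bigcup_n F n)) = \sum_(n <oo) mean rho (with_side W j (F n)))%E.
Proof. by move=> mW mF tF; apply: (box_integral_bigcup parametric_counting_lebesgue). Qed.

Lemma campbell_bigcup k (W : 'I_k -> set E) j (F : (set E)^nat) : (forall i, measurable (W i)) ->
  (forall n, measurable (F n)) -> trivIset setT F ->
  (forall n, campbell (with_side W j (F n))) -> campbell (with_side W j (\bigcup_n F n)).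
Proof.
move=> mW mF tF hF.
rewrite /campbell mean_bigcup// (funext (fun o => counting_bigcup W j o tF)); split.
  rewrite (_ : (fun o => _) = (fun o => \sum_(n <oo | n \in [set: nat])
     @counting _ R (tuples (Y o) (with_side W j (F n)))))%E; last first.
    by apply/funext => o; apply: eq_eseriesl => n; rewrite in_setT.
  by apply: ge0_emeasurable_sum => // n _; case: (hF n).
rewrite integral_nneseries//; last by move=> n; case: (hF n).
by apply: eq_eseriesr => n _; case: (hF n).
Qed.

Lemma nneseries2 (f : nat -> \bar R) : (forall n, (0 <= f n)%E) -> (forall n, f n.+2 = 0%E) ->
  (\sum_(n <oo) f n = f 0%N + f 1%N)%E.
Proof.
move=> f0 f2; rewrite (nneseries_split 0 2)// eseries0 ?adde0; last by case=> [|[]].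
by rewrite big_nat_recr//= big_nat1.
Qed.

Lemma with_side0 k (W : 'I_k -> set E) j :
  (forall o, @counting _ R (tuples (Y o) (with_side W j set0)) = 0%E) /\
  mean rho (with_side W j set0) = 0%E.
Proof.
have w0 i : i = j -> with_side W j set0 i = set0 by move=> ->; rewrite /with_side eqxx.
split=> [z|].
  rewrite (_ : tuples _ _ = set0) ?measure0//; apply/seteqP; split => // s [_ /(_ j)[_]].
  by rewrite w0.
rewrite /mean -(box_integral0 cl (with_side W j set0)); apply: eq_box_integral => s /(_ j).
by rewrite w0.
Qed.

Lemma campbell_setD k (W : 'I_k -> set E) M j (B : set E) : (forall i, measurable (W i)) ->
  (forall i, W i `<=` dwindow M) -> measurable B -> B `<=` dwindow M ->
  campbell (with_side W j B) -> campbell (with_side W j (dwindow M)) ->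
  campbell (with_side W j (dwindow M `\` B)).
Proof.
move=> mW WM mB BM [mN eN] [mN' eN']; have mD := measurable_dwindow M.
have mDB := measurableD mD mB; have [c0 m0] := with_side0 W j.
have eD : dwindow M = \bigcup_n bigcup2 B (dwindow M `\` B) n by rewrite bigcup2E setDUK.
have tF : trivIset setT (bigcup2 B (dwindow M `\` B)).
  by rewrite -trivIset_bigcup2 setDIK.
have mF n : measurable (bigcup2 B (dwindow M `\` B) n) by rewrite /bigcup2; case: n => [|[|n]] /=; [exact: mB|exact: mDB|exact: measurable0].
have sN o : (@counting _ R (tuples (Y o) (with_side W j (dwindow M))) =
    @counting _ R (tuples (Y o) (with_side W j B)) +
    @counting _ R (tuples (Y o) (with_side W j (dwindow M `\` B))))%E.
  by rewrite {1}eD counting_bigcup// nneseries2//.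
have sM : (mean rho (with_side W j (dwindow M)) =
    mean rho (with_side W j B) + mean rho (with_side W j (dwindow M `\` B)))%E.
  by rewrite {1}eD mean_bigcup// nneseries2// => n; exact: mean_ge0.
have wM C : C `<=` dwindow M -> forall i, with_side W j C i `<=` dwindow M.
  by move=> CM i; rewrite /with_side; case: ifP.
have fc C o : C `<=` dwindow M -> @counting _ R (tuples (Y o) (with_side W j C)) \is a fin_num.
  by move=> CM; apply: counting_tuples_fin (fY M o) _; exact: wM.
have fm C : measurable C -> C `<=` dwindow M -> mean rho (with_side W j C) \is a fin_num.
  move=> mC CM; apply: (mean_fin hrho (M := M)); first exact: with_side_measurable.
  by move=> i; apply: subset_trans (wM _ CM i) _; exact: dwindow_window.
have DM : dwindow M `\` B `<=` (dwindow M : set E) by move=> p [].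
have mN'' : measurable_fun [set: O]
    (fun o => @counting _ R (tuples (Y o) (with_side W j (dwindow M `\` B)))).
  rewrite (_ : (fun o => _) = (fun o => @counting _ R (tuples (Y o) (with_side W j (dwindow M)))
    - @counting _ R (tuples (Y o) (with_side W j B)))%E); first exact: emeasurable_funB.
  by apply/funext => o; rewrite sN addeAC subee ?add0e//; exact: fc.
split => //; move: eN'; rewrite sM -eN.
rewrite (eq_integral (fun o => @counting _ R (tuples (Y o) (with_side W j B)) +
    @counting _ R (tuples (Y o) (with_side W j (dwindow M `\` B))))%E); last by move=> o _.
rewrite ge0_integralD//; have : (\int[P]_o @counting _ R (tuples (Y o) (with_side W j B)))%E \is a fin_num.
  by rewrite eN; exact: fm.
move: (\int[P]_o _)%E => a fa /(congr1 (fun x => x - a)%E).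
by rewrite !(addeAC a _ (- a)%E) subee// !add0e.
Qed.

Lemma with_side_id k (W : 'I_k -> set E) j : with_side W j (W j) = W.
Proof. by apply/funext => i; rewrite /with_side; case: eqP => [->|]. Qed.

(** Dynkin's pi-lambda theorem in each side of the box in turn. *)
Lemma campbell_bounded k M (W : 'I_k -> set E) : (forall i, measurable (W i)) ->
  (forall i, W i `<=` dwindow M) -> campbell W.
Proof.
suff h (j : nat) : forall W : 'I_k -> set E, (forall i, measurable (W i)) ->
    (forall i, W i `<=` dwindow M) -> (forall i : 'I_k, (j <= i)%N -> dyadic (W i)) -> campbell W.
  by move=> mW WM; apply: (h k) => // i; rewrite leqNgt ltn_ord.
elim: j => [|j ih] {}W mW WM dW.
  have /choice[l hl] : forall i, exists l, saturated l (W i) by move=> i; case: (dW i isT).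
  apply: (sY (l := (\max_i l i)%N) _ WM) => i; last by case: (dW i isT).
  by apply: round_saturated (hl i); exact: leq_bigmax.
have [jk|kj] := ltnP j k; last first.
  by apply: ih => // i ji; have := leq_trans (ltn_ord i) (leq_trans kj ji); rewrite ltnn.
pose jo := Ordinal jk; have mD := measurable_dwindow M.
have step B : dyadic B -> campbell (with_side W jo (B `&` dwindow M)).
  move=> dB; apply: ih.
  - apply: with_side_measurable => //; apply: measurableI => //; by case: dB => -[].
  - by move=> i; rewrite /with_side; case: eqP => [_ p []|].
  move=> i ji; rewrite /with_side; case: eqP => [_|/eqP ij]; first exact: dyadic_setI dB (dyadic_dwindow M).
  apply: dW; rewrite ltn_neqAle ji andbT; apply: contra ij => /eqP e; exact/eqP/val_inj.
have QT : campbell (with_side W jo ([set: E] `&` dwindow M)).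
  by rewrite setTI -[dwindow M]setIid; exact: step (dyadic_dwindow M).
rewrite -(with_side_id W jo) -(setIidl (WM jo)).
apply: (dynkin_induction (P := fun B => campbell (with_side W jo (B `&` dwindow M)))
  dyadic_generates dyadic_setI QT step).
- move=> B mB h; rewrite (_ : ~` B `&` _ = dwindow M `\` (B `&` dwindow M)); last first.
    by rewrite setDE setCI setIUr setICr setU0 setIC.
  apply: campbell_setD => //; first exact: measurableI.
  by move: QT; rewrite setTI.
- move=> F mF tF hF; rewrite setI_bigcupl; apply: campbell_bigcup => //.
    by move=> n; exact: measurableI.
  by apply/trivIsetP => n m _ _ nm; have /trivIsetP/(_ n m I I nm) e := tF; rewrite setIACA e set0I.
by rewrite -dyadic_generates; exact: mW.
Qed.

(** Each side is cut into bounded pieces. *)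
Lemma campbell_box k (W : 'I_k -> set E) : (forall i, measurable (W i)) -> campbell W.
Proof.
suff h (j : nat) : forall W : 'I_k -> set E, (forall i, measurable (W i)) ->
    (forall i : 'I_k, (j <= i)%N -> exists M, W i `<=` dwindow M) -> campbell W.
  by move=> mW; apply: (h k) => // i; rewrite leqNgt ltn_ord.
elim: j => [|j ih] {}W mW dW.
  have /choice[l hl] : forall i, exists l, W i `<=` dwindow l by move=> i; exact: dW.
  apply: (@campbell_bounded k (\max_i l i)%N W mW) => i.
  by apply: subset_trans (hl i) (dwindow_homo _); exact: leq_bigmax.
have [jk|kj] := ltnP j k; last first.
  by apply: ih => // i ji; have := leq_trans (ltn_ord i) (leq_trans kj ji); rewrite ltnn.
pose jo := Ordinal jk; pose F := seqDU (fun M => W jo `&` dwindow M).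
have mF n : measurable (F n).
  by apply: seqDU_measurable => M; apply: measurableI => //; exact: measurable_dwindow.
rewrite -(with_side_id W jo) (_ : W jo = \bigcup_n F n); last first.
  rewrite -seqDU_bigcup_eq -setI_bigcupr setIidl// => p _.
  by have [M hM] := in_dwindow p; exists M.
apply: campbell_bigcup => //; first exact: trivIset_seqDU.
move=> n; apply: ih; first exact: with_side_measurable.
move=> i ji; rewrite /with_side; case: eqP => [_|/eqP ij].
  by exists n => p [[_ hp] _].
apply: dW; rewrite ltn_neqAle ji andbT; apply: contra ij => /eqP e; exact/eqP/val_inj.
Qed.

End box_counts.

(** * Convergence of the numbers of points in intervals *)

Section counting_bijections.
Context {R : realType}.

Lemma counting_bij d (S : measurableType d) d' (S' : measurableType d') (g : S -> S') (g' : S' -> S)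
    (A : set S) (B : set S') : B `<=` g @` A -> A `<=` g' @` B ->
  @counting _ R A = @counting _ R B.
Proof.
move=> BA AB; have [fA|nfA] := pselect (finite_set A); last first.
  have nfB : ~ finite_set B by move=> fB; apply: nfA; exact: sub_finite_set AB (finite_image _ fB).
  by rewrite /counting !asboolF.
have fB : finite_set B by exact: sub_finite_set BA (finite_image _ fA).
by apply/eqP; rewrite eq_le (counting_le_image fB AB) (counting_le_image fA BA).
Qed.

End counting_bijections.

Section counts_in_intervals.
Context {R : realType}.
Local Notation T := (measurableTypeR R).
Local Notation E := (int * T)%type.

Lemma counting_npts (A : set E) : finite_set A -> @counting _ R A = (npts A)%:R%:E.
Proof. by move=> fA; rewrite /counting asboolT. Qed.

Lemma grid_uniq M n : uniq (grid M n).
Proof.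
apply: allpairs_uniq; last by move=> [a b] [a' b'] _ _.
  by rewrite map_inj_uniq ?iota_uniq// => i j /addIr [].
by rewrite map_inj_uniq ?iota_uniq// => i j /addIr [].
Qed.

(** The points are then in bijection with the cells that they hit. *)
Lemma npts_cells M n (A W : set E) : finite_set (A `&` W) -> W `<=` dwindow M ->
  (forall c, c \in grid M n -> finite_set (A `&` cell (c, n)) /\ (npts (A `&` cell (c, n)) < 2)%N) ->
  npts (A `&` W) = count (fun c => `[< A `&` (W `&` cell (c, n)) !=set0 >]) (grid M n).
Proof.
move=> fA WM h1; rewrite -size_filter /npts -(size_map (lev n)).
have inA p : p \in fset_set (A `&` W) -> A p /\ W p by rewrite in_fset_set// => /set_mem.
apply/perm_size/uniq_perm; last 1 first.
- move=> c; rewrite mem_filter; apply/mapP/andP => [[p pA ->]|[/asboolP[p [Ap [Wp pc]]] cg]].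
    have [Ap Wp] := inA p pA; split; last by apply: lev_grid; exact: WM.
    by apply/asboolP; exists p.
  by exists p => //; rewrite in_fset_set// mem_set.
- rewrite map_inj_in_uniq ?fset_uniq// => p q /inA[Ap Wp] /inA[Aq Wq] e.
  have [fc] := h1 _ (lev_grid n (WM _ Wp)); apply: contraTeq => pq; rewrite -leqNgt /npts.
  have -> : 2%N = size [:: p; q] by [].
  apply: uniq_leq_size => /=; first by rewrite inE andbT.
  move=> r; rewrite !inE in_fset_set// => /orP[/eqP ->|/eqP ->]; apply: mem_set; split => //.
- exact/filter_uniq/grid_uniq.
Qed.

Variables (m : nat) (x : 'I_m -> int) (I : 'I_m -> interval R).
Hypothesis bI : forall j, bounded_set [set` I j].

Let W j : set E := [set x j] `*` [set` I j].

Let nW j : nice (W j). Proof. exact: nice_thread. Qed.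

Lemma interval_countsE (A : set E) : (forall M, finite_set (A `&` window M)) ->
  interval_counts x I A = fun j => npts (A `&` W j).
Proof.
move=> fA; apply/funext => j; have [_ [M WM] _] := nW j.
have fW : finite_set (A `&` W j) by apply: sub_finite_set (fA M); exact: setIS.
have fI : finite_set [set xi : T | xi \in I j /\ A (x j, xi)].
  apply: (@sub_finite_set _ _ (snd @` (A `&` W j))); last exact: finite_image.
  by move=> xi [h1 h2]; exists (x j, xi).
have : @counting T R [set xi : T | xi \in I j /\ A (x j, xi)] = @counting E R (A `&` W j).
  apply: (counting_bij (g := pair (x j)) (g' := snd)).
    by move=> [y xi] [h1 [/= ? h2]]; subst y; exists xi.
  by move=> xi [h1 h2]; exists (x j, xi).
by rewrite counting_npts// /counting asboolT// => -[/eqP]; rewrite eqr_nat => /eqP.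
Qed.

Variables (M : nat) (WM : forall j, W j `<=` dwindow M).

Let keys n := [seq (j, c) | j <- enum 'I_m, c <- grid M n].
Let quads n := [seq W k.1 `&` cell (k.2, n) | k <- keys n].

Let nice_quads n : every (@nice R) (quads n).
Proof. by apply: every_map => k; apply: nice_setI; [exact: nW|exact: nice_cell]. Qed.

Let word_count n (w : seq bool) (j : 'I_m) : nat :=
  count (fun c => nth false w (index (j, c) (keys n))) (grid M n).

Section one_process.
Context d (O : measurableType d) (P : probability O R) (Z : O -> set E).
Hypothesis pZ : process Z.

Let quad_bits n (o : O) : (size (quads n)).-tuple bool :=
  @Tuple _ _ (bits Z (quads n) o) (introT eqP (size_map _ _)).

Lemma word_count_bits n o j : word_count n (bits Z (quads n) o) j =
  count (fun c => `[< Z o `&` (W j `&` cell (c, n)) !=set0 >]) (grid M n).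
Proof.
apply: eq_in_count => c cg; have kin : (j, c) \in keys n.
  by apply/allpairsP; exists (j, c); rewrite mem_enum.
rewrite (nth_map set0) ?size_map ?index_mem// (nth_map (j, c)) ?index_mem//.
by rewrite nth_index.
Qed.

Lemma word_event n (S : set ('I_m -> nat)) :
  measurable [set o | S (word_count n (bits Z (quads n) o))] /\
  fine (P [set o | S (word_count n (bits Z (quads n) o))]) =
  \sum_(w : (size (quads n)).-tuple bool) `[< S (word_count n w) >]%:R *
    hit_miss (fun U => fine (P (void Z U))) (quads n) w set0.
Proof.
have mb (w : (size (quads n)).-tuple bool) : measurable [set o | quad_bits n o = w] /\
    fine (P [set o | quad_bits n o = w]) = hit_miss (fun U => fine (P (void Z U))) (quads n) w set0.
  have := bits_probability P pZ w (nice_quads n) (nice_set0 (R := R)).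
  rewrite (_ : [set o | _ /\ _] = [set o | quad_bits n o = w])//.
  apply/seteqP; split => o /=; first by move=> [h _]; exact: val_inj.
  by move=> <-; split => //; rewrite /void /= setI0.
have [h1 h2] := finite_expectation P (fun w : (size (quads n)).-tuple bool => `[< S (word_count n w) >]%:R) (fun w => (mb w).1).
have mS : measurable [set o | S (word_count n (bits Z (quads n) o))].
  rewrite (_ : mkset _ = [set o | exists w : (size (quads n)).-tuple bool,
      quad_bits n o = w /\ S (word_count n w)]); last first.
    by apply/seteqP; split => [z h|z [w [<- h]]//]; exists (quad_bits n z).
  apply: measurable_exists => w; have [h|h] := pselect (S (word_count n w)).
    by rewrite (_ : (fun o => _) = [set o | quad_bits n o = w]); [case: (mb w)|apply/seteqP; split => o // [] ].
  by rewrite (_ : (fun o => _) = set0)//; apply/seteqP; split => // o [].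
split => //; transitivity (\int[P]_o `[< S (word_count n (quad_bits n o)) >]%:R).
  by rewrite -[X in P X]setIT -integral_indic// /Rintegral; congr fine.
by rewrite h2; apply: eq_bigr => w _; case: (mb w) => _ ->.
Qed.

Lemma counts_event (S : set ('I_m -> nat)) : measurable [set o | S (interval_counts x I (Z o))].
Proof.
rewrite (_ : mkset _ = [set o | exists v : {ffun 'I_m -> nat}, S v /\ forall j, npts (Z o `&` W j) = v j]).
  apply: measurable_exists => v; have [h|h] := pselect (S v); last first.
    by rewrite (_ : (fun o => _) = set0)//; apply/seteqP; split => // o [].
  rewrite (_ : (fun o => _) = [set o | forall j, npts (Z o `&` W j) = v j]); last first.
    by apply/seteqP; split => o // [].
  apply: measurable_forall => j; have [mj [N WN] _] := nW j; exact: (pZ.2 N _ mj WN (v j)).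
apply/seteqP; split => o /=; rewrite interval_countsE; try by move=> N; exact: (pZ.1 N o).
  move=> h; exists [ffun j => npts (Z o `&` W j)]; split; last by move=> j; rewrite ffunE.
  by rewrite (_ : (fun_of_fin _ : _ -> nat) = (fun j => npts (Z o `&` W j)))//; apply/funext => j; rewrite ffunE.
by move=> [v [h /funext ->]].
Qed.

Hypothesis fin2 : forall c, moment P Z (cell c) 2 \is a fin_num.

Lemma pair_probability c : measurable [set o | (2 <= npts (Z o `&` cell c))%N] /\
  (P [set o | (2 <= npts (Z o `&` cell c))%N] <= (fine (moment P Z (cell c) 2))%:E)%E.
Proof.
have [mc [N cN] _] := @nice_cell R c.
have mn := pZ.2 N _ mc cN.
have m2 : measurable [set o | (2 <= npts (Z o `&` cell c))%N].
  rewrite (_ : mkset _ = [set o | exists k, (2 <= k)%N /\ npts (Z o `&` cell c) = k]).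
    apply: measurable_exists => k; have [h|h] := boolP (2 <= k)%N.
      by rewrite (_ : (fun o => _) = [set o | npts (Z o `&` cell c) = k])//; apply/seteqP; split => o // [].
    by rewrite (_ : (fun o => _) = set0)//; apply/seteqP; split => // o [].
  by apply/seteqP; split => [z h|z [k [h e]]]; [exists (npts (Z z `&` cell c))|rewrite /= e].
split => //; rewrite fineK//.
rewrite -[X in P X]setIT -integral_indic//; apply: ge0_le_integral => //.
- by apply/measurable_EFinP; exact: measurable_indic.
- rewrite (_ : (fun o => _) = (fun o => ((npts (Z o `&` cell c) ^_ 2)%:R)%:E)); last first.
    by apply/funext => o; apply: counting_tuples_diag; exact: (process_finite pZ _ cN).
  by apply/measurable_EFinP; apply: (measurable_of_nat (fun n => (n ^_ 2)%:R)) => j; exact: mn.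
move=> o _; rewrite counting_tuples_diag; last exact: (process_finite pZ _ cN).
rewrite lee_fin indicE -/(npts _); case: (boolP (o \in _)) => [/set_mem/= h|_]; last exact: ler0n.
by rewrite ler1n ffact_gt0.
Qed.

Lemma crowded_probability n (s : seq (int * int)) :
  measurable [set o | exists2 c, c \in s & (2 <= npts (Z o `&` cell (c, n)))%N] /\
  (P [set o | exists2 c, c \in s & (2 <= npts (Z o `&` cell (c, n)))%N] <=
    (\sum_(c <- s) fine (moment P Z (cell (c, n)) 2))%:E)%E.
Proof.
elim: s => [|c s [ih1 ih2]].
  by rewrite (_ : mkset _ = set0) ?measure0 ?big_nil//; apply/seteqP; split => // o [].
have [m2 p2] := pair_probability (c, n).
rewrite (_ : mkset _ = [set o | (2 <= npts (Z o `&` cell (c, n)))%N] `|`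
    [set o | exists2 c, c \in s & (2 <= npts (Z o `&` cell (c, n)))%N]); last first.
  apply/seteqP; split => [z [c']|z [h|[c' cs h]]].
  - by rewrite inE => /orP[/eqP ->|cs] h; [left|right; exists c'].
  - by exists c => //; rewrite inE eqxx.
  - by exists c' => //; rewrite inE cs orbT.
split; first exact: measurableU.
by rewrite big_cons EFinD; apply: le_trans (measureU2 P m2 ih1) _; exact: leeD.
Qed.

(** Off the event that a cell contains two points, the counts are read off the
    hits. *)
Lemma counts_word_close n (S : set ('I_m -> nat)) :
  `|fine (P [set o | S (interval_counts x I (Z o))]) -
    fine (P [set o | S (word_count n (bits Z (quads n) o))])| <=
  \sum_(c <- grid M n) fine (moment P Z (cell (c, n)) 2).
Proof.
have [mB pB] := crowded_probability n (grid M n); set B := mkset _ in mB pB.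
have mA := counts_event S; set A := mkset _ in mA.
have [mA' _] := word_event n S; set A' := mkset _ in mA' *.
have agree o : ~ B o -> A o <-> A' o.
  move=> nB; rewrite /A /A' /= interval_countsE; last by move=> N; exact: (pZ.1 N o).
  rewrite (_ : (fun j => npts (Z o `&` W j)) = word_count n (bits Z (quads n) o))//.
  apply/funext => j; rewrite word_count_bits; apply: npts_cells => //.
    by have [_ [N WN] _] := nW j; exact: (process_finite pZ _ WN).
  move=> c cg; have [_ [N cN] _] := @nice_cell R (c, n); split; first exact: (process_finite pZ _ cN).
  by rewrite ltnNge; apply/negP => h; apply: nB; exists c.
have half (C D : set O) : measurable C -> measurable D -> (forall o, ~ B o -> C o -> D o) ->
    fine (P C) - fine (P D) <= \sum_(c <- grid M n) fine (moment P Z (cell (c, n)) 2).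
  move=> mC mD CD; rewrite lerBlDl -lee_fin EFinD !fineK ?fin_num_measure//.
  apply: (@le_trans _ _ (P (D `|` B))); last first.
    by apply: le_trans (measureU2 P mD mB) _; exact: leeD.
  apply: (le_measure P (mem_set mC) (mem_set (measurableU _ _ mD mB))) => o Co.
  by have [|nB] := pselect (B o); [right|left; exact: CD].
rewrite ler_norml lerNl opprB; apply/andP; split; apply: half => // o nB h; exact/(agree o nB).
Qed.

End one_process.

Variable rho : forall k, k.-tuple E -> R.
Hypothesis hrho : density rho.
Variables (d : nat -> measure_display) (Omega : forall n, measurableType (d n)).
Variables (P : forall n, probability (Omega n) R) (X : forall n, Omega n -> set E).
Hypothesis pX : forall n, process (@X n).
Hypothesis X_fin : forall n k W, nice W -> moment (P n) (@X n) W k \is a fin_num.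
Hypothesis X_cvg : forall k (W : 'I_k -> set E), (forall i, nice (W i)) ->
  (\int[P n]_o @counting (k.-tuple E) R (tuples (@X n o) W) @[n --> \oo] --> mean rho W)%E.
Context d' (O : measurableType d') (P' : probability O R) (Y : O -> set E).
Hypothesis pY : process Y.
Hypothesis Y_mean : forall k W, nice W -> moment P' Y W k = mean rho (fun _ : 'I_k => W).
Hypothesis void_cvg : forall U, nice U ->
  fine (P n (void (@X n) U)) @[n --> \oo] --> fine (P' (void Y U)).

(** The hits of the cells of a fixed level converge in law by
    inclusion-exclusion, and two points share a cell of this level with a
    probability that is small along the whole sequence. *)
Lemma counts_cvg (S : set ('I_m -> nat)) :
  fine (P n [set o | S (interval_counts x I (@X n o))]) @[n --> \oo] -->
  fine (P' [set o | S (interval_counts x I (Y o))]).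
Proof.
have [L L0 hL] := pairs_in_cells hrho M.
have Yfin c : moment P' Y (cell c) 2 \is a fin_num by have nc := @nice_cell R c; rewrite Y_mean//; exact: nice_fin.
apply/cvgrPdist_le => e e0.
have : L * (2^-1) ^+ l @[l --> \oo] --> 0.
  rewrite -[X in _ --> X](mulr0 L); apply: cvgMr; apply: cvg_expr.
  by rewrite ger0_norm//; lra.
move=> /cvgrPdist_le/(_ (e / 4) ltac:(by rewrite divr_gt0))[l _ /(_ l (leqnn l))].
rewrite /= sub0r normrN ger0_norm ?mulr_ge0 ?exprn_ge0// => hl.
have c1 : \sum_(c <- grid M l) fine (moment (P n) (@X n) (cell (c, l)) 2) @[n --> \oo] -->
    \sum_(c <- grid M l) fine (mean rho (fun _ : 'I_2 => cell (c, l))).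
  elim: (grid M l) => [|c s ih]; first by rewrite big_nil; under eq_fun do rewrite big_nil; exact: cvg_cst.
  rewrite big_cons; under eq_fun do rewrite big_cons; apply: cvgD ih.
  exact: (moment_cvg hrho X_cvg (k := 2%N) (@nice_cell R (c, l))).
have sY : \sum_(c <- grid M l) fine (moment P' Y (cell (c, l)) 2) <= e / 4.
  apply: le_trans hl; apply: le_trans (hL l); rewrite le_eqVlt; apply/orP; left; apply/eqP.
  by apply: eq_bigr => c _; rewrite Y_mean//; exact: nice_cell.
have c2 : fine (P n [set o | S (word_count l (bits (@X n) (quads l) o))]) @[n --> \oo] -->
    fine (P' [set o | S (word_count l (bits Y (quads l) o))]).
  rewrite (word_event P' pY l S).2 (funext (fun n => (word_event (P n) (pX n) l S).2)).
  elim: (index_enum _) => [|w s ih]; first by rewrite big_nil; under eq_fun do rewrite big_nil; exact: cvg_cst.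
  rewrite big_cons; under eq_fun do rewrite big_cons; apply: cvgD ih.
  apply: cvgMr.
  exact: (cvg_hit_miss (Vn := fun n U => fine (P n (void (@X n) U))) void_cvg (nice_quads l) (nice_set0 (R := R))).
move/cvgrPdist_le : c1 => /(_ (e / 4) ltac:(by rewrite divr_gt0))[N1 _ hN1].
move/cvgrPdist_le : c2 => /(_ (e / 4) ltac:(by rewrite divr_gt0))[N2 _ hN2].
exists (maxn N1 N2) => // n /=; rewrite geq_max => /andP[n1 n2].
have h1 := counts_word_close pY Yfin l S.
have h2 := counts_word_close (pX n) (fun c => @X_fin n 2%N _ (@nice_cell R c)) l S.
have /= h3 := hN2 n n2; have /= := hN1 n n1; rewrite ler_norml => /andP[h4 _].
have h5 := hL l.
move: h1 h2 h3 h4 h5 sY hl; rewrite !ler_norml.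
move: (fine (P' _)) (fine (P' _)) (fine (P n _)) (fine (P n _)) (\sum_(_ <- _) fine (moment P' Y _ _)) => a b a' b' s'.
move: (\sum_(_ <- _) _) (\sum_(_ <- _) _) => s1 s2.
by move=> /andP[? ?] /andP[? ?] /andP[? ?] *; apply/andP; split; lra.
Qed.

End counts_in_intervals.

(** * The sine kernel and the threads *)

Section sine_kernel.
Context {R : realType}.
Local Notation leb := (@lebesgue_measure R).
Variable gamma : R.

Lemma J_sine xi : J gamma 0 xi = (sine_kernel xi)%:C.
Proof.
have pi0 : (pi : R) != 0 by rewrite gt_eqF ?pi_gt0.
have le11 : -1 <= 1 :> R by rewrite (@le_trans _ _ 0)// lerN10.
have -> : J gamma 0 xi = cintegral leb `[-1, 1] (fun phi => ((2 * pi)^-1)%:C * expi (- xi * phi + 0)).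
  rewrite /J lexx; apply: eq_cintegral => phi _.
  by rewrite expr0z mulr1 addr0 mulNr mulrC fmorphV.
rewrite /sine_kernel; case: eqP => [->|/eqP xi0].
  have -> : cintegral leb `[-1, 1] (fun phi => ((2 * pi)^-1)%:C * expi (- 0 * phi + 0)) =
      cintegral leb `[-1, 1] (fun=> ((2 * pi)^-1)%:C).
    by apply: eq_cintegral => phi _; rewrite oppr0 mul0r addr0 expi0 mulr1.
  rewrite cintegral_cst_itv// -rmorphM /=; congr (_%:C).
  by rewrite opprK -[1 + 1]/(2 : R) invfM mulrA divff ?mul1r.
pose F (y : R) := ((- (2 * pi * xi))^-1)%:C * - 'i * expi (- xi * y + 0).
have lt11 : -1 < 1 :> R by lra.
rewrite (@cintegral_FTC _ F) //; last 2 first.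
- move=> y _; have := cderiveM (cderive_cst (((- (2 * pi * xi))^-1)%:C * - 'i) y) (cderive_expi (- xi) 0 y).
  rewrite mul0r add0r (_ : _ * ('i * _ * _) = ((2 * pi)^-1)%:C * expi (- xi * y + 0))//.
  rewrite mulrA; congr (_ * _).
  have -> : (- (2 * pi * xi))^-1%:C * - 'i * ('i * (- xi)%:C) =
      (- (2 * pi * xi))^-1%:C * (- xi)%:C * - ('i ^+ 2) :> R[i] by ring.
  rewrite sqr_i opprK mulr1 -rmorphM /=; congr (_%:C).
  by rewrite invrN mulrNN invfM -mulrA mulVf// mulr1.
- move=> y _ u uy; apply: ccvgM; first exact: ccvg_cst.
  by apply: ccvg_expi; rewrite addr0; under eq_fun do rewrite addr0; exact: cvgMr.
rewrite /F -mulrBr !addr0 mulr1 mulrN1 opprK.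
have -> : expi (- xi) - expi xi = (- 2 * sin xi)%:C * 'i.
  by apply/eqP; rewrite eq_complex /= cosN sinN; apply/andP; split; apply/eqP; ring.
have -> : (- (2 * pi * xi))^-1%:C * - 'i * ((- 2 * sin xi)%:C * 'i) =
    (- (2 * pi * xi))^-1%:C * (- 2 * sin xi)%:C * - ('i ^+ 2) :> R[i] by ring.
rewrite sqr_i opprK mulr1 -rmorphM /=; congr (_%:C).
by move: (sin xi) (pi : R) pi0 => s p p0; field; rewrite xi0 p0.
Qed.

End sine_kernel.

Section limit_fields.
Context {R : realType}.
Local Notation T := (measurableTypeR R).
Local Notation E := (int * T)%type.
Local Notation cl := (@counting_lebesgue R).
Local Notation leb := (@lebesgue_measure R).

Lemma compact_dwindow (K : set (int * R)) : compact K -> exists M, K `<=` (dwindow M : set E).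
Proof.
move=> cK.
have c1 : compact ((fun p : int * R => p.1%:~R : R) @` K).
  apply: continuous_compact => //; apply: continuous_subspaceT => p.
  apply: (@continuous_comp _ _ _ fst (fun z : int => z%:~R : R)); first exact: cvg_fst.
  move=> A /nbhs_singleton h; change (principal_filter p.1 ((fun z : int => z%:~R : R) @^-1` A)).
  exact/principal_filterP.
have c2 : compact (snd @` K).
  by apply: continuous_compact => //; apply: continuous_subspaceT => p; exact: cvg_snd.
have /compact_bounded[B1 [_ h1]] := c1; have /compact_bounded[B2 [_ h2]] := c2.
have {}h1 := h1 (B1 + 1) ltac:(by rewrite ltrDl); have {}h2 := h2 (B2 + 1) ltac:(by rewrite ltrDl).
exists (maxn (Num.bound `|B1 + 1|) (Num.bound `|B2 + 1|)).+1 => -[y xi] Kp.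
apply: window_dwindow; split => /=.
  rewrite leq_max -(ler_nat R) natr_absz intr_norm; apply/orP; left.
  apply: le_trans (h1 _ _) _; first by exists (y, xi).
  by apply: le_trans (ler_norm _) _; exact/ltW/archi_boundP.
apply: le_trans (h2 _ _) _; first by exists (y, xi).
apply: le_trans (ler_norm _) _; apply: (@le_trans _ _ (Num.bound `|B2 + 1|)%:R); first exact/ltW/archi_boundP.
by rewrite ler_nat leq_maxr.
Qed.

Lemma counting_tuples1 (A B : set E) :
  @counting (1.-tuple E) R (tuples A (fun _ => B)) = @counting E R (A `&` B).
Proof.
apply: (counting_bij (g := fun s => tnth s ord0) (g' := fun p => [tuple p])).
  by move=> p hp; exists [tuple p] => //; split => // i; rewrite ord1.
move=> s [_ hs]; exists (tnth s ord0); first exact: hs.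
by apply: eq_from_tnth => i; rewrite (ord1 i).
Qed.

Definition on_thread (x : int) k (s : k.-tuple T) : k.-tuple E := [tuple of map (pair x) s].

Lemma measurable_on_thread x k : measurable_fun [set: k.-tuple T] (@on_thread x k).
Proof.
apply/measurable_fun_tnthP => i.
rewrite (_ : _ \o _ = (fun s => (x, tnth s i))); last by apply/funext => s; rewrite /= tnth_map.
by apply: measurable_fun_pair => //; exact: measurable_tnth.
Qed.

Lemma box_integral_thread x k (B : 'I_k -> set T) (f : k.-tuple E -> \bar R) :
  (forall i, measurable (B i)) -> measurable_fun [set: k.-tuple E] f -> (forall s, (0 <= f s)%E) ->
  box_integral cl (fun i => [set x] `*` B i) f = box_integral leb B (fun s => f (on_thread x s)).
Proof.
elim: k B f => [|k ih] B f mB mf f0 /=; first by congr f; exact: val_inj.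
rewrite integral_thread//; last first.
  by apply: (measurable_box_cons parametric_counting_lebesgue) => // i; exact: measurableX.
apply: eq_integral => xi _; rewrite ih//; last exact: measurable_fun_cons1.
by congr box_integral; apply/funext => s; congr f; exact: val_inj.
Qed.

Variable rho : forall k, k.-tuple E -> R.
Hypothesis hrho : density rho.
Context d (O : measurableType d) (P : probability O R) (Y : O -> set E).
Hypothesis fY : forall M o, finite_set (Y o `&` dwindow M).
Hypothesis cY : forall k (W : 'I_k -> set E), (forall i, measurable (W i)) -> campbell rho P Y W.

Lemma measurable_counting B : measurable B ->
  measurable_fun [set: O] (fun o => @counting E R (Y o `&` B)).
Proof.
move=> mB; have [h _] := @cY 1 (fun _ => B) (fun _ => mB).
by rewrite (_ : (fun o => _) = (fun o => @counting (1.-tuple E) R (tuples (Y o) (fun _ => B))))//;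
  apply/funext => o; rewrite counting_tuples1.
Qed.

Lemma campbell_process : process Y.
Proof.
have fw M o : finite_set (Y o `&` window M).
  by apply: sub_finite_set (fY M.+1 o); apply: setIS; exact: window_dwindow.
split=> // M B mB BM m.
rewrite (_ : mkset _ = [set: O] `&` (fun o => @counting E R (Y o `&` B)) @^-1` [set m%:R%:E]).
  exact: measurable_counting.
have e o : @counting E R (Y o `&` B) = (npts (Y o `&` B))%:R%:E.
  by apply: counting_npts; apply: sub_finite_set (fw M o); exact: setIS.
rewrite setTI; apply/seteqP; split => o /=; rewrite e; first by move=> ->.
by move=> -[] /eqP; rewrite eqr_nat => /eqP.
Qed.

Lemma campbell_moment k W : nice W -> moment P Y W k = mean rho (fun _ : 'I_k => W).
Proof. by case=> mW _ _; case: (@cY k (fun _ => W) (fun _ => mW)). Qed.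

(** So the factorial moments determine the void probabilities. *)
Lemma campbell_void W m : nice W ->
  `|fine (P (void Y W)) - alt_sum (fun k => fine (mean rho (fun _ : 'I_k => W))) m| <=
    fine (mean rho (fun _ : 'I_m => W)) / m`!%:R.
Proof.
move=> nW; have [mW [M WM] _] := nW.
have := @void_bonferroni R _ _ P Y campbell_process M W mW WM _ m.
rewrite campbell_moment// (_ : (fun k => _) = (fun k => fine (mean rho (fun _ : 'I_k => W)))).
  by apply => k; rewrite campbell_moment//; exact: nice_fin.
by apply/funext => k; rewrite campbell_moment.
Qed.

Lemma campbell_point_field : @point_field R _ _ _ _ (@compact (int * R)%type) Y.
Proof.
split; last exact: measurable_counting.
move=> o K /compact_dwindow[M KM]; apply: sub_finite_set (fY M o); exact: setIS.
Qed.

Let thread x o : set T := [set xi | Y o (x, xi)].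

Lemma thread_point_field x : @point_field R _ _ _ _ (@compact R) (thread x).
Proof.
split=> [z K cK|B mB].
  have /compact_bounded[B [_ hB]] := cK; have {}hB := hB (B + 1) ltac:(by rewrite ltrDl).
  apply: (@sub_finite_set _ _ (snd @` (Y z `&` dwindow (maxn `|x|%N (Num.bound `|B + 1|)).+1))).
    move=> xi [h Kxi]; exists (x, xi) => //; split => //; apply: window_dwindow; split => /=.
      exact: leq_maxl.
    apply: le_trans (hB _ Kxi) _; apply: le_trans (ler_norm _) _.
    apply: (@le_trans _ _ (Num.bound `|B + 1|)%:R); first exact/ltW/archi_boundP.
    by rewrite ler_nat leq_maxr.
  exact/finite_image/fY.
rewrite (_ : (fun o => _) = (fun o => @counting E R (Y o `&` ([set x] `*` B)))).
  by apply: measurable_counting; exact: measurableX.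
apply/funext => z; apply: (counting_bij (g := pair x) (g' := snd)).
  by move=> [y xi] [h1 [/= ? h2]]; subst y; exists xi.
by move=> xi [h1 h2]; exists (x, xi).
Qed.

Lemma thread_campbell x k (B : 'I_k -> set T) : (forall i, measurable (B i)) ->
  (\int[P]_o @counting (k.-tuple T) R
     [set s : k.-tuple T | uniq s /\ forall i, (thread x o `&` B i) (tnth s i)] =
   box_integral leb B (fun s => (rho (on_thread x s))%:E))%E.
Proof.
move=> mB; have mX i : measurable ([set x] `*` B i : set E) by exact: measurableX.
have [_ e] := @cY k (fun i => [set x] `*` B i) mX.
rewrite -(box_integral_thread x (f := fun s => (rho s)%:E) mB).
- rewrite -/(mean rho _) -e; apply: eq_integral => z _.
  apply: (counting_bij (g := on_thread x (k := k)) (g' := fun s => [tuple of map snd s])).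
    move=> s [us hs]; exists [tuple of map snd s]; last first.
      apply: eq_from_tnth => i; rewrite !tnth_map; have [_ [h _]] := hs i.
      by move: h => /= <-; case: (tnth s i).
    have e1 : val s = map (pair x) (map snd s).
      rewrite -map_comp -[LHS]map_id; apply/eq_in_map => p /tnthP[i ->] /=.
      by have [_ [/= <- _]] := hs i; case: (tnth s i).
    have us2 : uniq (map snd s).
      by have := us; rewrite {1}e1 map_inj_uniq// => y y' [].
    split; first exact: us2.
    move=> i; rewrite tnth_map; have [h1 [h2 h3]] := hs i; split => //.
    by rewrite /thread /=; move: h1 h2 => /= + <-; case: (tnth s i).
  move=> s [us hs]; exists (on_thread x s).
    split; first by rewrite map_inj_uniq// => y y' [].
    by move=> i; rewrite tnth_map; have [h1 h2] := hs i.
  by apply: eq_from_tnth => i; rewrite !tnth_map.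
- exact: mrho_EFin.
- by move=> s; rewrite lee_fin; case: hrho.
Qed.

End limit_fields.

(** * Sequences of bead models *)

Section bead_processes.
Context {R : realType}.
Local Notation T := (measurableTypeR R).
Local Notation E := (int * T)%type.
Local Notation cl := (@counting_lebesgue R).
Variable gamma : R.
Hypothesis hgamma : -1 < gamma < 1.

(** The triangle inequalities hold up to this value. *)
Definition small : R := (1 - gamma) / 2.

Lemma small_gt0 : 0 < small. Proof. by have /andP[] := hgamma; rewrite /small; lra. Qed.

Lemma small_triangle t : 0 < t <= small -> strict_triangle t 1 (expR (gamma * t)).
Proof.
rewrite /small => /andP[t0 ts]; have /andP[g1 g2] := hgamma.
have h1 := expR_ge1Dx (gamma * t); have h2 := expR_ge1Dx (- (gamma * t)); have h3 := expR_gt0 (gamma * t).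
have h4 : expR (gamma * t) * (1 + - (gamma * t)) <= 1.
  by rewrite -[leRHS](expRxMexpNx_1 (gamma * t)) ler_pM2l.
split; first by lra.
- have : 0 < t * (1 + gamma) by rewrite mulr_gt0//; lra.
  by move: h1; rewrite mulrDr mulr1 (mulrC t); lra.
have gt : gamma * t < 1 - gamma /\ gamma * t < 1.
  have [g0|g0] := leP 0 gamma; last by have : gamma * t <= 0; [rewrite nmulr_rle0// ltW|split; lra].
  have : gamma * t <= t by rewrite ger_pMl//; lra.
  by split; lra.
case: gt => gt gt1.
have h5 : 1 < (1 + t) * (1 + - (gamma * t)).
  have -> : (1 + t) * (1 + - (gamma * t)) = 1 + t * (1 - gamma - gamma * t) by ring.
  by rewrite ltrDl mulr_gt0//; lra.
have h6 : 0 < 1 + - (gamma * t) by lra.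
by rewrite -(ltr_pM2r h6); apply: le_lt_trans h4 _; rewrite addrC.
Qed.

Lemma small_le1 t : 0 < t <= small -> 0 < t <= 1.
Proof. by have /andP[g1 g2] := hgamma; rewrite /small => /andP[-> h] /=; lra. Qed.

(** Equal to the determinant at generic tuples, and nonnegative at all of them. *)
Definition bead_density k (s : k.-tuple E) : R := Num.max 0 (complex.Re (det_J gamma s)).

Lemma measurable_Re_det_J k : measurable_fun [set: k.-tuple E] (fun s : k.-tuple E => complex.Re (det_J gamma s) : T).
Proof. by case: (cmeas_det_J hgamma k). Qed.

Lemma bead_density_density : density (@bead_density).
Proof.
split=> [k|k s|M].
- by apply: measurable_maxr => //; exact: measurable_Re_det_J.
- by rewrite /bead_density le_max lexx.
have [C hC] := Re_det_J_bounded hgamma M; exists (hadamard_bound C); split.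
- by move=> k; rewrite /hadamard_bound sqrtr_ge0.
- move=> k s gs Ms; rewrite /bead_density ge_max {1}/hadamard_bound sqrtr_ge0 /=.
  exact: le_trans (ler_norm _) (hC k s gs Ms).
- by move=> L L0; exact: hadamard_bound_decay.
Qed.

Section one_model.
Variable t : R.
Hypothesis ht : 0 < t <= small.
Context d (O : measurableType d) (P : probability O R) (omega : O -> set (int * int)).
Hypothesis homega : discrete_bead_model gamma t P omega.

Let t01 := small_le1 ht.

Lemma measurable_sites (L : seq (int * int)) (S : set (set (int * int))) :
  measurable [set o | S (omega o `&` [set` L])].
Proof.
elim: L S => [|q L ih] S.
  have [h|h] := pselect (S set0).
    rewrite (_ : mkset _ = setT)//; apply/seteqP; split => // z _ /=.
    by rewrite (_ : _ `&` _ = set0)//; apply/seteqP; split => // p [].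
  rewrite (_ : mkset _ = set0)//; apply/seteqP; split => // z /=.
  by rewrite (_ : _ `&` _ = set0)//; apply/seteqP; split => // p [].
have [mq _] := homega.
rewrite (_ : mkset _ = ([set o | omega o q] `&` [set o | S (q |` (omega o `&` [set` L]))]) `|`
    (~` [set o | omega o q] `&` [set o | S (omega o `&` [set` L])])).
  apply: measurableU; apply: measurableI => //.
  - exact: (ih (fun A => S (q |` A))).
  - exact: measurableC.
have e1 z : omega z q -> omega z `&` [set` q :: L] = q |` (omega z `&` [set` L]).
  move=> zq; apply/seteqP; split => [p [zp]|p [->|[zp pL]]] /=.
  - by rewrite inE => /orP[/eqP ->|pL]; [left|right].
  - by rewrite inE eqxx.
  - by rewrite inE pL orbT.
have e2 z : ~ omega z q -> omega z `&` [set` q :: L] = omega z `&` [set` L].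
  move=> zq; apply/seteqP; split => [p [zp]|p [zp pL]] /=.
  - by rewrite inE => /orP[/eqP e|pL] //; case: zq; rewrite -e.
  - by rewrite inE pL orbT.
apply/seteqP; split => z /=.
  by have [zq|zq] := pselect (omega z q); [rewrite e1//; left|rewrite e2//; right].
by case=> -[zq]; [rewrite e1|rewrite e2].
Qed.

Local Notation beads o := (rescaled_beads gamma t (omega o) : set E).

Let sites M := fset_set [set q | window M (lattice_point gamma t q)].

Lemma beads_window M o : beads o `&` window M =
  lattice_point gamma t @` (omega o `&` [set` sites M]).
Proof.
have fL := finite_lattice_window hgamma t01 M.
apply/seteqP; split => [p [/rescaled_beads_lattice[q -> oq] Mp]|_ [q [oq qs] <-]].
  by exists q => //; split => //=; rewrite /sites in_fset_set// mem_set.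
move: qs; rewrite /sites /= in_fset_set// => /set_mem Mq; split => //.
exact/(rescaled_beadsE hgamma t01).
Qed.

Lemma beads_finitary : finitary (fun o => beads o).
Proof.
split=> [M z|M S].
  by rewrite beads_window; apply/finite_image/finite_setIr; exact: finite_fset.
rewrite (_ : mkset _ = [set o | (fun A => S (lattice_point gamma t @` A)) (omega o `&` [set` sites M])]).
  exact: (measurable_sites (sites M) (fun A => S (lattice_point gamma t @` A))).
by apply/seteqP; split => z /=; rewrite beads_window.
Qed.

Lemma beads_moment_fin k W : nice W -> moment P (fun o => beads o) W k \is a fin_num.
Proof.
move=> nW; have [mW [M WM] _] := nW; have fL := finite_lattice_window hgamma t01 M.
pose A0 : set E := lattice_point gamma t @` [set` sites M].
have fA : finite_set (A0 `&` setT) by apply/finite_setIl/finite_image/finite_fset.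
have c0 := @counting_tuples_fin R A0 setT k (fun _ => setT) fA (fun _ => @subset_refl _ _).
have le0 o : (@counting (k.-tuple E) R (tuples (beads o) (fun _ => W)) <=
    @counting (k.-tuple E) R (tuples A0 (fun _ : 'I_k => setT)))%E.
  apply: (counting_le_image (g := id)).
    have sub : forall s, tuples A0 (fun _ : 'I_k => setT) s -> {subset s <= fset_set (A0 `&` setT)}.
      by apply: tuples_sub => i p hp; rewrite in_fset_set//; exact: mem_set.
    exact: (card_tuples (fset_uniq _) sub).1.
  move=> s [us hs]; exists s => //; split => // i; have [h1 h2] := hs i; split => //.
  have : (beads o `&` window M) (tnth s i) by split => //; exact: WM.
  by rewrite beads_window => -[q [_ qs] <-]; exists q.
have pB := finitary_process beads_finitary.
rewrite ge0_fin_numE; last by apply: integral_ge0.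
apply: (@le_lt_trans _ _ (\int[P]_o @counting (k.-tuple E) R (tuples A0 (fun _ : 'I_k => setT)))%E).
  apply: ge0_le_integral => //.
  rewrite (_ : (fun o => _) = (fun o => ((npts (beads o `&` W) ^_ k)%:R)%:E)); last first.
    by apply/funext => o; apply: counting_tuples_diag; exact: (process_finite pB _ WM).
  by apply/measurable_EFinP; apply: (measurable_of_nat (fun n => (n ^_ k)%:R)) => j; exact: (pB.2 M _ mW WM).
by rewrite integral_cst// ltey_eq fin_numM//; exact: fin_num_measure.
Qed.

End one_model.

Section sequence_of_models.
Variable t : nat -> R.
Hypothesis ht : forall n, 0 < t n <= small.
Hypothesis tc : t n @[n --> \oo] --> 0.
Variables (d : nat -> measure_display) (O : forall n, measurableType (d n)).
Variables (P : forall n, probability (O n) R) (omega : forall n, O n -> set (int * int)).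
Hypothesis homega : forall n, discrete_bead_model gamma (t n) (P n) (@omega n).

Let t01 n := small_le1 (ht n).
Let tri n := small_triangle (ht n).

Lemma det_J_ge0 k (s : k.-tuple E) : generic snd [::] s ->
  0 <= complex.Re (det_J gamma s) /\ complex.Im (det_J gamma s) = 0.
Proof. exact: (det_J_real_ge0 hgamma t01 tri tc homega). Qed.

Lemma mean_bead_density k (W : 'I_k -> set E) : (forall i, measurable (W i)) ->
  mean (@bead_density) W = box_integral cl W (fun s => (complex.Re (det_J gamma s))%:E).
Proof.
move=> mW; apply: (@box_integral_generic R _ E cl parametric_counting_lebesgue snd _ counting_lebesgue_null [::]) => //.
- by move=> r; rewrite -[X in measurable X]setTI; exact: measurable_snd.
- exact: (mrho_EFin bead_density_density).
- by apply/measurable_EFinP; exact: measurable_Re_det_J.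
- by move=> s gs; rewrite /bead_density max_r//; case: (det_J_ge0 gs).
Qed.

Lemma beads_cvg k (W : 'I_k -> set E) : (forall i, nice (W i)) ->
  (\int[P n]_o @counting (k.-tuple E) R (tuples (rescaled_beads gamma (t n) (@omega n o)) W) @[n --> \oo]
    --> mean (@bead_density) W)%E.
Proof.
move=> nW; rewrite mean_bead_density; last by move=> i; case: (nW i).
exact: (bead_moment_cvg hgamma t01 tri tc homega nW).
Qed.

Lemma beads_void_limit : exists V : set E -> R, forall W, nice W ->
  fine (P n (void (fun o => rescaled_beads gamma (t n) (@omega n o) : set E) W)) @[n --> \oo] --> V W /\
  forall m, `|V W - alt_sum (fun k => fine (mean (@bead_density) (fun _ : 'I_k => W))) m| <=
    fine (mean (@bead_density) (fun _ : 'I_m => W)) / m`!%:R.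
Proof.
apply: (void_limit bead_density_density (X := fun n o => rescaled_beads gamma (t n) (@omega n o) : set E)).
- by move=> n; exact: (beads_finitary (ht n) (homega n)).
- by move=> n k W nW; exact: (beads_moment_fin (ht n) (homega n) k nW).
- exact: beads_cvg.
Qed.

Context d' (O' : measurableType d') (P' : probability O' R) (Y : O' -> set E).
Hypothesis fY : forall M o, finite_set (Y o `&` dwindow M).
Hypothesis cY : forall k (W : 'I_k -> set E), (forall i, measurable (W i)) ->
  campbell (@bead_density) P' Y W.

(** The limit does not depend on the sequence, since its void probabilities are
    determined by its factorial moments. *)
Lemma beads_counts_cvg m (x : 'I_m -> int) (I : 'I_m -> interval R) (S : set ('I_m -> nat)) :
  (forall i, bounded_set [set` I i]) ->
  fine (P n [set o | S (interval_counts x I (rescaled_beads gamma (t n) (@omega n o)))]) @[n --> \oo]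
    --> fine (P' [set o | S (interval_counts x I (Y o))]).
Proof.
move=> bI; have hrho := bead_density_density.
have /choice[m0 hm] : forall j, exists M, [set x j] `*` [set` I j] `<=` (dwindow M : set E).
  move=> j; have [_ [M WM] _] := nice_thread (x j) (bI j).
  by exists M.+1; exact: subset_trans WM (@window_dwindow R M).
have WM j : [set x j] `*` [set` I j] `<=` (dwindow (\max_i m0 i) : set E).
  by apply: subset_trans (hm j) (dwindow_homo _); exact: leq_bigmax.
have [V hV] := beads_void_limit.
apply: (counts_cvg bI WM hrho (X := fun n o => rescaled_beads gamma (t n) (@omega n o) : set E)).
- by move=> n; apply: finitary_process; exact: (beads_finitary (ht n) (homega n)).
- by move=> n k W nW; exact: (beads_moment_fin (ht n) (homega n) k nW).
- exact: beads_cvg.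
- exact: campbell_process fY cY.
- by move=> k W nW; exact: (campbell_moment cY).
move=> U nU; have [c1 b1] := hV U nU.
rewrite (_ : fine (P' _) = V U)//.
apply: (alternating_unique (mean_decay hrho nU)) => // j.
exact: (campbell_void hrho fY cY).
Qed.

End sequence_of_models.

End bead_processes.

(** * The determinantal limit *)

Section determinantal_limit.
Context {R : realType}.
Local Notation T := (measurableTypeR R).
Local Notation E := (int * T)%type.
Local Notation cl := (@counting_lebesgue R).
Local Notation leb := (@lebesgue_measure R).
Variable gamma : R.
Hypothesis hgamma : -1 < gamma < 1.
Hypothesis det_ge0 : forall k (s : k.-tuple E), generic snd [::] s ->
  0 <= complex.Re (det_J gamma s) /\ complex.Im (det_J gamma s) = 0.

Lemma Im_box_integral k (W : 'I_k -> set E) : (forall i, measurable (W i)) ->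
  box_integral cl W (fun s => (complex.Im (det_J gamma s))%:E) = 0%E.
Proof.
move=> mW; rewrite -(box_integral0 cl W).
apply: (@box_integral_generic R _ E cl parametric_counting_lebesgue snd _ counting_lebesgue_null [::]) => //.
- by move=> r; rewrite -[X in measurable X]setTI; exact: measurable_snd.
- by apply/measurable_EFinP; case: (cmeas_det_J hgamma k).
- by move=> s gs; case: (det_ge0 gs) => _ ->.
Qed.

Definition det_J0 k (s : k.-tuple T) : R[i] := \det (\matrix_(i, j) J gamma 0 (tnth s i - tnth s j)).

Lemma det_J_on_thread x k (s : k.-tuple T) : det_J gamma (on_thread x s) = det_J0 s.
Proof.
by congr (\det _); apply/matrixP => i j; rewrite !mxE !tnth_map /= subrr.
Qed.

Lemma generic_on_thread x k (s : k.-tuple T) : generic id [::] s -> generic snd [::] (on_thread x s).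
Proof. by rewrite /generic /= -map_comp (eq_map (g := id)). Qed.

Lemma thread_box_integral x k (B : 'I_k -> set T) : (forall i, measurable (B i)) ->
  box_integral leb B (fun s => (bead_density gamma (on_thread x s))%:E) =
  box_integral leb B (fun s => (complex.Re (det_J0 s))%:E) /\
  box_integral leb B (fun s => (complex.Im (det_J0 s))%:E) = 0%E.
Proof.
move=> mB; have m1 r : measurable (id @^-1` [set (r : T)]) by exact: measurable_set1.
have n1 (r : R) : leb (id @^-1` [set (r : T)]) = 0%E by exact: lebesgue_measure_set1.
have [mRe mIm] := cmeas_det_J hgamma k; have mo := @measurable_on_thread R x k.
split; [|rewrite -(box_integral0 leb B)];
  apply: (@box_integral_generic R _ T leb (@parametric_lebesgue R) id m1 n1 [::]) => //.
- apply: (measurableT_comp (f := fun s : k.-tuple E => (bead_density gamma s)%:E)) => //.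
  exact: (mrho_EFin (bead_density_density hgamma)).
- rewrite (_ : (fun s => _) = (fun s => (complex.Re (det_J gamma (on_thread x s)))%:E)).
    by apply/measurable_EFinP; exact: (measurableT_comp mRe mo).
  by apply/funext => s; rewrite det_J_on_thread.
- move=> s /(generic_on_thread x) gs; rewrite /bead_density -(det_J_on_thread x) max_r//.
  by case: (det_ge0 gs).
- rewrite (_ : (fun s => _) = (fun s => (complex.Im (det_J gamma (on_thread x s)))%:E)).
    by apply/measurable_EFinP; exact: (measurableT_comp mIm mo).
  by apply/funext => s; rewrite det_J_on_thread.
- by move=> s /(generic_on_thread x) gs; rewrite -(det_J_on_thread x); case: (det_ge0 gs) => _ ->.
Qed.

End determinantal_limit.

Theorem theorem2 (R : realType) (gamma : R) (hgamma : -1 < gamma < 1)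
  (d : R -> measure_display) (Omega : forall t : R, measurableType (d t))
  (P : forall t : R, probability (Omega t) R)
  (omega : forall t : R, Omega t -> set (int * int))
  (homega : forall t : R, 0 < t -> strict_triangle t 1 (expR (gamma * t)) ->
     discrete_bead_model gamma t (P t) (omega t)) :
  (exists (d' : measure_display) (Omega' : measurableType d')
          (P' : probability Omega' R) (X : Omega' -> set (int * R)),
    [/\ cvg_weakly 0^'+ P (fun t o => rescaled_beads gamma t (omega t o)) P' X,
        determinantal_field P' counting_lebesgue (@compact (int * R)%type)
          (fun p q : int * R => J gamma (p.1 - q.1) (p.2 - q.2)) X
      & forall x : int,
          determinantal_field P' lebesgue_measure (@compact R)
            (fun xi xi' : R => J gamma 0 (xi - xi'))
            (fun o => [set xi : R | X o (x, xi)])]) /\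
  (forall xi : R, J gamma 0 xi = (sine_kernel xi)%:C).
Proof.
have s0 := small_gt0 hgamma; have hrho := bead_density_density hgamma.
have model t : 0 < t <= small gamma -> discrete_bead_model gamma t (P t) (omega t).
  by move=> ht; apply: homega; [case/andP: ht|exact: small_triangle].
(* The limit process is built along one sequence of models. *)
pose t0 n : R := small gamma / n.+1%:R.
have ht0 n : 0 < t0 n <= small gamma.
  by rewrite divr_gt0//= ler_pdivrMr// ler_peMr ?ler1n// ltW.
have tc0 : t0 n @[n --> \oo] --> (0 : R).
  by rewrite -[X in _ --> X](mulr0 (small gamma)); apply: cvgMr; exact: cvg_harmonic.
have hm n := model _ (ht0 n).
have [V hV] := beads_void_limit hgamma ht0 tc0 hm.
pose Y := @limit_process R V; pose P' := (@unit_measure R : probability (measurableTypeR R) R).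
have fY : forall M u, finite_set (Y u `&` dwindow M) := limit_process_finite V.
have cY k (W : 'I_k -> set (int * measurableTypeR R)) : (forall i, measurable (W i)) ->
    campbell (@bead_density R gamma) P' Y W.
  apply: (campbell_box hrho fY).
  apply: (saturated_counts hrho (X := fun n o => rescaled_beads gamma (t0 n) (omega (t0 n) o))
    _ _ _ (fun W nW => (hV W nW).1)).
  - by move=> n; exact: (beads_finitary hgamma (ht0 n) (hm n)).
  - by move=> n k' W' nW; exact: (beads_moment_fin hgamma (ht0 n) (hm n) k' nW).
  - exact: (beads_cvg hgamma ht0 tc0 hm).
have det_ge0 k (s : k.-tuple (int * measurableTypeR R)) : generic snd [::] s ->
    0 <= complex.Re (det_J gamma s) /\ complex.Im (det_J gamma s) = 0.
  exact: (det_J_ge0 hgamma ht0 tc0 hm).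
have pY := campbell_process fY cY.
split; last exact: J_sine.
exists _, (measurableTypeR R), P', Y; split.
- move=> m x I bI S.
  have mS : measurable [set u | S (interval_counts x I (Y u))] by exact: (@counts_event R m x I bI _ _ Y pY S).
  rewrite -[X in _ --> X]fineK; last exact: fin_num_measure.
  apply: cvg_EFin.
    near=> t.
    have ht : 0 < t <= small gamma.
      by apply/andP; split; near: t; [exact: nbhs_right_gt|exact: nbhs_right_le].
    have pt := finitary_process (beads_finitary hgamma ht (model t ht)).
    by apply: fin_num_measure; exact: (@counts_event R m x I bI _ _ _ pt S).
  apply/cvg_at_rightP => u [u0 uc].
  (* Only the tail of a sequence matters; its head is replaced by good values. *)
  pose t' n := Num.min (u n) (small gamma).
  have ht' n : 0 < t' n <= small gamma by rewrite /t' lt_min u0 s0 ge_min lexx orbT.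
  have tc' : t' n @[n --> \oo] --> (0 : R).
    apply: (@squeeze_cvgr _ _ _ _ (fun=> 0) u) => //; last exact: cvg_cst.
    by apply: nearW => n; case/andP: (ht' n) => /ltW -> _; rewrite ge_min lexx.
  have h := beads_counts_cvg hgamma ht' tc' (fun n => model _ (ht' n)) fY cY (x := x) (S := S) bI.
  apply: cvg_trans h; apply: near_eq_cvg.
  have /cvgrPdist_le/(_ _ s0)[N _ hN] := uc; exists N => // n /= Nn.
  have /= := hN n Nn; rewrite sub0r normrN ger0_norm; last exact: ltW (u0 n).
  by move=> un; rewrite /t' min_l.
- split; first exact: campbell_point_field fY cY.
  move=> n B mB; split; last exact: (Im_box_integral hgamma det_ge0).
  have [_ e] := cY n B mB.
  exact: (etrans e (mean_bead_density hgamma ht0 tc0 hm mB)).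
- move=> x; split; first exact: (thread_point_field fY cY).
  move=> n B mB; have [e1 e2] := thread_box_integral hgamma det_ge0 x mB; split; last exact: e2.
  exact: (etrans (thread_campbell hrho cY x mB) e1).
Unshelve. all: by end_near.
Qed.
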